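(* Let $F:\mathbb{C}\to\mathbb{C}$ be an entire function, $F\not\equiv 0$, and let $a\in\mathbb{C}$ be a node or focus of $\dot x=F(x)$ with its corresponding basin $\mathcal{N}$. Then the path components of $\partial\mathcal{N}$ can be indexed by an at most countable index set $\mathcal{Q}\subset\mathbb{N}$, i.e. the path components $\{C_n\}_{n\in\mathcal{Q}}$ satisfy $$\partial\mathcal{N}=\bigcup_{n\in\mathcal{Q}}C_n .$$ Furthermore, for all $n\in\mathcal{Q}$ the path component $C_n\subset\partial\mathcal{N}$ is of one of the following types: (A) The set $C_n$ consists of one separatrix $\Gamma_n^{[1]}$. This separatrix is positive (negative) if and only if $a$ is stable (unstable). (B) The set $C_n$ consists of one separatrix $\Gamma_n$ and one attached equilibrium $a_n$. This separatrix is positive (negative) if and only if $a$ is stable (unstable). (C) The set $C_n$ consists of two separatrices $\Gamma_n^{[1]}$ and $\Gamma_n^{[2]}$ and one equilibrium $a_n$ attached to these separatrices. Both separatrices are positive (negative) if and only if $a$ is stable (unstable).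
   Context: Setting: for an entire function $F$, consider the planar ODE $\dot x=F(x)$, $x\in\mathbb{C}$, with real time $t$. For $x_0\in\mathbb{C}$ let $I(x_0)\subset\mathbb{R}$ be the maximal interval of existence of the solution $\Phi(\cdot,x_0)$ with $\Phi(0,x_0)=x_0$; the orbit through $x_0$ is $\Gamma(x_0)=\Phi(I(x_0),x_0)$. Equilibria are the zeros of $F$. Limit sets: for an orbit $\Gamma=\Gamma(x_0)$, $\omega_{+}(\Gamma)$ (resp. $\omega_-(\Gamma)$) is the set of all $v\in\mathbb{C}$ for which there is a sequence $(t_k)\subset I(x_0)$ with $t_k\to+\infty$ (resp. $t_k\to-\infty$) and $\Phi(t_k,x_0)\to v$. It is independent of the choice of $x_0\in\Gamma$ and is empty if $I(x_0)$ is bounded above (resp. below). Node or focus: a simple zero $a$ of $F$ that is attracting (stable) or repelling (unstable), i.e. all orbits through points of some neighborhood of $a$ tend to $a$ as $t\to+\infty$ (stable) or as $t\to-\infty$ (unstable). Basin: $\mathcal{N}:=\{x\in\mathbb{C}:\omega_{+}(\Gamma(x))=\{a\}\}$ if $a$ is stable, and $\mathcal{N}:=\{x\in\mathbb{C}:\omega_{-}(\Gamma(x))=\{a\}\}$ if $a$ is unstable. Separatrix: an orbit $\Gamma$, with $x_0\in\Gamma$, is a positive separatrix if $I(x_0)\cap[0,\infty)$ is bounded, and a negative separatrix if $I(x_0)\cap(-\infty,0]$ is bounded (independent of $x_0\in\Gamma$). It is a double-sided separatrix if $I(x_0)$ is bounded. A separatrix is an orbit that is a positive or a negative separatrix. An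 orbit and an equilibrium $\tilde a$ are attached to each other if the orbit has the equilibrium as one of its limit sets, i.e. $\omega_+(\Gamma)=\{\tilde a\}$ or $\omega_-(\Gamma)=\{\tilde a\}$. Path components are the path-connected components (of $\partial\mathcal{N}$ with the subspace topology).
   Formalization: In type (A), for a double-sided separatrix (both positive and negative, so the two equivalences cannot both hold) only ''a stable implies positive, a unstable implies negative'' is claimed; for any other separatrix both equivalences are claimed as stated. *)

(* Defs.v *)
From Stdlib Require Import Reals ClassicalEpsilon.
From Coquelicot Require Import Coquelicot.
Open Scope R_scope.

Definition same_set {T : Type} (A B : T -> Prop) : Prop :=
  forall x, A x <-> B x.

Definition bounded_set (E : R -> Prop) : Prop :=
  exists M, forall t, E t -> Rabs t <= M.

(** * Topology of the plane *)

Definition closure (S : C -> Prop) (z : C) : Prop :=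
  forall U : C -> Prop, locally z U -> exists y, U y /\ S y.

Definition boundary (S : C -> Prop) (z : C) : Prop :=
  closure S z /\ closure (fun y => ~ S y) z.

Definition unit_interval (t : R) : Prop := 0 <= t <= 1.

(* [continuous_on] is continuity for the subspace topology of [0,1]; the
   values of [gamma] outside [0,1] are irrelevant. *)
Definition joined (B : C -> Prop) (x y : C) : Prop :=
  exists gamma : R -> C,
    continuous_on unit_interval gamma /\
    (forall t, unit_interval t -> B (gamma t)) /\
    gamma 0 = x /\ gamma 1 = y.

Definition path_component (B S : C -> Prop) : Prop :=
  exists x, B x /\ same_set S (joined B x).

(** * The flow of x' = F(x), in real time *)

Definition entire (F : C -> C) : Prop :=
  forall z : C, @ex_derive C_AbsRing C_NormedModule F z.

Definition open_interval (J : R -> Prop) : Prop :=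
  open J /\ forall s t u, J s -> J u -> s <= t <= u -> J t.

Definition solution (F : C -> C) (x0 : C) (J : R -> Prop) (phi : R -> C)
  : Prop :=
  open_interval J /\ J 0 /\ phi 0 = x0 /\
  forall t, J t -> @is_derive R_AbsRing C_R_NormedModule phi t (F (phi t)).

(* Solutions of the initial value problem are unique, so the maximal interval
   of existence is the union of the intervals carrying a solution, and any two
   solutions agree at a common time. *)
Definition Imax (F : C -> C) (x0 : C) (t : R) : Prop :=
  exists J phi, solution F x0 J phi /\ J t.

(* Meaningful only for [t] in [Imax F x0]. *)
Definition Phi (F : C -> C) (t : R) (x0 : C) : C :=
  epsilon (inhabits x0)
    (fun y => exists J phi, solution F x0 J phi /\ J t /\ phi t = y).

(* In what follows an orbit is represented by one of its points. *)
Definition orbit (F : C -> C) (x0 v : C) : Prop :=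
  exists t, Imax F x0 t /\ v = Phi F t x0.

Definition omega_plus (F : C -> C) (x0 v : C) : Prop :=
  exists tk : nat -> R,
    (forall k, Imax F x0 (tk k)) /\ is_lim_seq tk p_infty /\
    filterlim (fun k => Phi F (tk k) x0) eventually (locally v).

Definition omega_minus (F : C -> C) (x0 v : C) : Prop :=
  exists tk : nat -> R,
    (forall k, Imax F x0 (tk k)) /\ is_lim_seq tk m_infty /\
    filterlim (fun k => Phi F (tk k) x0) eventually (locally v).

(** * Nodes and foci, basins *)

Definition equilibrium (F : C -> C) (a : C) : Prop := F a = RtoC 0.

Definition simple_zero (F : C -> C) (a : C) : Prop :=
  F a = RtoC 0 /\ C_derive F a <> RtoC 0.

Definition tends_to_plus (F : C -> C) (x a : C) : Prop :=
  (forall t, 0 <= t -> Imax F x t) /\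
  filterlim (fun t => Phi F t x) (Rbar_locally p_infty) (locally a).

Definition tends_to_minus (F : C -> C) (x a : C) : Prop :=
  (forall t, t <= 0 -> Imax F x t) /\
  filterlim (fun t => Phi F t x) (Rbar_locally m_infty) (locally a).

Definition stable (F : C -> C) (a : C) : Prop :=
  locally a (fun x => tends_to_plus F x a).

Definition unstable (F : C -> C) (a : C) : Prop :=
  locally a (fun x => tends_to_minus F x a).

Definition node_or_focus (F : C -> C) (a : C) : Prop :=
  simple_zero F a /\ (stable F a \/ unstable F a).

Definition singleton (a : C) (v : C) : Prop := v = a.

(* A simple zero is never both stable and unstable, so exactly one of the two
   disjuncts is active at a node or focus. *)
Definition basin (F : C -> C) (a x : C) : Prop :=
  (stable F a /\ same_set (omega_plus F x) (singleton a)) \/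
  (unstable F a /\ same_set (omega_minus F x) (singleton a)).

(** * Separatrices *)

Definition positive_separatrix (F : C -> C) (x0 : C) : Prop :=
  bounded_set (fun t => Imax F x0 t /\ 0 <= t).

Definition negative_separatrix (F : C -> C) (x0 : C) : Prop :=
  bounded_set (fun t => Imax F x0 t /\ t <= 0).

Definition double_sided_separatrix (F : C -> C) (x0 : C) : Prop :=
  bounded_set (Imax F x0).

Definition separatrix (F : C -> C) (x0 : C) : Prop :=
  positive_separatrix F x0 \/ negative_separatrix F x0.

Definition attached (F : C -> C) (x0 e : C) : Prop :=
  same_set (omega_plus F x0) (singleton e) \/
  same_set (omega_minus F x0) (singleton e).

(** * The three types of path components *)

Definition sign_matches (F : C -> C) (a x0 : C) : Prop :=
  (positive_separatrix F x0 <-> stable F a) /\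
  (negative_separatrix F x0 <-> unstable F a).

(* A double-sided separatrix is both positive and negative, and does occur as
   a path component of type A (for instance the homoclinic loop at infinity
   around a center of a cubic whose two other zeros are foci).  For it only
   "stable implies positive, unstable implies negative" makes sense; for any
   other separatrix the two equivalences of [sign_matches] are required. *)
Definition sign_compatible (F : C -> C) (a x0 : C) : Prop :=
  (stable F a -> positive_separatrix F x0) /\
  (unstable F a -> negative_separatrix F x0) /\
  (~ double_sided_separatrix F x0 -> sign_matches F a x0).

Definition type_A (F : C -> C) (a : C) (S : C -> Prop) : Prop :=
  exists x1,
    separatrix F x1 /\ sign_compatible F a x1 /\
    same_set S (orbit F x1).

(* A separatrix attached to an equilibrium is never double-sided, since its
   time interval is unbounded on the side of that limit set. *)
Definition type_B (F : C -> C) (a : C) (S : C -> Prop) : Prop :=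
  exists x1 e,
    separatrix F x1 /\ sign_matches F a x1 /\
    equilibrium F e /\ attached F x1 e /\
    same_set S (fun v => orbit F x1 v \/ v = e).

Definition type_C (F : C -> C) (a : C) (S : C -> Prop) : Prop :=
  exists x1 x2 e,
    separatrix F x1 /\ sign_matches F a x1 /\
    separatrix F x2 /\ sign_matches F a x2 /\
    ~ same_set (orbit F x1) (orbit F x2) /\
    equilibrium F e /\ attached F x1 e /\ attached F x2 e /\
    same_set S (fun v => orbit F x1 v \/ orbit F x2 v \/ v = e).

(* Main.v *)
(* Reversing time if necessary, let [a] be stable.  The flow of [i F], in
   imaginary time, commutes with the flow of [F].  If a boundary point of the basin is
   joined to the basin by an arc of an imaginary-time orbit, then its own orbit
   blows up in positive time, for otherwise the linear dynamics near [a] would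
   put the point into the basin.

   In a flow box at a boundary point that is not an equilibrium, the heights of
   the points of the basin do not form infinitely many intervals near 0: the first
   return to a transversal section is a translation on each interval, and loops
   made of orbit arcs and section segments, whose sides are told apart by winding
   numbers, show that at most one interval never returns and that all the others
   have the same length.  Hence the boundary is locally an orbit arc, met
   by the basin on at least one side, and this orbit blows up in positive time.

   So a path in the boundary can leave an orbit only through an equilibrium from
   which the orbit emanates at time [-oo].  Some orbit emanates from each boundary
   equilibrium, since otherwise a punctured neighbourhood would lie in the basin.
   Two orbits which emanate from the same equilibrium with the basin on the same
   side coincide: otherwise a loop through the equilibrium and the basin, drawn in
   a logarithmic coordinate, would separate their positive halves, while both
   halves escape to infinity and a path joins them across the loop once.  This
   leaves one or two orbits per equilibrium.  Finally each component contains all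
   boundary points in some disc with rational data. *)
Require Import Defs.
From Stdlib Require Import Cantor ZArith Reals Lra Lia Classical ClassicalEpsilon FunctionalExtensionality PropExtensionality List.
From Coquelicot Require Import Coquelicot.
Open Scope R_scope.


(** The Jordan curve theorem is replaced by three facts on winding numbers, which are computed as
    increments of a continuous logarithm: they are constant along a path off the loop, they vanish
    far away, and they differ at two points on either side of an arc that is the image of a segment
    under an injective holomorphic map. An orbit off the loop that blows up therefore has winding
    number 0, and each separation argument finds such orbits, or paths leading to them, on both
    sides of one arc.

    The main obstacle is that blow-up is known at first only for the ends of basin intervals in a
    section. A boundary point could a priori be a limit of shorter and shorter intervals; equality
    of lengths forbids this, because arbitrarily small neighbourhoods would have to contain
    intervals of one fixed length.

    Boundary equilibria may have any multiplicity, so no normal form is used there. The orbit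
    leaving such a point is a limit of exit points on a small circle, and its backward convergence
    follows from the local structure of the boundary at other points. *)

Lemma Rlt_Rmin_l {r u v} : r < Rmin u v -> r < u.
Proof. intros H. eapply Rlt_le_trans; [apply H|apply Rmin_l]. Qed.

Lemma Rlt_Rmin_r {r u v} : r < Rmin u v -> r < v.
Proof. intros H. eapply Rlt_le_trans; [apply H|apply Rmin_r]. Qed.

Lemma exp_le u v : u <= v -> exp u <= exp v.
Proof. intros [H| ->]; [left; apply exp_increasing; auto|lra]. Qed.

Ltac minmax H :=
  first [rewrite Rmin_left, Rmax_right in H by lra | rewrite Rmin_right, Rmax_left in H by lra].


(** * Cousin's lemma *)

(** The supremum of the good right ends is itself good and cannot be less than [b]. Compactness,
    connectedness, the mean value inequality, the Gronwall bootstrap and lifts of paths are all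
    obtained below as instances, each with its own additive predicate [P]. *)
Lemma cousin (P : R -> R -> Prop) (a b : R) :
  a <= b ->
  (forall u v w, a <= u -> u <= v -> v <= w -> w <= b -> P u v -> P v w -> P u w) ->
  (forall t, a <= t <= b -> exists d, 0 < d /\
     forall u v, a <= u -> u <= t -> t <= v -> v <= b -> v - u < d -> P u v) ->
  P a b.
Proof.
  intros Hab Hadd Hloc.
  destruct (completeness (fun v => a <= v <= b /\ P a v)) as [c [Hub Hlub]].
  - exists b. intros v [Hv _]. lra.
  - exists a. split; [lra|].
    destruct (Hloc a) as [d [Hd H]]; [lra|]. apply H; lra.
  - assert (Hac : a <= c).
    { apply Hub. split; [lra|].
      destruct (Hloc a) as [d [Hd H]]; [lra|]. apply H; lra. }
    assert (Hcb : c <= b) by (apply Hlub; intros v [Hv _]; lra).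
    destruct (Hloc c) as [d [Hd H]]; [lra|].
    assert (Hex : exists v, (a <= v <= b /\ P a v) /\ c - d/2 < v).
    { apply NNPP; intro Hn.
      assert (c <= c - d/2); [|lra].
      apply Hlub. intros v Hv. apply Rnot_lt_le. intro. apply Hn. exists v. tauto. }
    destruct Hex as [v [[Hv HPv] Hcv]].
    assert (Hvc : v <= c) by (apply Hub; tauto).
    pose (w := Rmin b (c + d/4)).
    assert (Hw : c <= w /\ w <= b /\ w <= c + d/4).
    { unfold w. repeat split; [apply Rmin_glb; lra|apply Rmin_l|apply Rmin_r]. }
    assert (HPw : P a w).
    { apply (Hadd a v w); try lra; auto. apply H; lra. }
    assert (w <= c) by (apply Hub; split; [lra|auto]).
    assert (w = b).
    { unfold w in *. destruct (Rle_dec b (c + d/4)).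
      - apply Rmin_left; auto.
      - rewrite Rmin_right in *; lra. }
    rewrite <- H1. exact HPw.
Qed.

(** Takes the place of finite subcovers: [d] is a margin that may always be shrunk, so the minimum
    over two adjacent intervals works for both. Upper bounds and late times are handled by using
    [/ d] as the bound. *)
Lemma compact_interval (Q : R -> R -> Prop) (a b : R) :
  (forall d d' t, 0 < d' -> d' <= d -> Q d t -> Q d' t) ->
  (forall t, a <= t <= b -> exists d, 0 < d /\
     forall u, a <= u <= b -> Rabs (u - t) < d -> Q d u) ->
  exists d, 0 < d /\ forall t, a <= t <= b -> Q d t.
Proof.
  intros Hmon Hloc.
  destruct (Rle_dec a b) as [Hab|Hab].
  2:{ exists 1. split; [lra|]. intros; lra. }
  apply (cousin (fun u v => exists d, 0 < d /\ forall t, u <= t <= v -> Q d t)); auto.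
  - intros u v w _ _ _ _ [d1 [H1 K1]] [d2 [H2 K2]].
    assert (0 < Rmin d1 d2) by (apply Rmin_glb_lt; auto).
    exists (Rmin d1 d2). split; auto.
    intros t Ht. destruct (Rle_dec t v).
    + apply (Hmon d1); auto. apply Rmin_l. apply K1; lra.
    + apply (Hmon d2); auto. apply Rmin_r. apply K2; lra.
  - intros t Ht. destruct (Hloc t Ht) as [d [Hd H]].
    exists d. split; auto. intros u v **. exists d. split; auto.
    intros s Hs. apply H; try lra. apply Rabs_def1; lra.
Qed.

(** The form in which all continuation arguments are run: a truth value that is locally constant is
    transported from one end of the interval to the other. *)
Lemma interval_connected (X : R -> Prop) (a b : R) :
  a <= b ->
  (forall t, a <= t <= b -> exists d, 0 < d /\
     forall u, a <= u <= b -> Rabs (u - t) < d -> (X u <-> X t)) ->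
  (X a <-> X b).
Proof.
  intros Hab Hloc.
  apply (cousin (fun u v => X u <-> X v)); auto.
  - intros. tauto.
  - intros t Ht. destruct (Hloc t Ht) as [d [Hd H]].
    exists d. split; auto. intros u v **.
    rewrite (H u), (H v); try tauto; try lra; apply Rabs_def1; lra.
Qed.

Definition in_box (x1 x2 y1 y2 : R) (z : C) : Prop :=
  x1 <= Re z <= x2 /\ y1 <= Im z <= y2.

Lemma compact_box (Q : R -> C -> Prop) (x1 x2 y1 y2 : R) :
  (forall d d' z, 0 < d' -> d' <= d -> Q d z -> Q d' z) ->
  (forall z, in_box x1 x2 y1 y2 z -> exists d, 0 < d /\
     forall w, in_box x1 x2 y1 y2 w -> Rabs (Re w - Re z) < d -> Rabs (Im w - Im z) < d -> Q d w) ->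
  exists d, 0 < d /\ forall z, in_box x1 x2 y1 y2 z -> Q d z.
Proof.
  intros Hmon Hloc.
  destruct (compact_interval (fun d y => forall x, x1 <= x <= x2 -> Q d (x, y)) y1 y2) as [d [Hd H]].
  - intros d d' t Hd' Hle HQ x Hx. eapply Hmon; eauto.
  - intros y Hy.
    destruct (compact_interval (fun d x => forall y', y1 <= y' <= y2 -> Rabs (y' - y) < d -> Q d (x, y')) x1 x2)
      as [d [Hd H]].
    + intros d d' t Hd' Hle HQ y' Hy' Hyy. eapply Hmon; eauto. apply HQ; lra.
    + intros x Hx. destruct (Hloc (x, y)) as [d [Hd H]]; [split; simpl; auto|].
      exists d. split; auto. intros u Hu Hux y' Hy' Hyy. apply H; [split; simpl; auto| |]; simpl; auto.
    + exists d. split; auto.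
  - exists d. split; auto. intros [x y] [Hx Hy]. apply H; auto.
Qed.

(** * Continuity and derivatives *)

Lemma Cmod_sym (x y : C) : Cmod (x - y) = Cmod (y - x).
Proof. rewrite <- Cmod_opp. f_equal. ring. Qed.

Lemma separated x y : (forall eps, 0 < eps -> Cmod (x - y) <= eps) -> x = y.
Proof.
  intros H. apply Ceq_minus, Cmod_eq_0, Rle_antisym; [|apply Cmod_ge_0].
  apply le_epsilon. intros e He. rewrite Rplus_0_l. auto.
Qed.

Lemma Cmod_self z : Cmod (z - z) = 0.
Proof. replace (z - z)%C with (RtoC 0) by ring. apply Cmod_0. Qed.

Lemma Cmod_tri (x y z : C) : Cmod (x - z) <= Cmod (x - y) + Cmod (y - z).
Proof. replace (x - z)%C with ((x - y) + (y - z))%C by ring. apply Cmod_triangle. Qed.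

Lemma Cmod_rev (x y : C) : Cmod x - Cmod y <= Cmod (x - y).
Proof. pose proof (Cmod_tri x y 0). replace (x - 0)%C with x in H by ring. replace (y - 0)%C with y in H by ring. lra. Qed.

Lemma Cmod_tri2 (x y : C) : Cmod (x - y) <= Cmod x + Cmod y.
Proof. replace (x - y)%C with (x + (- y))%C by ring. rewrite <- (Cmod_opp y). apply Cmod_triangle. Qed.

Lemma Cmod_RtoC_minus (s t : R) : Cmod (RtoC s - RtoC t) = Rabs (s - t).
Proof. rewrite <- RtoC_minus. apply Cmod_R. Qed.

Lemma Re_le_Cmod (z : C) : Rabs (Re z) <= Cmod z.
Proof. eapply Rle_trans; [apply Rmax_l|apply Rmax_Cmod]. Qed.

Lemma Im_le_Cmod (z : C) : Rabs (Im z) <= Cmod z.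
Proof. eapply Rle_trans; [apply Rmax_r|apply Rmax_Cmod]. Qed.

Lemma Cmod_le_ReIm (z : C) : Cmod z <= Rabs (Re z) + Rabs (Im z).
Proof.
  destruct z as [x y]. simpl.
  replace (x, y) with (RtoC x + Ci * RtoC y)%C by (unfold RtoC, Ci, Cplus, Cmult; simpl; f_equal; ring).
  eapply Rle_trans; [apply Cmod_triangle|].
  rewrite Cmod_mult, Cmod_Ci, !Cmod_R. lra.
Qed.

Lemma Re_minus (z w : C) : Re (z - w) = Re z - Re w.
Proof. reflexivity. Qed.

Lemma Im_minus (z w : C) : Im (z - w) = Im z - Im w.
Proof. reflexivity. Qed.

Ltac Ccomp := unfold Re, Im, Cminus, Cplus, Cmult, Copp, Ci, RtoC; simpl; ring.

Lemma C_split (z : C) : z = (RtoC (Re z) + Ci * RtoC (Im z))%C.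
Proof. destruct z as [x y]. unfold RtoC, Ci, Cplus, Cmult; simpl; f_equal; ring. Qed.

(* The map [j] embeds the domain, [R] or [C], into [C], so that functions of
   a real and of a complex variable are treated together. *)
Definition cont {X : Type} (j : X -> C) (f : X -> C) (x : X) : Prop :=
  forall eps, 0 < eps -> exists d, 0 < d /\
    forall y, Cmod (j y - j x) < d -> Cmod (f y - f x) < eps.

Definition der {X : Type} (j : X -> C) (f : X -> C) (x : X) (l : C) : Prop :=
  forall eps, 0 < eps -> exists d, 0 < d /\
    forall y, Cmod (j y - j x) < d ->
      Cmod (f y - f x - (j y - j x) * l) <= eps * Cmod (j y - j x).

Definition cid (z : C) : C := z.
Notation pcont := (cont RtoC).
Notation ccont := (cont cid).
Notation rder := (der RtoC).
Notation cder := (der cid).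

Section Calculus.
Context {X : Type} (j : X -> C).

Lemma cont_ext (f g : X -> C) x r :
  0 < r -> (forall y, Cmod (j y - j x) < r -> f y = g y) -> cont j f x -> cont j g x.
Proof.
  intros Hr He Hf eps Heps. destruct (Hf eps Heps) as [d [Hd H]].
  exists (Rmin d r). split; [apply Rmin_glb_lt; auto|].
  intros y Hy. rewrite <- !He. apply H. apply (Rlt_Rmin_l Hy).
  replace (j x - j x)%C with (RtoC 0) by ring. rewrite Cmod_0; auto.
  apply (Rlt_Rmin_r Hy).
Qed.

Lemma cont_const (c : C) x : cont j (fun _ => c) x.
Proof.
  intros eps H. exists 1. split; [lra|]. intros.
  replace (c - c)%C with (RtoC 0) by ring. rewrite Cmod_0; auto.
Qed.

Lemma cont_self x : cont j j x.
Proof. intros eps H. exists eps. auto. Qed.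

Lemma cont_plus f g x : cont j f x -> cont j g x -> cont j (fun y => f y + g y)%C x.
Proof.
  intros Hf Hg eps He.
  destruct (Hf (eps/2)) as [d1 [H1 K1]]; [lra|]. destruct (Hg (eps/2)) as [d2 [H2 K2]]; [lra|].
  exists (Rmin d1 d2). split; [apply Rmin_glb_lt; auto|]. intros y Hy.
  replace (f y + g y - (f x + g x))%C with ((f y - f x) + (g y - g x))%C by ring.
  eapply Rle_lt_trans; [apply Cmod_triangle|].
  assert (Cmod (f y - f x) < eps/2) by (apply K1; apply (Rlt_Rmin_l Hy)).
  assert (Cmod (g y - g x) < eps/2) by (apply K2; apply (Rlt_Rmin_r Hy)).
  lra.
Qed.

Lemma cont_mult f g x : cont j f x -> cont j g x -> cont j (fun y => f y * g y)%C x.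
Proof.
  intros Hf Hg eps He.
  set (A := Cmod (f x) + Cmod (g x) + 1).
  pose proof (Cmod_ge_0 (f x)). pose proof (Cmod_ge_0 (g x)).
  assert (HA : 0 < A) by (unfold A; lra).
  set (e := Rmin 1 (eps / (2 * A))).
  assert (He' : 0 < e).
  { unfold e. apply Rmin_glb_lt; [lra|]. apply Rdiv_lt_0_compat; lra. }
  assert (e <= 1) by apply Rmin_l.
  assert (e * A <= eps / 2).
  { apply Rle_trans with (eps / (2*A) * A). apply Rmult_le_compat_r; [lra|apply Rmin_r].
    right; field; lra. }
  destruct (Hf e) as [d1 [H1' K1]]; [auto|]. destruct (Hg e) as [d2 [H2' K2]]; [auto|].
  exists (Rmin d1 d2). split; [apply Rmin_glb_lt; auto|]. intros y Hy.
  replace (f y * g y - (f x * g x))%C with ((f y - f x) * (g y - g x) + (f x * (g y - g x) + g x * (f y - f x)))%C by ring.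
  assert (Cmod (f y - f x) < e) by (apply K1; apply (Rlt_Rmin_l Hy)).
  assert (Cmod (g y - g x) < e) by (apply K2; apply (Rlt_Rmin_r Hy)).
  eapply Rle_lt_trans; [apply Cmod_triangle|]. rewrite Cmod_mult.
  eapply Rle_lt_trans; [apply Rplus_le_compat_l; apply Cmod_triangle|]. rewrite !Cmod_mult.
  pose proof (Cmod_ge_0 (f y - f x)). pose proof (Cmod_ge_0 (g y - g x)).
  unfold A in *. nra.
Qed.

Lemma cont_opp f x : cont j f x -> cont j (fun y => - f y)%C x.
Proof.
  intros Hf eps He. destruct (Hf eps He) as [d [Hd H]]. exists d; split; auto.
  intros y Hy. replace (- f y - - f x)%C with (- (f y - f x))%C by ring.
  rewrite Cmod_opp. auto.
Qed.

Lemma cont_minus f g x : cont j f x -> cont j g x -> cont j (fun y => f y - g y)%C x.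
Proof. intros. apply (cont_plus f (fun y => - g y)%C); auto. apply cont_opp; auto. Qed.

Lemma cont_nonzero f x : cont j f x -> f x <> 0 ->
  exists d, 0 < d /\ forall y, Cmod (j y - j x) < d -> Cmod (f x) / 2 < Cmod (f y).
Proof.
  intros Hf Hn. apply Cmod_gt_0 in Hn.
  destruct (Hf (Cmod (f x) / 2)) as [d [Hd H]]; [lra|].
  exists d; split; auto. intros y Hy. specialize (H y Hy).
  pose proof (Cmod_rev (f x) (f y)). rewrite Cmod_sym in H. lra.
Qed.

Lemma cont_inv f x : cont j f x -> f x <> 0 -> cont j (fun y => / f y)%C x.
Proof.
  intros Hf Hn eps He.
  destruct (cont_nonzero f x Hf Hn) as [d0 [Hd0 H0]].
  assert (Hm := proj1 (Cmod_gt_0 _) Hn). set (m := Cmod (f x)) in *.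
  destruct (Hf (eps * m * m / 2)) as [d [Hd H]].
  { apply Rdiv_lt_0_compat; [|lra]. apply Rmult_lt_0_compat; [apply Rmult_lt_0_compat|]; auto. }
  exists (Rmin d0 d). split; [apply Rmin_glb_lt; auto|]. intros y Hy.
  assert (Hy0 : m / 2 < Cmod (f y)) by (apply H0; apply (Rlt_Rmin_l Hy)).
  assert (Hy1 : Cmod (f y - f x) < eps * m * m / 2) by (apply H; apply (Rlt_Rmin_r Hy)).
  assert (Hny : f y <> 0) by (apply Cmod_gt_0; lra).
  replace (/ f y - / f x)%C with (- (f y - f x) / (f y * f x))%C by (field; auto).
  rewrite Cmod_div, Cmod_opp, Cmod_mult; [|apply Cmult_neq_0; auto].
  fold m. apply Rlt_div_l; [nra|].
  assert (0 < eps * m) by (apply Rmult_lt_0_compat; auto).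
  pose proof (Rmult_lt_compat_l _ _ _ H1 Hy0). lra.
Qed.

Lemma cont_div f g x : cont j f x -> cont j g x -> g x <> 0 -> cont j (fun y => f y / g y)%C x.
Proof. intros. apply (cont_mult f (fun y => / g y)%C); auto. apply cont_inv; auto. Qed.

Lemma der_cont f x l : der j f x l -> cont j f x.
Proof.
  intros Hf eps He. destruct (Hf 1) as [d [Hd H]]; [lra|].
  pose proof (Cmod_ge_0 l).
  exists (Rmin d (eps / (Cmod l + 2))). split.
  { apply Rmin_glb_lt; auto. apply Rdiv_lt_0_compat; lra. }
  intros y Hy.
  assert (H1 : Cmod (j y - j x) < d) by (apply (Rlt_Rmin_l Hy)).
  assert (H2 : Cmod (j y - j x) < eps / (Cmod l + 2)) by (apply (Rlt_Rmin_r Hy)).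
  specialize (H y H1).
  replace (f y - f x)%C with ((f y - f x - (j y - j x) * l) + (j y - j x) * l)%C by ring.
  eapply Rle_lt_trans; [apply Cmod_triangle|]. rewrite Cmod_mult.
  apply Rlt_div_r in H2; [|lra].
  pose proof (Cmod_ge_0 (j y - j x)). nra.
Qed.

Lemma der_ext f g x l r :
  0 < r -> (forall y, Cmod (j y - j x) < r -> f y = g y) -> der j f x l -> der j g x l.
Proof.
  intros Hr He Hf eps Heps. destruct (Hf eps Heps) as [d [Hd H]].
  exists (Rmin d r). split; [apply Rmin_glb_lt; auto|].
  intros y Hy. rewrite <- !He. apply H. apply (Rlt_Rmin_l Hy).
  replace (j x - j x)%C with (RtoC 0) by ring. rewrite Cmod_0; auto.
  apply (Rlt_Rmin_r Hy).
Qed.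

Lemma der_val f x l m : l = m -> der j f x l -> der j f x m.
Proof. intros ->. auto. Qed.

Lemma der_const (c : C) x : der j (fun _ => c) x 0.
Proof.
  intros eps H. exists 1. split; [lra|]. intros y _.
  replace (c - c - (j y - j x) * 0)%C with (RtoC 0) by ring. rewrite Cmod_0.
  apply Rmult_le_pos; [lra|apply Cmod_ge_0].
Qed.

Lemma der_self x : der j j x 1.
Proof.
  intros eps H. exists 1. split; [lra|]. intros y _.
  replace (j y - j x - (j y - j x) * 1)%C with (RtoC 0) by ring. rewrite Cmod_0.
  apply Rmult_le_pos; [lra|apply Cmod_ge_0].
Qed.

Lemma der_plus f g x l m : der j f x l -> der j g x m -> der j (fun y => f y + g y)%C x (l + m).
Proof.
  intros Hf Hg eps He.
  destruct (Hf (eps/2)) as [d1 [H1 K1]]; [lra|]. destruct (Hg (eps/2)) as [d2 [H2 K2]]; [lra|].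
  exists (Rmin d1 d2). split; [apply Rmin_glb_lt; auto|]. intros y Hy.
  replace (f y + g y - (f x + g x) - (j y - j x) * (l + m))%C
    with ((f y - f x - (j y - j x) * l) + (g y - g x - (j y - j x) * m))%C by ring.
  eapply Rle_trans; [apply Cmod_triangle|].
  specialize (K1 y (Rlt_Rmin_l Hy)).
  specialize (K2 y (Rlt_Rmin_r Hy)). lra.
Qed.

Lemma der_scal (c : C) f x l : der j f x l -> der j (fun y => c * f y)%C x (c * l).
Proof.
  intros Hf eps He. pose proof (Cmod_ge_0 c).
  destruct (Hf (eps / (Cmod c + 1))) as [d [Hd H1]]; [apply Rdiv_lt_0_compat; lra|].
  exists d. split; auto. intros y Hy.
  replace (c * f y - c * f x - (j y - j x) * (c * l))%C with (c * (f y - f x - (j y - j x) * l))%C by ring.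
  rewrite Cmod_mult. specialize (H1 y Hy).
  apply Rle_trans with (Cmod c * (eps / (Cmod c + 1) * Cmod (j y - j x))).
  - apply Rmult_le_compat_l; auto.
  - pose proof (Cmod_ge_0 (j y - j x)).
    replace (Cmod c * (eps / (Cmod c + 1) * Cmod (j y - j x)))
      with ((eps * Cmod (j y - j x)) * (Cmod c / (Cmod c + 1))) by (field; lra).
    rewrite <- (Rmult_1_r (eps * _)) at 2. apply Rmult_le_compat_l; [nra|].
    apply Rle_div_l; lra.
Qed.

Lemma der_opp f x l : der j f x l -> der j (fun y => - f y)%C x (- l).
Proof.
  intros H. apply (der_scal (-1)) in H.
  replace (- l)%C with (-1 * l)%C by ring.
  apply (der_ext (fun y => -1 * f y)%C _ _ _ 1); auto; [lra|]. intros; ring.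
Qed.

Lemma der_minus f g x l m : der j f x l -> der j g x m -> der j (fun y => f y - g y)%C x (l - m).
Proof. intros. apply (der_plus f (fun y => - g y)%C); auto. apply der_opp; auto. Qed.

Lemma der_unique f x l m :
  (forall d, 0 < d -> exists y, 0 < Cmod (j y - j x) < d) -> der j f x l -> der j f x m -> l = m.
Proof.
  intros Hacc Hl Hm. apply NNPP; intro Hn.
  apply Cminus_eq_contra, Cmod_gt_0 in Hn.
  set (e := Cmod (l - m)) in *.
  destruct (Hl (e/4)) as [d1 [Hd1 K1]]; [lra|]. destruct (Hm (e/4)) as [d2 [Hd2 K2]]; [lra|].
  destruct (Hacc (Rmin d1 d2)) as [y [Hy0 Hy]]; [apply Rmin_glb_lt; auto|].
  specialize (K1 y (Rlt_Rmin_l Hy)).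
  specialize (K2 y (Rlt_Rmin_r Hy)).
  assert (Cmod ((j y - j x) * (l - m)) <= e/2 * Cmod (j y - j x)).
  { replace ((j y - j x) * (l - m))%C with ((f y - f x - (j y - j x) * m) - (f y - f x - (j y - j x) * l))%C by ring.
    eapply Rle_trans; [apply Cmod_tri2|]. lra. }
  rewrite Cmod_mult in H. fold e in H. nra.
Qed.
End Calculus.

Lemma cont_comp {X Y : Type} (j : X -> C) (k : Y -> C) (f : X -> Y) (g : Y -> C) x :
  cont j (fun y => k (f y)) x -> cont k g (f x) -> cont j (fun y => g (f y)) x.
Proof.
  intros Hf Hg eps He. destruct (Hg eps He) as [d [Hd H]].
  destruct (Hf d Hd) as [d' [Hd' H']]. exists d'. split; auto.
Qed.

Lemma der_comp {X Y : Type} (j : X -> C) (k : Y -> C) (f : X -> Y) (g : Y -> C) x l m :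
  der j (fun y => k (f y)) x l -> der k g (f x) m -> der j (fun y => g (f y)) x (l * m).
Proof.
  intros Hf Hg eps He.
  pose proof (Cmod_ge_0 l). pose proof (Cmod_ge_0 m).
  destruct (Hg (eps / (2 * (Cmod l + 1)))) as [d1 [Hd1 K1]]; [apply Rdiv_lt_0_compat; lra|].
  destruct (Hf (eps / (2 * (Cmod m + 1)))) as [d2 [Hd2 K2]]; [apply Rdiv_lt_0_compat; lra|].
  destruct (Hf 1) as [d3 [Hd3 K3]]; [lra|].
  destruct (der_cont j _ x l Hf d1 Hd1) as [d4 [Hd4 K4]].
  exists (Rmin (Rmin d2 d3) d4). split; [repeat apply Rmin_glb_lt; auto|].
  intros y Hy.
  assert (Hy4 := Rlt_Rmin_r Hy).
  assert (Hy23 := Rlt_Rmin_l Hy).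
  assert (Hy2 := Rlt_Rmin_l Hy23).
  assert (Hy3 := Rlt_Rmin_r Hy23).
  specialize (K2 y Hy2). specialize (K3 y Hy3). specialize (K1 (f y) (K4 y Hy4)).
  simpl in *.
  set (dx := (j y - j x)%C) in *. set (dk := (k (f y) - k (f x))%C) in *.
  replace (g (f y) - g (f x) - dx * (l * m))%C
    with ((g (f y) - g (f x) - dk * m) + (dk - dx * l) * m)%C by ring.
  eapply Rle_trans; [apply Cmod_triangle|]. rewrite Cmod_mult.
  assert (Hdk : Cmod dk <= (Cmod l + 1) * Cmod dx).
  { replace dk with ((dk - dx * l) + dx * l)%C by ring.
    eapply Rle_trans; [apply Cmod_triangle|]. rewrite Cmod_mult. lra. }
  pose proof (Cmod_ge_0 dx). pose proof (Cmod_ge_0 dk).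
  assert (A1 : eps / (2 * (Cmod l + 1)) * Cmod dk <= eps / 2 * Cmod dx).
  { apply Rle_trans with (eps / (2 * (Cmod l + 1)) * ((Cmod l + 1) * Cmod dx)).
    - apply Rmult_le_compat_l; auto. left; apply Rdiv_lt_0_compat; lra.
    - right; field; lra. }
  assert (A2 : eps / (2 * (Cmod m + 1)) * Cmod dx * Cmod m <= eps / 2 * Cmod dx).
  { replace (eps / (2 * (Cmod m + 1)) * Cmod dx * Cmod m)
      with ((eps / 2 * Cmod dx) * (Cmod m / (Cmod m + 1))) by (field; lra).
    rewrite <- (Rmult_1_r (eps / 2 * _)) at 2. apply Rmult_le_compat_l; [nra|].
    apply Rle_div_l; lra. }
  pose proof (Rmult_le_compat_r (Cmod m) _ _ H0 K2). lra.
Qed.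

Lemma cder_inv (z : C) : z <> 0 -> cder (fun w => / w)%C z (- / (z * z)).
Proof.
  intros Hz eps He.
  destruct (cont_nonzero cid cid z (cont_self cid z) Hz) as [d0 [Hd0 K0]].
  assert (Hm := proj1 (Cmod_gt_0 _) Hz). unfold cid in *. set (m := Cmod z) in *.
  exists (Rmin d0 (eps * (m * m * m) / 2)). split.
  { apply Rmin_glb_lt; auto. apply Rdiv_lt_0_compat; [|lra]. repeat apply Rmult_lt_0_compat; auto. }
  intros y Hy.
  assert (Hy0 := K0 y (Rlt_Rmin_l Hy)).
  assert (Hy1 := Rlt_Rmin_r Hy).
  assert (Hny : y <> 0) by (apply Cmod_gt_0; lra).
  replace (/ y - / z - (y - z) * - / (z * z))%C with ((y - z) * (y - z) / (y * (z * z)))%C by (field; auto).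
  rewrite Cmod_div, !Cmod_mult; [|repeat apply Cmult_neq_0; auto]. fold m.
  pose proof (Cmod_ge_0 (y - z)).
  apply Rle_div_l; [apply Rmult_lt_0_compat; nra|].
  replace (eps * Cmod (y - z) * (Cmod y * (m * m))) with (Cmod (y-z) * (eps * Cmod y * (m * m))) by ring.
  apply Rmult_le_compat_l; auto.
  assert (0 < eps * (m * m)) by (repeat apply Rmult_lt_0_compat; auto). nra.
Qed.

(** Polarization: the product is a quarter of the difference of the squares of sum and difference,
    so the chain rule for the square suffices. *)
Lemma der_mult {X} (j : X -> C) f g x l m :
  der j f x l -> der j g x m -> der j (fun y => f y * g y)%C x (l * g x + f x * m).
Proof.
  intros Hf Hg.
  assert (Hsq : forall h n, der j h x n -> der j (fun y => h y * h y)%C x (n * (2 * h x))).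
  { intros h n Hh. apply (der_comp j cid h (fun w => w * w)%C x n (2 * h x)); auto.
    intros eps He. exists eps. split; auto. intros y Hy. unfold cid in *.
    replace (y * y - h x * h x - (y - h x) * (2 * h x))%C with ((y - h x) * (y - h x))%C by ring.
    rewrite Cmod_mult. apply Rmult_le_compat_r; [apply Cmod_ge_0|lra]. }
  pose proof (Hsq _ _ (der_plus j _ _ _ _ _ Hf Hg)) as H1.
  pose proof (Hsq _ _ (der_minus j _ _ _ _ _ Hf Hg)) as H2.
  pose proof (der_scal j (/4) _ _ _ (der_minus j _ _ _ _ _ H1 H2)) as H3. simpl in H3.
  assert (H4 : (RtoC 4) <> 0) by (apply Cmod_gt_0; rewrite Cmod_R, Rabs_pos_eq; lra).
  replace (l * g x + f x * m)%C with
    (/ 4 * ((l + m) * (2 * (f x + g x)) - (l - m) * (2 * (f x - g x))))%C by (field; auto).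
  eapply (der_ext j) with (r := 1); [lra| |apply H3].
  intros. simpl. field; auto.
Qed.

Lemma der_inv {X} (j : X -> C) f x l :
  der j f x l -> f x <> 0 -> der j (fun y => / f y)%C x (- l / (f x * f x)).
Proof.
  intros Hf Hn. replace (- l / (f x * f x))%C with (l * - / (f x * f x))%C by (field; auto).
  apply (der_comp j cid f (fun w => / w)%C); auto. apply cder_inv; auto.
Qed.

Lemma der_div {X} (j : X -> C) f g x l m :
  der j f x l -> der j g x m -> g x <> 0 ->
  der j (fun y => f y / g y)%C x ((l * g x - f x * m) / (g x * g x)).
Proof.
  intros Hf Hg Hn.
  replace ((l * g x - f x * m) / (g x * g x))%C with (l * (/ g x) + f x * (- m / (g x * g x)))%C by (field; auto).
  apply (der_mult j f (fun y => / g y)%C); auto. apply der_inv; auto.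
Qed.

Lemma cder_unique f z l m : cder f z l -> cder f z m -> l = m.
Proof.
  apply der_unique. intros d Hd. exists (z + RtoC (d/2))%C. unfold cid.
  replace (z + RtoC (d/2) - z)%C with (RtoC (d/2)) by ring. rewrite Cmod_R, Rabs_pos_eq; lra.
Qed.

(** Complex values admit no intermediate point. The inequality with slope [M + e'] is additive over
    intervals and holds on short ones by the definition of the derivative, which is what [cousin]
    asks for. *)
Lemma mean_value (f : R -> C) (df : R -> C) (M a b : R) :
  a <= b -> (forall t, a <= t <= b -> rder f t (df t) /\ Cmod (df t) <= M) ->
  Cmod (f b - f a) <= M * (b - a).
Proof.
  intros Hab H. apply le_epsilon. intros e He.
  set (e' := e / (b - a + 1)).
  assert (He' : 0 < e') by (apply Rdiv_lt_0_compat; lra).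
  apply Rle_trans with ((M + e') * (b - a)).
  2:{ unfold e'. rewrite Rmult_plus_distr_r. apply Rplus_le_compat_l.
      unfold Rdiv. rewrite Rmult_assoc. rewrite <- (Rmult_1_r e) at 2. apply Rmult_le_compat_l; [lra|].
      rewrite Rmult_comm. apply (Rle_div_l (b - a)); lra. }
  apply (cousin (fun u v => Cmod (f v - f u) <= (M + e') * (v - u))); auto.
  - intros u v w _ _ _ _ H1 H2. pose proof (Cmod_tri (f w) (f v) (f u)). lra.
  - intros t Ht. destruct (H t Ht) as [Hd HM]. destruct (Hd e' He') as [d [Hd0 K]].
    exists d. split; auto. intros u v Hau Hut Htv Hvb Hvu.
    assert (Hs : forall s, Rabs (s - t) < d -> Cmod (f s - f t) <= (M + e') * Rabs (s - t)).
    { intros s Hs. specialize (K s). rewrite Cmod_RtoC_minus in K. specialize (K Hs).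
      replace (f s - f t)%C with ((f s - f t - (s - t) * df t) + (s - t) * df t)%C by ring.
      eapply Rle_trans; [apply Cmod_triangle|]. rewrite Cmod_mult, Cmod_RtoC_minus.
      pose proof (Rabs_pos (s - t)). nra. }
    pose proof (Cmod_tri (f v) (f t) (f u)).
    assert (Hv := Hs v). assert (Hu := Hs u).
    rewrite Rabs_pos_eq in Hv by lra. rewrite Rabs_left1 in Hu by lra.
    rewrite Cmod_sym in Hu. specialize (Hv ltac:(lra)). specialize (Hu ltac:(lra)). lra.
Qed.

Lemma const_of_rder_0 (f : R -> C) a b :
  a <= b -> (forall t, a <= t <= b -> rder f t 0) -> f b = f a.
Proof.
  intros Hab H. assert (Cmod (f b - f a) <= 0 * (b - a)).
  { apply (mean_value f (fun _ => RtoC 0)); auto. intros t Ht. split; auto. rewrite Cmod_0; lra. }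
  apply Ceq_minus, Cmod_eq_0. pose proof (Cmod_ge_0 (f b - f a)). lra.
Qed.

Lemma rder_segment (z w : C) (t : R) : rder (fun t => z + RtoC t * (w - z))%C t (w - z).
Proof.
  intros eps He. exists 1. split; [lra|]. intros y _.
  replace (z + y * (w - z) - (z + t * (w - z)) - (y - t) * (w - z))%C with (RtoC 0) by ring.
  rewrite Cmod_0. apply Rmult_le_pos; [lra|apply Cmod_ge_0].
Qed.

Lemma rder_comp_cder (f : C -> C) (g : R -> C) t l m :
  rder g t l -> cder f (g t) m -> rder (fun s => f (g s)) t (l * m).
Proof. intros. apply (der_comp RtoC cid g f); auto. Qed.

Lemma mean_value_segment (f df : C -> C) (z w : C) (M : R) :
  (forall t, 0 <= t <= 1 -> cder f (z + RtoC t * (w - z))%C (df (z + RtoC t * (w - z))%C) /\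
     Cmod (df (z + RtoC t * (w - z))%C) <= M) ->
  Cmod (f w - f z) <= M * Cmod (w - z).
Proof.
  intros H.
  pose proof (mean_value (fun t => f (z + RtoC t * (w - z))%C)
    (fun t => (w - z) * df (z + RtoC t * (w - z)))%C (M * Cmod (w - z)) 0 1) as K.
  simpl in K.
  replace (z + 1 * (w - z))%C with w in K by ring.
  replace (z + 0 * (w - z))%C with z in K by ring.
  rewrite Rminus_0_r, Rmult_1_r in K. apply K; [lra|].
  intros t Ht. destruct (H t Ht) as [H1 H2]. split.
  - apply rder_comp_cder; auto. apply rder_segment.
  - rewrite Cmod_mult. rewrite Rmult_comm. apply Rmult_le_compat_r; auto. apply Cmod_ge_0.
Qed.

(** * Line integrals, Goursat's theorem and primitives *)

Lemma rder_RtoC (A : R -> R) t l :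
  is_derive A t l -> rder (fun s => RtoC (A s)) t (RtoC l).
Proof.
  intros H%is_derive_Reals eps He. destruct (H eps He) as [[d Hd] K]. simpl in K.
  exists d. split; auto. intros s Hs. rewrite Cmod_RtoC_minus in Hs.
  rewrite <- !RtoC_minus, <- RtoC_mult, <- RtoC_minus, !Cmod_R.
  destruct (Req_dec s t) as [->|Hst].
  - rewrite !Rminus_diag, Rmult_0_l, Rminus_0_r, Rabs_R0. lra.
  - specialize (K (s - t) ltac:(lra) Hs). replace (t + (s - t)) with s in K by ring.
    replace (A s - A t - (s - t) * l) with (((A s - A t) / (s - t) - l) * (s - t)) by (field; lra).
    rewrite Rabs_mult. apply Rmult_le_compat_r; [apply Rabs_pos|lra].
Qed.

Lemma rder_Re (f : R -> C) t l : rder f t l -> is_derive (fun s => Re (f s)) t (Re l).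
Proof.
  intros H. apply is_derive_Reals. intros eps He. destruct (H (eps/2)) as [d [Hd K]]; [lra|].
  exists (mkposreal d Hd). intros h Hh Hhd. simpl in Hhd.
  specialize (K (t + h)). rewrite Cmod_RtoC_minus in K.
  replace (t + h - t) with h in K by ring. specialize (K Hhd).
  pose proof (Re_le_Cmod (f (t + h) - f t - (RtoC (t + h) - RtoC t) * l)) as R.
  replace (Re (f (t + h) - f t - (RtoC (t + h) - RtoC t) * l))
    with (Re (f (t + h)) - Re (f t) - h * Re l) in R
    by (destruct (f (t+h)), (f t), l; Ccomp).
  replace ((Re (f (t + h)) - Re (f t)) / h - Re l) with ((Re (f (t + h)) - Re (f t) - h * Re l) / h) by (field; auto).
  rewrite Rabs_div by auto. apply Rlt_div_l; [apply Rabs_pos_lt; auto|].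
  pose proof (Rabs_pos_lt _ Hh). nra.
Qed.

Lemma rder_Im (f : R -> C) t l : rder f t l -> is_derive (fun s => Im (f s)) t (Im l).
Proof.
  intros H. apply (der_scal RtoC (- Ci)) in H. apply rder_Re in H.
  replace (Im l) with (Re (- Ci * l)) by (destruct l; Ccomp).
  eapply is_derive_ext; [|apply H]. intros s. change (Re (- Ci * f s) = Im (f s)). destruct (f s); Ccomp.
Qed.

Lemma pcont_real (f : R -> R) t : continuous f t <-> pcont (fun s => RtoC (f s)) t.
Proof.
  split.
  - intros H eps He. apply continuity_pt_filterlim in H.
    destruct (H eps He) as [d [Hd K]]. exists d. split; auto.
    intros s Hs. rewrite Cmod_RtoC_minus in *. destruct (Req_dec s t) as [->|Hst].
    + rewrite Rminus_diag, Rabs_R0; auto.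
    + apply K. split; [split; [exact I|auto]|exact Hs].
  - intros H. apply continuity_pt_filterlim. intros eps He.
    destruct (H eps He) as [d [Hd K]]. exists d. split; auto.
    intros s [_ Hs]. specialize (K s). rewrite !Cmod_RtoC_minus in K. apply K, Hs.
Qed.

Lemma cont_Re {X} (j : X -> C) f x : cont j f x -> cont j (fun y => RtoC (Re (f y))) x.
Proof.
  intros H eps He. destruct (H eps He) as [d [Hd K]]. exists d; split; auto.
  intros y Hy. rewrite Cmod_RtoC_minus. eapply Rle_lt_trans; [|apply (K y Hy)].
  apply (Re_le_Cmod (f y - f x)).
Qed.

Lemma cont_Im {X} (j : X -> C) f x : cont j f x -> cont j (fun y => RtoC (Im (f y))) x.
Proof.
  intros H eps He. destruct (H eps He) as [d [Hd K]]. exists d; split; auto.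
  intros y Hy. rewrite Cmod_RtoC_minus. eapply Rle_lt_trans; [|apply (K y Hy)].
  apply (Im_le_Cmod (f y - f x)).
Qed.

Lemma cont_pair {X} (j : X -> C) (f g : X -> R) x :
  cont j (fun y => RtoC (f y)) x -> cont j (fun y => RtoC (g y)) x -> cont j (fun y => (f y, g y)) x.
Proof.
  intros Hf Hg. apply (cont_ext j (fun y => RtoC (f y) + Ci * RtoC (g y))%C) with (r := 1); [lra| |].
  - intros y _. rewrite (C_split (f y, g y)). reflexivity.
  - apply cont_plus; auto. apply cont_mult; auto. apply cont_const.
Qed.

Lemma pcont_affine (c d s : R) (p : R -> C) : pcont p (c + d * s) -> pcont (fun s => p (c + d * s)) s.
Proof.
  intros H. apply (cont_comp RtoC RtoC (fun s => c + d * s) p); auto.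
  apply (cont_ext RtoC (fun s => RtoC c + RtoC d * RtoC s)%C) with (r := 1); [lra|intros; rewrite RtoC_plus, RtoC_mult; auto|].
  apply cont_plus; [apply cont_const|apply cont_mult; [apply cont_const|apply cont_self]].
Qed.

(** Since [pcont] and [rder] are two-sided, functions given on an interval are extended by composing
    with this 1-Lipschitz retraction. *)
Definition clamp (a b t : R) : R := Rmax a (Rmin b t).

Lemma clamp_in a b t : a <= b -> a <= clamp a b t <= b.
Proof. unfold clamp. intros. split; [apply Rmax_l|]. apply Rmax_lub; auto. apply Rmin_l. Qed.

Lemma clamp_id a b t : a <= t <= b -> clamp a b t = t.
Proof. unfold clamp. intros. rewrite Rmin_right by lra. apply Rmax_right. lra. Qed.

Lemma clamp_lip a b s t : Rabs (clamp a b s - clamp a b t) <= Rabs (s - t).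
Proof.
  unfold clamp, Rmax, Rmin.
  repeat destruct Rle_dec; unfold Rabs; repeat destruct Rcase_abs; lra.
Qed.

Lemma antiderivative (f : R -> C) a b :
  a <= b -> (forall t, a <= t <= b -> pcont f t) ->
  exists A, forall t, a <= t <= b -> rder A t (f t).
Proof.
  intros Hab Hf.
  assert (Hg : forall t, pcont (fun s => f (clamp a b s)) t).
  { intros t. apply (cont_comp RtoC RtoC (clamp a b) f).
    - intros eps He. exists eps. split; auto. intros s Hs. rewrite Cmod_RtoC_minus in *.
      eapply Rle_lt_trans; [apply clamp_lip|auto].
    - apply Hf, clamp_in; auto. }
  assert (Hreal : forall g : R -> R, (forall t, continuous g t) -> forall t, is_derive (RInt g a) t (g t)).
  { intros g Hcg t. apply is_derive_RInt with (a := a); auto.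
    exists (mkposreal 1 Rlt_0_1). intros y _. apply (RInt_correct g).
    apply ex_RInt_continuous. intros; auto. }
  set (fr := fun s => Re (f (clamp a b s))). set (fi := fun s => Im (f (clamp a b s))).
  exists (fun t => RtoC (RInt fr a t) + Ci * RtoC (RInt fi a t))%C.
  intros t Ht.
  replace (f t) with (RtoC (fr t) + Ci * RtoC (fi t))%C.
  2:{ unfold fr, fi. rewrite clamp_id by auto. symmetry. apply C_split. }
  apply der_plus; [|apply der_scal]; apply rder_RtoC, Hreal; intros s; apply pcont_real.
  - apply (cont_Re RtoC _ _ (Hg s)).
  - apply (cont_Im RtoC _ _ (Hg s)).
Qed.

(** The integral as the increment of an antiderivative, with the orientation built in for [b < a].
    The value does not depend on the antiderivative by [antiderivative_unique], and is arbitrary if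
    there is none. *)
Definition CInt (f : R -> C) (a b : R) : C :=
  epsilon (inhabits (RtoC 0)) (fun v => exists A,
    (forall t, Rmin a b <= t <= Rmax a b -> rder A t (f t)) /\ v = (A b - A a)%C).

Lemma antiderivative_unique (f A B : R -> C) a b :
  (forall t, Rmin a b <= t <= Rmax a b -> rder A t (f t)) ->
  (forall t, Rmin a b <= t <= Rmax a b -> rder B t (f t)) ->
  (A b - A a = B b - B a)%C.
Proof.
  intros HA HB.
  assert (H : forall t, Rmin a b <= t <= Rmax a b -> rder (fun s => A s - B s)%C t 0).
  { intros t Ht. replace (RtoC 0) with (f t - f t)%C by ring. apply der_minus; auto. }
  assert ((A b - B b = A a - B a)%C).
  { destruct (Rle_dec a b).
    - minmax H. apply (const_of_rder_0 (fun s => A s - B s)%C); auto.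
    - minmax H. symmetry.
      apply (const_of_rder_0 (fun s => A s - B s)%C); auto; lra. }
  replace (A b) with ((A b - B b) + B b)%C by ring. rewrite H0. ring.
Qed.

Lemma CInt_eq (f A : R -> C) a b :
  (forall t, Rmin a b <= t <= Rmax a b -> rder A t (f t)) -> CInt f a b = (A b - A a)%C.
Proof.
  intros HA. unfold CInt.
  assert (Hex : exists v, exists A,
    (forall t, Rmin a b <= t <= Rmax a b -> rder A t (f t)) /\ v = (A b - A a)%C) by eauto.
  apply epsilon_spec with (i := inhabits (RtoC 0)) in Hex.
  destruct Hex as [B [HB ->]]. apply (antiderivative_unique f); auto.
Qed.

Lemma CInt_antiderivative (f : R -> C) m M :
  m <= M -> (forall t, m <= t <= M -> pcont f t) ->
  exists A, (forall t, m <= t <= M -> rder A t (f t)) /\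
    forall a b, m <= a <= M -> m <= b <= M -> CInt f a b = (A b - A a)%C.
Proof.
  intros HmM Hf. destruct (antiderivative f m M HmM Hf) as [A HA].
  exists A. split; auto. intros a b Ha Hb. apply CInt_eq. intros t Ht. apply HA.
  unfold Rmin, Rmax in Ht. destruct (Rle_dec a b); lra.
Qed.

Lemma CInt_ext (f g : R -> C) a b :
  (forall t, Rmin a b <= t <= Rmax a b -> f t = g t) -> CInt f a b = CInt g a b.
Proof.
  intros H. unfold CInt. f_equal. apply functional_extensionality. intros v.
  apply propositional_extensionality. split; intros [A [HA ->]]; exists A; split; auto; intros t Ht.
  - rewrite <- H; auto.
  - rewrite H; auto.
Qed.

Lemma CInt_bound (f : R -> C) a b M :
  (forall t, Rmin a b <= t <= Rmax a b -> pcont f t /\ Cmod (f t) <= M) ->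
  Cmod (CInt f a b) <= M * Rabs (b - a).
Proof.
  intros H. set (m := Rmin a b) in *. set (n := Rmax a b) in *.
  assert (Hmn : m <= a <= n /\ m <= b <= n).
  { unfold m, n. repeat split; auto using Rmin_l, Rmax_l, Rmin_r, Rmax_r. }
  destruct (CInt_antiderivative f m n) as [A [HA HI]]; [lra|intros; apply H; auto|].
  rewrite HI by tauto.
  destruct (Rle_dec a b).
  - rewrite Rabs_pos_eq by lra. apply (mean_value A f); auto.
    intros t Ht. split; [apply HA|apply H]; lra.
  - rewrite Rabs_left by lra. rewrite Cmod_sym. replace (- (b - a)) with (a - b) by ring.
    apply (mean_value A f); [lra|]. intros t Ht. split; [apply HA|apply H]; lra.
Qed.

Lemma CInt_plus_scal (f g : R -> C) (c : C) a b :
  (forall t, Rmin a b <= t <= Rmax a b -> pcont f t) ->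
  (forall t, Rmin a b <= t <= Rmax a b -> pcont g t) ->
  CInt (fun t => f t + c * g t)%C a b = (CInt f a b + c * CInt g a b)%C.
Proof.
  intros Hf Hg.
  assert (Hm : Rmin a b <= Rmax a b) by (apply Rle_trans with a; [apply Rmin_l|apply Rmax_l]).
  destruct (antiderivative f _ _ Hm Hf) as [A HA].
  destruct (antiderivative g _ _ Hm Hg) as [B HB].
  rewrite (CInt_eq f A), (CInt_eq g B), (CInt_eq _ (fun t => A t + c * B t)%C); auto.
  - ring.
  - intros t Ht. apply der_plus; auto. apply der_scal; auto.
Qed.

(** Pieces of the contour integral of [f dz]: the factor [Ci] of [vint] is [dz/dt] on a vertical
    side, and [rect] runs counterclockwise around the rectangle. *)
Definition hint (f : C -> C) (y a b : R) : C := CInt (fun t => f (t, y)) a b.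
Definition vint (f : C -> C) (x a b : R) : C := (Ci * CInt (fun t => f (x, t)) a b)%C.
Definition rect (f : C -> C) (x1 x2 y1 y2 : R) : C :=
  (hint f y1 x1 x2 + vint f x2 y1 y2 - hint f y2 x1 x2 - vint f x1 y1 y2)%C.

Lemma pcont_hor (f : C -> C) x y : ccont f (x, y) -> pcont (fun t => f (t, y)) x.
Proof.
  intros H. apply (cont_comp RtoC cid (fun t => (t, y)) f); auto.
  apply cont_pair; [apply cont_self|apply cont_const].
Qed.

Lemma pcont_ver (f : C -> C) x y : ccont f (x, y) -> pcont (fun t => f (x, t)) y.
Proof.
  intros H. apply (cont_comp RtoC cid (fun t => (x, t)) f); auto.
  apply cont_pair; [apply cont_const|apply cont_self].
Qed.

Lemma rder_hor x y : rder (fun t => (t, y) : C) x 1.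
Proof.
  apply (der_ext RtoC (fun t => RtoC t + (0, y))%C) with (r := 1); [lra| |].
  - intros. unfold RtoC, Cplus; simpl; f_equal; ring.
  - replace (RtoC 1) with (1 + 0)%C by ring. apply der_plus; [apply der_self|apply der_const].
Qed.

Lemma rder_ver x y : rder (fun t => (x, t) : C) y Ci.
Proof.
  apply (der_ext RtoC (fun t => RtoC x + Ci * RtoC t)%C) with (r := 1); [lra| |].
  - intros t _. rewrite (C_split (x, t)). reflexivity.
  - apply (der_val RtoC _ _ (0 + Ci * 1)%C); [ring|]. apply der_plus; [apply der_const|apply der_scal, der_self].
Qed.

Section Box.
Context (X1 X2 Y1 Y2 : R) (HX : X1 <= X2) (HY : Y1 <= Y2).

Definition cont_on_box (f : C -> C) : Prop := forall z, in_box X1 X2 Y1 Y2 z -> ccont f z.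

Lemma hint_antiderivative f y : cont_on_box f -> Y1 <= y <= Y2 ->
  exists A, (forall t, X1 <= t <= X2 -> rder A t (f (t, y))) /\
    forall a b, X1 <= a <= X2 -> X1 <= b <= X2 -> hint f y a b = (A b - A a)%C.
Proof.
  intros Hf Hy. apply CInt_antiderivative; auto. intros t Ht. apply pcont_hor, Hf. split; auto.
Qed.

Lemma vint_antiderivative f x : cont_on_box f -> X1 <= x <= X2 ->
  exists A, (forall t, Y1 <= t <= Y2 -> rder A t (Ci * f (x, t))%C) /\
    forall a b, Y1 <= a <= Y2 -> Y1 <= b <= Y2 -> vint f x a b = (A b - A a)%C.
Proof.
  intros Hf Hy.
  destruct (CInt_antiderivative (fun t => f (x, t)) Y1 Y2) as [A [HA HI]]; auto.
  { intros t Ht. apply pcont_ver, Hf. split; auto. }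
  exists (fun t => Ci * A t)%C. split.
  - intros. apply der_scal. auto.
  - intros. unfold vint. rewrite HI; auto. ring.
Qed.

Lemma hint_chasles f y a b c : cont_on_box f -> Y1 <= y <= Y2 ->
  X1 <= a <= X2 -> X1 <= b <= X2 -> X1 <= c <= X2 -> hint f y a c = (hint f y a b + hint f y b c)%C.
Proof.
  intros. destruct (hint_antiderivative f y) as [A [_ HI]]; auto. rewrite !HI; auto. ring.
Qed.

Lemma vint_chasles f x a b c : cont_on_box f -> X1 <= x <= X2 ->
  Y1 <= a <= Y2 -> Y1 <= b <= Y2 -> Y1 <= c <= Y2 -> vint f x a c = (vint f x a b + vint f x b c)%C.
Proof.
  intros. destruct (vint_antiderivative f x) as [A [_ HI]]; auto. rewrite !HI; auto. ring.
Qed.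

Lemma rect_split_x f a b c y1 y2 : cont_on_box f ->
  X1 <= a <= X2 -> X1 <= b <= X2 -> X1 <= c <= X2 -> Y1 <= y1 <= Y2 -> Y1 <= y2 <= Y2 ->
  rect f a c y1 y2 = (rect f a b y1 y2 + rect f b c y1 y2)%C.
Proof.
  intros. unfold rect. rewrite (hint_chasles f y1 a b c), (hint_chasles f y2 a b c); auto. ring.
Qed.

Lemma rect_split_y f a b c x1 x2 : cont_on_box f ->
  Y1 <= a <= Y2 -> Y1 <= b <= Y2 -> Y1 <= c <= Y2 -> X1 <= x1 <= X2 -> X1 <= x2 <= X2 ->
  rect f x1 x2 a c = (rect f x1 x2 a b + rect f x1 x2 b c)%C.
Proof.
  intros. unfold rect. rewrite (vint_chasles f x1 a b c), (vint_chasles f x2 a b c); auto. ring.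
Qed.

Lemma rect_flip_x f a b y1 y2 : cont_on_box f ->
  X1 <= a <= X2 -> X1 <= b <= X2 -> Y1 <= y1 <= Y2 -> Y1 <= y2 <= Y2 ->
  rect f a b y1 y2 = (- rect f b a y1 y2)%C.
Proof.
  intros. unfold rect. destruct (hint_antiderivative f y1) as [A [_ HA]]; auto.
  destruct (hint_antiderivative f y2) as [B [_ HB]]; auto. rewrite !HA, !HB; auto. ring.
Qed.

Lemma rect_flip_y f a b y1 y2 : cont_on_box f ->
  X1 <= a <= X2 -> X1 <= b <= X2 -> Y1 <= y1 <= Y2 -> Y1 <= y2 <= Y2 ->
  rect f a b y1 y2 = (- rect f a b y2 y1)%C.
Proof.
  intros. unfold rect. destruct (vint_antiderivative f a) as [A [_ HA]]; auto.
  destruct (vint_antiderivative f b) as [B [_ HB]]; auto. rewrite !HA, !HB; auto. ring.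
Qed.

End Box.

Definition on_frame (x1 x2 y1 y2 : R) (z : C) : Prop :=
  in_box x1 x2 y1 y2 z /\ (Re z = x1 \/ Re z = x2 \/ Im z = y1 \/ Im z = y2).

Lemma rect_ext f g a b c d : a <= b -> c <= d ->
  (forall z, on_frame a b c d z -> f z = g z) -> rect f a b c d = rect g a b c d.
Proof.
  intros Hab Hcd H.
  assert (Hh : forall y, y = c \/ y = d -> hint f y a b = hint g y a b).
  { intros y Hy. apply CInt_ext. rewrite Rmin_left, Rmax_right by lra. intros t Ht.
    apply H. split; [split; simpl|]; try tauto. destruct Hy; lra. }
  assert (Hv : forall x, x = a \/ x = b -> vint f x c d = vint g x c d).
  { intros x Hx. unfold vint. f_equal. apply CInt_ext. rewrite Rmin_left, Rmax_right by lra. intros t Ht.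
    apply H. split; [split; simpl|]; try tauto. destruct Hx; lra. }
  unfold rect. rewrite !Hh, !Hv; auto.
Qed.

Lemma rect_primitive f P a b c d : a <= b -> c <= d ->
  (forall z, on_frame a b c d z -> cder P z (f z)) -> rect f a b c d = 0.
Proof.
  intros Hab Hcd HP.
  assert (Hh : forall y, y = c \/ y = d -> hint f y a b = (P (b, y) - P (a, y))%C).
  { intros y Hy. apply (CInt_eq _ (fun t => P (t, y))). rewrite Rmin_left, Rmax_right by lra. intros t Ht.
    replace (f (t, y)) with (1 * f (t, y))%C by ring.
    apply (rder_comp_cder P (fun s => (s, y))). apply rder_hor. apply HP. split; [split; simpl|]; try tauto.
    destruct Hy; lra. }
  assert (Hii : (Ci * Ci = - (1))%C) by (unfold Ci, Cmult, Copp, RtoC; simpl; f_equal; ring).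
  assert (Hv : forall x, x = a \/ x = b -> vint f x c d = (P (x, d) - P (x, c))%C).
  { intros x Hx. unfold vint. rewrite (CInt_eq _ (fun t => (- Ci) * P (x, t))%C).
    - replace (Ci * (- Ci * P (x, d) - - Ci * P (x, c)))%C with (- (Ci * Ci) * (P (x, d) - P (x, c)))%C by ring.
      rewrite Hii. ring.
    - rewrite Rmin_left, Rmax_right by lra. intros t Ht.
      apply (der_val RtoC _ _ (- Ci * (Ci * f (x, t)))%C).
      { replace (- Ci * (Ci * f (x, t)))%C with (- (Ci * Ci) * f (x, t))%C by ring. rewrite Hii. ring. }
      apply der_scal. apply (rder_comp_cder P (fun s => (x, s))). apply rder_ver.
      apply HP. split; [split; simpl|]; try tauto. destruct Hx; lra. }
  unfold rect. rewrite !Hh, !Hv; auto. ring.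
Qed.

Lemma rect_bound f a b c d M : a <= b -> c <= d ->
  (forall z, on_frame a b c d z -> ccont f z /\ Cmod (f z) <= M) ->
  Cmod (rect f a b c d) <= 2 * M * ((b - a) + (d - c)).
Proof.
  intros Hab Hcd HM.
  assert (Hh : forall y, y = c \/ y = d -> Cmod (hint f y a b) <= M * (b - a)).
  { intros y Hy. unfold hint. rewrite <- (Rabs_pos_eq (b - a)) by lra. apply CInt_bound.
    rewrite Rmin_left, Rmax_right by lra. intros t Ht.
    destruct (HM (t, y)); [split; [split; simpl|]; try tauto; destruct Hy; lra|].
    split; auto. apply pcont_hor; auto. }
  assert (Hv : forall x, x = a \/ x = b -> Cmod (vint f x c d) <= M * (d - c)).
  { intros x Hx. unfold vint. rewrite Cmod_mult, Cmod_Ci, Rmult_1_l. rewrite <- (Rabs_pos_eq (d - c)) by lra. apply CInt_bound.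
    rewrite Rmin_left, Rmax_right by lra. intros t Ht.
    destruct (HM (x, t)); [split; [split; simpl|]; try tauto; destruct Hx; lra|].
    split; auto. apply pcont_ver; auto. }
  unfold rect.
  eapply Rle_trans; [apply Cmod_tri2|]. eapply Rle_trans; [apply Rplus_le_compat_r, Cmod_tri2|].
  eapply Rle_trans; [apply Rplus_le_compat_r, Rplus_le_compat_r, Cmod_triangle|].
  pose proof (Hh c ltac:(auto)). pose proof (Hh d ltac:(auto)). pose proof (Hv a ltac:(auto)). pose proof (Hv b ltac:(auto)).
  lra.
Qed.

Lemma rect_plus_scal f g (k : C) a b c d : a <= b -> c <= d ->
  (forall z, on_frame a b c d z -> ccont f z) -> (forall z, on_frame a b c d z -> ccont g z) ->
  rect (fun z => f z + k * g z)%C a b c d = (rect f a b c d + k * rect g a b c d)%C.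
Proof.
  intros Hab Hcd Hf Hg.
  assert (Hh : forall y, y = c \/ y = d -> hint (fun z => f z + k * g z)%C y a b = (hint f y a b + k * hint g y a b)%C).
  { intros y Hy. unfold hint. apply (CInt_plus_scal (fun t => f (t, y)) (fun t => g (t, y)));
    rewrite Rmin_left, Rmax_right by lra; intros t Ht; apply pcont_hor; [apply Hf|apply Hg];
    (split; [split; simpl|]; try tauto; destruct Hy; lra). }
  assert (Hv : forall x, x = a \/ x = b -> vint (fun z => f z + k * g z)%C x c d = (vint f x c d + k * vint g x c d)%C).
  { intros x Hx. unfold vint. rewrite (CInt_plus_scal (fun t => f (x, t)) (fun t => g (x, t))); [ring| |];
    rewrite Rmin_left, Rmax_right by lra; intros t Ht; apply pcont_ver; [apply Hf|apply Hg];
    (split; [split; simpl|]; try tauto; destruct Hx; lra). }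
  unfold rect. rewrite !Hh, !Hv; auto. ring.
Qed.

Lemma nested_intervals (u v : nat -> R) :
  (forall n, u n <= u (S n)) -> (forall n, v (S n) <= v n) -> (forall n, u n <= v n) ->
  exists x, forall n, u n <= x <= v n.
Proof.
  intros Hu Hv Huv.
  assert (Mu : forall n m, (n <= m)%nat -> u n <= u m).
  { intros n m H. induction H; [lra|]. specialize (Hu m). lra. }
  assert (Mv : forall n m, (n <= m)%nat -> v m <= v n).
  { intros n m H. induction H; [lra|]. specialize (Hv m). lra. }
  assert (Mm : forall n m, u n <= v m).
  { intros n m. destruct (Nat.le_ge_cases n m) as [H|H].
    - specialize (Mu n m H). specialize (Huv m). lra.
    - specialize (Mv m n H). specialize (Huv n). lra. }
  destruct (completeness (fun x => exists n, x = u n)) as [x [H1 H2]].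
  - exists (v O). intros y [n ->]. apply Mm.
  - exists (u O). eauto.
  - exists x. intros n. split; [apply H1; eauto|]. apply H2. intros y [m ->]. apply Mm.
Qed.

(** Goursat's bisection in contrapositive form: a bad rectangle has a bad quarter, and the nested
    bad quarters shrink to a point at which small rectangles are good. The single scale [k] keeps
    all rectangles similar to the first one. *)
Lemma quartering (P : R -> R -> R -> Prop) (X Y w h : R) :
  0 < w -> 0 < h ->
  (forall k x y, 0 < k -> X <= x -> x + k * w <= X + w -> Y <= y -> y + k * h <= Y + h ->
     P (k/2) x y -> P (k/2) (x + k/2*w) y -> P (k/2) x (y + k/2*h) -> P (k/2) (x + k/2*w) (y + k/2*h) -> P k x y) ->
  (forall z, in_box X (X + w) Y (Y + h) z -> exists d, 0 < d /\
     forall k x y, 0 < k < d -> X <= x -> x + k * w <= X + w -> Y <= y -> y + k * h <= Y + h ->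
       in_box x (x + k*w) y (y + k*h) z -> P k x y) ->
  P 1 X Y.
Proof.
  intros Hw Hh Hq Hloc. apply NNPP. intro HnP.
  set (good := fun (k : R) (p : R * R) =>
     X <= fst p /\ fst p + k * w <= X + w /\ Y <= snd p /\ snd p + k * h <= Y + h /\ ~ P k (fst p) (snd p)).
  set (next := fun (k : R) (p q : R * R) => good (k/2) q /\
     fst p <= fst q /\ fst q + k/2*w <= fst p + k * w /\ snd p <= snd q /\ snd q + k/2*h <= snd p + k*h).
  assert (Hstep : forall k p, 0 < k -> good k p -> exists q, next k p q).
  { intros k [x y] Hk (H1 & H2 & H3 & H4 & H5). simpl in *. apply NNPP. intro Hn. apply H5.
    assert (0 < k * w) by nra. assert (0 < k * h) by nra.
    apply Hq; auto; apply NNPP; intro H6; apply Hn; eexists (_, _); unfold next, good; simpl;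
    (split; [split; [|split; [|split; [|split; [|exact H6]]]]|]); lra. }
  set (seq := fix seq n := match n with O => (X, Y) | S n => epsilon (inhabits (0, 0)) (next (/2^n) (seq n)) end).
  assert (Hpos : forall n, 0 < /2^n) by (intros; apply Rinv_0_lt_compat, pow_lt; lra).
  assert (Hhalf : forall n, /2^(S n) = /2^n/2) by (intros; simpl; field; apply pow_nonzero; lra).
  assert (Hgood : forall n, good (/2^n) (seq n)).
  { induction n.
    - simpl. unfold good; simpl. replace (/1) with 1 by field. repeat split; try lra. auto.
    - rewrite Hhalf. pose proof (epsilon_spec (inhabits (0,0)) _ (Hstep _ _ (Hpos n) IHn)) as [H _]. exact H. }
  assert (Hnext : forall n, next (/2^n) (seq n) (seq (S n))).
  { intros n. apply (epsilon_spec (inhabits (0,0)) _ (Hstep _ _ (Hpos n) (Hgood n))). }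
  destruct (nested_intervals (fun n => fst (seq n)) (fun n => fst (seq n) + /2^n * w)) as [x Hx].
  { intros n. apply (Hnext n). }
  { intros n. rewrite Hhalf. apply (Hnext n). }
  { intros n. pose proof (Hpos n). nra. }
  destruct (nested_intervals (fun n => snd (seq n)) (fun n => snd (seq n) + /2^n * h)) as [y Hy].
  { intros n. apply (Hnext n). }
  { intros n. rewrite Hhalf. apply (Hnext n). }
  { intros n. pose proof (Hpos n). nra. }
  destruct (Hloc (x, y)) as [d [Hd H]].
  { split; simpl.
    - specialize (Hx O). simpl in Hx. lra.
    - specialize (Hy O). simpl in Hy. lra. }
  destruct (pow_lt_1_zero (/2) ltac:(rewrite Rabs_pos_eq; lra) d Hd) as [n Hn].
  specialize (Hn n (le_n n)). rewrite pow_inv in Hn. rewrite Rabs_pos_eq in Hn by (left; auto).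
  destruct (Hgood n) as (H1 & H2 & H3 & H4 & H5). apply H5. apply H; auto.
  split; simpl; auto.
Qed.

Definition holo_on_box (X1 X2 Y1 Y2 : R) (f : C -> C) : Prop :=
  forall z, in_box X1 X2 Y1 Y2 z -> exists l, cder f z l.

Lemma holo_cont_on_box X1 X2 Y1 Y2 f : holo_on_box X1 X2 Y1 Y2 f -> cont_on_box X1 X2 Y1 Y2 f.
Proof. intros H z Hz. destruct (H z Hz) as [l Hl]. eapply der_cont; eauto. Qed.

Lemma cder_affine (A B z0 z : C) : cder (fun z => A * (z - z0) + B * (z - z0) * (z - z0))%C z (A + 2 * B * (z - z0)).
Proof.
  assert (H0 : cder (fun z => z - z0)%C z 1).
  { replace (RtoC 1) with (1 - 0)%C by ring. apply der_minus; [apply der_self|apply der_const]. }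
  replace (A + 2 * B * (z - z0))%C with (A * 1 + (B * 1 * (z - z0) + B * (z - z0) * 1))%C by ring.
  apply der_plus; [apply der_scal; auto|].
  apply (der_mult cid (fun z => B * (z - z0))%C (fun z => z - z0)%C); auto. apply der_scal; auto.
Qed.

(** The bound [e * (k * k)] is proportional to the area, so it is inherited from the quarters. On a
    small rectangle the affine part of [f] has a primitive, and the rest is of smaller order than
    the size of the rectangle. *)
Lemma goursat_pos X Y w h f : 0 < w -> 0 < h -> holo_on_box X (X + w) Y (Y + h) f ->
  rect f X (X + w) Y (Y + h) = 0.
Proof.
  intros Hw Hh Hf. apply Cmod_eq_0. apply Rle_antisym; [|apply Cmod_ge_0].
  apply le_epsilon. intros e He. rewrite Rplus_0_l.
  pose proof (holo_cont_on_box _ _ _ _ _ Hf) as Hc.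
  assert (K : Cmod (rect f X (X + 1 * w) Y (Y + 1 * h)) <= e * (1 * 1)).
  2:{ rewrite !Rmult_1_l, Rmult_1_r in K. exact K. }
  apply (quartering (fun k x y => Cmod (rect f x (x + k * w) y (y + k * h)) <= e * (k * k)) X Y w h); auto.
  - intros k x y Hk Hx1 Hx2 Hy1 Hy2 P1 P2 P3 P4.
    assert (0 < k * w) by nra. assert (0 < k * h) by nra.
    rewrite (rect_split_x X (X + w) Y (Y + h) ltac:(lra) f x (x + k/2*w) (x + k*w)); auto; try lra.
    rewrite (rect_split_y X (X + w) Y (Y + h) ltac:(lra) f y (y + k/2*h) (y + k*h)); auto; try lra.
    rewrite (rect_split_y X (X + w) Y (Y + h) ltac:(lra) f y (y + k/2*h) (y + k*h)); auto; try lra.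
    replace (x + k/2*w + k/2*w) with (x + k * w) in * by field.
    replace (y + k/2*h + k/2*h) with (y + k * h) in * by field.
    eapply Rle_trans; [apply Cmod_triangle|].
    eapply Rle_trans; [apply Rplus_le_compat; apply Cmod_triangle|].
    lra.
  - intros z Hz. destruct (Hf z Hz) as [l Hl].
    set (e' := e / (2 * (w + h) * (w + h))).
    assert (He' : 0 < e') by (apply Rdiv_lt_0_compat; nra).
    destruct (Hl e' He') as [d [Hd HK]].
    exists (d / (w + h)). split; [apply Rdiv_lt_0_compat; lra|].
    intros k x y [Hk Hkd] Hx1 Hx2 Hy1 Hy2 [Hzx Hzy].
    apply Rlt_div_r in Hkd; [|lra].
    assert (0 < k * w) by nra. assert (0 < k * h) by nra.
    (* The slope is written [2 * (l / 2)] to match the derivative in [cder_affine]. *)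
    set (L := fun v => (f z + 2 * (l / 2) * (v - z))%C).
    assert (H2 : (RtoC 2) <> 0) by (apply Cmod_gt_0; rewrite Cmod_R, Rabs_pos_eq; lra).
    set (g := fun v => (f v + (-1) * L v)%C).
    assert (HLc : cont_on_box X (X + w) Y (Y + h) L).
    { intros v _. unfold L. apply cont_plus; [apply cont_const|]. apply cont_mult; [apply cont_const|].
      apply cont_minus; [apply cont_self|apply cont_const]. }
    assert (HL : rect L x (x + k * w) y (y + k * h) = 0).
    { apply rect_primitive with (P := fun v => (f z * (v - z) + (l/2) * (v - z) * (v - z))%C); try lra.
      intros. apply cder_affine. }
    assert (Hg : rect f x (x + k * w) y (y + k * h) = rect g x (x + k * w) y (y + k * h)).
    { unfold g. rewrite rect_plus_scal; try lra. rewrite HL. ring.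
      - intros v [[Hvx Hvy] _]. apply Hc. split; lra.
      - intros v [[Hvx Hvy] _]. apply HLc. split; lra. }
    rewrite Hg.
    eapply Rle_trans.
    + apply rect_bound with (M := e' * (k * (w + h))); try lra.
      intros v [[Hvx Hvy] _]. split.
      * assert (in_box X (X + w) Y (Y + h) v) by (split; lra).
        unfold g. apply cont_plus; auto. apply cont_mult; [apply cont_const|auto].
      * unfold g, L.
        assert (Hvz : Cmod (v - z) <= k * (w + h)).
        { eapply Rle_trans; [apply Cmod_le_ReIm|]. rewrite Re_minus, Im_minus.
          assert (Rabs (Re v - Re z) <= k * w) by (apply Rabs_le; lra).
          assert (Rabs (Im v - Im z) <= k * h) by (apply Rabs_le; lra). lra. }
        specialize (HK v). unfold cid in HK.
        replace (f v + -1 * (f z + 2 * (l / 2) * (v - z)))%C with (f v - f z - (v - z) * l)%C by (field; auto).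
        eapply Rle_trans; [apply HK; lra|]. apply Rmult_le_compat_l; lra.
    + right. unfold e'. field. lra.
Qed.

Lemma sub_holo X1 X2 Y1 Y2 a b c d f : holo_on_box X1 X2 Y1 Y2 f ->
  X1 <= a -> b <= X2 -> Y1 <= c -> d <= Y2 -> holo_on_box a b c d f.
Proof. intros H ? ? ? ? z [? ?]. apply H. split; lra. Qed.

(** Degenerate and reversed rectangles are included, so that a primitive can be built without
    distinguishing the relative positions of points. *)
Lemma goursat X1 X2 Y1 Y2 f a b c d : holo_on_box X1 X2 Y1 Y2 f ->
  X1 <= a <= X2 -> X1 <= b <= X2 -> Y1 <= c <= Y2 -> Y1 <= d <= Y2 -> rect f a b c d = 0.
Proof.
  intros Hf. pose proof (holo_cont_on_box _ _ _ _ _ Hf) as Hc.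
  assert (Hpos : forall a b c d, X1 <= a -> a < b -> b <= X2 -> Y1 <= c -> c < d -> d <= Y2 -> rect f a b c d = 0).
  { clear a b c d. intros a b c d **. replace b with (a + (b - a)) by ring. replace d with (c + (d - c)) by ring.
    apply goursat_pos; try lra. apply (sub_holo X1 X2 Y1 Y2); auto; lra. }
  assert (Hx : forall a b c d, X1 <= a <= X2 -> X1 <= b <= X2 -> Y1 <= c -> c < d -> d <= Y2 -> rect f a b c d = 0).
  { clear a b c d. intros a b c d **. destruct (Rtotal_order a b) as [?|[->|?]].
    - apply Hpos; lra.
    (* Splitting at a repeated abscissa says that the integral equals its own double. *)
    - pose proof (rect_split_x X1 X2 Y1 Y2 ltac:(lra) f b b b c d Hc ltac:(lra) ltac:(lra) ltac:(lra) ltac:(lra) ltac:(lra)) as E.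
      replace (rect f b b c d) with (rect f b b c d + rect f b b c d - rect f b b c d)%C at 1 by ring.
      rewrite <- E. ring.
    - rewrite (rect_flip_x X1 X2 Y1 Y2); auto; try lra. rewrite Hpos; try lra. ring. }
  intros. destruct (Rtotal_order c d) as [?|[->|?]].
  - apply Hx; lra.
  - pose proof (rect_split_y X1 X2 Y1 Y2 ltac:(lra) f d d d a b Hc ltac:(lra) ltac:(lra) ltac:(lra) ltac:(lra) ltac:(lra)) as E.
    replace (rect f a b d d) with (rect f a b d d + rect f a b d d - rect f a b d d)%C at 1 by ring.
    rewrite <- E. ring.
  - rewrite (rect_flip_y X1 X2 Y1 Y2); auto; try lra. rewrite Hx; try lra. ring.
Qed.

Definition in_square (c : C) (r : R) (z : C) : Prop := Rabs (Re z - Re c) < r /\ Rabs (Im z - Im c) < r.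
Definition in_csquare (c : C) (r : R) (z : C) : Prop := in_box (Re c - r) (Re c + r) (Im c - r) (Im c + r) z.

Lemma CInt_near (f : R -> C) t0 t v eps :
  (forall s, Rmin t0 t <= s <= Rmax t0 t -> pcont f s /\ Cmod (f s - v) <= eps) ->
  Cmod (CInt f t0 t - (t - t0) * v) <= eps * Rabs (t - t0).
Proof.
  intros H.
  replace (CInt f t0 t - (t - t0) * v)%C with (CInt (fun s => f s + (-1) * v)%C t0 t).
  - apply CInt_bound. intros s Hs. destruct (H s Hs). split.
    + apply cont_plus; auto. apply cont_const.
    + replace (f s + -1 * v)%C with (f s - v)%C by ring. auto.
  - rewrite (CInt_plus_scal f (fun _ => v)); [|apply H|intros; apply cont_const].
    rewrite (CInt_eq (fun _ => v) (fun s => RtoC s * v)%C). ring.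
    intros s _. apply (der_val RtoC _ _ (1 * v + s * 0)%C); [ring|]. apply (der_mult RtoC RtoC (fun _ => v)); [apply der_self|apply der_const].
Qed.

(** The primitive integrates along an L-shaped path from the centre. By Goursat its increment from
    [z] to [w] is the integral along the L-shaped path between them, where [f] is close to [f z]. *)
Lemma holo_primitive (f : C -> C) (c : C) (r : R) :
  (forall z, in_csquare c r z -> exists l, cder f z l) ->
  exists P, forall z, in_square c r z -> cder P z (f z).
Proof.
  intros Hf. set (X1 := Re c - r) in *. set (X2 := Re c + r) in *. set (Y1 := Im c - r) in *. set (Y2 := Im c + r) in *.
  assert (Hf' : holo_on_box X1 X2 Y1 Y2 f) by exact Hf.
  pose proof (holo_cont_on_box _ _ _ _ _ Hf') as Hc.
  exists (fun z => hint f (Im c) (Re c) (Re z) + vint f (Re z) (Im c) (Im z))%C.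
  intros z [Hzx Hzy]. apply Rabs_def2 in Hzx, Hzy.
  assert (Hr : 0 < r) by lra.
  intros eps He.
  assert (Hzc : ccont f z) by (apply Hc; unfold X1, X2, Y1, Y2; split; lra).
  destruct (Hzc (eps/2)) as [d [Hd HK]]; [lra|]. unfold cid in HK.
  set (m := Rmin (r - Rabs (Re z - Re c)) (r - Rabs (Im z - Im c))).
  assert (Hm : 0 < m) by (apply Rmin_glb_lt; [assert (Rabs (Re z - Re c) < r) by (apply Rabs_def1; lra)|assert (Rabs (Im z - Im c) < r) by (apply Rabs_def1; lra)]; lra).
  exists (Rmin (d/2) m). split; [apply Rmin_glb_lt; lra|].
  intros w Hw. unfold cid in *.
  assert (Hwd := Rlt_Rmin_l Hw). assert (Hwm := Rlt_Rmin_r Hw).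
  pose proof (Re_le_Cmod (w - z)) as HwR. pose proof (Im_le_Cmod (w - z)) as HwI. rewrite Re_minus in HwR. rewrite Im_minus in HwI.
  assert (m <= r - Rabs (Re z - Re c)) by apply Rmin_l. assert (m <= r - Rabs (Im z - Im c)) by apply Rmin_r.
  assert (Bx : Rabs (Re w - Re c) < r).
  { replace (Re w - Re c) with ((Re w - Re z) + (Re z - Re c)) by ring. eapply Rle_lt_trans; [apply Rabs_triang|]. lra. }
  assert (By : Rabs (Im w - Im c) < r).
  { replace (Im w - Im c) with ((Im w - Im z) + (Im z - Im c)) by ring. eapply Rle_lt_trans; [apply Rabs_triang|]. lra. }
  apply Rabs_def2 in Bx, By.
  assert (E1 : (hint f (Im c) (Re c) (Re w) + vint f (Re w) (Im c) (Im w)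
      - (hint f (Im c) (Re c) (Re z) + vint f (Re z) (Im c) (Im z))
      = hint f (Im z) (Re z) (Re w) + vint f (Re w) (Im z) (Im w))%C).
  { pose proof (goursat X1 X2 Y1 Y2 f (Re z) (Re w) (Im c) (Im z) Hf' ltac:(unfold X1,X2; lra) ltac:(unfold X1,X2; lra) ltac:(unfold Y1,Y2; lra) ltac:(unfold Y1,Y2; lra)) as E.
    unfold rect in E.
    rewrite (hint_chasles X1 X2 Y1 Y2 ltac:(unfold X1,X2; lra) f (Im c) (Re c) (Re z) (Re w)); auto; try (unfold X1,X2,Y1,Y2; lra).
    rewrite (vint_chasles X1 X2 Y1 Y2 ltac:(unfold Y1,Y2; lra) f (Re w) (Im c) (Im z) (Im w)); auto; try (unfold X1,X2,Y1,Y2; lra).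
    match goal with |- ?L = ?R => replace L with (R + 0)%C; [ring|] end.
    rewrite <- E. ring. }
  rewrite E1.
  replace (hint f (Im z) (Re z) (Re w) + vint f (Re w) (Im z) (Im w) - (w - z) * f z)%C
    with ((hint f (Im z) (Re z) (Re w) - (RtoC (Re w) - RtoC (Re z)) * f z)
       + Ci * (CInt (fun t => f (Re w, t)) (Im z) (Im w) - (RtoC (Im w) - RtoC (Im z)) * f z))%C.
  2:{ unfold vint. replace (w - z)%C with ((RtoC (Re w) - RtoC (Re z)) + Ci * (RtoC (Im w) - RtoC (Im z)))%C.
      ring. rewrite (C_split w) at 3. rewrite (C_split z) at 3. ring. }
  eapply Rle_trans; [apply Cmod_triangle|]. rewrite Cmod_mult, Cmod_Ci, Rmult_1_l.
  assert (Hnear : forall v, Rmin (Re z) (Re w) <= Re v <= Rmax (Re z) (Re w) -> Rmin (Im z) (Im w) <= Im v <= Rmax (Im z) (Im w) ->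
     ccont f v /\ Cmod (f v - f z) <= eps / 2).
  { intros v Hvx Hvy.
    assert (Rabs (Re v - Re z) <= Rabs (Re w - Re z) /\ X1 <= Re v <= X2).
    { unfold Rmin, Rmax in Hvx. unfold X1, X2. destruct (Rle_dec (Re z) (Re w)).
      rewrite !Rabs_pos_eq by lra; lra. rewrite !Rabs_left1 by lra; lra. }
    assert (Rabs (Im v - Im z) <= Rabs (Im w - Im z) /\ Y1 <= Im v <= Y2).
    { unfold Rmin, Rmax in Hvy. unfold Y1, Y2. destruct (Rle_dec (Im z) (Im w)).
      rewrite !Rabs_pos_eq by lra; lra. rewrite !Rabs_left1 by lra; lra. }
    split; [apply Hc; split; tauto|]. left. apply HK.
    eapply Rle_lt_trans; [apply Cmod_le_ReIm|]. rewrite Re_minus, Im_minus. lra. }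
  assert (Ax : Cmod (hint f (Im z) (Re z) (Re w) - (RtoC (Re w) - RtoC (Re z)) * f z) <= eps/2 * Rabs (Re w - Re z)).
  { apply CInt_near. intros s Hs. destruct (Hnear (s, Im z)); simpl; auto. split; [apply Rmin_l|apply Rmax_l].
    split; auto. apply pcont_hor; auto. }
  assert (Ay : Cmod (CInt (fun t => f (Re w, t)) (Im z) (Im w) - (RtoC (Im w) - RtoC (Im z)) * f z) <= eps/2 * Rabs (Im w - Im z)).
  { apply CInt_near. intros s Hs. destruct (Hnear (Re w, s)); simpl; auto. split; [apply Rmin_r|apply Rmax_r].
    split; auto. apply pcont_ver; auto. }
  pose proof (Rmult_le_compat_l (eps/2) _ _ ltac:(lra) HwR). pose proof (Rmult_le_compat_l (eps/2) _ _ ltac:(lra) HwI). lra.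
Qed.

(** * Cauchy's formula and zeros of entire functions *)

(** Everything outside a small square around [p] contributes nothing, and the square contributes at
    most a constant times its side, since [f] is continuous at [p]. *)
Lemma rect_removable f p X1 X2 Y1 Y2 :
  X1 < Re p < X2 -> Y1 < Im p < Y2 -> cont_on_box X1 X2 Y1 Y2 f ->
  (forall z, in_box X1 X2 Y1 Y2 z -> z <> p -> exists l, cder f z l) ->
  rect f X1 X2 Y1 Y2 = 0.
Proof.
  intros Hx Hy Hc Hf.
  assert (Hsub : forall a b c d, X1 <= a -> a <= b -> b <= X2 -> Y1 <= c -> c <= d -> d <= Y2 ->
    (Re p < a \/ b < Re p \/ Im p < c \/ d < Im p) -> rect f a b c d = 0).
  { intros a b c d **. apply (goursat a b c d); try lra.
    intros z [Hz1 Hz2]. apply Hf; [split; lra|]. intros ->. lra. }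
  assert (Hp : in_box X1 X2 Y1 Y2 p) by (split; lra).
  destruct (Hc p Hp 1 Rlt_0_1) as [d [Hd K]]. unfold cid in K.
  apply Cmod_eq_0, Rle_antisym; [|apply Cmod_ge_0].
  apply le_epsilon. intros e He. rewrite Rplus_0_l.
  set (M := Cmod (f p) + 1).
  assert (HM : 0 < M) by (pose proof (Cmod_ge_0 (f p)); unfold M; lra).
  (* The square has half-side [n], for which [rect_bound] gives [2 * M * (4 * n)]; hence the divisor
     [8 * M]. The third of [d] keeps the square inside the disc of continuity. *)
  set (n := Rmin (Rmin (d / 3) (e / (8 * M))) (Rmin (Rmin (Re p - X1) (X2 - Re p)) (Rmin (Im p - Y1) (Y2 - Im p)))).
  assert (Hn : 0 < n).
  { unfold n. repeat apply Rmin_glb_lt; try lra. apply Rdiv_lt_0_compat; lra. }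
  assert (Hb : n <= d/3 /\ n <= e / (8*M) /\ n <= Re p - X1 /\ n <= X2 - Re p /\ n <= Im p - Y1 /\ n <= Y2 - Im p).
  { repeat split; unfold n.
    - eapply Rle_trans; [apply Rmin_l|apply Rmin_l].
    - eapply Rle_trans; [apply Rmin_l|apply Rmin_r].
    - eapply Rle_trans; [apply Rmin_r|]. eapply Rle_trans; [apply Rmin_l|apply Rmin_l].
    - eapply Rle_trans; [apply Rmin_r|]. eapply Rle_trans; [apply Rmin_l|apply Rmin_r].
    - eapply Rle_trans; [apply Rmin_r|]. eapply Rle_trans; [apply Rmin_r|apply Rmin_l].
    - eapply Rle_trans; [apply Rmin_r|]. eapply Rle_trans; [apply Rmin_r|apply Rmin_r]. }
  destruct Hb as (B1 & B2 & B3 & B4 & B5 & B6).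
  rewrite (rect_split_x X1 X2 Y1 Y2 ltac:(lra) f X1 (Re p - n) X2); auto; try lra.
  rewrite (rect_split_x X1 X2 Y1 Y2 ltac:(lra) f (Re p - n) (Re p + n) X2); auto; try lra.
  rewrite (rect_split_y X1 X2 Y1 Y2 ltac:(lra) f Y1 (Im p - n) Y2 (Re p - n)); auto; try lra.
  rewrite (rect_split_y X1 X2 Y1 Y2 ltac:(lra) f (Im p - n) (Im p + n) Y2 (Re p - n)); auto; try lra.
  rewrite (Hsub X1 (Re p - n)), (Hsub (Re p + n) X2), (Hsub _ _ Y1 (Im p - n)), (Hsub _ _ (Im p + n) Y2); try lra.
  match goal with |- Cmod (?L) <= _ => replace L with (rect f (Re p - n) (Re p + n) (Im p - n) (Im p + n)) by ring end.
  eapply Rle_trans.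
  - apply rect_bound with (M := M); try lra. intros z [[Hz1 Hz2] _]. split; [apply Hc; split; lra|].
    assert (Cmod (z - p) < d).
    { eapply Rle_lt_trans; [apply Cmod_le_ReIm|]. rewrite Re_minus, Im_minus.
      assert (Rabs (Re z - Re p) <= n) by (apply Rabs_le; lra).
      assert (Rabs (Im z - Im p) <= n) by (apply Rabs_le; lra). lra. }
    specialize (K z H). pose proof (Cmod_rev (f z) (f p)). unfold M. lra.
  - apply Rle_div_r in B2; [|lra]. lra.
Qed.

Lemma frame_dist a b c d p e z :
  a + e <= Re p <= b - e -> c + e <= Im p <= d - e -> on_frame a b c d z -> e <= Cmod (z - p).
Proof.
  intros Hx Hy [[Hzx Hzy] Hf].
  pose proof (Re_le_Cmod (z - p)). pose proof (Im_le_Cmod (z - p)). rewrite Re_minus in H. rewrite Im_minus in H0.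
  pose proof (Rle_abs (Re z - Re p)). pose proof (Rle_abs (Im z - Im p)).
  pose proof (Rle_abs (- (Re z - Re p))). pose proof (Rle_abs (- (Im z - Im p))). rewrite Rabs_Ropp in *.
  destruct Hf as [Hf|[Hf|[Hf|Hf]]]; lra.
Qed.

Lemma ccont_minus_const p z : ccont (fun w => w - p)%C z.
Proof. apply cont_minus; [apply cont_self|apply cont_const]. Qed.

Lemma cder_minus_const p z : cder (fun w => w - p)%C z 1.
Proof. apply (der_val cid _ _ (1 - 0)%C); [ring|]. apply der_minus; [apply der_self|apply der_const]. Qed.

(** The divided difference of [f] at [p] has a removable singularity. The integral of [1 / (z - p)]
    is left as it stands instead of being evaluated to [2 i pi]; its nonvanishing is enough to solve
    for [f p]. *)
Lemma cauchy_formula f p X1 X2 Y1 Y2 :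
  X1 < Re p < X2 -> Y1 < Im p < Y2 -> holo_on_box X1 X2 Y1 Y2 f ->
  rect (fun z => f z * / (z - p))%C X1 X2 Y1 Y2 = (f p * rect (fun z => / (z - p))%C X1 X2 Y1 Y2)%C.
Proof.
  intros Hx Hy Hf.
  destruct (Hf p) as [l Hl]; [split; lra|].
  set (q := fun z => if Ceq_dec z p then l else ((f z - f p) * / (z - p))%C).
  assert (Hnp : forall z, on_frame X1 X2 Y1 Y2 z -> z <> p).
  { intros z Hz ->. destruct Hz as [_ Hz]. lra. }
  assert (Hq : rect q X1 X2 Y1 Y2 = 0).
  { apply (rect_removable q p); auto.
    - intros z Hz. destruct (Ceq_dec z p) as [->|Hn].
      + intros eps He. destruct (Hl (eps/2)) as [d [Hd K]]; [lra|]. exists d. split; auto.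
        intros y Hyd. unfold q, cid in *. destruct (Ceq_dec p p); [|congruence].
        destruct (Ceq_dec y p) as [->|Hyp].
        * rewrite Cmod_self; auto.
        * specialize (K y Hyd). apply Cminus_eq_contra in Hyp.
          replace ((f y - f p) * / (y - p) - l)%C with ((f y - f p - (y - p) * l) / (y - p))%C by (field; auto).
          rewrite Cmod_div by auto. apply Cmod_gt_0 in Hyp. apply Rlt_div_l; auto. nra.
      + destruct (Hf z Hz) as [m Hm]. pose proof (proj1 (Cmod_gt_0 _) (Cminus_eq_contra _ _ Hn)) as Hpos.
        apply (cont_ext cid (fun z => (f z - f p) * / (z - p))%C) with (r := Cmod (z - p)); auto.
        * intros y Hyz. unfold q, cid in *. destruct (Ceq_dec y p) as [->|]; auto.
          rewrite Cmod_sym in Hyz. lra.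
        * apply cont_mult; [apply cont_minus; [eapply der_cont; eauto|apply cont_const]|].
          apply cont_inv; [apply ccont_minus_const|]. apply Cminus_eq_contra; auto.
    - intros z Hz Hn. destruct (Hf z Hz) as [m Hm]. pose proof (proj1 (Cmod_gt_0 _) (Cminus_eq_contra _ _ Hn)) as Hpos.
      eexists. apply (der_ext cid (fun z => (f z - f p) / (z - p))%C) with (r := Cmod (z - p)); auto.
      + intros y Hyz. unfold q, cid in *. destruct (Ceq_dec y p) as [->|]; auto.
        rewrite Cmod_sym in Hyz. lra.
      + apply der_div; [apply der_minus; [apply Hm|apply der_const]|apply cder_minus_const|].
        apply Cminus_eq_contra; auto. }
  assert (E : rect (fun z => f z * / (z - p) + (- f p) * (/ (z - p)))%C X1 X2 Y1 Y2 = 0).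
  { rewrite <- Hq. apply rect_ext; try lra. intros z Hz. unfold q.
    destruct (Ceq_dec z p) as [->|]; [exfalso; apply (Hnp p); auto|]. ring. }
  rewrite rect_plus_scal in E; try lra.
  - replace (rect (fun z => f z * / (z - p))%C X1 X2 Y1 Y2) with
      (rect (fun z => f z * / (z - p))%C X1 X2 Y1 Y2 + - f p * rect (fun z => / (z - p))%C X1 X2 Y1 Y2
       + f p * rect (fun z => / (z - p))%C X1 X2 Y1 Y2)%C by ring.
    rewrite E. ring.
  - intros z Hz. destruct (Hf z (proj1 Hz)) as [m Hm].
    apply cont_mult; [eapply der_cont; eauto|apply cont_inv; [apply ccont_minus_const|apply Cminus_eq_contra; auto]].
  - intros z Hz. apply cont_inv; [apply ccont_minus_const|apply Cminus_eq_contra; auto].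
Qed.

Lemma CInt_Im_ge f a b m : a <= b ->
  (forall t, a <= t <= b -> pcont f t /\ m <= Im (f t)) -> m * (b - a) <= Im (CInt f a b).
Proof.
  intros Hab H.
  destruct (CInt_antiderivative f a b Hab) as [A [HA HI]]; [apply H|].
  rewrite HI by lra. rewrite Im_minus.
  destruct (MVT_gen (fun s => Im (A s)) a b (fun s => Im (f s))) as [c [Hc E]].
  - rewrite Rmin_left, Rmax_right by lra. intros x Hx. apply rder_Im, HA. lra.
  - rewrite Rmin_left, Rmax_right by lra. intros x Hx. apply continuity_pt_filterlim.
    apply (ex_derive_continuous (V := R_NormedModule)). eexists. apply rder_Im, HA; auto.
  - rewrite E. minmax Hc. apply Rmult_le_compat_r; [lra|]. apply H; auto.
Qed.

Lemma CInt_Im_scal_nonneg c f a b : a <= b ->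
  (forall t, a <= t <= b -> pcont f t /\ 0 <= Im (c * f t)) -> 0 <= Im (c * CInt f a b).
Proof.
  intros Hab H. replace (c * CInt f a b)%C with (CInt (fun t => 0 + c * f t)%C a b).
  - pose proof (CInt_Im_ge (fun t => 0 + c * f t)%C a b 0 Hab) as Q. rewrite Rmult_0_l in Q. apply Q. clear Q. intros t Ht. destruct (H t Ht). split.
    + apply cont_plus; [apply cont_const|apply cont_mult; [apply cont_const|auto]].
    + replace (0 + c * f t)%C with (c * f t)%C by ring. auto.
  - rewrite (CInt_plus_scal (fun _ => RtoC 0) f c a b).
    + rewrite (CInt_eq (fun _ => RtoC 0) (fun _ => RtoC 0)); [ring|]. intros; apply der_const.
    + intros; apply cont_const.
    + intros t Ht. minmax Ht. apply H; auto.
Qed.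

Lemma Cinv_comp x y : (/ (x, y))%C = (x / (x^2 + y^2), (- y) / (x^2+y^2)).
Proof. reflexivity. Qed.

(** Seen from [p], every side is traversed with increasing argument, so each contributes a
    nonnegative imaginary part, and the bottom side a positive one. *)
Lemma rect_inv_nonzero p X1 X2 Y1 Y2 :
  X1 < Re p < X2 -> Y1 < Im p < Y2 -> rect (fun z => / (z - p))%C X1 X2 Y1 Y2 <> 0.
Proof.
  intros Hx Hy E. destruct p as [u v]. simpl in *.
  assert (Hc : forall z, on_frame X1 X2 Y1 Y2 z -> ccont (fun z => / (z - (u, v)))%C z).
  { intros z Hz. apply cont_inv; [apply ccont_minus_const|]. apply Cminus_eq_contra.
    intros ->. destruct Hz as [_ Hz]. simpl in Hz. lra. }
  assert (Hin : forall s t, ((s, t) - (u, v))%C = (s - u, t - v)) by reflexivity.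
  assert (P : forall s t, X1 <= s <= X2 /\ (t = Y1 \/ t = Y2) \/ Y1 <= t <= Y2 /\ (s = X1 \/ s = X2) ->
    0 < (s - u)^2 + (t - v)^2 /\ pcont (fun s => / ((s, t) - (u, v)))%C s /\ pcont (fun t => / ((s, t) - (u, v)))%C t).
  { intros s t H. split.
    - destruct H as [[_ Ht]|[_ Hs]].
      + apply Rplus_le_lt_0_compat; [apply pow2_ge_0|apply pow2_gt_0; lra].
      + apply Rplus_lt_le_0_compat; [apply pow2_gt_0; lra|apply pow2_ge_0].
    - split; [apply (pcont_hor (fun z => / (z - (u,v)))%C)|apply (pcont_ver (fun z => / (z - (u,v)))%C)];
      apply Hc; (split; [split; simpl; lra|simpl; tauto]). }
  set (D := (X2 - X1)^2 + (Y2 - Y1)^2).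
  assert (HD : 0 < D) by (unfold D; nra).
  assert (I1 : (v - Y1) / D * (X2 - X1) <= Im (hint (fun z => / (z - (u, v)))%C Y1 X1 X2)).
  { apply CInt_Im_ge; [lra|]. intros t Ht. destruct (P t Y1) as (P1 & P2 & P3); [tauto|]. split; auto.
    rewrite Hin, Cinv_comp. unfold Im, snd. replace (- (Y1 - v)) with (v - Y1) by ring.
    apply Rmult_le_compat_l; [lra|]. apply Rinv_le_contravar; auto. unfold D.
    apply Rplus_le_compat; apply pow_maj_Rabs, Rabs_le; lra. }
  assert (Hs : forall c s t, X1 <= s <= X2 /\ (t = Y1 \/ t = Y2) \/ Y1 <= t <= Y2 /\ (s = X1 \/ s = X2) ->
    0 <= Im c * (s - u) - Re c * (t - v) -> 0 <= Im (c * / ((s, t) - (u, v)))).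
  { intros c s t H Hle. destruct (P s t H) as [P1 _]. rewrite Hin, Cinv_comp.
    replace (Im (c * _)%C) with ((Im c * (s - u) - Re c * (t - v)) / ((s - u)^2 + (t - v)^2)).
    - apply Rmult_le_pos; [auto|left; apply Rinv_0_lt_compat; auto].
    - destruct c. unfold Re, Im, Cmult. simpl fst. simpl snd. field. lra. }
  assert (I2 : 0 <= Im (-1 * CInt (fun s => / ((s, Y2) - (u, v)))%C X1 X2)).
  { apply CInt_Im_scal_nonneg; [lra|]. intros t Ht. split; [apply P; tauto|apply Hs; [tauto|simpl; lra]]. }
  assert (I3 : 0 <= Im (Ci * CInt (fun t => / ((X2, t) - (u, v)))%C Y1 Y2)).
  { apply CInt_Im_scal_nonneg; [lra|]. intros t Ht. split; [apply P; tauto|apply Hs; [tauto|simpl; lra]]. }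
  assert (I4 : 0 <= Im (- Ci * CInt (fun t => / ((X1, t) - (u, v)))%C Y1 Y2)).
  { apply CInt_Im_scal_nonneg; [lra|]. intros t Ht. split; [apply P; tauto|apply Hs; [tauto|simpl; lra]]. }
  apply (f_equal Im) in E. unfold rect in E.
  unfold hint, vint in *.
  set (a1 := CInt (fun s => / ((s, Y1) - (u, v)))%C X1 X2) in *. set (a3 := CInt (fun s => / ((s, Y2) - (u, v)))%C X1 X2) in *.
  set (a2 := CInt (fun t => / ((X2, t) - (u, v)))%C Y1 Y2) in *. set (a4 := CInt (fun t => / ((X1, t) - (u, v)))%C Y1 Y2) in *.
  replace (Im (a1 + Ci * a2 - a3 - Ci * a4)%C) with (Im a1 + Im (-1 * a3)%C + Im (Ci * a2)%C + Im (- Ci * a4)%C) in E by Ccomp.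
  change (Im 0) with 0 in E.
  assert (0 < (v - Y1) / D * (X2 - X1)) by (apply Rmult_lt_0_compat; [apply Rdiv_lt_0_compat|]; lra).
  lra.
Qed.

(* Differentiation under the integral sign, for a kernel [K] with a uniform
   second order expansion away from 0. *)
Lemma rect_kernel_cder f (K K1 : C -> C) X1 X2 Y1 Y2 e p Mf B :
  0 < e -> X1 + e <= Re p <= X2 - e -> Y1 + e <= Im p <= Y2 - e ->
  (forall z, on_frame X1 X2 Y1 Y2 z -> ccont f z /\ Cmod (f z) <= Mf) ->
  (forall u : C, u <> 0 -> ccont K u /\ ccont K1 u) ->
  (forall u h, e <= Cmod u -> Cmod h <= e / 2 -> Cmod (K (u - h)%C - K u - h * K1 u) <= B * (Cmod h * Cmod h)) ->
  cder (fun p => rect (fun z => f z * K (z - p))%C X1 X2 Y1 Y2) p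
       (rect (fun z => f z * K1 (z - p))%C X1 X2 Y1 Y2).
Proof.
  intros He Hx Hy Hf HK HB eps Heps.
  assert (HMf : 0 <= Mf).
  { destruct (Hf (X1, Y1)) as [_ H]; [split; [split; simpl|]; simpl; try tauto; lra|].
    pose proof (Cmod_ge_0 (f (X1, Y1))). lra. }
  assert (HB0 : 0 <= B).
  { assert (He2 : Cmod (RtoC (e/2)) = e/2) by (rewrite Cmod_R, Rabs_pos_eq; lra).
    assert (H := HB (RtoC e) (RtoC (e/2))). rewrite He2 in H. rewrite Cmod_R, Rabs_pos_eq in H by lra.
    specialize (H (Rle_refl _) (Rle_refl _)). pose proof (Cmod_ge_0 (K (RtoC e - RtoC (e/2))%C - K (RtoC e) - RtoC (e/2) * K1 (RtoC e))).
    assert (0 < e/2*(e/2)) by nra. nra. }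
  set (L := 2 * (Mf * B) * ((X2 - X1) + (Y2 - Y1))).
  assert (HL : 0 <= L).
  { unfold L. repeat apply Rmult_le_pos; lra. }
  exists (Rmin (e/2) (eps / (L + 1))). split; [apply Rmin_glb_lt; [lra|apply Rdiv_lt_0_compat; lra]|].
  intros p' Hp'. unfold cid in *.
  assert (H1 := Rlt_Rmin_l Hp'). assert (H2 := Rlt_Rmin_r Hp').
  apply Rlt_div_r in H2; [|lra].
  set (h := (p' - p)%C) in *.
  assert (Hd : forall z, on_frame X1 X2 Y1 Y2 z -> e <= Cmod (z - p)) by (intros; eapply frame_dist; eauto).
  assert (Hd' : forall z, on_frame X1 X2 Y1 Y2 z -> e/2 <= Cmod (z - p')).
  { intros z Hz. specialize (Hd z Hz). pose proof (Cmod_tri z p' p). fold h in H. lra. }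
  assert (N1 : forall z, on_frame X1 X2 Y1 Y2 z -> (z - p)%C <> 0).
  { intros z Hz. apply Cmod_gt_0. specialize (Hd z Hz). lra. }
  assert (N2 : forall z, on_frame X1 X2 Y1 Y2 z -> (z - p')%C <> 0).
  { intros z Hz. apply Cmod_gt_0. specialize (Hd' z Hz). lra. }
  assert (C0 : forall k q z, (forall u : C, u <> 0 -> ccont k u) -> (z - q)%C <> 0 -> on_frame X1 X2 Y1 Y2 z ->
    ccont (fun z => f z * k (z - q))%C z).
  { intros k q z Hk Hq Hz. apply cont_mult; [apply Hf; auto|].
    apply (cont_comp cid cid (fun z => z - q)%C k); [apply ccont_minus_const|auto]. }
  assert (C1 : forall z, on_frame X1 X2 Y1 Y2 z -> ccont (fun z => f z * K (z - p))%C z) by (intros; apply C0; auto; apply HK).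
  assert (C2 : forall z, on_frame X1 X2 Y1 Y2 z -> ccont (fun z => f z * K (z - p'))%C z) by (intros; apply C0; auto; apply HK).
  assert (C3 : forall z, on_frame X1 X2 Y1 Y2 z -> ccont (fun z => f z * K1 (z - p))%C z) by (intros; apply C0; auto; apply HK).
  replace (rect (fun z => f z * K (z - p'))%C X1 X2 Y1 Y2 - rect (fun z => f z * K (z - p))%C X1 X2 Y1 Y2
     - h * rect (fun z => f z * K1 (z - p))%C X1 X2 Y1 Y2)%C
    with (rect (fun z => (f z * K (z - p') + (-1) * (f z * K (z - p))) + (- h) * (f z * K1 (z - p)))%C X1 X2 Y1 Y2).
  2:{ rewrite rect_plus_scal; try lra; auto.
      - rewrite rect_plus_scal; try lra; auto. ring.
      - intros z Hz. apply cont_plus; auto. apply cont_mult; [apply cont_const|auto]. }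
  eapply Rle_trans.
  - apply rect_bound with (M := Mf * B * (Cmod h * Cmod h)); try lra.
    intros z Hz. split.
    + apply cont_plus; [apply cont_plus; auto; apply cont_mult; [apply cont_const|auto]|].
      apply cont_mult; [apply cont_const|auto].
    + replace (f z * K (z - p') + -1 * (f z * K (z - p)) + - h * (f z * K1 (z - p)))%C
        with (f z * (K ((z - p) - h) - K (z - p) - h * K1 (z - p)))%C.
      * rewrite Cmod_mult, Rmult_assoc. apply Rmult_le_compat; try apply Cmod_ge_0; [apply Hf; auto|].
        apply HB; [auto|lra].
      * replace (z - p - h)%C with (z - p')%C by (unfold h; ring). ring.
  - pose proof (Cmod_ge_0 h).
    replace (2 * (Mf * B * (Cmod h * Cmod h)) * (X2 - X1 + (Y2 - Y1))) with (L * Cmod h * Cmod h) by (unfold L; ring).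
    apply Rmult_le_compat_r; auto. nra.
Qed.

Lemma kernel1 e u h : 0 < e -> e <= Cmod u -> Cmod h <= e / 2 ->
  Cmod (/ (u - h) - / u - h * / (u * u)) <= 2 / (e * e * e) * (Cmod h * Cmod h).
Proof.
  intros He Hu Hh. pose proof (Cmod_rev u h).
  assert (Nu : u <> 0) by (apply Cmod_gt_0; lra).
  assert (Nv : (u - h)%C <> 0) by (apply Cmod_gt_0; lra).
  replace (/ (u - h) - / u - h * / (u * u))%C with (h * h / ((u - h) * (u * u)))%C by (field; auto).
  rewrite Cmod_div, !Cmod_mult by (repeat apply Cmult_neq_0; auto).
  pose proof (Cmod_ge_0 h).
  replace (2 / (e * e * e) * (Cmod h * Cmod h)) with (Cmod h * Cmod h / (e / 2 * (e * e))) by (field; lra).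
  assert (0 < e * e) by (apply Rmult_lt_0_compat; auto).
  assert (e * e <= Cmod u * Cmod u) by (apply Rmult_le_compat; lra).
  apply Rmult_le_compat_l; [nra|]. apply Rinv_le_contravar; [apply Rmult_lt_0_compat; lra|].
  apply Rmult_le_compat; lra.
Qed.

Lemma kernel2 e u h : 0 < e -> e <= Cmod u -> Cmod h <= e / 2 ->
  Cmod (/ ((u - h) * (u - h)) - / (u * u) - h * (2 * / (u * u * u))) <= 16 / (e * e * e * e) * (Cmod h * Cmod h).
Proof.
  intros He Hu Hh. pose proof (Cmod_rev u h).
  assert (Nu : u <> 0) by (apply Cmod_gt_0; lra).
  assert (Nv : (u - h)%C <> 0) by (apply Cmod_gt_0; lra).
  replace (/ ((u - h) * (u - h)) - / (u * u) - h * (2 * / (u * u * u)))%C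
    with (h * h * / (u * u) * (/ ((u - h) * (u - h)) + 2 * (/ (u - h) * / u)))%C by (field; auto).
  rewrite !Cmod_mult, Cmod_inv, Cmod_mult by (repeat apply Cmult_neq_0; auto).
  pose proof (Cmod_ge_0 h).
  assert (Hee : 0 < e * e) by (apply Rmult_lt_0_compat; auto).
  assert (Huu : e * e <= Cmod u * Cmod u) by (apply Rmult_le_compat; lra).
  assert (A1 : Cmod (/ (u - h)) <= 2 / e).
  { rewrite Cmod_inv by auto. replace (2/e) with (/ (e/2)) by (field; lra). apply Rinv_le_contravar; lra. }
  assert (A2 : Cmod (/ u) <= 1 / e).
  { rewrite Cmod_inv by auto. replace (1/e) with (/ e) by (field; lra). apply Rinv_le_contravar; lra. }
  assert (A3 : Cmod (/ ((u - h) * (u - h)) + 2 * (/ (u - h) * / u)) <= 8 / (e * e)).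
  { eapply Rle_trans; [apply Cmod_triangle|].
    replace (/ ((u - h) * (u - h)))%C with (/ (u - h) * / (u - h))%C by (field; auto).
    rewrite !Cmod_mult, Cmod_R, (Rabs_pos_eq 2) by lra.
    replace (8 / (e * e)) with (2 / e * (2 / e) + 2 * (2 / e * (1 / e))) by (field; lra).
    pose proof (Cmod_ge_0 (/ (u - h))). pose proof (Cmod_ge_0 (/ u)).
    apply Rplus_le_compat; [apply Rmult_le_compat; auto|]. apply Rmult_le_compat_l; [lra|]. apply Rmult_le_compat; auto. }
  assert (A4 : / (Cmod u * Cmod u) <= / (e * e)) by (apply Rinv_le_contravar; lra).
  assert (0 < / (Cmod u * Cmod u)) by (apply Rinv_0_lt_compat; lra).
  apply Rle_trans with (Cmod h * Cmod h * / (e * e) * (8 / (e * e))).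
  - apply Rmult_le_compat; auto; [|apply Cmod_ge_0|].
    + apply Rmult_le_pos; [nra|lra].
    + apply Rmult_le_compat_l; nra.
  - replace (16 / (e * e * e * e) * (Cmod h * Cmod h)) with (Cmod h * Cmod h * / (e * e) * (8 / (e * e)) * 2) by (field; lra).
    assert (0 <= Cmod h * Cmod h * / (e * e) * (8 / (e * e))); [|lra].
    apply Rmult_le_pos; [apply Rmult_le_pos; [nra|left; apply Rinv_0_lt_compat; lra]|].
    left; apply Rdiv_lt_0_compat; lra.
Qed.

Lemma box_bounded f X1 X2 Y1 Y2 : cont_on_box X1 X2 Y1 Y2 f ->
  exists M, 0 < M /\ forall z, in_box X1 X2 Y1 Y2 z -> Cmod (f z) <= M.
Proof.
  intros Hf.
  destruct (compact_box (fun d z => Cmod (f z) <= / d) X1 X2 Y1 Y2) as [d [Hd H]].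
  - intros d d' z H1 H2 H. eapply Rle_trans; [apply H|]. apply Rinv_le_contravar; auto.
  - intros z Hz. destruct (Hf z Hz 1 Rlt_0_1) as [d [Hd K]].
    pose proof (Cmod_ge_0 (f z)).
    assert (0 < / (Cmod (f z) + 1)) by (apply Rinv_0_lt_compat; lra).
    exists (Rmin (d/2) (/ (Cmod (f z) + 1))). split; [apply Rmin_glb_lt; [lra|auto]|].
    intros w _ Hx Hy.
    assert (Hx' := Rlt_Rmin_l Hx). assert (Hy' := Rlt_Rmin_l Hy).
    assert (Cmod (w - z) < d).
    { eapply Rle_lt_trans; [apply Cmod_le_ReIm|]. rewrite Re_minus, Im_minus. lra. }
    specialize (K w H1). pose proof (Cmod_rev (f w) (f z)).
    apply Rle_trans with (/ / (Cmod (f z) + 1)); [rewrite Rinv_inv; lra|]. apply Rinv_le_contravar; [apply Rmin_glb_lt; [lra|auto]|apply Rmin_r].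
  - exists (/ d). split; [apply Rinv_0_lt_compat; auto|auto].
Qed.

Definition holo (f : C -> C) : Prop := forall z, exists l, cder f z l.

Lemma holo_ccont f z : holo f -> ccont f z.
Proof. intros H. destruct (H z) as [l Hl]. eapply der_cont; eauto. Qed.

Lemma in_square_Cmod c r z : Cmod (z - c) < r -> in_square c r z.
Proof.
  intros H. pose proof (Re_le_Cmod (z - c)). pose proof (Im_le_Cmod (z - c)).
  rewrite Re_minus in H0. rewrite Im_minus in H1. split; lra.
Qed.

(** Near [p0], Cauchy's formula for [f] divided by the one for the constant 1 writes [f] as a
    quotient of two kernel integrals over one fixed rectangle. Both can be differentiated twice
    under the integral sign. *)
Lemma holo_derivative f : holo f -> exists f', (forall z, cder f z (f' z)) /\ holo f'.
Proof.
  intros Hf.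
  exists (fun z => proj1_sig (constructive_indefinite_description _ (Hf z))).
  split; [intros z; apply proj2_sig|]. intros p0.
  set (X1 := Re p0 - 2). set (X2 := Re p0 + 2). set (Y1 := Im p0 - 2). set (Y2 := Im p0 + 2).
  destruct (box_bounded f X1 X2 Y1 Y2) as [M [HM Hb]]; [intros z _; apply holo_ccont; auto|].
  set (R := fun (g K : C -> C) p => rect (fun z => g z * K (z - p))%C X1 X2 Y1 Y2).
  set (one := fun _ : C => RtoC 1).
  set (k0 := fun u : C => (/ u)%C). set (k1 := fun u : C => (/ (u * u))%C). set (k2 := fun u : C => (2 * / (u * u * u))%C).
  assert (Hcu : forall u : C, u <> 0 -> ccont k0 u /\ ccont k1 u /\ ccont k2 u).
  { intros u Hu. repeat split.
    - apply cont_inv; auto. apply cont_self.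
    - apply cont_inv; [|apply Cmult_neq_0; auto]. apply cont_mult; apply cont_self.
    - apply cont_mult; [apply cont_const|]. apply cont_inv; [|repeat apply Cmult_neq_0; auto].
      repeat apply cont_mult; apply cont_self. }
  assert (D : forall g Mg, (forall z, on_frame X1 X2 Y1 Y2 z -> ccont g z /\ Cmod (g z) <= Mg) ->
    forall p, in_square p0 1 p -> cder (R g k0) p (R g k1 p) /\ cder (R g k1) p (R g k2 p)).
  { intros g Mg Hg p [Hpx Hpy]. apply Rabs_def2 in Hpx, Hpy. unfold R. split.
    - apply (rect_kernel_cder g k0 k1 _ _ _ _ 1 p Mg 2); auto; try (unfold X1, X2, Y1, Y2; lra).
      + intros u Hu. destruct (Hcu u Hu) as (? & ? & ?); auto.
      + intros u h Hu Hh. pose proof (kernel1 1 u h Rlt_0_1 Hu Hh). unfold k0, k1. lra.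
    - apply (rect_kernel_cder g k1 k2 _ _ _ _ 1 p Mg 16); auto; try (unfold X1, X2, Y1, Y2; lra).
      + intros u Hu. destruct (Hcu u Hu) as (? & ? & ?); auto.
      + intros u h Hu Hh. pose proof (kernel2 1 u h Rlt_0_1 Hu Hh). unfold k1, k2. lra. }
  assert (Df := D f M). assert (Do := D one 1).
  assert (H1 : forall p, in_square p0 1 p -> cder (R f k0) p (R f k1 p) /\ cder (R f k1) p (R f k2 p)).
  { apply Df. intros z Hz. split; [apply holo_ccont; auto|]. apply Hb. apply Hz. }
  assert (H2 : forall p, in_square p0 1 p -> cder (R one k0) p (R one k1 p) /\ cder (R one k1) p (R one k2 p)).
  { apply Do. intros z Hz. split; [apply cont_const|]. unfold one. rewrite Cmod_1. lra. }
  clear Df Do D.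
  assert (Hnz : forall p, in_square p0 1 p -> R one k0 p <> 0).
  { intros p [Hpx Hpy]. apply Rabs_def2 in Hpx, Hpy. unfold R, one, k0.
    rewrite (rect_ext _ (fun z => / (z - p))%C); try (unfold X1, X2, Y1, Y2; lra).
    - apply rect_inv_nonzero; unfold X1, X2, Y1, Y2; lra.
    - intros; ring. }
  assert (Hform : forall p, in_square p0 1 p -> f p = (R f k0 p / R one k0 p)%C).
  { intros p Hp. assert (Hp' := Hp). destruct Hp' as [Hpx Hpy]. apply Rabs_def2 in Hpx, Hpy.
    assert (E : R f k0 p = (f p * R one k0 p)%C).
    { unfold R, one, k0. rewrite cauchy_formula; try (unfold X1, X2, Y1, Y2; lra).
      - f_equal. apply rect_ext; try (unfold X1, X2, Y1, Y2; lra). intros; ring.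
      - intros z _; apply Hf. }
    rewrite E. field. auto. }
  set (df := fun p => ((R f k1 p * R one k0 p - R f k0 p * R one k1 p) / (R one k0 p * R one k0 p))%C).
  assert (Hdf : forall p, Cmod (p - p0) < 1 / 2 -> proj1_sig (constructive_indefinite_description _ (Hf p)) = df p).
  { intros p Hp. apply (cder_unique f p); [apply proj2_sig|].
    assert (Hs : forall y, Cmod (y - p) < 1/2 -> in_square p0 1 y).
    { intros y Hy. apply in_square_Cmod. pose proof (Cmod_tri y p p0). lra. }
    assert (Hsp : in_square p0 1 p) by (apply in_square_Cmod; lra).
    apply (der_ext cid (fun p => R f k0 p / R one k0 p)%C) with (r := 1/2); [lra| |].
    - intros y Hy. symmetry. apply Hform. auto.
    - apply der_div; [apply H1|apply H2|apply Hnz]; auto. }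
  assert (Hp0 : in_square p0 1 p0).
  { apply in_square_Cmod. rewrite Cmod_self; lra. }
  eexists. apply (der_ext cid df) with (r := 1/2); [lra| |].
  - intros y Hy. symmetry. apply Hdf. auto.
  - unfold df. apply der_div.
    + apply der_minus; apply der_mult; [apply H1|apply H2|apply H1|apply H2]; auto.
    + apply der_mult; apply H2; auto.
    + apply Cmult_neq_0; apply Hnz; auto.
Qed.

(* The quotient is holomorphic at the zero [e] because of the second order
   Taylor expansion of [f] there. *)
Lemma holo_factor f e : holo f -> f e = 0 ->
  exists g, holo g /\ (forall z, f z = ((z - e) * g z)%C) /\ cder f e (g e).
Proof.
  intros Hf H0. destruct (holo_derivative f Hf) as [f' [Hf' Hh]].
  set (g := fun z => if Ceq_dec z e then f' e else (f z / (z - e))%C).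
  exists g. split; [|split].
  - intros z. destruct (Ceq_dec z e) as [->|Hn].
    + destruct (Hh e) as [l Hl]. exists (l / 2)%C.
      assert (N2 : (RtoC 2) <> 0) by (apply Cmod_gt_0; rewrite Cmod_R, Rabs_pos_eq; lra).
      intros eps He. destruct (Hl eps He) as [d [Hd K]]. exists d. split; auto.
      intros y Hy. unfold cid, g in *. destruct (Ceq_dec e e); [|congruence].
      destruct (Ceq_dec y e) as [->|Hye].
      * replace (f' e - f' e - (e - e) * (l / 2))%C with (RtoC 0) by ring. rewrite Cmod_0.
        apply Rmult_le_pos; [lra|apply Cmod_ge_0].
      * apply Cminus_eq_contra in Hye.
        set (r := fun w => (f w - (f' e * (w - e) + (l/2) * (w - e) * (w - e)))%C).
        assert (Hr : Cmod (r y - r e) <= eps * Cmod (y - e) * Cmod (y - e)).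
        { apply (mean_value_segment r (fun w => f' w - (f' e + 2 * (l/2) * (w - e)))%C). intros t Ht. split.
          - apply der_minus; [apply Hf'|apply cder_affine].
          - set (w := (e + t * (y - e))%C).
            replace (f' w - (f' e + 2 * (l / 2) * (w - e)))%C with (f' w - f' e - (w - e) * l)%C by (field; auto).
            assert (Hw : Cmod (w - e) <= Cmod (y - e)).
            { unfold w. replace (e + t * (y - e) - e)%C with (t * (y - e))%C by ring.
              rewrite Cmod_mult, Cmod_R, Rabs_pos_eq by lra. pose proof (Cmod_ge_0 (y - e)). nra. }
            eapply Rle_trans; [apply K; lra|]. apply Rmult_le_compat_l; lra. }
        replace (r y - r e)%C with (f y - f' e * (y - e) - (l/2) * (y - e) * (y - e))%C in Hr by (unfold r; rewrite H0; ring).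
        replace (f y / (y - e) - f' e - (y - e) * (l / 2))%C
          with ((f y - f' e * (y - e) - l / 2 * (y - e) * (y - e)) / (y - e))%C by (field; auto).
        rewrite Cmod_div by auto. apply Cmod_gt_0 in Hye. apply Rle_div_l; auto.
    + pose proof (proj1 (Cmod_gt_0 _) (Cminus_eq_contra _ _ Hn)) as Hpos.
      eexists. apply (der_ext cid (fun z => f z / (z - e))%C) with (r := Cmod (z - e)); auto.
      * intros y Hy. unfold g, cid in *. destruct (Ceq_dec y e) as [->|]; auto. rewrite Cmod_sym in Hy. lra.
      * apply der_div; [apply Hf'|apply cder_minus_const|apply Cminus_eq_contra; auto].
  - intros z. unfold g. destruct (Ceq_dec z e) as [->|Hn]; [rewrite H0; ring|].
    apply Cminus_eq_contra in Hn. field. auto.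
  - unfold g. destruct (Ceq_dec e e); [apply Hf'|congruence].
Qed.

(** If zeros accumulate at [e], every power of [z - e] divides [f]. Cauchy's formula for the
    quotient on the square of half-side [r], which exceeds twice the distance from [p] to [e],
    bounds the value at [p] by a constant times [(1/2)^k] for all [k]. *)
Lemma isolated_zeros f e : holo f -> (exists z, f z <> 0) ->
  exists d, 0 < d /\ forall z, 0 < Cmod (z - e) < d -> f z <> 0.
Proof.
  intros Hf [p Hp]. apply NNPP. intro Hn. apply Hp.
  assert (Hacc : forall d, 0 < d -> exists z, 0 < Cmod (z - e) < d /\ f z = 0).
  { intros d Hd. apply NNPP. intro K. apply Hn. exists d. split; auto. intros z Hz Hfz. apply K. eauto. }
  clear Hn Hp.
  assert (Hk : forall k, exists g, holo g /\ forall z, f z = ((z - e)^k * g z)%C).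
  { intros k. cut (exists g, holo g /\ (forall z, f z = ((z - e)^k * g z)%C)); [auto|].
    induction k as [|k [g [Hg E]]].
    - exists f. split; auto. intros z. simpl. ring.
    - assert (g e = 0).
      { apply NNPP. intro Hge. destruct (cont_nonzero cid g e (holo_ccont g e Hg) Hge) as [d [Hd K]].
        destruct (Hacc d Hd) as [z [Hz Hfz]]. specialize (K z (proj2 Hz)). unfold cid in K.
        rewrite E in Hfz. apply Cmod_gt_0 in Hge.
        assert ((z - e)^k * g z <> 0)%C; [|contradiction].
        apply Cmult_neq_0; [apply Cpow_nz, Cmod_gt_0; tauto|apply Cmod_gt_0; lra]. }
      destruct (holo_factor g e Hg H) as [g' [Hg' [E' _]]]. exists g'. split; auto.
      intros z. rewrite E, E', Cpow_S. ring. }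
  set (r := 2 * Cmod (p - e) + 1). pose proof (Cmod_ge_0 (p - e)) as Hpe.
  set (X1 := Re e - r). set (X2 := Re e + r). set (Y1 := Im e - r). set (Y2 := Im e + r).
  assert (Hps : in_square e (r/2) p) by (apply in_square_Cmod; unfold r; lra).
  destruct Hps as [Hpx Hpy]. apply Rabs_def2 in Hpx, Hpy.
  destruct (box_bounded f X1 X2 Y1 Y2) as [M [HM Hb]]; [intros z _; apply holo_ccont; auto|].
  set (k0 := rect (fun z => / (z - p))%C X1 X2 Y1 Y2).
  assert (Hk0 : 0 < Cmod k0) by (apply Cmod_gt_0, rect_inv_nonzero; unfold X1, X2, Y1, Y2; lra).
  assert (Hest : forall k, Cmod (f p) * Cmod k0 <= (1/2)^k * (2 * (M * (2 / r)) * (4 * r))).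
  { intros k. destruct (Hk k) as [g [Hg E]].
    assert (Hd : forall z, on_frame X1 X2 Y1 Y2 z -> r <= Cmod (z - e)).
    { intros z. apply frame_dist; unfold X1, X2, Y1, Y2; lra. }
    assert (Hd' : forall z, on_frame X1 X2 Y1 Y2 z -> r/2 <= Cmod (z - p)).
    { intros z. apply frame_dist; unfold X1, X2, Y1, Y2; lra. }
    assert (Hgb : Cmod (g p * k0) <= 2 * (M / r^k * (2 / r)) * (4 * r)).
    { unfold k0. rewrite <- cauchy_formula; try (unfold X1, X2, Y1, Y2; lra); [|intros z _; apply Hg].
      eapply Rle_trans; [apply rect_bound with (M := M / r^k * (2 / r)); try (unfold X1, X2, Y1, Y2; lra)|unfold X1, X2, Y1, Y2; lra].
      intros z Hz. assert (Hz1 := Hd z Hz). assert (Hz2 := Hd' z Hz).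
      assert (N1 : (z - p)%C <> 0) by (apply Cmod_gt_0; lra).
      split.
      - apply cont_mult; [apply holo_ccont; auto|]. apply cont_inv; auto. apply ccont_minus_const.
      - rewrite Cmod_mult, Cmod_inv by auto. apply Rmult_le_compat; try apply Cmod_ge_0.
        + left; apply Rinv_0_lt_compat; lra.
        + pose proof (Hb z (proj1 Hz)) as Hbz. rewrite E, Cmod_mult, Cmod_pow in Hbz.
          assert (0 < r^k) by (apply pow_lt; lra). apply Rle_div_r; auto.
          eapply Rle_trans; [|apply Hbz]. rewrite Rmult_comm. apply Rmult_le_compat_r; [apply Cmod_ge_0|].
          apply pow_incr. lra.
        + replace (2/r) with (/ (r/2)) by (field; lra). apply Rinv_le_contravar; lra. }
    rewrite E, Cmod_mult, Cmod_pow. rewrite Cmod_mult in Hgb.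
    assert (Hr : r <> 0) by lra.
    assert (0 < r^k) by (apply pow_lt; lra).
    assert (Hpk : Cmod (p - e)^k <= (r/2)^k) by (apply pow_incr; unfold r; lra).
    rewrite Rmult_assoc.
    eapply Rle_trans; [apply Rmult_le_compat_l; [apply pow_le, Cmod_ge_0|apply Hgb]|].
    eapply Rle_trans; [apply Rmult_le_compat_r; [|apply Hpk]|].
    - repeat apply Rmult_le_pos; try lra; [left; apply Rinv_0_lt_compat; auto|left; apply Rinv_0_lt_compat; lra].
    - right. replace ((r/2)^k) with (r^k * (1/2)^k) by (rewrite <- Rpow_mult_distr; f_equal; field). field. split; lra. }
  apply Cmod_eq_0, Rle_antisym; [|apply Cmod_ge_0].
  apply Rnot_lt_le. intro Hpos.
  set (A := 2 * (M * (2 / r)) * (4 * r)) in *.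
  assert (HA : 0 < A) by (unfold A; repeat apply Rmult_lt_0_compat; try lra; apply Rinv_0_lt_compat; lra).
  destruct (pow_lt_1_zero (1/2) ltac:(rewrite Rabs_pos_eq; lra) (Cmod (f p) * Cmod k0 / A)) as [n Hn].
  { apply Rdiv_lt_0_compat; auto. apply Rmult_lt_0_compat; auto. }
  specialize (Hn n (le_n n)). rewrite Rabs_pos_eq in Hn by (apply pow_le; lra).
  apply Rlt_div_r in Hn; auto. specialize (Hest n). lra.
Qed.

(** * The complex exponential *)

Definition cexp (z : C) : C := (exp (Re z) * cos (Im z), exp (Re z) * sin (Im z)).

Lemma cexp_plus z w : cexp (z + w) = (cexp z * cexp w)%C.
Proof.
  destruct z as [a b], w as [c d]. unfold cexp, Cplus, Cmult; simpl.
  rewrite exp_plus, cos_plus, sin_plus. f_equal; ring.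
Qed.

Lemma Cmod_cexp z : Cmod (cexp z) = exp (Re z).
Proof.
  unfold cexp, Cmod; simpl.
  replace (exp (Re z) * cos (Im z) * (exp (Re z) * cos (Im z) * 1) + exp (Re z) * sin (Im z) * (exp (Re z) * sin (Im z) * 1))
    with (exp (Re z) * exp (Re z) * (Rsqr (sin (Im z)) + Rsqr (cos (Im z)))) by (unfold Rsqr; ring).
  rewrite sin2_cos2, Rmult_1_r. apply sqrt_square. left; apply exp_pos.
Qed.

Lemma cexp_nonzero z : cexp z <> 0.
Proof. apply Cmod_gt_0. rewrite Cmod_cexp. apply exp_pos. Qed.

Lemma cexp_0 : cexp 0 = 1.
Proof. unfold cexp, RtoC; simpl. rewrite exp_0, cos_0, sin_0. f_equal; ring. Qed.

Lemma cder_cexp z : cder cexp z (cexp z).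
Proof.
  assert (D : forall (f : R -> R) l, derivable_pt_lim f 0 l -> forall e, 0 < e -> exists d, 0 < d /\
    forall h, Rabs h < d -> Rabs (f h - f 0 - h * l) <= e * Rabs h).
  { intros f l Hf e He. apply is_derive_Reals, rder_RtoC in Hf. destruct (Hf e He) as [d [Hd K]].
    exists d; split; auto. intros h Hh. specialize (K h). rewrite Cmod_RtoC_minus, Rminus_0_r in K.
    specialize (K Hh). rewrite <- !RtoC_minus, <- RtoC_mult, <- RtoC_minus, Cmod_R, Rminus_0_r in K. exact K. }
  intros eps He. pose proof (exp_pos (Re z)) as Hez.
  set (e := Rmin (eps / (20 * exp (Re z))) 1).
  assert (He0 : 0 < e) by (apply Rmin_glb_lt; [apply Rdiv_lt_0_compat; lra|lra]).
  assert (He1 : e <= 1) by apply Rmin_r.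
  assert (He2 : 20 * e * exp (Re z) <= eps).
  { assert (e <= eps / (20 * exp (Re z))) by apply Rmin_l. apply Rle_div_r in H; lra. }
  destruct (D exp 1) with (e := e) as [d1 [Hd1 K1]]; auto. { pose proof (derivable_pt_lim_exp 0) as E. rewrite exp_0 in E. exact E. }
  destruct (D cos (- sin 0)) with (e := e) as [d2 [Hd2 K2]]; auto. { apply derivable_pt_lim_cos. }
  destruct (D sin (cos 0)) with (e := e) as [d3 [Hd3 K3]]; auto. { apply derivable_pt_lim_sin. }
  rewrite exp_0, cos_0, sin_0 in *.
  exists (Rmin (Rmin d1 d2) (Rmin d3 e)). split; [apply Rmin_glb_lt; apply Rmin_glb_lt; auto|].
  intros w Hw. unfold cid in *. set (h := (w - z)%C) in *.
  assert (Hw12 := Rlt_Rmin_l Hw). assert (Hw34 := Rlt_Rmin_r Hw).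
  assert (H1 := Rlt_Rmin_l Hw12). assert (H2 := Rlt_Rmin_r Hw12).
  assert (H3 := Rlt_Rmin_l Hw34). assert (H4 := Rlt_Rmin_r Hw34).
  replace w with (z + h)%C by (unfold h; ring). rewrite cexp_plus.
  replace (cexp z * cexp h - cexp z - h * cexp z)%C with (cexp z * (cexp h - 1 - h))%C by ring.
  rewrite Cmod_mult, Cmod_cexp.
  assert (K : Cmod (cexp h - 1 - h) <= 20 * e * Cmod h).
  2:{ pose proof (Cmod_ge_0 h). nra. }
  pose proof (Re_le_Cmod h) as Hx. pose proof (Im_le_Cmod h) as Hy.
  eapply Rle_trans; [apply Cmod_le_ReIm|].
  destruct h as [x y]. set (m := Cmod (x, y)) in *. simpl in Hx, Hy.
  specialize (K1 x ltac:(lra)). specialize (K2 y ltac:(lra)). specialize (K3 y ltac:(lra)).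
  replace (Re (cexp (x, y) - 1 - (x, y))%C) with ((exp x - 1 - x * 1) * cos y + (1 + x) * (cos y - 1 - y * - 0))
    by (unfold cexp, Re, Cminus, Cplus, Copp, RtoC; simpl; ring).
  replace (Im (cexp (x, y) - 1 - (x, y))%C) with ((exp x - 1) * sin y + (sin y - 0 - y * 1))
    by (unfold cexp, Im, Cminus, Cplus, Copp, RtoC; simpl; ring).
  assert (Hm : 0 <= m) by apply Cmod_ge_0.
  assert (C1 : Rabs (cos y) <= 1) by (apply Rabs_le; apply COS_bound).
  assert (A0 : Rabs (exp x - 1 - x * 1) <= e * m) by (eapply Rle_trans; [apply K1|]; apply Rmult_le_compat_l; lra).
  assert (A1 : Rabs (cos y - 1 - y * - 0) <= e * m) by (eapply Rle_trans; [apply K2|]; apply Rmult_le_compat_l; lra).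
  assert (A2 : Rabs (sin y - 0 - y * 1) <= e * m) by (eapply Rle_trans; [apply K3|]; apply Rmult_le_compat_l; lra).
  assert (A3 : Rabs (exp x - 1) <= 2 * m).
  { replace (exp x - 1) with ((exp x - 1 - x * 1) + x) by ring. eapply Rle_trans; [apply Rabs_triang|]. nra. }
  assert (A4 : Rabs (sin y) <= 2 * m).
  { replace (sin y) with ((sin y - 0 - y * 1) + y) by ring. eapply Rle_trans; [apply Rabs_triang|]. nra. }
  assert (A5 : Rabs (1 + x) <= 2).
  { eapply Rle_trans; [apply Rabs_triang|]. rewrite Rabs_R1. lra. }
  assert (B1 : Rabs ((exp x - 1 - x * 1) * cos y + (1 + x) * (cos y - 1 - y * - 0)) <= 3 * (e * m)).
  { eapply Rle_trans; [apply Rabs_triang|]. rewrite !Rabs_mult.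
    pose proof (Rabs_pos (exp x - 1 - x * 1)). pose proof (Rabs_pos (cos y)).
    pose proof (Rabs_pos (1 + x)). pose proof (Rabs_pos (cos y - 1 - y * - 0)). nra. }
  assert (B2 : Rabs ((exp x - 1) * sin y + (sin y - 0 - y * 1)) <= 5 * (e * m)).
  { eapply Rle_trans; [apply Rabs_triang|]. rewrite Rabs_mult.
    pose proof (Rabs_pos (exp x - 1)). pose proof (Rabs_pos (sin y)).
    assert (Rabs (exp x - 1) * Rabs (sin y) <= (2 * m) * (2 * m)) by (apply Rmult_le_compat; auto).
    nra. }
  nra.
Qed.

(** * The flow of a holomorphic vector field *)

Lemma locally_Cmod (z : C) (P : C -> Prop) :
  locally z P <-> exists d, 0 < d /\ forall y, Cmod (y - z) < d -> P y.
Proof.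
  split.
  - intros [[d Hd] H]. exists d. split; auto. intros y Hy. apply H. split.
    + apply Rle_lt_trans with (2 := Hy). apply (Re_le_Cmod (y - z)).
    + apply Rle_lt_trans with (2 := Hy). apply (Im_le_Cmod (y - z)).
  - intros [d [Hd H]]. exists (mkposreal (d/2) ltac:(lra)). intros y [Hx Hy]. apply H.
    simpl in Hx, Hy. eapply Rle_lt_trans; [apply Cmod_le_ReIm|].
    assert (Rabs (Re (y - z)) < d/2) by exact Hx. assert (Rabs (Im (y - z)) < d/2) by exact Hy. lra.
Qed.

Lemma locally_Rabs (t : R) (P : R -> Prop) :
  locally t P <-> exists d, 0 < d /\ forall s, Rabs (s - t) < d -> P s.
Proof.
  split.
  - intros [[d Hd] H]. exists d. split; auto.
  - intros [d [Hd H]]. exists (mkposreal d Hd). intros y Hy. apply H. exact Hy.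
Qed.

Lemma is_derive_cder (F : C -> C) z l :
  @is_derive C_AbsRing C_NormedModule F z l <-> cder F z l.
Proof.
  split.
  - intros [_ H] eps He. specialize (H z (fun P HP => HP) (mkposreal eps He)).
    apply locally_C, locally_Cmod in H. destruct H as [d [Hd K]]. exists d. split; auto.
  - intros H. split; [apply is_linear_scal_l|]. intros z' Hz' [eps He].
    assert (z' = z) as ->.
    { symmetry. apply (is_filter_lim_locally_unique (V := AbsRing_NormedModule C_AbsRing) z z'). exact Hz'. }
    destruct (H eps He) as [d [Hd K]]. apply locally_C, locally_Cmod. exists d. split; auto.
Qed.

Lemma entire_holo F : entire F <-> holo F.
Proof.
  split; intros H z; destruct (H z) as [l Hl]; exists l; apply is_derive_cder; auto.
Qed.

Lemma is_derive_rder (f : R -> C) t l :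
  @is_derive R_AbsRing C_R_NormedModule f t l <-> rder f t l.
Proof.
  assert (E : forall s, minus (minus (f s) (f t)) (scal (minus s t) l) = (f s - f t - (RtoC s - RtoC t) * l)%C).
  { intros s. rewrite <- RtoC_minus.
    change (scal (minus s t) l) with (scal (V := C_R_NormedModule) (s - t) l).
    rewrite scal_R_Cmult. reflexivity. }
  split.
  - intros [_ H] eps He. specialize (H t (fun P HP => HP) (mkposreal eps He)).
    apply locally_Rabs in H. destruct H as [d [Hd K]]. exists d. split; auto.
    intros s Hs. rewrite Cmod_RtoC_minus in *. specialize (K s Hs). simpl in K. rewrite <- E, Cmod_norm. exact K.
  - intros H. split; [apply is_linear_scal_l|]. intros t' Ht' [eps He].
    assert (t' = t) as ->.
    { symmetry. apply (is_filter_lim_locally_unique (V := AbsRing_NormedModule R_AbsRing) t t'). exact Ht'. }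
    destruct (H eps He) as [d [Hd K]]. apply locally_Rabs. exists d. split; auto.
    intros s Hs. specialize (K s). rewrite Cmod_RtoC_minus in K. specialize (K Hs). rewrite <- E, Cmod_norm in K. exact K.
Qed.

Lemma rder_shift (f : R -> C) t s l : rder f (t + s) l -> rder (fun u => f (t + u)) s l.
Proof.
  intros H eps He. destruct (H eps He) as [d [Hd K]]. exists d. split; auto. intros u Hu.
  rewrite Cmod_RtoC_minus in *.
  replace (RtoC u - RtoC s)%C with (RtoC (t + u) - RtoC (t + s))%C by (rewrite !RtoC_plus; ring).
  replace (u - s) with (t + u - (t + s)) by ring. rewrite <- Cmod_RtoC_minus. apply K.
  rewrite Cmod_RtoC_minus. replace (t + u - (t + s)) with (u - s) by ring. auto.
Qed.

Lemma rder_neg (f : R -> C) t l : rder f (- t) l -> rder (fun u => f (- u)) t (- l).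
Proof.
  intros H. apply (der_val RtoC _ _ ((-1) * l)%C); [ring|].
  apply (der_comp RtoC RtoC (fun u => - u) f); auto.
  apply (der_ext RtoC (fun u => (-1) * RtoC u)%C) with (r := 1); [lra| |].
  - intros. rewrite RtoC_opp. ring.
  - apply (der_val RtoC _ _ ((-1) * 1)%C); [ring|]. apply der_scal, der_self.
Qed.

Lemma rder_affine_comp (g : C -> C) (w d : C) t l :
  cder g (w + RtoC t * d)%C l -> rder (fun s => g (w + RtoC s * d)%C) t (d * l).
Proof.
  intros H. apply (rder_comp_cder g (fun s => w + RtoC s * d)%C); auto.
  intros eps He. exists 1. split; [lra|]. intros y _.
  replace (w + y * d - (w + t * d) - (y - t) * d)%C with (RtoC 0) by ring.
  rewrite Cmod_0. apply Rmult_le_pos; [lra|apply Cmod_ge_0].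
Qed.

Definition negf (F : C -> C) : C -> C := fun z => (- F z)%C.
Definition rotf (F : C -> C) : C -> C := fun z => (Ci * F z)%C.

Lemma holo_negf F : holo F -> holo (negf F).
Proof. intros H z. destruct (H z) as [l Hl]. exists (- l)%C. apply der_opp; auto. Qed.

Lemma holo_rotf F : holo F -> holo (rotf F).
Proof. intros H z. destruct (H z) as [l Hl]. exists (Ci * l)%C. apply der_scal; auto. Qed.

Lemma holo_lipschitz F R : holo F -> exists L, 0 < L /\
  forall z w, Cmod z <= R -> Cmod w <= R -> Cmod (F z - F w) <= L * Cmod (z - w).
Proof.
  intros HF. destruct (holo_derivative F HF) as [F' [HF' Hh]].
  destruct (box_bounded F' (-R) R (-R) R) as [M [HM Hb]]; [intros z _; apply holo_ccont; auto|].
  exists M. split; auto. intros z w Hz Hw.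
  apply (mean_value_segment F F'). intros t Ht. split; auto. apply Hb.
  set (v := (w + t * (z - w))%C).
  assert (Hv : Cmod v <= R).
  { replace v with (RtoC (1 - t) * w + RtoC t * z)%C by (unfold v; rewrite RtoC_minus; ring).
    eapply Rle_trans; [apply Cmod_triangle|]. rewrite !Cmod_mult, !Cmod_R, !Rabs_pos_eq by lra. nra. }
  pose proof (Re_le_Cmod v) as H1. pose proof (Im_le_Cmod v) as H2.
  split; apply Rabs_le_between; lra.
Qed.

Lemma Cmod_sqr z : Cmod z * Cmod z = Re z * Re z + Im z * Im z.
Proof. unfold Cmod. rewrite sqrt_sqrt; [unfold Re, Im; ring|]. nra. Qed.

(** The square of the distance times [exp (- 2 L t)] does not increase, by Cauchy-Schwarz. Squaring
    avoids differentiating the modulus where it vanishes. *)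
Lemma gronwall F x y a b L : 0 <= L -> a <= b ->
  (forall t, a <= t <= b -> rder x t (F (x t)) /\ rder y t (F (y t)) /\
     Cmod (F (x t) - F (y t)) <= L * Cmod (x t - y t)) ->
  Cmod (x b - y b) <= Cmod (x a - y a) * exp (L * (b - a)).
Proof.
  intros HL Hab H.
  set (u := fun t => Re (x t - y t)). set (v := fun t => Im (x t - y t)).
  set (g := fun t => (u t * u t + v t * v t) * exp (- (2 * L * t))).
  set (dg := fun t => (2 * (u t * Re (F (x t) - F (y t)) + v t * Im (F (x t) - F (y t)))
                       - 2 * L * (u t * u t + v t * v t)) * exp (- (2 * L * t))).
  assert (Hdg : forall t, a <= t <= b -> is_derive g t (dg t)).
  { intros t Ht. destruct (H t Ht) as (H1 & H2 & _).
    pose proof (der_minus RtoC _ _ _ _ _ H1 H2) as Hd.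
    pose proof (rder_Re _ _ _ Hd) as Du. pose proof (rder_Im _ _ _ Hd) as Dv.
    fold u in Du. fold v in Dv. unfold g, dg. auto_derive.
    - repeat split; eexists; eauto.
    - change (Derive (fun x => u x) t) with (Derive u t). change (Derive (fun x => v x) t) with (Derive v t).
      rewrite (is_derive_unique u t _ Du), (is_derive_unique v t _ Dv). ring. }
  assert (Hle : forall t, a <= t <= b -> dg t <= 0).
  { intros t Ht. destruct (H t Ht) as (_ & _ & H3). unfold dg.
    assert (Hcs : u t * Re (F (x t) - F (y t)) + v t * Im (F (x t) - F (y t)) <= Cmod (x t - y t) * Cmod (F (x t) - F (y t))).
    { set (p := (x t - y t)%C) in *. set (q := (F (x t) - F (y t))%C) in *.
      change (u t) with (Re p). change (v t) with (Im p).
      apply Rle_trans with (Rabs (Re (p * Cconj q)%C)).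
      - eapply Rle_trans; [|apply Rle_abs]. right. destruct p, q. unfold Re, Im, Cconj, Cmult. simpl. ring.
      - eapply Rle_trans; [apply Re_le_Cmod|]. rewrite Cmod_mult, Cmod_conj. lra. }
    pose proof (Cmod_sqr (x t - y t)) as Hs. change (Re (x t - y t)) with (u t) in Hs. change (Im (x t - y t)) with (v t) in Hs.
    pose proof (exp_pos (- (2 * L * t))). pose proof (Cmod_ge_0 (x t - y t)).
    assert (Cmod (x t - y t) * Cmod (F (x t) - F (y t)) <= L * (u t * u t + v t * v t)) by nra.
    nra. }
  assert (Hg : g b <= g a).
  { destruct (MVT_gen g a b dg) as [c [Hc E]].
    - rewrite Rmin_left, Rmax_right by lra. intros t Ht. apply Hdg; lra.
    - rewrite Rmin_left, Rmax_right by lra. intros t Ht. apply continuity_pt_filterlim.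
      apply (ex_derive_continuous (V := R_NormedModule)). eexists. apply Hdg; auto.
    - minmax Hc. specialize (Hle c Hc). nra. }
  unfold g in Hg.
  pose proof (Cmod_sqr (x a - y a)) as Ha. change (Re (x a - y a)) with (u a) in Ha. change (Im (x a - y a)) with (v a) in Ha.
  pose proof (Cmod_sqr (x b - y b)) as Hb. change (Re (x b - y b)) with (u b) in Hb. change (Im (x b - y b)) with (v b) in Hb.
  rewrite <- Ha, <- Hb in Hg.
  pose proof (Cmod_ge_0 (x a - y a)) as Pa. pose proof (Cmod_ge_0 (x b - y b)) as Pb.
  apply Rsqr_incr_0_var; [|apply Rmult_le_pos; [auto|left; apply exp_pos]]. unfold Rsqr.
  apply Rmult_le_reg_r with (exp (- (2 * L * b))); [apply exp_pos|].
  eapply Rle_trans; [apply Hg|]. right.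
  replace (Cmod (x a - y a) * exp (L * (b - a)) * (Cmod (x a - y a) * exp (L * (b - a))) * exp (- (2 * L * b)))
    with (Cmod (x a - y a) * Cmod (x a - y a) * (exp (L * (b - a)) * exp (L * (b - a)) * exp (- (2 * L * b)))) by ring.
  f_equal. rewrite <- !exp_plus. f_equal. ring.
Qed.

(** The Lipschitz constant is valid only in the disc of radius [R + 1], so the estimate and the fact
    that [y] stays in this disc are proved together, by continuation along the interval. The
    smallness of the initial distance keeps it below 1 throughout. *)
Lemma gronwall_tube F x y T L R : 0 <= L -> 0 <= T ->
  (forall z w, Cmod z <= R + 1 -> Cmod w <= R + 1 -> Cmod (F z - F w) <= L * Cmod (z - w)) ->
  (forall t, 0 <= t <= T -> rder x t (F (x t)) /\ Cmod (x t) <= R) ->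
  (forall t, 0 <= t <= T -> rder y t (F (y t))) ->
  Cmod (x 0 - y 0) * exp (L * T) < 1 ->
  forall t, 0 <= t <= T -> Cmod (x t - y t) <= Cmod (x 0 - y 0) * exp (L * t) /\ Cmod (y t) <= R + 1.
Proof.
  intros HL HT Hlip Hx Hy Hsm.
  set (D := fun t => Cmod (x t - y t)). set (D0 := Cmod (x 0 - y 0)) in *.
  assert (HD0 : 0 <= D0) by apply Cmod_ge_0.
  assert (Hexp : forall t, t <= T -> D0 * exp (L * t) < 1).
  { intros t Ht. eapply Rle_lt_trans; [|apply Hsm]. apply Rmult_le_compat_l; auto.
    apply exp_le. nra. }
  assert (Hyb : forall t, 0 <= t <= T -> D t < 1 -> Cmod (y t) <= R + 1).
  { intros t Ht HDt. destruct (Hx t Ht) as [_ HR]. pose proof (Cmod_rev (y t) (x t)).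
    unfold D in HDt. rewrite Cmod_sym in HDt. lra. }
  assert (Main : forall t, 0 <= t <= T -> D t <= D0 * exp (L * t)).
  { intros t0 Ht0.
    apply (cousin (fun u v => D u <= D0 * exp (L * u) -> D v <= D0 * exp (L * v)) 0 t0); try lra.
    3:{ unfold D, D0. rewrite Rmult_0_r, exp_0. lra. }
    - intros; auto.
    - intros t Ht.
      assert (Hc : pcont (fun s => x s - y s)%C t).
      { apply cont_minus; eapply der_cont; [apply Hx|apply Hy]; lra. }
      destruct (Hc ((1 - D0 * exp (L * T))/2)) as [d [Hd K]]; [lra|].
      assert (K' : forall s, Rabs (s - t) < d -> Rabs (D s - D t) < (1 - D0 * exp (L * T)) / 2).
      { intros s Hs. rewrite <- Cmod_RtoC_minus in Hs. specialize (K s Hs). simpl in K.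
        pose proof (Cmod_rev (x s - y s) (x t - y t)). pose proof (Cmod_rev (x t - y t) (x s - y s)).
        rewrite (Cmod_sym (x t - y t)) in H0. unfold D. apply Rabs_def1; lra. }
      exists d. split; auto. intros u v Hu Hut Htv Hv Huv HDu.
      assert (Ku := K' u ltac:(apply Rabs_def1; lra)). apply Rabs_def2 in Ku.
      assert (Hu1 : D0 * exp (L * u) <= D0 * exp (L * T)).
      { apply Rmult_le_compat_l; auto. apply exp_le. nra. }
      assert (G : D v <= D u * exp (L * (v - u))).
      { apply (gronwall F x y u v L); auto; try lra. intros s Hs.
        assert (Ks := K' s ltac:(apply Rabs_def1; lra)). apply Rabs_def2 in Ks.
        repeat split; [apply Hx; lra|apply Hy; lra|]. apply Hlip.
        - destruct (Hx s) as [_ HR]; lra.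
        - apply Hyb; lra. }
      eapply Rle_trans; [apply G|].
      replace (L * v) with (L * u + L * (v - u)) by ring. rewrite exp_plus, <- Rmult_assoc.
      apply Rmult_le_compat_r; auto. left; apply exp_pos. }
  intros t Ht. split; [apply Main; auto|]. apply Hyb; auto.
  eapply Rle_lt_trans; [apply Main; auto|]. apply Hexp; lra.
Qed.

Lemma path_bounded (x : R -> C) a b : (forall t, a <= t <= b -> pcont x t) ->
  exists M, 0 < M /\ forall t, a <= t <= b -> Cmod (x t) <= M.
Proof.
  intros Hx. destruct (box_bounded (fun z => x (Re z)) a b 0 0) as [M [HM K]].
  - intros z [Hz _]. apply (cont_comp cid RtoC Re x); auto. apply (cont_Re cid cid), cont_self.
  - exists M. split; auto. intros t Ht. apply (K (t, 0)). split; simpl; lra.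
Qed.

(** * Inverse functions and flow boxes *)

(** Newton iteration with the derivative frozen at [x] halves the error at each step. The solution
    is then found by compactness rather than as a limit: without one, the error would be bounded
    below on the closed disc of radius [rho]. *)
Lemma inverse_function (h h' : C -> C) x r :
  0 < r -> (forall z, Cmod (z - x) < r -> cder h z (h' z)) -> ccont h' x -> h' x <> 0 ->
  exists r1, 0 < r1 <= r /\
    (forall z z', Cmod (z - x) < r1 -> Cmod (z' - x) < r1 ->
       Cmod (h z - h z' - (z - z') * h' x) <= Cmod (h' x) / 2 * Cmod (z - z')) /\
    (forall w, Cmod (w - h x) < Cmod (h' x) * r1 / 4 ->
       exists z, Cmod (z - x) <= 2 * Cmod (w - h x) / Cmod (h' x) /\ h z = w).
Proof.
  intros Hr Hh Hc HA. set (A := h' x) in *. assert (HA0 := proj1 (Cmod_gt_0 _) HA). set (m := Cmod A) in *.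
  destruct (Hc (m/2)) as [d [Hd K]]; [lra|]. unfold cid in K.
  exists (Rmin d r).
  assert (Hr1 : 0 < Rmin d r) by (apply Rmin_glb_lt; auto).
  assert (Hlip : forall z z', Cmod (z - x) < Rmin d r -> Cmod (z' - x) < Rmin d r ->
       Cmod (h z - h z' - (z - z') * A) <= m / 2 * Cmod (z - z')).
  { intros z z' Hz Hz'.
    replace (h z - h z' - (z - z') * A)%C with ((h z - A * z) - (h z' - A * z'))%C by ring.
    apply (mean_value_segment (fun v => h v - A * v)%C (fun v => h' v - A * 1)%C).
    intros t Ht. set (v := (z' + t * (z - z'))%C).
    assert (Hv : Cmod (v - x) < Rmin d r).
    { replace (v - x)%C with (RtoC (1 - t) * (z' - x) + RtoC t * (z - x))%C by (unfold v; rewrite RtoC_minus; ring).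
      eapply Rle_lt_trans; [apply Cmod_triangle|]. rewrite !Cmod_mult, !Cmod_R, !Rabs_pos_eq by lra.
      assert (M1 : Cmod (z' - x) <= Rmax (Cmod (z' - x)) (Cmod (z - x))) by apply Rmax_l.
      assert (M2 : Cmod (z - x) <= Rmax (Cmod (z' - x)) (Cmod (z - x))) by apply Rmax_r.
      assert (M3 : Rmax (Cmod (z' - x)) (Cmod (z - x)) < Rmin d r) by (apply Rmax_lub_lt; auto).
      apply Rle_lt_trans with (2 := M3).
      apply (Rmult_le_compat_l (1 - t)) in M1; [|lra]. apply (Rmult_le_compat_l t) in M2; [|lra]. lra. }
    split.
    - apply der_minus; [apply Hh; apply (Rlt_Rmin_r Hv)|apply der_scal, der_self].
    - replace (h' v - A * 1)%C with (h' v - A)%C by ring. left. apply K.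
      apply (Rlt_Rmin_l Hv). }
  split; [split; [auto|apply Rmin_r]|]. split; [exact Hlip|].
  intros w Hw. set (r1 := Rmin d r) in *. set (e := Cmod (w - h x)) in *.
  assert (He : 0 <= e) by apply Cmod_ge_0.
  (* The steps have length at most [e / m] times [(1/2)^n], so their sum is at most this. *)
  set (rho := 2 * e / m).
  assert (Hrho : rho < r1 / 2).
  { unfold rho. apply Rlt_div_l; auto. lra. }
  assert (Hrho0 : 0 <= rho) by (unfold rho; apply Rmult_le_pos; [lra|left; apply Rinv_0_lt_compat; auto]).
  set (zs := fix zs n := match n with O => x | S n => (zs n + (w - h (zs n)) / A)%C end).
  assert (Hit : forall n, Cmod (w - h (zs n)) <= e / 2^n /\ Cmod (zs n - x) <= rho * (1 - /2^n)).
  { induction n as [|n [I1 I2]].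
    - simpl. unfold e. split; [lra|]. rewrite Cmod_self, Rinv_1. lra.
    - assert (P2 : 0 < / 2^n <= 1).
      { split; [apply Rinv_0_lt_compat, pow_lt; lra|]. rewrite <- Rinv_1. apply Rinv_le_contravar; [lra|]. apply pow_R1_Rle; lra. }
      assert (Hstep : Cmod (zs (S n) - zs n) = Cmod (w - h (zs n)) / m).
      { simpl. replace (zs n + (w - h (zs n)) / A - zs n)%C with ((w - h (zs n)) / A)%C by ring.
        apply Cmod_div; auto. }
      assert (E2 : e / 2^(S n) = e / 2^n / 2) by (simpl; field; apply pow_nonzero; lra).
      assert (E3 : / 2^(S n) = / 2^n / 2) by (simpl; field; apply pow_nonzero; lra).
      assert (J2 : Cmod (zs (S n) - x) <= rho * (1 - / 2^(S n))).
      { eapply Rle_trans; [apply (Cmod_tri _ (zs n))|]. rewrite Hstep, E3.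
        assert (Cmod (w - h (zs n)) / m <= rho * (/2^n / 2)).
        { unfold rho. apply Rle_div_l; auto. eapply Rle_trans; [apply I1|]. right. field. split; [apply pow_nonzero|]; lra. }
        lra. }
      split; auto. rewrite E2.
      replace (w - h (zs (S n)))%C with (- (h (zs (S n)) - h (zs n) - (zs (S n) - zs n) * A))%C.
      + rewrite Cmod_opp. eapply Rle_trans; [apply Hlip|].
        * assert (/2^(S n) > 0) by (rewrite E3; lra). nra.
        * nra.
        * rewrite Hstep. replace (m / 2 * (Cmod (w - h (zs n)) / m)) with (Cmod (w - h (zs n)) / 2) by (field; lra). lra.
      + simpl. field. auto. }
  assert (Hin : forall n, Cmod (zs n - x) <= rho).
  { intros n. destruct (Hit n) as [_ I2]. assert (0 < / 2^n) by (apply Rinv_0_lt_compat, pow_lt; lra). nra. }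
  apply NNPP. intro Hno.
  destruct (compact_box (fun d z => Cmod (z - x) <= rho -> d <= Cmod (h z - w)) (Re x - rho) (Re x + rho) (Im x - rho) (Im x + rho)) as [dd [Hdd Hall]].
  - intros; lra.
  - intros z Hz. destruct (Rle_dec (Cmod (z - x)) rho) as [Hzr|Hzr].
    + assert (Hzw : (h z - w)%C <> 0).
      { apply Cminus_eq_contra. intro E. apply Hno. exists z. split; auto. }
      assert (Hhc : ccont (fun v => h v - w)%C z).
      { apply cont_minus; [|apply cont_const]. eapply der_cont. apply Hh. assert (r1 <= r) by apply Rmin_r. lra. }
      destruct (cont_nonzero cid _ z Hhc Hzw) as [d1 [Hd1 K1]]. simpl in K1.
      apply Cmod_gt_0 in Hzw.
      exists (Rmin (d1/2) (Cmod (h z - w) / 2)). split; [apply Rmin_glb_lt; lra|].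
      intros v _ Hv1 Hv2 _.
      assert (A1 := Rlt_Rmin_l Hv1). assert (A2 := Rlt_Rmin_l Hv2).
      left. eapply Rle_lt_trans; [apply Rmin_r|]. apply K1. unfold cid.
      eapply Rle_lt_trans; [apply Cmod_le_ReIm|]. rewrite Re_minus, Im_minus. lra.
    + exists ((Cmod (z - x) - rho) / 2). split; [lra|]. intros v _ Hv1 Hv2 Hvr. exfalso.
      assert (Cmod (v - z) < Cmod (z - x) - rho).
      { eapply Rle_lt_trans; [apply Cmod_le_ReIm|]. rewrite Re_minus, Im_minus. lra. }
      pose proof (Cmod_tri z v x). rewrite (Cmod_sym z v) in H0. lra.
  - assert (Hbox : forall n, dd <= e / 2^n).
    { intros n. eapply Rle_trans; [apply (Hall (zs n))|].
      - pose proof (Re_le_Cmod (zs n - x)) as R1. pose proof (Im_le_Cmod (zs n - x)) as R2.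
        rewrite Re_minus in R1. rewrite Im_minus in R2. specialize (Hin n).
        split; [assert (Rabs (Re (zs n) - Re x) <= rho) as B by lra|assert (Rabs (Im (zs n) - Im x) <= rho) as B by lra];
        apply Rabs_le_between in B; lra.
      - apply Hin.
      - rewrite Cmod_sym. apply Hit. }
    destruct (pow_lt_1_zero (/2) ltac:(rewrite Rabs_pos_eq; lra) (dd / (e + 1))) as [n Hn].
    { apply Rdiv_lt_0_compat; lra. }
    specialize (Hn n (le_n n)). rewrite pow_inv in Hn.
    assert (0 < / 2^n) by (apply Rinv_0_lt_compat, pow_lt; lra).
    rewrite Rabs_pos_eq in Hn by lra. apply Rlt_div_r in Hn; [|lra]. specialize (Hbox n). unfold Rdiv in Hbox. nra.
Qed.

(** A flow box in complex time: [g] solves [g' = F (g)] with [g 0 = x], so real and imaginary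
    translations of [w] are the flows of [F] and of [i F]. *)
Record chart (F : C -> C) (x : C) (g : C -> C) (rho : R) : Prop := {
  chart_pos : 0 < rho;
  chart_0 : g 0 = x;
  chart_der : forall w, Cmod w < rho -> cder g w (F (g w));
  chart_inj : forall w w', Cmod w < rho -> Cmod w' < rho -> g w = g w' -> w = w';
  chart_open : forall eps, 0 < eps -> exists d, 0 < d /\
    forall z, Cmod (z - x) < d -> exists w, Cmod w < eps /\ Cmod w < rho /\ g w = z }.

Arguments chart_pos {F x g rho}. Arguments chart_0 {F x g rho}. Arguments chart_der {F x g rho}.
Arguments chart_inj {F x g rho}. Arguments chart_open {F x g rho}.

(** Complex time is a primitive of [1 / F], and the chart is its local inverse. *)
Lemma chart_exists F x : holo F -> F x <> 0 -> exists g rho, chart F x g rho.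
Proof.
  intros HF Hx.
  destruct (cont_nonzero cid F x (holo_ccont F x HF) Hx) as [d [Hd K]]. unfold cid in K.
  assert (Hx0 := proj1 (Cmod_gt_0 _) Hx).
  assert (Hnz : forall z, Cmod (z - x) < d -> F z <> 0).
  { intros z Hz. apply Cmod_gt_0. specialize (K z Hz). lra. }
  destruct (holo_primitive (fun z => / F z)%C x (d/3)) as [P HP].
  { intros z [Hz1 Hz2]. destruct (HF z) as [l Hl]. eexists. apply der_inv; [apply Hl|]. apply Hnz.
    eapply Rle_lt_trans; [apply Cmod_le_ReIm|]. rewrite Re_minus, Im_minus.
    assert (Rabs (Re z - Re x) <= d/3) by (apply Rabs_le; lra).
    assert (Rabs (Im z - Im x) <= d/3) by (apply Rabs_le; lra). lra. }
  set (h := fun z => (P z - P x)%C).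
  assert (Hh : forall z, Cmod (z - x) < d/3 -> cder h z (/ F z)).
  { intros z Hz. apply (der_val cid _ _ (/ F z - 0)%C); [ring|]. apply der_minus; [|apply der_const].
    apply HP, in_square_Cmod; auto. }
  destruct (inverse_function h (fun z => / F z)%C x (d/3)) as [r1 [Hr1 [Hlip Hsurj]]]; auto; try lra.
  { apply cont_inv; auto. apply holo_ccont; auto. }
  { intro E. apply C1_nz. rewrite <- (Cinv_l (F x)) by auto. rewrite E. ring. }
  assert (Hhx : h x = 0) by (unfold h; ring). rewrite Hhx in Hsurj.
  set (A := (/ F x)%C) in *.
  assert (HA : 0 < Cmod A) by (unfold A; rewrite Cmod_inv by auto; apply Rinv_0_lt_compat; auto).
  set (rho := Cmod A * r1 / 4) in *.
  assert (Hrho : 0 < rho) by (unfold rho; apply Rdiv_lt_0_compat; [apply Rmult_lt_0_compat|]; lra).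
  set (g := fun w => epsilon (inhabits x) (fun z => Cmod (z - x) <= 2 * Cmod w / Cmod A /\ h z = w)).
  assert (Hg : forall w, Cmod w < rho -> Cmod (g w - x) <= 2 * Cmod w / Cmod A /\ h (g w) = w).
  { intros w Hw. apply epsilon_spec. destruct (Hsurj w) as [z Hz].
    - replace (w - 0)%C with w by ring. auto.
    - replace (w - 0)%C with w in Hz by ring. exists z. auto. }
  assert (Hgr : forall w, Cmod w < rho -> Cmod (g w - x) < r1).
  { intros w Hw. eapply Rle_lt_trans; [apply Hg; auto|]. apply Rlt_div_l; auto.
    unfold rho in Hw. assert (0 < Cmod A * r1) by (apply Rmult_lt_0_compat; lra). lra. }
  assert (Hbi : forall z z', Cmod (z - x) < r1 -> Cmod (z' - x) < r1 -> Cmod A / 2 * Cmod (z - z') <= Cmod (h z - h z')).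
  { intros z z' Hz Hz'. specialize (Hlip z z' Hz Hz').
    pose proof (Cmod_tri2 (h z - h z') (h z - h z' - (z - z') * A)).
    replace (h z - h z' - (h z - h z' - (z - z') * A))%C with ((z - z') * A)%C in H by ring.
    rewrite Cmod_mult in H. lra. }
  assert (Huniq : forall w z, Cmod w < rho -> Cmod (z - x) < r1 -> h z = w -> z = g w).
  { intros w z Hw Hz E. specialize (Hbi z (g w) Hz (Hgr w Hw)). rewrite (proj2 (Hg w Hw)), E in Hbi.
    replace (w - w)%C with (RtoC 0) in Hbi by ring. rewrite Cmod_0 in Hbi.
    apply Ceq_minus, Cmod_eq_0. pose proof (Cmod_ge_0 (z - g w)). nra. }
  exists g, rho. constructor; auto.
  - symmetry. apply Huniq; auto. rewrite Cmod_0; auto.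
    rewrite Cmod_self; lra.
  - intros w Hw eps He. set (z := g w). assert (Hz := Hgr w Hw). fold z in Hz.
    assert (Hzd : Cmod (z - x) < d / 3) by lra.
    assert (HFz : 0 < Cmod (F z)) by (apply Cmod_gt_0, Hnz; lra).
    destruct (Hh z Hzd (eps * Cmod A / (2 * Cmod (F z)))) as [d1 [Hd1 K1]].
    { apply Rdiv_lt_0_compat; [apply Rmult_lt_0_compat|]; lra. }
    exists (Rmin (rho - Cmod w) (d1 * Cmod A / 2)). split.
    { apply Rmin_glb_lt; [lra|]. apply Rdiv_lt_0_compat; [apply Rmult_lt_0_compat|]; lra. }
    intros w' Hw'. unfold cid in *.
    assert (B1 := Rlt_Rmin_l Hw'). assert (B2 := Rlt_Rmin_r Hw').
    assert (Hw'r : Cmod w' < rho) by (pose proof (Cmod_rev w' w); lra).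
    assert (Hz' := Hgr w' Hw'r). set (z' := g w') in *.
    assert (E : h z = w) by apply (Hg w Hw). assert (E' : h z' = w') by apply (Hg w' Hw'r).
    assert (Hzz := Hbi z' z Hz' Hz). rewrite E, E' in Hzz.
    assert (Hzz' : Cmod (z' - z) < d1) by (apply Rmult_lt_reg_l with (Cmod A / 2); lra).
    specialize (K1 z' Hzz'). rewrite E, E' in K1.
    replace (z' - z - (w' - w) * F z)%C with (- F z * (w' - w - (z' - z) * / F z))%C.
    2:{ field. apply Cmod_gt_0; auto. }
    rewrite Cmod_mult, Cmod_opp.
    apply Rle_trans with (Cmod (F z) * (eps * Cmod A / (2 * Cmod (F z)) * Cmod (z' - z))).
    + apply Rmult_le_compat_l; lra.
    + replace (Cmod (F z) * (eps * Cmod A / (2 * Cmod (F z)) * Cmod (z' - z))) with (eps * (Cmod A / 2 * Cmod (z' - z))) by (field; lra).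
      apply Rmult_le_compat_l; lra.
  - intros w w' Hw Hw' E. rewrite <- (proj2 (Hg w Hw)), <- (proj2 (Hg w' Hw')), E. auto.
  - intros eps He.
    assert (Hcx : ccont h x) by (eapply der_cont; apply Hh; rewrite Cmod_self; lra).
    destruct (Hcx (Rmin eps rho)) as [d1 [Hd1 K1]]; [apply Rmin_glb_lt; auto|]. unfold cid in K1. rewrite Hhx in K1.
    exists (Rmin d1 r1). split; [apply Rmin_glb_lt; lra|]. intros z Hz.
    specialize (K1 z (Rlt_Rmin_l Hz)). replace (h z - 0)%C with (h z) in K1 by ring.
    exists (h z). split; [apply (Rlt_Rmin_l K1)|].
    assert (Hhr : Cmod (h z) < rho) by (apply (Rlt_Rmin_r K1)).
    split; auto. symmetry. apply Huniq; auto. apply (Rlt_Rmin_r Hz).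
Qed.

(** * Maximal solutions *)

(** A solution on an explicit open interval around 0. It replaces the abstract intervals of
    [solution], and by [Imax_isol] reaches the same times. *)
Definition isol (F : C -> C) (x : C) (a b : R) (phi : R -> C) : Prop :=
  a < 0 < b /\ phi 0 = x /\ forall t, a < t < b -> rder phi t (F (phi t)).

Lemma isol_neg F x a b phi : isol F x a b phi -> isol (negf F) x (- b) (- a) (fun t => phi (- t)).
Proof.
  intros (Hab & H0 & H). split; [lra|]. split; [rewrite Ropp_0; auto|].
  intros t Ht. apply (rder_neg phi t). apply H. lra.
Qed.

Lemma negf_invol F : negf (negf F) = F.
Proof. apply functional_extensionality. intros z. unfold negf. ring. Qed.

Lemma Imax_isol F x t : Imax F x t <-> exists a b phi, isol F x a b phi /\ a < t < b.
Proof.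
  split.
  - intros (J & phi & ((Ho & Hc) & HJ0 & H0 & H) & HJ).
    destruct (proj1 (locally_Rabs _ _) (Ho _ HJ0)) as [d0 [Hd0 K0]].
    destruct (proj1 (locally_Rabs _ _) (Ho _ HJ)) as [d [Hd K]].
    exists (Rmin 0 t - Rmin d0 d), (Rmax 0 t + Rmin d0 d), phi.
    assert (Hm : 0 < Rmin d0 d) by (apply Rmin_glb_lt; auto).
    assert (Hm1 : Rmin d0 d <= d0) by apply Rmin_l. assert (Hm2 : Rmin d0 d <= d) by apply Rmin_r.
    assert (Rmin 0 t <= 0 <= Rmax 0 t) by (split; [apply Rmin_l|apply Rmax_l]).
    assert (Rmin 0 t <= t <= Rmax 0 t) by (split; [apply Rmin_r|apply Rmax_r]).
    split; [|lra]. split; [lra|]. split; auto. intros s Hs. apply is_derive_rder, H.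
    destruct (Rle_dec 0 t) as [Hle|Hle].
    + minmax Hs.
      destruct (Rlt_dec s 0); [apply K0; apply Rabs_def1; lra|].
      destruct (Rlt_dec t s); [apply K; apply Rabs_def1; lra|]. apply (Hc 0 s t); auto; lra.
    + minmax Hs.
      destruct (Rlt_dec s t); [apply K; apply Rabs_def1; lra|].
      destruct (Rlt_dec 0 s); [apply K0; apply Rabs_def1; lra|]. apply (Hc t s 0); auto; lra.
  - intros (a & b & phi & (Hab & H0 & H) & Ht). exists (fun s => a < s < b), phi. split; auto.
    split; [split|].
    + intros s Hs. apply locally_Rabs. exists (Rmin (s - a) (b - s)). split; [apply Rmin_glb_lt; lra|].
      intros u Hu. assert (U1 := Rlt_Rmin_l Hu). assert (U2 := Rlt_Rmin_r Hu).
      apply Rabs_def2 in U1, U2. lra.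
    + intros; lra.
    + split; [lra|]. split; auto. intros s Hs. apply is_derive_rder, H; auto.
Qed.

Lemma isol_unique_pos F x a b c d phi psi t : holo F ->
  isol F x a b phi -> isol F x c d psi -> 0 <= t -> t < b -> t < d -> phi t = psi t.
Proof.
  intros HF (Hab & H0 & H) (Hcd & H0' & H') Ht Htb Htd.
  destruct (path_bounded phi 0 t) as [R [HR Hb]].
  { intros s Hs. eapply der_cont. apply H; lra. }
  destruct (holo_lipschitz F (R + 1) HF) as [L [HL Hlip]].
  destruct (gronwall_tube F phi psi t L R) with (t := t) as [G _]; auto; try lra.
  - intros s Hs. split; [apply H; lra|auto].
  - intros s Hs. apply H'; lra.
  - rewrite H0, H0'. rewrite Cmod_self. lra.
  - rewrite H0, H0' in G. replace (x - x)%C with (RtoC 0) in G by ring. rewrite Cmod_0 in G.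
    apply Ceq_minus, Cmod_eq_0. pose proof (Cmod_ge_0 (phi t - psi t)). lra.
Qed.

Lemma isol_unique F x a b c d phi psi t : holo F ->
  isol F x a b phi -> isol F x c d psi -> a < t < b -> c < t < d -> phi t = psi t.
Proof.
  intros HF H1 H2 Ht Ht'. destruct (Rle_dec 0 t).
  - apply (isol_unique_pos F x a b c d); auto; lra.
  - pose proof (isol_unique_pos (negf F) x _ _ _ _ _ _ (- t) (holo_negf F HF) (isol_neg _ _ _ _ _ H1) (isol_neg _ _ _ _ _ H2)) as E.
    simpl in E. rewrite Ropp_involutive in E. apply E; lra.
Qed.

Lemma Phi_isol F x a b phi t : holo F -> isol F x a b phi -> a < t < b -> Phi F t x = phi t.
Proof.
  intros HF H Ht. unfold Phi.
  assert (Hex : exists y, exists J phi, solution F x J phi /\ J t /\ phi t = y).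
  { destruct (proj2 (Imax_isol F x t)) as (J & ph & HS & HJ); [exists a, b, phi; auto|].
    exists (ph t), J, ph. auto. }
  apply epsilon_spec with (i := inhabits x) in Hex. destruct Hex as (J & ph & HS & HJ & E).
  rewrite <- E. clear E. destruct HS as ((Ho & Hc) & HJ0 & H0 & HD).
  destruct (proj1 (locally_Rabs _ _) (Ho _ HJ0)) as [d0 [Hd0 K0]].
  destruct (proj1 (locally_Rabs _ _) (Ho _ HJ)) as [d [Hd K]].
  assert (Hm : 0 < Rmin d0 d) by (apply Rmin_glb_lt; auto).
  assert (Hm1 : Rmin d0 d <= d0) by apply Rmin_l. assert (Hm2 : Rmin d0 d <= d) by apply Rmin_r.
  assert (Rmin 0 t <= 0 <= Rmax 0 t) by (split; [apply Rmin_l|apply Rmax_l]).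
  assert (Rmin 0 t <= t <= Rmax 0 t) by (split; [apply Rmin_r|apply Rmax_r]).
  apply (isol_unique F x (Rmin 0 t - Rmin d0 d) (Rmax 0 t + Rmin d0 d) a b); auto; [|lra].
  split; [lra|]. split; auto. intros s Hs. apply is_derive_rder, HD.
  destruct (Rle_dec 0 t) as [Hle|Hle].
  + minmax Hs.
    destruct (Rlt_dec s 0); [apply K0; apply Rabs_def1; lra|].
    destruct (Rlt_dec t s); [apply K; apply Rabs_def1; lra|]. apply (Hc 0 s t); auto; lra.
  + minmax Hs.
    destruct (Rlt_dec s t); [apply K; apply Rabs_def1; lra|].
    destruct (Rlt_dec 0 s); [apply K0; apply Rabs_def1; lra|]. apply (Hc t s 0); auto; lra.
Qed.

Lemma Imax_negf F x t : Imax (negf F) x t <-> Imax F x (- t).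
Proof.
  assert (H : forall F t, Imax F x t -> Imax (negf F) x (- t)).
  { intros G s Hs. apply Imax_isol in Hs. destruct Hs as (a & b & phi & HS & Hab).
    apply Imax_isol. exists (- b), (- a), (fun t => phi (- t)). split; [apply isol_neg; auto|lra]. }
  split; intros K.
  - apply H in K. rewrite negf_invol in K. auto.
  - apply H in K. rewrite Ropp_involutive in K. auto.
Qed.

Lemma Phi_negf F x t : holo F -> Imax F x (- t) -> Phi (negf F) t x = Phi F (- t) x.
Proof.
  intros HF Hs. apply Imax_isol in Hs. destruct Hs as (a & b & phi & HS & Hab).
  rewrite (Phi_isol F x a b phi) by auto.
  apply (Phi_isol (negf F) x (- b) (- a) (fun t => phi (- t))); [apply holo_negf; auto|apply isol_neg; auto|lra].
Qed.

Lemma isol_chart F x g rho w : chart F x g rho -> Cmod w < rho ->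
  isol F (g w) (- (rho - Cmod w)) (rho - Cmod w) (fun t => g (w + RtoC t)%C).
Proof.
  intros H Hw. split; [lra|]. split; [f_equal; ring|]. intros t Ht.
  apply (der_ext RtoC (fun s => g (w + RtoC s * 1)%C)) with (r := 1); [lra|intros; f_equal; ring|].
  apply (der_val RtoC _ _ (1 * F (g (w + RtoC t)))%C); [ring|].
  apply rder_affine_comp. replace (w + t * 1)%C with (w + t)%C by ring. apply (chart_der H).
  eapply Rle_lt_trans; [apply Cmod_triangle|]. rewrite Cmod_R. assert (Rabs t < rho - Cmod w) by (apply Rabs_def1; lra). lra.
Qed.

Lemma isol_chart_rot F x g rho w : chart F x g rho -> Cmod w < rho ->
  isol (rotf F) (g w) (- (rho - Cmod w)) (rho - Cmod w) (fun t => g (w + RtoC t * Ci)%C).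
Proof.
  intros H Hw. split; [lra|]. split; [f_equal; ring|]. intros t Ht.
  apply rder_affine_comp. apply (chart_der H).
  eapply Rle_lt_trans; [apply Cmod_triangle|]. rewrite Cmod_mult, Cmod_Ci, Cmod_R.
  assert (Rabs t < rho - Cmod w) by (apply Rabs_def1; lra). lra.
Qed.

Section Flow.
Context (F : C -> C) (HF : holo F).

Lemma local_existence x : F x <> 0 -> exists d, 0 < d /\
  forall z t, Cmod (z - x) < d -> Rabs t < d -> Imax F z t.
Proof.
  intros Hx. destruct (chart_exists F x HF Hx) as [g [rho Hg]].
  pose proof (chart_pos Hg).
  destruct (chart_open Hg (rho/2)) as [d [Hd K]]; [lra|].
  exists (Rmin d (rho/2)). split; [apply Rmin_glb_lt; lra|]. intros z t Hz Ht.
  destruct (K z (Rlt_Rmin_l Hz)) as [w [Hw [Hw' <-]]].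
  apply Imax_isol. eexists _, _, _. split; [apply (isol_chart F x g rho w); auto|].
  assert (Ht' := Rlt_Rmin_r Ht). apply Rabs_def2 in Ht'. lra.
Qed.

Lemma isol_equilibrium x T : F x = 0 -> 0 < T -> isol F x (- T) T (fun _ => x).
Proof.
  intros Hx HT. split; [lra|]. split; auto. intros t _. rewrite Hx. apply der_const.
Qed.

Lemma Imax_equilibrium x t : F x = 0 -> Imax F x t.
Proof.
  intros Hx. apply Imax_isol. exists (- (Rabs t + 1)), (Rabs t + 1), (fun _ => x).
  pose proof (Rabs_pos t). split; [apply isol_equilibrium; auto; lra|].
  assert (Rabs t < Rabs t + 1) as K by lra. apply Rabs_def2 in K. lra.
Qed.

Lemma Phi_equilibrium x t : F x = 0 -> Phi F t x = x.
Proof.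
  intros Hx. pose proof (Rabs_pos t). rewrite (Phi_isol F x (- (Rabs t + 1)) (Rabs t + 1) (fun _ => x)); auto.
  - apply isol_equilibrium; auto. lra.
  - assert (Rabs t < Rabs t + 1) as K by lra. apply Rabs_def2 in K. lra.
Qed.

Lemma Imax_0 x : Imax F x 0.
Proof.
  destruct (Ceq_dec (F x) 0) as [Hx|Hx]; [apply Imax_equilibrium; auto|].
  destruct (local_existence x Hx) as [d [Hd K]]. apply K.
  - rewrite Cmod_self; auto.
  - rewrite Rabs_R0; auto.
Qed.

Lemma Phi_0 x : Phi F 0 x = x.
Proof.
  destruct (proj1 (Imax_isol F x 0) (Imax_0 x)) as (a & b & phi & HS & Hab).
  rewrite (Phi_isol F x a b phi); auto. apply HS.
Qed.

Lemma Imax_open x t : Imax F x t -> exists d, 0 < d /\ forall s, Rabs (s - t) < d -> Imax F x s.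
Proof.
  intros H. apply Imax_isol in H. destruct H as (a & b & phi & HS & Hab).
  exists (Rmin (t - a) (b - t)). split; [apply Rmin_glb_lt; lra|]. intros s Hs.
  assert (U1 := Rlt_Rmin_l Hs). assert (U2 := Rlt_Rmin_r Hs).
  apply Rabs_def2 in U1, U2. apply Imax_isol. exists a, b, phi. split; auto. lra.
Qed.

Lemma Imax_convex x s t u : Imax F x s -> Imax F x u -> s <= t <= u -> Imax F x t.
Proof.
  intros H1 H2 Ht. apply Imax_isol in H1, H2. destruct H1 as (a & b & phi & HS & Hab).
  destruct H2 as (c & d & psi & HS' & Hcd). apply Imax_isol.
  destruct HS as (A & B). destruct HS' as (A' & B').
  destruct (Rle_dec 0 t).
  - exists c, d, psi. split; [split; auto|lra].
  - exists a, b, phi. split; [split; auto|lra].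
Qed.

Lemma Phi_der x t : Imax F x t -> rder (fun s => Phi F s x) t (F (Phi F t x)).
Proof.
  intros H. apply Imax_isol in H. destruct H as (a & b & phi & HS & Hab).
  rewrite (Phi_isol F x a b phi) by auto.
  apply (der_ext RtoC phi) with (r := Rmin (t - a) (b - t)); [apply Rmin_glb_lt; lra| |apply HS; auto].
  intros s Hs. rewrite Cmod_RtoC_minus in Hs.
  assert (U1 := Rlt_Rmin_l Hs). assert (U2 := Rlt_Rmin_r Hs).
  apply Rabs_def2 in U1, U2. symmetry. apply (Phi_isol F x a b phi); auto. lra.
Qed.

Lemma Phi_pcont x t : Imax F x t -> pcont (fun s => Phi F s x) t.
Proof. intros H. eapply der_cont. apply Phi_der; auto. Qed.

Lemma isol_shift x a b phi t : isol F x a b phi -> a < t < b -> isol F (phi t) (a - t) (b - t) (fun s => phi (t + s)).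
Proof.
  intros (Hab & H0 & H) Ht. split; [lra|]. split; [f_equal; ring|].
  intros s Hs. apply (rder_shift phi t s). apply H. lra.
Qed.

Lemma isol_Phi x s t : Imax F x s -> Imax F x t ->
  exists a b, isol F x a b (fun u => Phi F u x) /\ a < s < b /\ a < t < b.
Proof.
  intros H1 H2. apply Imax_isol in H1, H2. destruct H1 as (a & b & phi & HS & Hab). destruct H2 as (c & d & psi & HS' & Hcd).
  exists (Rmin a c), (Rmax b d).
  assert (Rmin a c <= a /\ Rmin a c <= c) by (split; [apply Rmin_l|apply Rmin_r]).
  assert (b <= Rmax b d /\ d <= Rmax b d) by (split; [apply Rmax_l|apply Rmax_r]).
  split; [|lra]. destruct (HS) as (A & _). destruct (HS') as (A' & _).
  split; [lra|]. split; [apply Phi_0|]. intros u Hu. apply Phi_der.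
  assert (Hc : a < u < b \/ c < u < d).
  { unfold Rmin, Rmax in Hu. destruct (Rle_dec a c), (Rle_dec b d);
    destruct (Rlt_dec u 0); try (left; lra); right; lra. }
  apply Imax_isol. destruct Hc; [exists a, b, phi|exists c, d, psi]; auto.
Qed.

Lemma flow_split x t s : Imax F x t -> Imax F x (t + s) ->
  Imax F (Phi F t x) s /\ Phi F s (Phi F t x) = Phi F (t + s) x.
Proof.
  intros H1 H2.
  destruct (isol_Phi x t (t + s) H1 H2) as (a & b & HS & Ht & Hts).
  pose proof (isol_shift x a b _ t HS Ht) as HS'. split.
  - apply Imax_isol. eexists _, _, _. split; [apply HS'|lra].
  - apply (Phi_isol F _ _ _ _ s HF HS'). lra.
Qed.

Lemma flow_join x t s : Imax F x t -> Imax F (Phi F t x) s -> Imax F x (t + s).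
Proof.
  intros H1 H2. apply Imax_isol in H1. destruct H1 as (a & b & phi & HS & Hab).
  rewrite (Phi_isol F x a b phi t) in H2 by auto.
  apply Imax_isol in H2. destruct H2 as (c & d & psi & HS' & Hcd).
  pose proof (isol_shift x a b phi t HS Hab) as HS2.
  assert (Hagree : forall u, a < u < b -> t + c < u < t + d -> phi u = psi (u - t)).
  { intros u Hu Hu'. replace (phi u) with (phi (t + (u - t))) by (f_equal; ring).
    apply (isol_unique F (phi t) (a - t) (b - t) c d (fun s => phi (t + s)) psi); auto; lra. }
  destruct HS as (A & B & D). destruct HS' as (A' & B' & D').
  (* By uniqueness the two solutions agree where both live, so near every time [chi] coincides with
     one of them. *)
  set (chi := fun u => if Rlt_dec a u then if Rlt_dec u b then phi u else psi (u - t) else psi (u - t)).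
  assert (Chi1 : forall u, a < u < b -> chi u = phi u).
  { intros u Hu. unfold chi. destruct (Rlt_dec a u); [destruct (Rlt_dec u b)|]; auto; lra. }
  assert (Chi2 : forall u, t + c < u < t + d -> chi u = psi (u - t)).
  { intros u Hu. unfold chi. destruct (Rlt_dec a u); [destruct (Rlt_dec u b)|]; auto. }
  apply Imax_isol. exists (Rmin a (t + c)), (Rmax b (t + d)), chi.
  assert (Rmin a (t + c) <= a /\ Rmin a (t+c) <= t + c) by (split; [apply Rmin_l|apply Rmin_r]).
  assert (b <= Rmax b (t + d) /\ t + d <= Rmax b (t + d)) by (split; [apply Rmax_l|apply Rmax_r]).
  split; [|lra]. split; [lra|]. split; [rewrite Chi1; auto; lra|].
  intros u Hu.
  assert (Hcase : a < u < b \/ t + c < u < t + d).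
  { destruct (Rlt_dec a u).
    - destruct (Rlt_dec u b); [left; lra|]. right. split; [lra|].
      unfold Rmax in Hu. destruct (Rle_dec b (t + d)); lra.
    - right. split; [|lra]. unfold Rmin in Hu. destruct (Rle_dec a (t + c)); lra. }
  destruct Hcase as [Hc|Hc].
  - rewrite Chi1 by auto. apply (der_ext RtoC phi) with (r := Rmin (u - a) (b - u)); [apply Rmin_glb_lt; lra| |apply D; auto].
    intros v Hv. rewrite Cmod_RtoC_minus in Hv.
    assert (U1 := Rlt_Rmin_l Hv). assert (U2 := Rlt_Rmin_r Hv).
    apply Rabs_def2 in U1, U2. symmetry. apply Chi1; lra.
  - rewrite Chi2 by auto.
    apply (der_ext RtoC (fun v => psi (- t + v))) with (r := Rmin (u - (t + c)) (t + d - u)); [apply Rmin_glb_lt; lra| |].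
    + intros v Hv. rewrite Cmod_RtoC_minus in Hv.
      assert (U1 := Rlt_Rmin_l Hv). assert (U2 := Rlt_Rmin_r Hv).
      apply Rabs_def2 in U1, U2. rewrite Chi2 by lra. f_equal; ring.
    + apply rder_shift. replace (- t + u) with (u - t) by ring. apply D'. lra.
Qed.

Lemma flow_back x t : Imax F x t -> Imax F (Phi F t x) (- t) /\ Phi F (- t) (Phi F t x) = x.
Proof.
  intros H. destruct (flow_split x t (- t)) as [A B]; auto.
  - replace (t + - t) with 0 by ring. apply Imax_0.
  - split; auto. rewrite B. replace (t + - t) with 0 by ring. apply Phi_0.
Qed.

Lemma flow_nonzero x t : Imax F x t -> F x <> 0 -> F (Phi F t x) <> 0.
Proof.
  intros H Hx E. destruct (flow_back x t H) as [A B]. rewrite Phi_equilibrium in B by auto.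
  rewrite B in E. auto.
Qed.

Lemma first_exit x T : 0 < T -> ~ Imax F x T ->
  exists T', 0 < T' <= T /\ (forall t, 0 <= t < T' -> Imax F x t) /\ ~ Imax F x T'.
Proof.
  intros HT Hn.
  destruct (completeness (fun t => 0 <= t /\ Imax F x t)) as [T' [H1 H2]].
  - exists T. intros t [Ht HI]. apply Rnot_lt_le. intro. apply Hn. apply (Imax_convex x 0 T t); auto. apply Imax_0. lra.
  - exists 0. split; [lra|apply Imax_0].
  - assert (HTT : T' <= T).
    { apply H2. intros t [Ht HI]. apply Rnot_lt_le. intro. apply Hn. apply (Imax_convex x 0 T t); auto. apply Imax_0. lra. }
    assert (Hlt : forall t, 0 <= t < T' -> Imax F x t).
    { intros t Ht. apply NNPP. intro K. assert (T' <= t); [|lra]. apply H2. intros s [Hs HI].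
      apply Rnot_lt_le. intro. apply K. apply (Imax_convex x 0 t s); auto. apply Imax_0. lra. }
    assert (Hnot : ~ Imax F x T').
    { intro K. destruct (Imax_open x T' K) as [d [Hd HK]].
      assert (0 <= T') by (apply H1; split; [lra|apply Imax_0]).
      assert (T' + d/2 <= T'); [|lra]. apply H1. split; [lra|]. apply HK. apply Rabs_def1; lra. }
    exists T'. repeat split; auto.
    assert (0 <= T') by (apply H1; split; [lra|apply Imax_0]).
    destruct (Req_dec T' 0) as [E|]; [|lra]. exfalso. apply Hnot. rewrite E. apply Imax_0.
Qed.
End Flow.

Lemma box_of_Cmod R z : Cmod z <= R -> in_box (-R) R (-R) R z.
Proof.
  intros H. pose proof (Re_le_Cmod z) as A. pose proof (Im_le_Cmod z) as B.
  split; apply Rabs_le_between; lra.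
Qed.

Lemma Cmod_near z w d : Rabs (Re w - Re z) < d/2 -> Rabs (Im w - Im z) < d/2 -> Cmod (w - z) < d.
Proof.
  intros. eapply Rle_lt_trans; [apply Cmod_le_ReIm|]. rewrite Re_minus, Im_minus. lra.
Qed.

Section Flow2.
Context (F : C -> C) (HF : holo F).

(** Otherwise the orbit accumulates at some [z0] as the time tends to [T]. If [F z0] is nonzero,
    solutions near [z0] live for a uniform time and continue past [T]. If [z0] is an equilibrium,
    Gronwall backwards in time gives [x = z0], which lives forever. *)
Lemma blowup x T : (forall t, 0 <= t < T -> Imax F x t) -> ~ Imax F x T -> 0 < T ->
  forall R, exists t1, 0 <= t1 < T /\ forall t, t1 <= t < T -> R < Cmod (Phi F t x).
Proof.
  intros Hlt Hn HT R. apply NNPP. intro Hno.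
  assert (Hrec : forall t1, 0 <= t1 < T -> exists t, t1 <= t < T /\ Cmod (Phi F t x) <= R).
  { intros t1 Ht1. apply NNPP. intro K. apply Hno. exists t1. split; auto. intros t Ht.
    apply Rnot_le_lt. intro. apply K. exists t. auto. }
  clear Hno.
  assert (Hacc : exists z0, forall d, 0 < d -> exists t, T - d < t < T /\ 0 <= t /\ Cmod (Phi F t x - z0) < d).
  { apply NNPP. intro Hno.
    destruct (compact_box (fun d z => forall t, T - d < t < T -> 0 <= t -> Phi F t x <> z) (-R) R (-R) R) as [d [Hd K]].
    - intros d d' z H1 H2 H t Ht. apply H. lra.
    - intros z _. apply NNPP. intro K. apply Hno. exists z. intros d Hd. apply NNPP. intro K'. apply K.
      exists (d/2). split; [lra|]. intros w _ Hw1 Hw2 t Ht Ht0 E. apply K'. exists t.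
      split; [lra|]. split; auto. rewrite E. apply Cmod_near; auto.
    - destruct (Hrec (Rmax 0 (T - d/2))) as [t [Ht HR]].
      + split; [apply Rmax_l|apply Rmax_lub_lt; lra].
      + assert (0 <= Rmax 0 (T - d/2)) by apply Rmax_l. assert (T - d/2 <= Rmax 0 (T - d/2)) by apply Rmax_r.
        apply (K (Phi F t x) (box_of_Cmod _ _ HR) t); auto; lra. }
  destruct Hacc as [z0 Hz0].
  destruct (Ceq_dec (F z0) 0) as [Hz|Hz].
  - assert (Hx : x = z0).
    { destruct (holo_lipschitz (negf F) (Cmod z0 + 1) (holo_negf F HF)) as [L [HL Hlip]].
      apply separated. intros e He.
      assert (He' := exp_pos (- (L * T))).
      destruct (Hz0 (Rmin e (1/2) * exp (- (L * T)))) as [t [Ht [Ht0 Hc]]].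
      { apply Rmult_lt_0_compat; auto. apply Rmin_glb_lt; lra. }
      assert (Hcc : Cmod (Phi F t x - z0) * exp (L * T) < Rmin e (1/2)).
      { apply (Rmult_lt_compat_r (exp (L * T))) in Hc; [|apply exp_pos].
        rewrite Rmult_assoc, <- exp_plus in Hc. replace (- (L * T) + L * T) with 0 in Hc by ring.
        rewrite exp_0, Rmult_1_r in Hc. exact Hc. }
      assert (Hlt' : Cmod (Phi F t x - z0) * exp (L * t) <= Cmod (Phi F t x - z0) * exp (L * T)).
      { apply Rmult_le_compat_l; [apply Cmod_ge_0|]. left. apply exp_increasing. nra. }
      assert (Rmin e (1/2) <= e) by apply Rmin_l. assert (Rmin e (1/2) <= 1/2) by apply Rmin_r.
      destruct (gronwall_tube (negf F) (fun _ => z0) (fun s => Phi F (t - s) x) t L (Cmod z0)) with (t := t) as [G _]; auto; try lra.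
      - intros s Hs. split; [|lra]. unfold negf. rewrite Hz. apply (der_val RtoC _ _ (RtoC 0)); [ring|apply der_const].
      - intros s Hs. apply (rder_neg (fun u => Phi F (t + u) x) s). apply (rder_shift (fun u => Phi F u x) t (- s)).
        replace (t + - s) with (t - s) by ring. apply Phi_der; auto. apply Hlt. lra.
      - rewrite Rminus_0_r, Cmod_sym. lra.
      - rewrite Rminus_0_r, Rminus_diag, Phi_0, (Cmod_sym z0 x), (Cmod_sym z0) in G by auto. lra. }
    subst z0. apply Hn. apply Imax_equilibrium; auto.
  - destruct (local_existence F HF z0 Hz) as [d [Hd K]].
    destruct (Hz0 d Hd) as [t [Ht [Ht0 Hc]]]. apply Hn.
    replace T with (t + (T - t)) by ring. apply flow_join; auto. apply Hlt; lra. apply K; auto.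
    apply Rabs_def1; lra.
Qed.

(** Existence up to [t0] for the neighbour [y] comes from the estimate itself: as long as [y] lives
    it stays in the disc of radius [R + 1], which a blow-up would have to leave. *)
Lemma dep_pos x t0 : Imax F x t0 -> 0 <= t0 -> exists K d, 0 < K /\ 0 < d /\
  forall y t, Cmod (y - x) < d -> 0 <= t <= t0 -> Imax F y t /\ Cmod (Phi F t y - Phi F t x) <= K * Cmod (y - x).
Proof.
  intros Hx Ht0.
  assert (HxI : forall t, 0 <= t <= t0 -> Imax F x t).
  { intros t Ht. apply (Imax_convex F x 0 t t0); auto. apply Imax_0; auto. }
  destruct (path_bounded (fun t => Phi F t x) 0 t0) as [R [HR Hb]].
  { intros t Ht. apply Phi_pcont; auto. }
  destruct (holo_lipschitz F (R + 1) HF) as [L [HL Hlip]].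
  exists (exp (L * t0)), (/ (2 * exp (L * t0))).
  pose proof (exp_pos (L * t0)) as He.
  split; auto. split; [apply Rinv_0_lt_compat; lra|].
  assert (Hgw : forall y t, Cmod (y - x) < / (2 * exp (L * t0)) -> 0 <= t <= t0 -> (forall s, 0 <= s <= t -> Imax F y s) ->
     Cmod (Phi F t x - Phi F t y) <= exp (L * t0) * Cmod (y - x) /\ Cmod (Phi F t y) <= R + 1).
  { intros y t Hy Ht HyI.
    assert (Hle : exp (L * t) <= exp (L * t0)).
    { apply exp_le. nra. }
    pose proof (Cmod_ge_0 (x - y)) as P. rewrite Cmod_sym in Hy.
    assert (Hs : Cmod (x - y) * exp (L * t0) < 1).
    { apply (Rmult_lt_compat_r (exp (L * t0))) in Hy; auto.
      replace (/ (2 * exp (L * t0)) * exp (L * t0)) with (1/2) in Hy by (field; lra). lra. }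
    destruct (gronwall_tube F (fun s => Phi F s x) (fun s => Phi F s y) t L R) with (t := t) as [G1 G2]; auto; try lra.
    - intros s Hs'. split; [apply Phi_der; auto; apply HxI; lra|apply Hb; lra].
    - intros s Hs'. apply Phi_der; auto.
    - rewrite !Phi_0 by auto. apply Rle_lt_trans with (2 := Hs). apply Rmult_le_compat_l; auto.
    - split; auto. eapply Rle_trans; [apply G1|]. rewrite !Phi_0, (Cmod_sym y x), Rmult_comm by auto.
      apply Rmult_le_compat_r; auto. }
  assert (HyI : forall y, Cmod (y - x) < / (2 * exp (L * t0)) -> forall t, 0 <= t <= t0 -> Imax F y t).
  { intros y Hy t Ht. apply NNPP. intro Hn.
    assert (Htp : 0 < t).
    { destruct (Req_dec t 0) as [->|]; [|lra]. exfalso. apply Hn, Imax_0; auto. }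
    destruct (first_exit F HF y t Htp Hn) as [T [HT [HTI HTn]]].
    destruct (blowup y T HTI HTn (proj1 HT) (R + 1)) as [t1 [Ht1 Hbig]].
    specialize (Hbig t1 ltac:(lra)).
    destruct (Hgw y t1 Hy ltac:(lra)) as [_ G]; [|lra]. intros s Hs. apply HTI. lra. }
  intros y t Hy Ht. split; [apply HyI; auto|]. rewrite Cmod_sym. apply Hgw; auto.
  intros s Hs. apply HyI; auto. lra.
Qed.
End Flow2.

Section Flow3.
Context (F : C -> C) (HF : holo F).

Lemma dep_neg x t0 : Imax F x t0 -> t0 <= 0 -> exists K d, 0 < K /\ 0 < d /\
  forall y t, Cmod (y - x) < d -> t0 <= t <= 0 -> Imax F y t /\ Cmod (Phi F t y - Phi F t x) <= K * Cmod (y - x).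
Proof.
  intros Hx Ht0.
  destruct (dep_pos (negf F) (holo_negf F HF) x (- t0)) as (K & d & HK & Hd & H); [|lra|].
  { apply (proj2 (Imax_negf F x _)). rewrite Ropp_involutive. auto. }
  exists K, d. split; auto. split; auto. intros y t Hy Ht.
  assert (HxI : Imax F x t).
  { apply (Imax_convex F x t0 t 0); auto. apply Imax_0; auto. }
  destruct (H y (- t) Hy ltac:(lra)) as [A B]. apply (proj1 (Imax_negf F y _)) in A. rewrite Ropp_involutive in A.
  split; auto. rewrite !Phi_negf, Ropp_involutive in B; rewrite ?Ropp_involutive; auto.
Qed.

Lemma Phi_cont x t : Imax F x t -> forall eps, 0 < eps -> exists d, 0 < d /\
  forall y s, Cmod (y - x) < d -> Rabs (s - t) < d -> Imax F y s /\ Cmod (Phi F s y - Phi F t x) < eps.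
Proof.
  intros Hx eps He.
  destruct (Imax_open F x t Hx) as [r [Hr KI]].
  destruct (Phi_pcont F HF x t Hx (eps/2)) as [d0 [Hd0 K0]]; [lra|].
  assert (Hdep : exists K d, 0 < K /\ 0 < d /\ forall y s, Cmod (y - x) < d -> Rabs (s - t) < r/2 ->
     Imax F y s /\ Cmod (Phi F s y - Phi F s x) <= K * Cmod (y - x)).
  { assert (Hp : exists K d, 0 < K /\ 0 < d /\ forall y s, Cmod (y - x) < d -> 0 <= s -> Rabs (s - t) < r/2 ->
       Imax F y s /\ Cmod (Phi F s y - Phi F s x) <= K * Cmod (y - x)).
    { destruct (Rle_dec 0 (t + r/2)).
      - destruct (dep_pos F HF x (t + r/2)) as (K & d & HK & Hd & H); auto.
        { apply KI. apply Rabs_def1; lra. }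
        exists K, d. repeat split; auto; apply Rabs_def2 in H2; apply H; auto; lra.
      - exists 1, 1. split; [lra|]. split; [lra|]. intros y s _ H1 H2. apply Rabs_def2 in H2. lra. }
    assert (Hn : exists K d, 0 < K /\ 0 < d /\ forall y s, Cmod (y - x) < d -> s <= 0 -> Rabs (s - t) < r/2 ->
       Imax F y s /\ Cmod (Phi F s y - Phi F s x) <= K * Cmod (y - x)).
    { destruct (Rle_dec (t - r/2) 0).
      - destruct (dep_neg x (t - r/2)) as (K & d & HK & Hd & H); auto.
        { apply KI. apply Rabs_def1; lra. }
        exists K, d. repeat split; auto; apply Rabs_def2 in H2; apply H; auto; lra.
      - exists 1, 1. split; [lra|]. split; [lra|]. intros y s _ H1 H2. apply Rabs_def2 in H2. lra. }
    destruct Hp as (K1 & d1 & HK1 & Hd1 & H1). destruct Hn as (K2 & d2 & HK2 & Hd2 & H2).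
    exists (K1 + K2), (Rmin d1 d2). split; [lra|]. split; [apply Rmin_glb_lt; auto|].
    intros y s Hy Hs. pose proof (Cmod_ge_0 (y - x)).
    destruct (Rle_dec 0 s).
    - destruct (H1 y s) as [A B]; auto. apply (Rlt_Rmin_l Hy). split; auto. nra.
    - destruct (H2 y s) as [A B]; auto. apply (Rlt_Rmin_r Hy). lra. split; auto. nra. }
  destruct Hdep as (K & d & HK & Hd & H).
  exists (Rmin (Rmin d (eps / (2 * K))) (Rmin (r/2) d0)). split.
  { apply Rmin_glb_lt; apply Rmin_glb_lt; auto; [apply Rdiv_lt_0_compat; lra|lra]. }
  intros y s Hy Hs.
  assert (Hy1 := Rlt_Rmin_l Hy). assert (Hs1 := Rlt_Rmin_r Hs).
  assert (Hy2 := Rlt_Rmin_l Hy1). assert (Hy3 := Rlt_Rmin_r Hy1).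
  assert (Hs2 := Rlt_Rmin_l Hs1). assert (Hs3 := Rlt_Rmin_r Hs1).
  destruct (H y s Hy2 Hs2) as [A B]. split; auto.
  specialize (K0 s). rewrite Cmod_RtoC_minus in K0. specialize (K0 Hs3).
  pose proof (Cmod_tri (Phi F s y) (Phi F s x) (Phi F t x)).
  apply Rlt_div_r in Hy3; [|lra]. nra.
Qed.

Lemma Phi_ccont x t : Imax F x t -> ccont (Phi F t) x.
Proof.
  intros H eps He. destruct (Phi_cont x t H eps He) as [d [Hd K]]. exists d. split; auto.
  intros y Hy. apply K; auto. rewrite Rminus_diag, Rabs_R0. auto.
Qed.

Lemma chart_flow x g rho w t : chart F x g rho -> Cmod w + Rabs t < rho ->
  Imax F (g w) t /\ Phi F t (g w) = g (w + RtoC t)%C.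
Proof.
  intros Hg Hw. pose proof (Rabs_pos t).
  pose proof (isol_chart F x g rho w Hg ltac:(lra)) as HS.
  assert (Ht : - (rho - Cmod w) < t < rho - Cmod w) by (assert (Rabs t < rho - Cmod w) as Q by lra; apply Rabs_def2 in Q; lra).
  split; [apply Imax_isol; eexists _, _, _; split; [apply HS|auto]|].
  apply (Phi_isol F _ _ _ _ t HF HS); auto.
Qed.

Lemma chart_flow_rot x g rho w t : chart F x g rho -> Cmod w + Rabs t < rho ->
  Imax (rotf F) (g w) t /\ Phi (rotf F) t (g w) = g (w + RtoC t * Ci)%C.
Proof.
  intros Hg Hw. pose proof (Rabs_pos t).
  pose proof (isol_chart_rot F x g rho w Hg ltac:(lra)) as HS.
  assert (Ht : - (rho - Cmod w) < t < rho - Cmod w) by (assert (Rabs t < rho - Cmod w) as Q by lra; apply Rabs_def2 in Q; lra).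
  split; [apply Imax_isol; eexists _, _, _; split; [apply HS|auto]|].
  apply (Phi_isol _ _ _ _ _ t (holo_rotf F HF) HS); auto.
Qed.

Lemma commute_local x : F x <> 0 -> exists d, 0 < d /\ forall y t s,
  Cmod (y - x) < d -> Rabs t < d -> Rabs s < d ->
  Imax F y t /\ Imax (rotf F) y s /\ Imax F (Phi (rotf F) s y) t /\ Imax (rotf F) (Phi F t y) s /\
  Phi F t (Phi (rotf F) s y) = Phi (rotf F) s (Phi F t y).
Proof.
  intros Hx. destruct (chart_exists F x HF Hx) as [g [rho Hg]]. pose proof (chart_pos Hg).
  destruct (chart_open Hg (rho/4)) as [d [Hd K]]; [lra|].
  exists (Rmin d (rho/4)). split; [apply Rmin_glb_lt; lra|]. intros y t s Hy Ht Hs.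
  assert (Ht' := Rlt_Rmin_r Ht). assert (Hs' := Rlt_Rmin_r Hs).
  destruct (K y (Rlt_Rmin_l Hy)) as [w [Hw [_ <-]]].
  destruct (chart_flow x g rho w t Hg ltac:(lra)) as [A1 A2].
  destruct (chart_flow_rot x g rho w s Hg ltac:(lra)) as [B1 B2].
  assert (W1 : Cmod (w + RtoC s * Ci) <= Cmod w + Rabs s).
  { eapply Rle_trans; [apply Cmod_triangle|]. rewrite Cmod_mult, Cmod_Ci, Cmod_R. lra. }
  assert (W2 : Cmod (w + RtoC t) <= Cmod w + Rabs t).
  { eapply Rle_trans; [apply Cmod_triangle|]. rewrite Cmod_R. lra. }
  destruct (chart_flow x g rho (w + RtoC s * Ci)%C t Hg ltac:(lra)) as [A3 A4].
  destruct (chart_flow_rot x g rho (w + RtoC t)%C s Hg ltac:(lra)) as [B3 B4].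
  rewrite A2, B2. repeat split; auto. rewrite A4, B4. f_equal. ring.
Qed.

(* The real-time and imaginary-time flows commute, as both are translations
   in a flow box. *)
Lemma commute x t : F x <> 0 -> Imax F x t -> exists d, 0 < d /\ forall s, Rabs s < d ->
  Imax (rotf F) x s /\ Imax F (Phi (rotf F) s x) t /\ Imax (rotf F) (Phi F t x) s /\
  Phi F t (Phi (rotf F) s x) = Phi (rotf F) s (Phi F t x).
Proof.
  intros Hx Ht.
  set (X := fun t => exists d, 0 < d /\ forall s, Rabs s < d ->
    Imax (rotf F) x s /\ Imax F (Phi (rotf F) s x) t /\ Imax (rotf F) (Phi F t x) s /\
    Phi F t (Phi (rotf F) s x) = Phi (rotf F) s (Phi F t x)).
  assert (H0 : X 0).
  { destruct (commute_local x Hx) as [d [Hd K]]. exists d. split; auto. intros s Hs.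
    destruct (K x 0 s) as (A & B & C & D & E); auto.
    - rewrite Cmod_self; auto.
    - rewrite Rabs_R0; auto. }
  assert (Hloc : forall t, Imax F x t -> exists d, 0 < d /\ forall u v, Rabs (u - t) < d -> Rabs (v - t) < d -> X u -> X v).
  { intros t1 Ht1. destruct (commute_local (Phi F t1 x)) as [d [Hd K]]; [apply flow_nonzero; auto|].
    destruct (Phi_cont x t1 Ht1 d Hd) as [d1 [Hd1 K1]].
    exists (Rmin d1 (d/2)). split; [apply Rmin_glb_lt; lra|]. intros u v Hu Hv [du [Hdu Ku]].
    assert (Hu1 := Rlt_Rmin_l Hu). assert (Hu2 := Rlt_Rmin_r Hu).
    assert (Hv1 := Rlt_Rmin_l Hv). assert (Hv2 := Rlt_Rmin_r Hv).
    destruct (K1 x u) as [Iu Cu]; [rewrite Cmod_self; auto|auto|].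
    destruct (K1 x v) as [Iv Cv]; [rewrite Cmod_self; auto|auto|].
    assert (Huv : Rabs (v - u) < d) by (apply Rabs_def2 in Hu2, Hv2; apply Rabs_def1; lra).
    destruct (flow_split F HF x u (v - u) Iu) as [S1 S2]; [replace (u + (v - u)) with v by ring; auto|].
    replace (u + (v - u)) with v in S2 by ring.
    exists (Rmin du d). split; [apply Rmin_glb_lt; auto|]. intros s Hs.
    assert (Hs1 := Rlt_Rmin_l Hs). assert (Hs2 := Rlt_Rmin_r Hs).
    destruct (Ku s Hs1) as (A1 & A2 & A3 & A4).
    destruct (K (Phi F u x) (v - u) s Cu Huv Hs2) as (B1 & B2 & B3 & B4 & B5).
    rewrite <- A4 in B3, B5. rewrite S2 in B4, B5.
    assert (J : Imax F (Phi (rotf F) s x) v).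
    { replace v with (u + (v - u)) by ring. apply flow_join; auto. }
    repeat split; auto.
    destruct (flow_split F HF (Phi (rotf F) s x) u (v - u) A2) as [_ E]; [replace (u + (v - u)) with v by ring; auto|].
    replace (u + (v - u)) with v in E by ring. rewrite <- E. auto. }
  assert (Hc : forall a b, a <= b -> (forall u, a <= u <= b -> Imax F x u) -> (X a <-> X b)).
  { intros a b Hab HI. apply interval_connected; auto. intros u Hu.
    destruct (Hloc u (HI u Hu)) as [d [Hd K]]. exists d. split; auto. intros v _ Hv.
    split; apply K; auto; rewrite Rminus_diag, Rabs_R0; auto. }
  destruct (Rle_dec 0 t) as [Hle|Hle].
  - apply (Hc 0 t); auto. intros u Hu. apply (Imax_convex F x 0 u t); auto. apply Imax_0; auto.
  - apply (Hc t 0); auto; [lra|]. intros u Hu. apply (Imax_convex F x t u 0); auto. apply Imax_0; auto.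
Qed.
End Flow3.

(** * Linearization at a simple zero and the basin *)

(** The equation [lin_eq] says that the flow becomes multiplication by [exp (lam t)] in the
    coordinate [psi]. The Lipschitz constants 2 come from the normalization [psi' a = 1] in the
    construction. *)
Record linearization (F : C -> C) (a lam : C) (psi psi' : C -> C) (r : R) : Prop := {
  lin_pos : 0 < r;
  lin_a : psi a = 0;
  lin_der : forall z, Cmod (z - a) < r -> cder psi z (psi' z);
  lin_eq : forall z, Cmod (z - a) < r -> (F z * psi' z = lam * psi z)%C;
  lin_lower : forall z w, Cmod (z - a) < r -> Cmod (w - a) < r -> Cmod (z - w) <= 2 * Cmod (psi z - psi w);
  lin_upper : forall z w, Cmod (z - a) < r -> Cmod (w - a) < r -> Cmod (psi z - psi w) <= 2 * Cmod (z - w) }.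

Arguments lin_pos {F a lam psi psi' r}.
Arguments lin_a {F a lam psi psi' r}.
Arguments lin_der {F a lam psi psi' r}.
Arguments lin_eq {F a lam psi psi' r}.
Arguments lin_lower {F a lam psi psi' r}.
Arguments lin_upper {F a lam psi psi' r}.

(* Writing [F = (z - a) F1] and [F1 - lam = (z - a) F2], the coordinate is
   [(z - a) exp (int - F2 / F1)]. *)
Lemma linearization_exists F a lam : holo F -> F a = 0 -> cder F a lam -> lam <> 0 ->
  exists psi psi' r, linearization F a lam psi psi' r.
Proof.
  intros HF Ha Hl Hlam.
  destruct (holo_factor F a HF Ha) as [F1 [HF1 [E1 D1]]].
  assert (EF1 : F1 a = lam) by (apply (cder_unique F a); auto).
  destruct (holo_factor (fun z => F1 z - lam)%C a) as [F2 [HF2 [E2 _]]].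
  { intros z. destruct (HF1 z) as [l H]. eexists. apply der_minus; [apply H|apply der_const]. }
  { rewrite EF1. ring. }
  destruct (cont_nonzero cid F1 a (holo_ccont F1 a HF1)) as [d [Hd K]]; [rewrite EF1; auto|]. unfold cid in K.
  assert (Hlp := proj1 (Cmod_gt_0 _) Hlam).
  assert (Hnz : forall z, Cmod (z - a) < d -> F1 z <> 0).
  { intros z Hz. apply Cmod_gt_0. specialize (K z Hz). rewrite EF1 in K. lra. }
  destruct (holo_primitive (fun z => - F2 z / F1 z)%C a (d/3)) as [P0 HP0].
  { intros z [Hz1 Hz2]. destruct (HF1 z) as [l1 Hl1]. destruct (HF2 z) as [l2 Hl2].
    eexists. apply der_div; [apply der_opp, Hl2|apply Hl1|]. apply Hnz.
    eapply Rle_lt_trans; [apply Cmod_le_ReIm|]. rewrite Re_minus, Im_minus.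
    assert (Rabs (Re z - Re a) <= d/3) by (apply Rabs_le; lra).
    assert (Rabs (Im z - Im a) <= d/3) by (apply Rabs_le; lra). lra. }
  set (P := fun z => (P0 z - P0 a)%C).
  assert (HP : forall z, Cmod (z - a) < d/3 -> cder P z (- F2 z / F1 z)).
  { intros z Hz. apply (der_val cid _ _ (- F2 z / F1 z - 0)%C); [ring|].
    apply der_minus; [apply HP0, in_square_Cmod; auto|apply der_const]. }
  set (psi := fun z => ((z - a) * cexp (P z))%C).
  set (psi' := fun z => (lam * cexp (P z) / F1 z)%C).
  assert (Hpsi : forall z, Cmod (z - a) < d/3 -> cder psi z (psi' z)).
  { intros z Hz. assert (F1 z <> 0) by (apply Hnz; lra).
    apply (der_val cid _ _ (1 * cexp (P z) + (z - a) * ((- F2 z / F1 z) * cexp (P z)))%C).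
    - unfold psi'. assert (E : (lam = F1 z - (z - a) * F2 z)%C) by (rewrite <- E2; ring).
      rewrite E at 1. field. auto.
    - apply (der_mult cid (fun z => z - a)%C (fun z => cexp (P z))); [apply cder_minus_const|].
      apply (der_comp cid cid P cexp); [apply HP; auto|apply cder_cexp]. }
  assert (Hpa : Cmod (a - a) < d/3) by (rewrite Cmod_self; lra).
  assert (Hp1 : psi' a = 1).
  { unfold psi', P. rewrite EF1. replace (P0 a - P0 a)%C with (RtoC 0) by ring. rewrite cexp_0. field. auto. }
  destruct (inverse_function psi psi' a (d/3)) as [r1 [Hr1 [Hlip _]]]; auto; try lra.
  { unfold psi'. apply cont_div; [apply cont_mult; [apply cont_const|]|apply holo_ccont; auto|rewrite EF1; auto].
    apply (cont_comp cid cid P cexp); [eapply der_cont; apply HP; auto|eapply der_cont, cder_cexp]. }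
  { rewrite Hp1. apply C1_nz. }
  rewrite Hp1, Cmod_1 in Hlip.
  exists psi, psi', r1. constructor; try lra.
  - unfold psi. ring.
  - intros z Hz. apply Hpsi. lra.
  - intros z Hz. unfold psi', psi. rewrite E1. field. apply Hnz. lra.
  - intros z w Hz Hw. specialize (Hlip z w Hz Hw).
    pose proof (Cmod_tri2 (psi z - psi w) (psi z - psi w - (z - w) * 1)).
    replace (psi z - psi w - (psi z - psi w - (z - w) * 1))%C with (z - w)%C in H by ring. lra.
  - intros z w Hz Hw. specialize (Hlip z w Hz Hw).
    pose proof (Cmod_triangle (psi z - psi w - (z - w) * 1) (z - w)).
    replace (psi z - psi w - (z - w) * 1 + (z - w))%C with (psi z - psi w)%C in H by ring.
    pose proof (Cmod_ge_0 (z - w)). lra.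
Qed.

Lemma rder_cexp_lin (mu : C) t : rder (fun t => cexp (mu * RtoC t)) t (mu * cexp (mu * RtoC t)).
Proof.
  apply (der_ext RtoC (fun s => cexp (0 + RtoC s * mu)%C)) with (r := 1); [lra|intros; f_equal; ring|].
  apply rder_affine_comp. replace (0 + t * mu)%C with (mu * t)%C by ring. apply cder_cexp.
Qed.

(** The field [G] and the multiplier [mu] are free so that both [F] with [lam] and [i F] with
    [i lam] are covered by the one coordinate [psi]. *)
Lemma lin_flow F a lam psi psi' r (G : C -> C) mu (phi : R -> C) s t :
  linearization F a lam psi psi' r ->
  (forall z, Cmod (z - a) < r -> (G z * psi' z = mu * psi z)%C) -> s <= t ->
  (forall u, s <= u <= t -> rder phi u (G (phi u)) /\ Cmod (phi u - a) < r) ->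
  psi (phi t) = (cexp (mu * RtoC (t - s)) * psi (phi s))%C.
Proof.
  intros HL HG Hst H.
  assert (E : (cexp (- mu * RtoC t) * psi (phi t) = cexp (- mu * RtoC s) * psi (phi s))%C).
  { apply (const_of_rder_0 (fun u => cexp (- mu * RtoC u) * psi (phi u))%C); auto.
    intros u Hu. destruct (H u Hu) as [H1 H2].
    apply (der_val RtoC _ _ ((- mu * cexp (- mu * RtoC u)) * psi (phi u) + cexp (- mu * RtoC u) * (G (phi u) * psi' (phi u)))%C).
    - rewrite HG by auto. ring.
    - apply (der_mult RtoC (fun u => cexp (- mu * RtoC u)) (fun u => psi (phi u))); [apply rder_cexp_lin|].
      apply (rder_comp_cder psi phi); auto. apply (lin_der HL); auto. }
  replace (psi (phi t)) with (cexp (mu * RtoC t) * (cexp (- mu * RtoC t) * psi (phi t)))%C.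
  - rewrite E, !Cmult_assoc, <- cexp_plus. f_equal. f_equal. rewrite RtoC_minus. ring.
  - rewrite Cmult_assoc, <- cexp_plus. replace (mu * t + - mu * t)%C with (RtoC 0) by ring. rewrite cexp_0. ring.
Qed.

Lemma Cmod_cexp_lin mu t : Cmod (cexp (mu * RtoC t)) = exp (Re mu * t).
Proof. rewrite Cmod_cexp. f_equal. destruct mu. unfold Re, Cmult, RtoC; simpl. ring. Qed.

Lemma tends_to_plus_eventually F x a : tends_to_plus F x a ->
  forall eps, 0 < eps -> exists T, 0 <= T /\ forall t, T <= t -> Cmod (Phi F t x - a) < eps.
Proof.
  intros [_ H] eps He.
  assert (Hl : locally a (fun y => Cmod (y - a) < eps)) by (apply locally_Cmod; exists eps; auto).
  destruct (H _ Hl) as [M HM]. exists (Rmax 0 (M + 1)). split; [apply Rmax_l|].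
  intros t Ht. apply HM. apply Rlt_le_trans with (M + 1); [lra|]. eapply Rle_trans; [apply Rmax_r|apply Ht].
Qed.

(** If the real part were nonnegative, the modulus of [psi] could not decrease along an orbit that
    stays in the domain of [psi], whereas the orbit tends to [a]. *)
Lemma lin_stable_Re F a lam psi psi' r : holo F -> F a = 0 -> linearization F a lam psi psi' r ->
  stable F a -> Re lam < 0.
Proof.
  intros HF Ha HL Hs. apply locally_Cmod in Hs. destruct Hs as [d [Hd Hs]].
  set (z0 := (a + RtoC (d/2))%C).
  assert (Hz0 : Cmod (z0 - a) = d/2).
  { unfold z0. replace (a + RtoC (d/2) - a)%C with (RtoC (d/2)) by ring. rewrite Cmod_R, Rabs_pos_eq; lra. }
  specialize (Hs z0 ltac:(lra)). pose proof (lin_pos HL) as Hr.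
  destruct (tends_to_plus_eventually F z0 a Hs r Hr) as [T [HT HTr]]. destruct Hs as [HI Hlim].
  assert (Hne : Phi F T z0 <> a).
  { intro E. assert (K : Imax F z0 T) by (apply HI; lra).
    destruct (flow_back F HF z0 T K) as [_ B]. rewrite E, Phi_equilibrium in B by auto.
    rewrite <- B, Cmod_self in Hz0. lra. }
  assert (Hp : 0 < Cmod (psi (Phi F T z0))).
  { apply Cmod_gt_0. intro E. apply Hne.
    pose proof (lin_lower HL (Phi F T z0) a (HTr T (Rle_refl _)) ltac:(rewrite Cmod_self; auto)) as K.
    rewrite E, (lin_a HL), Cmod_self in K. apply Ceq_minus, Cmod_eq_0.
    pose proof (Cmod_ge_0 (Phi F T z0 - a)). lra. }
  apply Rnot_le_lt. intro Hge.
  destruct (tends_to_plus_eventually F z0 a (conj HI Hlim) (Cmod (psi (Phi F T z0)) / 4)) as [T2 [HT2 HT2r]]; [lra|].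
  set (t := Rmax T T2).
  assert (T <= t) by apply Rmax_l. assert (T2 <= t) by apply Rmax_r.
  assert (E : psi (Phi F t z0) = (cexp (lam * RtoC (t - T)) * psi (Phi F T z0))%C).
  { apply (lin_flow F a lam psi psi' r F lam (fun u => Phi F u z0)); auto.
    - intros; apply (lin_eq HL); auto.
    - intros u Hu. split; [apply Phi_der; auto; apply HI; lra|apply HTr; lra]. }
  pose proof (lin_upper HL (Phi F t z0) a (HTr t ltac:(lra)) ltac:(rewrite Cmod_self; auto)) as K.
  rewrite (lin_a HL) in K. replace (psi (Phi F t z0) - 0)%C with (psi (Phi F t z0)) in K by ring.
  rewrite E, Cmod_mult, Cmod_cexp_lin in K.
  assert (1 <= exp (Re lam * (t - T))).
  { rewrite <- exp_0. apply exp_le. apply Rmult_le_pos; lra. }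
  specialize (HT2r t ltac:(lra)). nra.
Qed.

Section Basin.
Context {F : C -> C} (HF : holo F) {a lam : C} (Ha : F a = 0)
  {psi psi' : C -> C} {r : R} (HL : linearization F a lam psi psi' r) (Hre : Re lam < 0).

Let Hr : 0 < r := lin_pos HL.

Lemma rotf_zero : rotf F a = 0.
Proof. unfold rotf. rewrite Ha. ring. Qed.

Lemma lin_Cmod_upper z : Cmod (z - a) < r -> Cmod (psi z) <= 2 * Cmod (z - a).
Proof.
  intros Hz. pose proof (lin_upper HL z a Hz ltac:(rewrite Cmod_self; auto)) as K.
  rewrite (lin_a HL) in K. replace (psi z - 0)%C with (psi z) in K by ring. auto.
Qed.

Lemma lin_Cmod_lower z : Cmod (z - a) < r -> Cmod (z - a) <= 2 * Cmod (psi z).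
Proof.
  intros Hz. pose proof (lin_lower HL z a Hz ltac:(rewrite Cmod_self; auto)) as K.
  rewrite (lin_a HL) in K. replace (psi z - 0)%C with (psi z) in K by ring. auto.
Qed.

Lemma lin_injective z w : Cmod (z - a) < r -> Cmod (w - a) < r -> psi z = psi w -> z = w.
Proof.
  intros Hz Hw E. pose proof (lin_lower HL z w Hz Hw) as K. rewrite E, Cmod_self in K.
  apply Ceq_minus, Cmod_eq_0. pose proof (Cmod_ge_0 (z - w)). lra.
Qed.

Lemma decay z u : 0 <= u -> (forall s, 0 <= s <= u -> Imax F z s /\ Cmod (Phi F s z - a) < r) ->
  psi (Phi F u z) = (cexp (lam * RtoC u) * psi z)%C /\
  Cmod (Phi F u z - a) <= 4 * Cmod (z - a) * exp (Re lam * u).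
Proof.
  intros Hu H.
  assert (E : psi (Phi F u z) = (cexp (lam * RtoC u) * psi z)%C).
  { pose proof (lin_flow F a lam psi psi' r F lam (fun u => Phi F u z) 0 u HL) as E. cbv beta in E. rewrite Phi_0, Rminus_0_r in E by auto.
    apply E; auto.
    - intros; apply (lin_eq HL); auto.
    - intros s Hs. destruct (H s Hs). split; auto. apply Phi_der; auto. }
  split; auto. destruct (H u) as [_ H1]; [lra|].
  eapply Rle_trans; [apply lin_Cmod_lower; auto|]. rewrite E, Cmod_mult, Cmod_cexp_lin.
  destruct (H 0) as [_ H0]; [lra|]. rewrite Phi_0 in H0 by auto.
  pose proof (lin_Cmod_upper z H0). pose proof (exp_pos (Re lam * u)). nra.
Qed.

Lemma exp_decay_le u : 0 <= u -> exp (Re lam * u) <= 1.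
Proof.
  intros Hu. rewrite <- exp_0. apply exp_le. nra.
Qed.

(** By [decay] the distance to [a] stays below four times its initial value, hence below [rho / 2],
    as long as it is below [rho]. The gap between the two bounds makes the condition persist, and
    boundedness excludes blow-up. *)
Lemma trapping rho z : 0 < rho <= r -> Cmod (z - a) < rho / 8 ->
  forall t, 0 <= t -> Imax F z t /\ Cmod (Phi F t z - a) < rho.
Proof.
  intros Hrho Hz.
  assert (Hstay : forall t, 0 <= t -> (forall s, 0 <= s <= t -> Imax F z s) -> forall s, 0 <= s <= t -> Cmod (Phi F s z - a) < rho).
  { intros t0 Ht0 HI.
    apply (cousin (fun u v => (forall s, 0 <= s <= u -> Cmod (Phi F s z - a) < rho) -> forall s, 0 <= s <= v -> Cmod (Phi F s z - a) < rho) 0 t0); auto.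
    - intros t Ht. pose proof (Phi_pcont F HF z t (HI t Ht)) as Hc.
      destruct (Rlt_dec (Cmod (Phi F t z - a)) rho) as [Hlt|Hge].
      + destruct (Hc (rho - Cmod (Phi F t z - a))) as [d [Hd K]]; [lra|].
        exists d. split; auto. intros u v Hu Hut Htv Hv Huv Hprem s Hs.
        destruct (Rle_dec s u); [apply Hprem; lra|].
        specialize (K s). rewrite Cmod_RtoC_minus in K. specialize (K ltac:(apply Rabs_def1; lra)).
        pose proof (Cmod_tri (Phi F s z) (Phi F t z) a). lra.
      + destruct (Hc (rho / 2)) as [d [Hd K]]; [lra|].
        exists d. split; auto. intros u v Hu Hut Htv Hv Huv Hprem. exfalso.
        destruct (decay z u) as [_ Hd4]; [lra| |].
        * intros s Hs. split; [apply HI; lra|]. specialize (Hprem s Hs). lra.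
        * specialize (K u). rewrite Cmod_RtoC_minus in K. specialize (K ltac:(apply Rabs_def1; lra)).
          pose proof (Cmod_tri (Phi F t z) (Phi F u z) a). rewrite (Cmod_sym (Phi F t z) (Phi F u z)) in H.
          pose proof (exp_decay_le u ltac:(lra)) as He. pose proof (Cmod_ge_0 (z - a)).
          apply (Rmult_le_compat_l (4 * Cmod (z - a))) in He; lra.
    - intros s Hs. replace s with 0 by lra. rewrite Phi_0 by auto. lra. }
  assert (HI : forall t, 0 <= t -> Imax F z t).
  { intros t Ht. apply NNPP. intro Hn.
    assert (0 < t) by (destruct (Req_dec t 0) as [->|]; [exfalso; apply Hn, Imax_0; auto|lra]).
    destruct (first_exit F HF z t H Hn) as [T [HT [HTI HTn]]].
    destruct (blowup F HF z T HTI HTn (proj1 HT) (Cmod a + rho)) as [t1 [Ht1 Hbig]].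
    specialize (Hbig t1 ltac:(lra)).
    assert (Cmod (Phi F t1 z - a) < rho).
    { apply (Hstay t1); try lra. intros s Hs. apply HTI. lra. }
    pose proof (Cmod_rev (Phi F t1 z) a). lra. }
  intros t Ht. split; auto. apply (Hstay t); auto; try lra. intros s Hs. apply HI. lra.
Qed.

(** The basin, described by one visit to the disc that [trapping] controls. [omega_plus_basin]
    identifies it with the description by limit sets. *)
Definition NN (x : C) : Prop := exists t, 0 <= t /\ Imax F x t /\ Cmod (Phi F t x - a) < r / 8.

Lemma NN_near z : Cmod (z - a) < r / 8 -> NN z.
Proof. intros H. exists 0. split; [lra|]. split; [apply Imax_0; auto|rewrite Phi_0; auto]. Qed.

Lemma NN_a : NN a.
Proof. apply NN_near. rewrite Cmod_self. lra. Qed.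

Lemma NN_forward x : NN x -> exists T, 0 <= T /\ (forall t, 0 <= t -> Imax F x t) /\
  (forall t, T <= t -> Cmod (Phi F t x - a) < r) /\
  forall t, 0 <= t -> Cmod (Phi F (T + t) x - a) <= r * exp (Re lam * t).
Proof.
  intros (T & HT & HI & HTr). exists T. split; auto.
  assert (Htr : forall t, 0 <= t -> Imax F x (T + t) /\ Cmod (Phi F (T + t) x - a) < r /\
     Cmod (Phi F (T + t) x - a) <= r * exp (Re lam * t)).
  { intros t Ht. pose proof (trapping r (Phi F T x) ltac:(lra) HTr) as Tr.
    destruct (Tr t Ht) as [A B]. assert (J : Imax F x (T + t)) by (apply flow_join; auto).
    destruct (flow_split F HF x T t HI J) as [_ E]. rewrite E in B. split; auto. split; auto.
    destruct (decay (Phi F T x) t Ht) as [_ D].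
    { intros s Hs. apply Tr. lra. }
    rewrite E in D. eapply Rle_trans; [apply D|]. apply Rmult_le_compat_r; [left; apply exp_pos|]. lra. }
  split; [|split].
  - intros t Ht. destruct (Rle_dec t T).
    + apply (Imax_convex F x 0 t T); auto. apply Imax_0; auto.
    + replace t with (T + (t - T)) by ring. apply Htr. lra.
  - intros t Ht. replace t with (T + (t - T)) by ring. apply Htr. lra.
  - intros t Ht. apply Htr; auto.
Qed.

Lemma exp_small eps : 0 < eps -> exists t0, 0 <= t0 /\ forall t, t0 <= t -> r * exp (Re lam * t) < eps.
Proof.
  intros He.
  exists (Rabs (ln (eps / (2 * r)) / Re lam)). split; [apply Rabs_pos|]. intros t Ht.
  assert (Hp : 0 < eps / (2 * r)) by (apply Rdiv_lt_0_compat; lra).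
  assert (Re lam * t <= ln (eps / (2 * r))).
  { pose proof (Rle_abs (ln (eps / (2 * r)) / Re lam)).
    assert (ln (eps / (2 * r)) / Re lam <= t) by lra.
    apply (Rmult_le_compat_neg_l (Re lam)) in H0; [|lra].
    replace (Re lam * (ln (eps / (2 * r)) / Re lam)) with (ln (eps / (2 * r))) in H0 by (field; lra). lra. }
  assert (exp (Re lam * t) <= eps / (2 * r)).
  { rewrite <- (exp_ln (eps / (2 * r))) by auto. destruct (Req_dec (Re lam * t) (ln (eps / (2*r)))) as [->|]; [lra|].
    left. apply exp_increasing. lra. }
  apply (Rmult_le_compat_l r) in H0; [|lra]. replace (r * (eps / (2 * r))) with (eps / 2) in H0 by (field; lra). lra.
Qed.

Lemma NN_tends x : NN x -> forall eps, 0 < eps -> exists T, 0 <= T /\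
  forall t, T <= t -> Imax F x t /\ Cmod (Phi F t x - a) < eps.
Proof.
  intros H eps He. destruct (NN_forward x H) as (T & HT & HI & _ & Hdec).
  destruct (exp_small eps He) as [t0 [Ht0 K]].
  exists (T + t0). split; [lra|]. intros t Ht. split; [apply HI; lra|].
  replace t with (T + (t - T)) by ring. eapply Rle_lt_trans; [apply Hdec; lra|apply K; lra].
Qed.

Lemma NN_open x : NN x -> exists d, 0 < d /\ forall y, Cmod (y - x) < d -> NN y.
Proof.
  intros (t & Ht & HI & Hn).
  destruct (Phi_cont F HF x t HI (r / 8 - Cmod (Phi F t x - a))) as [d [Hd K]]; [lra|].
  exists d. split; auto. intros y Hy. destruct (K y t Hy) as [A B]; [rewrite Rminus_diag, Rabs_R0; auto|].
  exists t. split; auto. split; auto. pose proof (Cmod_tri (Phi F t y) (Phi F t x) a). lra.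
Qed.

Lemma NN_flow x t : Imax F x t -> NN x -> NN (Phi F t x).
Proof.
  intros Ht Hx. destruct (NN_tends x Hx (r/8)) as [T [HT K]]; [lra|].
  set (s := Rmax T t). assert (T <= s) by apply Rmax_l. assert (t <= s) by apply Rmax_r.
  destruct (K s H) as [A B]. exists (s - t). split; [lra|].
  destruct (flow_split F HF x t (s - t) Ht) as [C D]; [replace (t + (s - t)) with s by ring; auto|].
  replace (t + (s - t)) with s in D by ring. rewrite D. auto.
Qed.

Lemma NN_flow_iff x t : Imax F x t -> (NN (Phi F t x) <-> NN x).
Proof.
  intros Ht. split; [|apply NN_flow; auto]. intros H.
  destruct (flow_back F HF x t Ht) as [A B]. rewrite <- B. apply NN_flow; auto.
Qed.

Lemma NN_equilibrium x : NN x -> F x = 0 -> x = a.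
Proof.
  intros Hx E. apply Ceq_minus, Cmod_eq_0. apply Rle_antisym; [|apply Cmod_ge_0].
  apply le_epsilon. intros e He. destruct (NN_tends x Hx e He) as [T [HT K]].
  destruct (K T (Rle_refl _)) as [_ B]. rewrite Phi_equilibrium in B by auto. lra.
Qed.

(** The extension of [psi] to the whole basin: [exp (- lam t)] times [psi] of the point reached at
    time [t], which is eventually constant in [t]. *)
Definition Psi (x : C) : C := epsilon (inhabits (RtoC 0)) (fun u =>
  exists T, forall t, T <= t -> Cmod (Phi F t x - a) < r /\ psi (Phi F t x) = (cexp (lam * RtoC t) * u)%C).

Lemma Psi_eventually x t0 : 0 <= t0 -> Imax F x t0 -> Cmod (Phi F t0 x - a) < r / 8 ->
  forall t, t0 <= t -> Cmod (Phi F t x - a) < r /\ psi (Phi F t x) = (cexp (lam * RtoC t) * Psi x)%C.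
Proof.
  intros Ht0 HI Hn.
  pose proof (trapping r (Phi F t0 x) ltac:(lra) Hn) as Tr.
  assert (HE : forall t, t0 <= t -> Cmod (Phi F t x - a) < r /\
     psi (Phi F t x) = (cexp (lam * RtoC t) * (cexp (- (lam * RtoC t0)) * psi (Phi F t0 x)))%C).
  { intros t Ht. destruct (Tr (t - t0) ltac:(lra)) as [A B].
    assert (J : Imax F x (t0 + (t - t0))) by (apply flow_join; auto).
    destruct (flow_split F HF x t0 (t - t0) HI J) as [_ E]. replace (t0 + (t - t0)) with t in E by ring.
    rewrite E in B. split; auto.
    destruct (decay (Phi F t0 x) (t - t0) ltac:(lra)) as [D _]; [intros s Hs; apply Tr; lra|].
    rewrite E in D. rewrite D, Cmult_assoc, <- cexp_plus. f_equal. f_equal. rewrite RtoC_minus. ring. }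
  assert (Hex : exists u, exists T, forall t, T <= t -> Cmod (Phi F t x - a) < r /\ psi (Phi F t x) = (cexp (lam * RtoC t) * u)%C).
  { eexists. exists t0. apply HE. }
  apply epsilon_spec with (i := inhabits (RtoC 0)) in Hex. fold (Psi x) in Hex. destruct Hex as [T HT].
  assert (E : Psi x = (cexp (- (lam * RtoC t0)) * psi (Phi F t0 x))%C).
  { set (s := Rmax T t0). destruct (HT s (Rmax_l _ _)) as [_ E1]. destruct (HE s (Rmax_r _ _)) as [_ E2].
    rewrite E1 in E2. pose proof (cexp_nonzero (lam * s)).
    replace (Psi x) with (/ cexp (lam * s) * (cexp (lam * s) * Psi x))%C by (field; auto). rewrite E2. field. auto. }
  intros t Ht. rewrite E. auto.
Qed.

Lemma Psi_spec x : NN x -> exists T, 0 <= T /\ forall t, T <= t ->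
  Cmod (Phi F t x - a) < r /\ psi (Phi F t x) = (cexp (lam * RtoC t) * Psi x)%C.
Proof.
  intros (T & HT & HI & Hn). exists T. split; auto. apply (Psi_eventually x T); auto.
Qed.

Lemma cexp_cancel z u v : (cexp z * u = cexp z * v)%C -> u = v.
Proof.
  intros E. pose proof (cexp_nonzero z).
  replace u with (/ cexp z * (cexp z * u))%C by (field; auto). rewrite E. field. auto.
Qed.

Lemma Psi_flow x t : NN x -> Imax F x t -> Psi (Phi F t x) = (cexp (lam * RtoC t) * Psi x)%C.
Proof.
  intros Hx Ht. destruct (Psi_spec x Hx) as [T1 [HT1 K1]].
  destruct (Psi_spec (Phi F t x) (NN_flow x t Ht Hx)) as [T2 [HT2 K2]].
  destruct (NN_forward x Hx) as (_ & _ & HI & _).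
  set (s := Rmax (Rmax T1 T2) (Rmax 0 (T2 + t))).
  assert (T1 <= s) by (eapply Rle_trans; [apply Rmax_l|apply Rmax_l]).
  assert (0 <= s) by (eapply Rle_trans; [apply Rmax_l|apply Rmax_r]).
  assert (T2 + t <= s) by (eapply Rle_trans; [apply Rmax_r|apply Rmax_r]).
  destruct (K1 s H) as [_ E1]. destruct (K2 (s - t) ltac:(lra)) as [_ E2].
  destruct (flow_split F HF x t (s - t) Ht) as [_ E]; [replace (t + (s - t)) with s by ring; auto|].
  replace (t + (s - t)) with s in E by ring. rewrite E, E1 in E2.
  apply (cexp_cancel (lam * RtoC (s - t))). rewrite <- E2, Cmult_assoc, <- cexp_plus. f_equal. f_equal.
  rewrite RtoC_minus. ring.
Qed.

Lemma Psi_injective x y : NN x -> NN y -> Psi x = Psi y -> x = y.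
Proof.
  intros Hx Hy E. destruct (Psi_spec x Hx) as [T1 [HT1 K1]]. destruct (Psi_spec y Hy) as [T2 [HT2 K2]].
  destruct (NN_forward x Hx) as (_ & _ & HIx & _). destruct (NN_forward y Hy) as (_ & _ & HIy & _).
  set (s := Rmax T1 T2). assert (T1 <= s) by apply Rmax_l. assert (T2 <= s) by apply Rmax_r.
  destruct (K1 s H) as [A1 B1]. destruct (K2 s H0) as [A2 B2].
  assert (Exy : Phi F s x = Phi F s y) by (apply lin_injective; auto; rewrite B1, B2, E; auto).
  destruct (flow_back F HF x s (HIx s ltac:(lra))) as [_ C1]. destruct (flow_back F HF y s (HIy s ltac:(lra))) as [_ C2].
  rewrite <- C1, <- C2, Exy. auto.
Qed.

Lemma Psi_nonzero x : NN x -> x <> a -> Psi x <> 0.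
Proof.
  intros Hx Hn E. apply Hn. apply Psi_injective; auto; [apply NN_a|]. rewrite E. symmetry.
  destruct (Psi_spec a NN_a) as [T [HT K]]. destruct (K T (Rle_refl _)) as [_ E1].
  rewrite Phi_equilibrium, (lin_a HL) in E1 by auto.
  apply (cexp_cancel (lam * T)). rewrite <- E1. ring.
Qed.

Lemma NN_nonzero x : NN x -> x <> a -> F x <> 0.
Proof. intros Hx Hn E. apply Hn. apply NN_equilibrium; auto. Qed.

Lemma rot_near_a s0 eps : 0 < eps -> exists d, 0 < d /\ forall z s,
  Cmod (z - a) < d -> Rabs s <= s0 -> Imax (rotf F) z s /\ Cmod (Phi (rotf F) s z - a) < eps.
Proof.
  intros He. pose proof (holo_rotf F HF) as HR. pose proof rotf_zero as Hz.
  destruct (Rle_dec 0 s0) as [Hs0|Hs0].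
  2:{ exists 1. split; [lra|]. intros z s _ Hs. pose proof (Rabs_pos s). lra. }
  destruct (dep_pos _ HR a s0) as (K1 & d1 & HK1 & Hd1 & H1); auto; [apply Imax_equilibrium; auto|].
  destruct (dep_neg _ HR a (- s0)) as (K2 & d2 & HK2 & Hd2 & H2); [apply Imax_equilibrium; auto|lra|].
  exists (Rmin (Rmin d1 d2) (eps / (K1 + K2))). split.
  { apply Rmin_glb_lt; [apply Rmin_glb_lt; auto|apply Rdiv_lt_0_compat; lra]. }
  intros z s Hzd Hs.
  assert (A := Rlt_Rmin_l Hzd). assert (B := Rlt_Rmin_r Hzd).
  assert (A1 := Rlt_Rmin_l A). assert (A2 := Rlt_Rmin_r A).
  apply Rlt_div_r in B; [|lra]. apply Rabs_le_between in Hs. pose proof (Cmod_ge_0 (z - a)).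
  destruct (Rle_dec 0 s).
  - destruct (H1 z s A1) as [C D]; [lra|]. rewrite (Phi_equilibrium _ HR a) in D by auto. split; auto. nra.
  - destruct (H2 z s A2) as [C D]; [lra|]. rewrite (Phi_equilibrium _ HR a) in D by auto. split; auto. nra.
Qed.

Lemma lin_rot_flow z s : (forall u, Rabs u <= Rabs s -> Imax (rotf F) z u /\ Cmod (Phi (rotf F) u z - a) < r) ->
  psi (Phi (rotf F) s z) = (cexp (Ci * lam * RtoC s) * psi z)%C.
Proof.
  intros H. pose proof (holo_rotf F HF) as HR.
  assert (HG : forall w, Cmod (w - a) < r -> (rotf F w * psi' w = Ci * lam * psi w)%C).
  { intros w Hw. unfold rotf. rewrite <- Cmult_assoc, (lin_eq HL w Hw). ring. }
  assert (HD : forall u, Rabs u <= Rabs s -> rder (fun u => Phi (rotf F) u z) u (rotf F (Phi (rotf F) u z)) /\ Cmod (Phi (rotf F) u z - a) < r).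
  { intros u Hu. destruct (H u Hu). split; auto. apply Phi_der; auto. }
  destruct (Rle_dec 0 s).
  - pose proof (lin_flow F a lam psi psi' r (rotf F) (Ci * lam) (fun u => Phi (rotf F) u z) 0 s HL HG ltac:(lra)) as E.
    simpl in E. rewrite Phi_0, Rminus_0_r in E by auto. apply E. intros u Hu. apply HD. rewrite !Rabs_pos_eq; lra.
  - pose proof (lin_flow F a lam psi psi' r (rotf F) (Ci * lam) (fun u => Phi (rotf F) u z) s 0 HL HG ltac:(lra)) as E.
    simpl in E. rewrite Phi_0 in E by auto. rewrite E, Cmult_assoc, <- cexp_plus.
    + replace (Ci * lam * s + Ci * lam * (0 - s)%R)%C with (RtoC 0) by (rewrite RtoC_minus; ring). rewrite cexp_0. ring.
    + intros u Hu. apply HD. rewrite !Rabs_left1; lra.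
Qed.

(** The point is carried close to [a], where the imaginary-time flow multiplies [psi] by
    [exp (i lam s)]; the commutation of the two flows brings the formula back to [y]. *)
Lemma Psi_rot_local y : NN y -> y <> a -> exists d, 0 < d /\ forall s, Rabs s < d ->
  Imax (rotf F) y s /\ NN (Phi (rotf F) s y) /\ Psi (Phi (rotf F) s y) = (cexp (Ci * lam * RtoC s) * Psi y)%C.
Proof.
  intros Hy Hn.
  destruct (rot_near_a 1 (r/8)) as [d1 [Hd1 K1]]; [lra|].
  destruct (NN_tends y Hy (Rmin d1 (r/8))) as [T [HT K]]; [apply Rmin_glb_lt; lra|].
  destruct (K T (Rle_refl _)) as [HI HTd].
  assert (HTd1 := Rlt_Rmin_l HTd). assert (HTd2 := Rlt_Rmin_r HTd).
  destruct (commute F HF y T (NN_nonzero y Hy Hn) HI) as [d2 [Hd2 K2]].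
  exists (Rmin 1 d2). split; [apply Rmin_glb_lt; lra|]. intros s Hs.
  assert (Hs1 := Rlt_Rmin_l Hs). assert (Hs2 := Rlt_Rmin_r Hs).
  destruct (K2 s Hs2) as (A1 & A2 & A3 & A4).
  destruct (K1 (Phi F T y) s HTd1 ltac:(lra)) as [B1 B2].
  split; auto. split; [exists T; rewrite A4; auto|].
  destruct (Psi_eventually (Phi (rotf F) s y) T HT A2 ltac:(rewrite A4; auto) T (Rle_refl _)) as [_ E1].
  destruct (Psi_eventually y T HT HI HTd2 T (Rle_refl _)) as [_ E2].
  rewrite A4 in E1. rewrite lin_rot_flow, E2 in E1.
  - apply (cexp_cancel (lam * T)). rewrite <- E1. ring.
  - intros u Hu. destruct (K1 (Phi F T y) u HTd1 ltac:(lra)) as [B3 B4]. split; auto. lra.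
Qed.

Lemma Psi_rot x s1 s2 : s1 <= s2 -> x <> a ->
  (forall s, s1 <= s <= s2 -> Imax (rotf F) x s /\ NN (Phi (rotf F) s x)) ->
  Psi (Phi (rotf F) s2 x) = (cexp (Ci * lam * RtoC (s2 - s1)) * Psi (Phi (rotf F) s1 x))%C.
Proof.
  intros H12 Hn H. pose proof (holo_rotf F HF) as HR.
  set (X := fun s => Psi (Phi (rotf F) s x) = (cexp (Ci * lam * RtoC (s - s1)) * Psi (Phi (rotf F) s1 x))%C).
  apply (interval_connected X s1 s2 H12).
  2:{ unfold X. replace (s1 - s1) with 0 by ring. replace (Ci * lam * 0)%C with (RtoC 0) by ring. rewrite cexp_0. ring. }
  intros t Ht. destruct (H t Ht) as [HI HN].
  assert (Hta : Phi (rotf F) t x <> a).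
  { intro E. destruct (flow_back _ HR x t HI) as [_ B]. rewrite E, Phi_equilibrium in B; auto. apply rotf_zero. }
  destruct (Psi_rot_local _ HN Hta) as [d [Hd K]]. exists d. split; auto. intros u Hu Hut.
  destruct (K (u - t) Hut) as (A & B & E).
  destruct (flow_split _ HR x t (u - t) HI) as [_ S]; [replace (t + (u - t)) with u by ring; apply H; lra|].
  replace (t + (u - t)) with u in S by ring. rewrite S in E. unfold X. rewrite E.
  replace (u - s1) with ((u - t) + (t - s1)) by ring. rewrite (RtoC_plus (u - t)), Cmult_plus_distr_l, cexp_plus, <- (Cmult_assoc (cexp (Ci * lam * RtoC (u - t)))%C (cexp _) (Psi _)).
  split; intros E'.
  - apply (cexp_cancel _ _ _ E').
  - rewrite E'. auto.
Qed.

(* If the orbit of [y] reached a large time, the imaginary-time flow near [a],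
   which commutes with the flow, would carry the image of a neighbour in the
   basin to the image of [y]. *)
Lemma edge_blowup y s0 : F y <> 0 -> ~ NN y ->
  (forall th, 0 < th <= 1 -> Imax (rotf F) y (th * s0) /\ NN (Phi (rotf F) (th * s0) y)) ->
  exists T, 0 < T /\ ~ Imax F y T.
Proof.
  intros Hy HnN H. pose proof (holo_rotf F HF) as HR.
  destruct (H 1 ltac:(lra)) as [HI1 HN1]. rewrite Rmult_1_l in HI1, HN1.
  set (q := Phi (rotf F) s0 y) in *.
  destruct (rot_near_a (Rabs s0) (r/8)) as [d1 [Hd1 K1]]; [lra|].
  destruct (NN_tends q HN1 d1 Hd1) as [T [HT K]].
  destruct (K (T + 1)) as [HIq Hq1]; [lra|].
  (* One is added because the conclusion requires a positive time. *)
  set (t1 := T + 1) in *. set (z1 := Phi F t1 q) in *.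
  exists t1. split; [unfold t1; lra|]. intro HIy. apply HnN.
  assert (Hrz : forall th, 0 <= th <= 1 -> Imax (rotf F) z1 ((th - 1) * s0) /\ Cmod (Phi (rotf F) ((th - 1) * s0) z1 - a) < r/8).
  { intros th Hth. apply K1; auto. rewrite Rabs_mult, (Rabs_left1 (th - 1)) by lra.
    pose proof (Rabs_pos s0). nra. }
  assert (Hrot0 : rotf F y <> 0).
  { unfold rotf. apply Cmult_neq_0; auto. apply Ci_nz. }
  (* Continuation in [th], starting from [th = 1], where both sides are [z1]; the two flows commute
     locally at each intermediate point. *)
  assert (HX : forall th, 0 < th <= 1 -> Phi F t1 (Phi (rotf F) (th * s0) y) = Phi (rotf F) ((th - 1) * s0) z1).
  { intros th0 Hth0.
    set (X := fun th => Phi F t1 (Phi (rotf F) (th * s0) y) = Phi (rotf F) ((th - 1) * s0) z1).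
    apply (interval_connected X th0 1); [lra| |].
    2:{ unfold X. rewrite Rmult_1_l, Rminus_diag, Rmult_0_l, Phi_0 by auto. reflexivity. }
    intros th Hth. destruct (H th ltac:(lra)) as [HI HN]. set (p := Phi (rotf F) (th * s0) y) in *.
    assert (Hp : F p <> 0).
    { intro E. apply (flow_nonzero _ HR y (th * s0) HI Hrot0). fold p. unfold rotf. rewrite E. ring. }
    destruct (NN_forward p HN) as (_ & _ & HIp & _).
    destruct (commute F HF p t1 Hp) as [d [Hd Kc]]; [apply HIp; unfold t1; lra|].
    exists (d / (Rabs s0 + 1)). pose proof (Rabs_pos s0). split; [apply Rdiv_lt_0_compat; lra|].
    intros u Hu Hut. apply Rlt_div_r in Hut; [|lra].
    assert (Hs : Rabs ((u - th) * s0) < d) by (rewrite Rabs_mult; pose proof (Rabs_pos (u - th)); nra).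
    destruct (Kc _ Hs) as (A1 & A2 & A3 & A4).
    destruct (H u ltac:(lra)) as [HIu _].
    destruct (flow_split _ HR y (th * s0) ((u - th) * s0) HI) as [_ S1]; [replace (th * s0 + (u - th) * s0) with (u * s0) by ring; auto|].
    replace (th * s0 + (u - th) * s0) with (u * s0) in S1 by ring. fold p in S1. rewrite S1 in A2, A4.
    destruct (Hrz th ltac:(lra)) as [I1 _]. destruct (Hrz u ltac:(lra)) as [I2 _].
    assert (E2 : (th - 1) * s0 + (u - th) * s0 = (u - 1) * s0) by ring.
    destruct (flow_split _ HR z1 ((th - 1) * s0) ((u - th) * s0) I1) as [I3 S2]; [rewrite E2; auto|]. rewrite E2 in S2.
    unfold X. fold p. rewrite A4, <- S2. split; intros E.
    - destruct (flow_back _ HR _ _ A3) as [_ B1]. destruct (flow_back _ HR _ _ I3) as [_ B2].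
      rewrite <- B1, <- B2, E. auto.
    - rewrite E. auto. }
  destruct (Hrz 0 ltac:(lra)) as [I0 N0]. replace ((0 - 1) * s0) with (- s0) in I0, N0 by ring.
  (* The limit [th -> 0] of the previous identity. Continuity of [Phi F t1] at [y] is available
     because the orbit of [y] is assumed to reach time [t1]. *)
  assert (E : Phi F t1 y = Phi (rotf F) (- s0) z1).
  { apply separated. intros e He.
    destruct (Phi_ccont F HF y t1 HIy (e/2)) as [d2 [Hd2 K2]]; [lra|].
    destruct (Phi_pcont _ HR y 0 (Imax_0 _ HR y) d2 Hd2) as [d3 [Hd3 K3]]. rewrite (Phi_0 _ HR) in K3.
    destruct (Phi_pcont _ HR z1 (- s0) I0 (e/2)) as [d4 [Hd4 K4]]; [lra|].
    pose proof (Rabs_pos s0). set (th := Rmin 1 (Rmin d3 d4 / (2 * (Rabs s0 + 1)))).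
    assert (Hm : 0 < Rmin d3 d4) by (apply Rmin_glb_lt; auto).
    assert (Hth : 0 < th <= 1).
    { split; [apply Rmin_glb_lt; [lra|]; apply Rdiv_lt_0_compat; lra|apply Rmin_l]. }
    assert (Hths : Rabs (th * s0) < Rmin d3 d4).
    { rewrite Rabs_mult, Rabs_pos_eq by lra.
      assert (th <= Rmin d3 d4 / (2 * (Rabs s0 + 1))) by apply Rmin_r. apply Rle_div_r in H1; [|lra]. nra. }
    assert (A : Cmod (Phi F t1 (Phi (rotf F) (th * s0) y) - Phi F t1 y) < e/2).
    { apply K2. unfold cid. apply K3. rewrite Cmod_RtoC_minus, Rminus_0_r. apply (Rlt_Rmin_l Hths). }
    assert (B : Cmod (Phi (rotf F) ((th - 1) * s0) z1 - Phi (rotf F) (- s0) z1) < e/2).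
    { apply K4. rewrite Cmod_RtoC_minus. replace ((th - 1) * s0 - - s0) with (th * s0) by ring.
      apply (Rlt_Rmin_r Hths). }
    rewrite (HX th Hth) in A. rewrite Cmod_sym in A.
    pose proof (Cmod_tri (Phi F t1 y) (Phi (rotf F) ((th - 1) * s0) z1) (Phi (rotf F) (- s0) z1)). lra. }
  exists t1. split; [unfold t1; lra|]. split; auto. rewrite E. auto.
Qed.
End Basin.

Arguments NN : clear implicits.
Arguments Psi : clear implicits.

(** * Logarithmic increments and winding numbers *)

(** The principal logarithm, meant for the right half-plane, where the arctangent gives the
    argument. *)
Definition clog (u : C) : C := (ln (Cmod u), atan (Im u / Re u)).

Lemma cexp_clog u : 0 < Re u -> cexp (clog u) = u.
Proof.
  intros Hu.
  assert (Hm : 0 < Cmod u) by (apply Cmod_gt_0; intros ->; unfold Re in Hu; simpl in Hu; lra).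
  unfold cexp, clog. simpl. rewrite exp_ln by auto.
  assert (E : sqrt (1 + (Im u / Re u)²) = Cmod u / Re u).
  { apply sqrt_lem_1.
    - unfold Rsqr. nra.
    - left. apply Rdiv_lt_0_compat; auto.
    - replace (Cmod u / Re u * (Cmod u / Re u)) with (Cmod u * Cmod u / (Re u * Re u)) by (field; lra).
      rewrite Cmod_sqr. unfold Rsqr. field. lra. }
  rewrite cos_atan, sin_atan, E. destruct u as [x y]. unfold Re, Im in *. simpl in *.
  f_equal; field; lra.
Qed.

Lemma ccont_clog u : 0 < Re u -> ccont clog u.
Proof.
  intros Hu.
  assert (Hm : 0 < Cmod u) by (apply Cmod_gt_0; intros ->; unfold Re in Hu; simpl in Hu; lra).
  assert (Rcomp : forall (f : C -> R) (h : R -> R), ccont (fun z => RtoC (f z)) u -> continuity_pt h (f u) ->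
    ccont (fun z => RtoC (h (f z))) u).
  { intros f h Hf Hh. apply (cont_comp cid RtoC f (fun s => RtoC (h s))); auto.
    apply pcont_real, continuity_pt_filterlim. auto. }
  apply cont_pair.
  - apply Rcomp.
    + intros eps He. exists eps. split; auto. intros y Hy. rewrite Cmod_RtoC_minus. unfold cid in Hy.
      apply Rabs_def1. pose proof (Cmod_rev y u). lra. pose proof (Cmod_rev u y). rewrite Cmod_sym in H. lra.
    + apply derivable_continuous_pt. exists (/ Cmod u). apply derivable_pt_lim_ln. auto.
  - apply Rcomp.
    + apply (cont_ext cid (fun z => RtoC (Im z) / RtoC (Re z))%C) with (r := Re u); auto.
      * intros y Hy. unfold cid in Hy. pose proof (Re_le_Cmod (y - u)). rewrite Re_minus in H.
        assert (Rabs (Re y - Re u) < Re u) by lra. apply Rabs_def2 in H0. symmetry. apply RtoC_div. lra.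
      * apply cont_div; [apply (cont_Im cid cid), cont_self|apply (cont_Re cid cid), cont_self|].
        intro E. apply RtoC_inj in E. lra.
    + apply derivable_continuous_pt, derivable_pt_atan.
Qed.

(** At most three divisions by [i] bring a nonzero number into the right half-plane, and each
    amounts to the logarithm [i pi / 2]. *)
Lemma cexp_surjective (c : C) : c <> 0 -> exists w, cexp w = c.
Proof.
  intros Hc.
  assert (Hi : cexp (Ci * RtoC (PI/2)) = Ci).
  { unfold cexp. replace (Re (Ci * RtoC (PI/2))) with 0 by (unfold Re, Ci, Cmult, RtoC; simpl; ring).
    replace (Im (Ci * RtoC (PI/2))) with (PI/2) by (unfold Im, Ci, Cmult, RtoC; simpl; ring).
    rewrite exp_0, cos_PI2, sin_PI2. unfold Ci. f_equal; ring. }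
  assert (Hrot : forall c, (exists w, cexp w = (c / Ci)%C) -> exists w, cexp w = c).
  { intros d [w Hw]. exists (w + Ci * RtoC (PI/2))%C. rewrite cexp_plus, Hi, Hw. field. apply Ci_nz. }
  assert (Hdiv : forall x y, ((x, y) / Ci)%C = (y, (- x)%R)).
  { intros x y. replace ((x, y) : C) with (Ci * (y, (- x)%R))%C by (unfold Ci, Cmult; simpl; f_equal; ring). field. apply Ci_nz. }
  assert (Hpos : forall c, 0 < Re c -> exists w, cexp w = c) by (intros d Hd; exists (clog d); apply cexp_clog; auto).
  destruct c as [x y].
  destruct (Rlt_dec 0 x); [apply Hpos; auto|].
  apply Hrot. rewrite Hdiv. destruct (Rlt_dec 0 y); [apply Hpos; auto|].
  apply Hrot. rewrite Hdiv. destruct (Rlt_dec 0 (- x)); [apply Hpos; auto|].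
  apply Hrot. rewrite Hdiv. apply Hpos. simpl.
  assert (x = 0) by lra. destruct (Req_dec y 0); [|lra]. subst. exfalso. apply Hc. reflexivity.
Qed.

Lemma cexp_1_small d : cexp d = 1 -> Cmod d < 1 -> d = 0.
Proof.
  intros E Hd.
  assert (Hre : Re d = 0).
  { pose proof (Cmod_cexp d) as K. rewrite E, Cmod_1 in K. rewrite <- exp_0 in K. apply exp_inv in K. auto. }
  assert (Him : Rabs (Im d) < 1) by (pose proof (Im_le_Cmod d); lra).
  unfold cexp in E. rewrite Hre, exp_0 in E. unfold RtoC in E. injection E as E1 E2.
  rewrite Rmult_1_l in E1, E2. apply Rabs_def2 in Him. pose proof PI2_3_2.
  assert (Im d = 0).
  { destruct (Rtotal_order (Im d) 0) as [Hlt|[?|Hgt]]; auto; exfalso.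
    - pose proof (sin_lt_0_var (Im d)). lra.
    - pose proof (sin_gt_0 (Im d)). lra. }
  rewrite (C_split d), Hre, H0. ring.
Qed.

Definition lift (f : R -> C) (a b : R) (L : R -> C) : Prop :=
  forall t, Rmin a b <= t <= Rmax a b -> pcont L t /\ cexp (L t) = f t.

(** The increment of a continuous logarithm of [f] from [a] to [b]; by [lift_unique] it does not
    depend on the lift that [epsilon] selects. *)
Definition Del (f : R -> C) (a b : R) : C :=
  epsilon (inhabits (RtoC 0)) (fun D => exists L, lift f a b L /\ D = (L b - L a)%C).

Definition nonvanishing (f : R -> C) (a b : R) : Prop :=
  forall t, Rmin a b <= t <= Rmax a b -> pcont f t /\ f t <> 0.

(** The difference of two lifts takes values in the periods of [cexp], which are isolated, so it is
    locally constant. *)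
Lemma lift_unique f a b L M : lift f a b L -> lift f a b M -> (L b - L a = M b - M a)%C.
Proof.
  assert (H : forall a b, a <= b -> lift f a b L -> lift f a b M -> (L b - L a = M b - M a)%C).
  { clear a b. intros a b Hab HL HM. unfold lift in *. rewrite Rmin_left, Rmax_right in * by lra.
    assert (E : (L b - M b = L a - M a)%C).
    { apply (interval_connected (fun t => (L t - M t = L a - M a)%C) a b Hab); auto.
      intros t Ht. destruct (HL t Ht) as [C1 E1]. destruct (HM t Ht) as [C2 E2].
      destruct (cont_minus RtoC _ _ _ C1 C2 1 Rlt_0_1) as [d [Hd K]].
      exists d. split; auto. intros u Hu Hut. specialize (K u). rewrite Cmod_RtoC_minus in K. specialize (K Hut).
      assert (Z : (L u - M u - (L t - M t) = 0)%C).
      { apply cexp_1_small; auto.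
        replace (L u - M u - (L t - M t))%C with ((L u + (- M u)) + (- L t + M t))%C by ring.
        assert (N : forall s, a <= s <= b -> cexp (L s + - M s) = 1).
        { intros s Hs. destruct (HL s Hs) as [_ F1]. destruct (HM s Hs) as [_ F2].
          replace (L s) with ((L s + - M s) + M s)%C in F1 by ring. rewrite cexp_plus, <- F2 in F1.
          pose proof (cexp_nonzero (M s)).
          replace (cexp (L s + - M s)) with (cexp (L s + - M s) * cexp (M s) / cexp (M s))%C by (field; auto).
          rewrite F1. field. auto. }
        rewrite cexp_plus, (N u Hu).
        replace (- L t + M t)%C with (- (L t + - M t))%C by ring.
        assert (cexp (- (L t + - M t)) * cexp (L t + - M t) = 1)%C.
        { rewrite <- cexp_plus. replace (- (L t + - M t) + (L t + - M t))%C with (RtoC 0) by ring. apply cexp_0. }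
        rewrite (N t Ht) in H. rewrite Cmult_1_l, <- H. ring. }
      split; intros W.
      - rewrite <- W. symmetry. apply Ceq_minus. exact Z.
      - rewrite <- W. apply Ceq_minus. auto. }
    replace (L b) with ((L b - M b) + M b)%C by ring. rewrite E. ring. }
  intros HL HM. destruct (Rle_dec a b); [apply H; auto|].
  assert (HL' : lift f b a L) by (unfold lift in *; rewrite Rmin_comm, Rmax_comm; auto).
  assert (HM' : lift f b a M) by (unfold lift in *; rewrite Rmin_comm, Rmax_comm; auto).
  assert (E := H b a ltac:(lra) HL' HM').
  replace (L b - L a)%C with (- (L a - L b))%C by ring. rewrite E. ring.
Qed.

Lemma pcont_clamp a b t : pcont (fun s => RtoC (clamp a b s)) t.
Proof.
  intros eps He. exists eps. split; auto. intros s Hs. rewrite Cmod_RtoC_minus in *.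
  eapply Rle_lt_trans; [apply clamp_lip|auto].
Qed.

Lemma pcont_glue (f g : R -> C) v t : pcont f t -> pcont g t -> f v = g v ->
  pcont (fun s => if Rle_dec s v then f s else g s) t.
Proof.
  intros Hf Hg E eps He.
  destruct (Hf eps He) as [d1 [Hd1 K1]]. destruct (Hg eps He) as [d2 [Hd2 K2]].
  destruct (Req_dec t v) as [->|Htv].
  - exists (Rmin d1 d2). split; [apply Rmin_glb_lt; auto|]. intros s Hs.
    destruct (Rle_dec v v); [|lra].
    destruct (Rle_dec s v); [apply K1; apply (Rlt_Rmin_l Hs)|].
    rewrite E. apply K2; apply (Rlt_Rmin_r Hs).
  - exists (Rmin (Rmin d1 d2) (Rabs (t - v))).
    split; [apply Rmin_glb_lt; [apply Rmin_glb_lt; auto|apply Rabs_pos_lt; lra]|]. intros s Hs.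
    assert (Hs1 := Rlt_Rmin_l Hs). assert (Hs2 := Rlt_Rmin_r Hs).
    rewrite Cmod_RtoC_minus in Hs2.
    destruct (Rle_dec s v), (Rle_dec t v).
    + apply K1; apply (Rlt_Rmin_l Hs1).
    + exfalso. rewrite (Rabs_pos_eq (t - v)), Rabs_left1 in Hs2 by lra. lra.
    + exfalso. rewrite (Rabs_left1 (t - v)), Rabs_pos_eq in Hs2 by lra. lra.
    + apply K2; apply (Rlt_Rmin_r Hs1).
Qed.

(** Near each parameter the quotient of [f] by its value there lies in the right half-plane, where
    [clog] is a lift. Adjacent lifts are glued after adding a constant. *)
Lemma lift_exists f a b : nonvanishing f a b -> exists L, lift f a b L.
Proof.
  intros H. unfold nonvanishing in H. set (m := Rmin a b) in *. set (n := Rmax a b) in *.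
  assert (Hmn : m <= n) by (apply Rle_trans with a; [apply Rmin_l|apply Rmax_l]).
  set (g := fun t => f (clamp m n t)).
  assert (Hg : forall t, pcont g t /\ g t <> 0).
  { intros t. destruct (H (clamp m n t) (clamp_in m n t Hmn)) as [C1 N1]. split; auto.
    apply (cont_comp RtoC RtoC (clamp m n) f); auto. apply pcont_clamp. }
  assert (Hex : exists L, (forall t, pcont L t) /\ forall t, m <= t <= n -> cexp (L t) = g t).
  { apply (cousin (fun u v => exists L, (forall t, pcont L t) /\ forall t, u <= t <= v -> cexp (L t) = g t) m n); auto.
    - intros u v w _ Huv Hvw _ [L [CL EL]] [M [CM EM]].
      exists (fun s => if Rle_dec s v then L s else (M s + (L v - M v))%C). split.
      + intros t. apply (pcont_glue L (fun s => M s + (L v - M v))%C v); auto; [|ring].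
        apply cont_plus; auto. apply cont_const.
      + intros t Ht. destruct (Rle_dec t v); [apply EL; lra|].
        rewrite cexp_plus, EM by lra.
        assert (E1 : (cexp (L v - M v) * cexp (M v) = cexp (L v))%C) by (rewrite <- cexp_plus; f_equal; ring).
        rewrite EM, EL in E1 by lra. destruct (Hg v) as [_ Nv].
        replace (cexp (L v - M v)) with (cexp (L v - M v) * g v / g v)%C by (field; auto). rewrite E1. field. auto.
    - intros t Ht. destruct (Hg t) as [Ct Nt].
      destruct (Ct (Cmod (g t))) as [d [Hd K]]; [apply Cmod_gt_0; auto|].
      destruct (cexp_surjective (g t) Nt) as [w Hw].
      exists d. split; auto. intros u v Hu Hut Htv Hv Huv.
      assert (Hpos : forall s, u <= s <= v -> 0 < Re (g s / g t)%C).
      { intros s Hs. specialize (K s). rewrite Cmod_RtoC_minus in K. specialize (K ltac:(apply Rabs_def1; lra)).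
        replace (g s / g t)%C with (1 + (g s - g t) / g t)%C by (field; auto).
        assert (Hlt : Cmod ((g s - g t) / g t) < 1).
        { rewrite Cmod_div by auto. apply Rlt_div_l; [apply Cmod_gt_0; auto|lra]. }
        pose proof (Re_le_Cmod ((g s - g t) / g t)). assert (Rabs (Re ((g s - g t) / g t)%C) < 1) by lra. apply Rabs_def2 in H1.
        unfold Re in *. simpl in *. lra. }
      exists (fun s => w + clog (g (clamp u v s) / g t))%C. split.
      + intros s. apply cont_plus; [apply cont_const|].
        apply (cont_comp RtoC cid (fun s => g (clamp u v s) / g t)%C clog).
        * apply cont_div; [|apply cont_const|auto]. apply (cont_comp RtoC RtoC (clamp u v) g); [apply pcont_clamp|apply Hg].
        * apply ccont_clog, Hpos, clamp_in. lra.
      + intros s Hs. rewrite clamp_id by auto. rewrite cexp_plus, cexp_clog, Hw by auto. field. auto. }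
  destruct Hex as [L [CL EL]]. exists L. intros t Ht. fold m in Ht. fold n in Ht. split; auto. rewrite EL by auto. unfold g. rewrite clamp_id; auto.
Qed.

Lemma Del_eq f a b L : lift f a b L -> Del f a b = (L b - L a)%C.
Proof.
  intros H. assert (Hex : exists D, exists L, lift f a b L /\ D = (L b - L a)%C) by eauto.
  apply epsilon_spec with (i := inhabits (RtoC 0)) in Hex. fold (Del f a b) in Hex.
  destruct Hex as [M [HM ->]]. apply (lift_unique f); auto.
Qed.

Lemma Del_lift f m n : nonvanishing f m n -> exists L, lift f m n L /\
  forall a b, Rmin m n <= a <= Rmax m n -> Rmin m n <= b <= Rmax m n -> Del f a b = (L b - L a)%C.
Proof.
  intros H. destruct (lift_exists f m n H) as [L HL]. exists L. split; auto.
  intros a b Ha Hb. apply Del_eq. intros t Ht. apply HL. unfold Rmin, Rmax in *.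
  repeat destruct Rle_dec; lra.
Qed.

Lemma Rmin_Rmax_in a b : Rmin a b <= a <= Rmax a b /\ Rmin a b <= b <= Rmax a b.
Proof. repeat split; auto using Rmin_l, Rmin_r, Rmax_l, Rmax_r. Qed.

Lemma Del_swap f a b : nonvanishing f a b -> Del f b a = (- Del f a b)%C.
Proof.
  intros H. destruct (Del_lift f a b H) as [L [_ K]]. destruct (Rmin_Rmax_in a b).
  rewrite !K by auto. ring.
Qed.

Lemma Del_chasles f m n a b c : nonvanishing f m n -> m <= a <= n -> m <= b <= n -> m <= c <= n ->
  Del f a c = (Del f a b + Del f b c)%C.
Proof.
  intros H Ha Hb Hc. destruct (Del_lift f m n H) as [L [_ K]].
  minmax K. rewrite !K by auto. ring.
Qed.

Lemma Del_ext f g a b : (forall t, Rmin a b <= t <= Rmax a b -> f t = g t) -> Del f a b = Del g a b.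
Proof.
  intros H. unfold Del. f_equal. apply functional_extensionality. intros D. apply propositional_extensionality.
  unfold lift. split; intros [L [HL E]]; exists L; split; auto; intros t Ht; destruct (HL t Ht); split; auto.
  - rewrite <- H; auto.
  - rewrite H; auto.
Qed.

Lemma Del_mult f g a b : nonvanishing f a b -> nonvanishing g a b ->
  Del (fun t => f t * g t)%C a b = (Del f a b + Del g a b)%C.
Proof.
  intros Hf Hg. destruct (lift_exists f a b Hf) as [L HL]. destruct (lift_exists g a b Hg) as [M HM].
  rewrite (Del_eq f a b L), (Del_eq g a b M), (Del_eq _ a b (fun t => L t + M t)%C); auto; [ring|].
  intros t Ht. destruct (HL t Ht), (HM t Ht). split; [apply cont_plus; auto|]. rewrite cexp_plus. congruence.
Qed.

Lemma Del_half f a b (c : C) : c <> 0 ->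
  (forall t, Rmin a b <= t <= Rmax a b -> pcont f t /\ 0 < Re (f t / c)%C) ->
  Del f a b = (clog (f b / c) - clog (f a / c))%C.
Proof.
  intros Hc H. destruct (cexp_surjective c Hc) as [w Hw].
  rewrite (Del_eq f a b (fun t => w + clog (f t / c))%C); [ring|].
  intros t Ht. destruct (H t Ht) as [C1 P1]. split.
  - apply cont_plus; [apply cont_const|]. apply (cont_comp RtoC cid (fun t => f t / c)%C clog).
    + apply cont_div; auto. apply cont_const.
    + apply ccont_clog; auto.
  - rewrite cexp_plus, cexp_clog, Hw by auto. field. auto.
Qed.

(** The increment of the logarithm counterclockwise around a rectangle, that is [2 i pi] times the
    winding number of the image around 0. *)
Definition dRect (f : C -> C) (x1 x2 y1 y2 : R) : C :=
  (Del (fun s => f (s, y1)) x1 x2 + Del (fun t => f (x2, t)) y1 y2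
   - Del (fun s => f (s, y2)) x1 x2 - Del (fun t => f (x1, t)) y1 y2)%C.

Lemma nonvanishing_hor f x1 x2 y1 y2 y :
  (forall z, in_box x1 x2 y1 y2 z -> ccont f z /\ f z <> 0) -> x1 <= x2 -> y1 <= y <= y2 ->
  nonvanishing (fun s => f (s, y)) x1 x2.
Proof.
  intros H Hx Hy s Hs. minmax Hs.
  destruct (H (s, y)) as [C1 N1]; [split; auto|]. split; auto. apply pcont_hor; auto.
Qed.

Lemma nonvanishing_ver f x1 x2 y1 y2 x :
  (forall z, in_box x1 x2 y1 y2 z -> ccont f z /\ f z <> 0) -> y1 <= y2 -> x1 <= x <= x2 ->
  nonvanishing (fun t => f (x, t)) y1 y2.
Proof.
  intros H Hx Hy s Hs. minmax Hs.
  destruct (H (x, s)) as [C1 N1]; [split; auto|]. split; auto. apply pcont_ver; auto.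
Qed.

(** Increments add up when rectangles are put together, and on a small rectangle a single branch of
    the logarithm serves all four sides. The two directions are subdivided by two nested uses of
    [cousin]. *)
Lemma dRect_zero f x1 x2 y1 y2 : x1 <= x2 -> y1 <= y2 ->
  (forall z, in_box x1 x2 y1 y2 z -> ccont f z /\ f z <> 0) -> dRect f x1 x2 y1 y2 = 0.
Proof.
  intros Hx Hy H.
  apply (cousin (fun c d => dRect f x1 x2 c d = 0) y1 y2 Hy).
  - intros u v w Hu Huv Hvw Hw E1 E2. unfold dRect in *.
    rewrite (Del_chasles (fun t => f (x2, t)) y1 y2 u v w), (Del_chasles (fun t => f (x1, t)) y1 y2 u v w); try lra;
    try (eapply nonvanishing_ver; eauto; lra).
    match goal with |- ?L = _ => transitivity (0 + 0)%C; [rewrite <- E1 at 1; rewrite <- E2; ring|ring] end.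
  - intros y Hyy.
    destruct (cousin (fun a b => exists e, 0 < e /\ forall c d, y1 <= c -> c <= y -> y <= d -> d <= y2 -> d - c < e ->
       dRect f a b c d = 0) x1 x2 Hx) as [e [He K]]; eauto.
    + intros u v w Hu Huv Hvw Hw [e1 [He1 K1]] [e2 [He2 K2]].
      exists (Rmin e1 e2). split; [apply Rmin_glb_lt; auto|]. intros c d Hc Hcy Hyd Hd Hcd.
      specialize (K1 c d Hc Hcy Hyd Hd (Rlt_Rmin_l Hcd)).
      specialize (K2 c d Hc Hcy Hyd Hd (Rlt_Rmin_r Hcd)).
      unfold dRect in *.
      rewrite (Del_chasles (fun s => f (s, c)) x1 x2 u v w), (Del_chasles (fun s => f (s, d)) x1 x2 u v w); try lra;
      try (eapply nonvanishing_hor; eauto; lra).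
      match goal with |- ?L = _ => transitivity (0 + 0)%C; [rewrite <- K1 at 1; rewrite <- K2; ring|ring] end.
    + intros x Hxx. destruct (H (x, y)) as [C1 N1]; [split; auto|].
      destruct (C1 (Cmod (f (x, y)))) as [d0 [Hd0 K0]]; [apply Cmod_gt_0; auto|].
      exists (d0/2). split; [lra|]. intros u v Hu Hux Hxv Hv Huv.
      exists (d0/2). split; [lra|]. intros c d Hc Hcy Hyd Hd Hcd.
      assert (HP : forall s t, u <= s <= v -> c <= t <= d -> 0 < Re (f (s, t) / f (x, y))%C).
      { intros s t Hs Ht. specialize (K0 (s, t)). unfold cid in K0.
        specialize (K0 ltac:(apply Cmod_near; simpl; apply Rabs_def1; lra)).
        replace (f (s, t) / f (x, y))%C with (1 + (f (s, t) - f (x, y)) / f (x, y))%C by (field; auto).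
        assert (Hlt : Cmod ((f (s, t) - f (x, y)) / f (x, y)) < 1).
        { rewrite Cmod_div by auto. apply Rlt_div_l; [apply Cmod_gt_0; auto|lra]. }
        pose proof (Re_le_Cmod ((f (s, t) - f (x, y)) / f (x, y))) as R1.
        assert (R2 : Rabs (Re ((f (s, t) - f (x, y)) / f (x, y))%C) < 1) by lra. apply Rabs_def2 in R2.
        unfold Re in *. simpl in *. lra. }
      unfold dRect. rewrite !(Del_half _ _ _ (f (x, y))); auto; try ring.
      all: rewrite Rmin_left, Rmax_right by lra; intros t Ht; split; try (apply HP; lra).
      all: try (apply pcont_hor; apply H; split; simpl; lra).
      all: apply pcont_ver; apply H; split; simpl; lra.
Qed.

(* A loop is a list of oriented pieces [(gamma, a, b)]. *)
Definition piece : Type := (R -> C) * R * R.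

Definition on_piece (P : piece) (z : C) : Prop :=
  let '(g, a, b) := P in exists t, Rmin a b <= t <= Rmax a b /\ g t = z.

Definition on_chain (L : list piece) (z : C) : Prop := exists P, In P L /\ on_piece P z.

Definition piece_ok (P : piece) : Prop :=
  let '(g, a, b) := P in forall t, Rmin a b <= t <= Rmax a b -> pcont g t.

Fixpoint joins (z : C) (L : list piece) (z' : C) : Prop :=
  match L with
  | nil => z = z'
  | (g, a, b) :: L => g a = z /\ joins (g b) L z'
  end.

(** For a closed chain this is [2 i pi] times the winding number around [p]. *)
Fixpoint wind (L : list piece) (p : C) : C :=
  match L with
  | nil => RtoC 0
  | (g, a, b) :: L => (Del (fun t => g t - p) a b + wind L p)%C
  end.

(** This is [dRect_zero] for the function [g t - p s] on the rectangle of the pairs [(s, t)]. *)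
Lemma Del_homotopy (g p : R -> C) a b s0 s1 : s0 <= s1 ->
  (forall t, Rmin a b <= t <= Rmax a b -> pcont g t) ->
  (forall s, s0 <= s <= s1 -> pcont p s) ->
  (forall s t, s0 <= s <= s1 -> Rmin a b <= t <= Rmax a b -> g t <> p s) ->
  (Del (fun t => g t - p s1) a b - Del (fun t => g t - p s0) a b
   = Del (fun s => g b - p s) s0 s1 - Del (fun s => g a - p s) s0 s1)%C.
Proof.
  intros Hs Hg Hp Hn.
  assert (Hmain : forall a b, a <= b -> (forall t, a <= t <= b -> pcont g t) ->
    (forall s t, s0 <= s <= s1 -> a <= t <= b -> g t <> p s) ->
    (Del (fun t => g t - p s1) a b - Del (fun t => g t - p s0) a b
     = Del (fun s => g b - p s) s0 s1 - Del (fun s => g a - p s) s0 s1)%C).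
  { clear a b Hg Hn. intros a b Hab Hg Hn.
    assert (E : dRect (fun z => g (Im z) - p (Re z))%C s0 s1 a b = 0).
    { apply dRect_zero; auto. intros z [Hz1 Hz2]. split; [|apply Cminus_eq_contra; auto].
      apply cont_minus.
      - apply (cont_comp cid RtoC Im g); auto. apply (cont_Im cid cid), cont_self.
      - apply (cont_comp cid RtoC Re p); auto. apply (cont_Re cid cid), cont_self. }
    unfold dRect in E. simpl in E.
    match goal with |- ?L = ?R => transitivity (L - 0)%C; [ring|]; rewrite <- E; ring end. }
  destruct (Rle_dec a b).
  - rewrite Rmin_left, Rmax_right in * by lra. apply Hmain; auto.
  - assert (N : forall s, s0 <= s <= s1 -> nonvanishing (fun t => g t - p s)%C b a).
    { intros s Hss t Ht. rewrite Rmin_comm, Rmax_comm in Ht. split; [apply cont_minus; auto; apply cont_const|].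
      apply Cminus_eq_contra; auto. }
    rewrite !(Del_swap _ b a) by (apply N; lra).
    rewrite Rmin_right, Rmax_left in * by lra.
    pose proof (Hmain b a ltac:(lra) Hg Hn) as E.
    match goal with |- ?L = ?R => transitivity (- (- L))%C; [ring|] end.
    match goal with |- (- ?X)%C = ?R => transitivity (- (Del (fun s => g a - p s) s0 s1 - Del (fun s => g b - p s) s0 s1))%C; [|ring] end.
    rewrite <- E. ring.
Qed.

(** The boundary terms of the homotopies of consecutive pieces cancel at the common points, and only
    those of the two ends of the chain remain. *)
Lemma wind_path (L : list piece) z z' (p : R -> C) s0 s1 : s0 <= s1 ->
  List.Forall piece_ok L -> joins z L z' -> (forall s, s0 <= s <= s1 -> pcont p s) ->
  (forall s, s0 <= s <= s1 -> ~ on_chain L (p s)) ->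
  (wind L (p s1) - wind L (p s0) = Del (fun s => z' - p s) s0 s1 - Del (fun s => z - p s) s0 s1)%C.
Proof.
  intros Hs. revert z. induction L as [|[[g a] b] L IH]; intros z Hok HJ Hp Hn.
  - simpl in *. subst. ring.
  - simpl in *. destruct HJ as [<- HJ]. inversion Hok; subst.
    specialize (IH (g b) H2 HJ Hp).
    assert (E1 : (Del (fun t => g t - p s1) a b - Del (fun t => g t - p s0) a b
      = Del (fun s => g b - p s) s0 s1 - Del (fun s => g a - p s) s0 s1)%C).
    { apply Del_homotopy; auto. intros s t Hss Ht E. apply (Hn s Hss).
      exists (g, a, b). split; [left; auto|]. exists t. auto. }
    assert (E2 : (wind L (p s1) - wind L (p s0) = Del (fun s => z' - p s) s0 s1 - Del (fun s => g b - p s) s0 s1)%C).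
    { apply IH. intros s Hss [P [HP HPz]]. apply (Hn s Hss). exists P. split; auto. right; auto. }
    transitivity ((Del (fun t => g t - p s1) a b - Del (fun t => g t - p s0) a b) + (wind L (p s1) - wind L (p s0)))%C; [ring|].
    rewrite E1, E2. ring.
Qed.

Lemma wind_move (L : list piece) z (p : R -> C) s0 s1 : s0 <= s1 ->
  List.Forall piece_ok L -> joins z L z -> (forall s, s0 <= s <= s1 -> pcont p s) ->
  (forall s, s0 <= s <= s1 -> ~ on_chain L (p s)) -> wind L (p s1) = wind L (p s0).
Proof.
  intros. apply Ceq_minus. rewrite (wind_path L z z p s0 s1); auto. ring.
Qed.

Lemma wind_move_between L z (p : R -> C) u v : List.Forall piece_ok L -> joins z L z ->
  (forall s, Rmin u v <= s <= Rmax u v -> pcont p s /\ ~ on_chain L (p s)) -> wind L (p u) = wind L (p v).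
Proof.
  intros Hok HJ H. destruct (Rle_dec u v).
  - rewrite Rmin_left, Rmax_right in H by lra. symmetry. apply (wind_move L z p u v); auto; apply H.
  - rewrite Rmin_right, Rmax_left in H by lra. apply (wind_move L z p v u); auto; try apply H. lra.
Qed.

Lemma piece_bounded P : piece_ok P -> exists M, 0 < M /\ forall z, on_piece P z -> Cmod z <= M.
Proof.
  destruct P as [[g a] b]. intros H. destruct (path_bounded g (Rmin a b) (Rmax a b) H) as [M [HM K]].
  exists M. split; auto. intros z [t [Ht <-]]. auto.
Qed.

Lemma chain_bounded L : List.Forall piece_ok L -> exists M, 0 < M /\ forall z, on_chain L z -> Cmod z <= M.
Proof.
  induction L as [|P L IH]; intros H.
  - exists 1. split; [lra|]. intros z [P [[] _]].
  - inversion H; subst. destruct (IH H3) as [M1 [HM1 K1]]. destruct (piece_bounded P H2) as [M2 [HM2 K2]].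
    exists (M1 + M2). split; [lra|]. intros z [Q [[<-|HQ] Hz]].
    + specialize (K2 z Hz). lra.
    + assert (on_chain L z) by (exists Q; auto). specialize (K1 z H0). lra.
Qed.

(** From a point beyond the bound [M] the whole chain is seen within a half-plane, so one branch of
    the logarithm serves all pieces. *)
Lemma wind_far_joins L z z' p M : List.Forall piece_ok L -> joins z L z' -> 0 < M ->
  (forall w, on_chain L w -> Cmod w <= M) -> M < Cmod p ->
  wind L p = (clog ((z' - p) / (- p)) - clog ((z - p) / (- p)))%C.
Proof.
  intros Hok HJ HM Hb Hp.
  assert (Np : (- p)%C <> 0) by (apply Cmod_gt_0; rewrite Cmod_opp; lra).
  assert (Np2 : p <> 0) by (apply Cmod_gt_0; lra).
  revert z Hok HJ Hb. induction L as [|[[g a] b] L IH]; intros z Hok HJ Hb.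
  - simpl in *. subst. ring.
  - simpl in *. destruct HJ as [<- HJ]. inversion Hok; subst.
    rewrite (IH (g b)); auto.
    + rewrite (Del_half _ a b (- p)%C); auto; [ring|]. intros t Ht. split; [apply cont_minus; [apply H1; auto|apply cont_const]|].
      replace ((g t - p) / (- p))%C with (1 + g t / (- p))%C by (field; auto).
      assert (Hgt : Cmod (g t) <= M).
      { apply Hb. exists (g, a, b). split; [left; auto|]. exists t. auto. }
      assert (Hlt : Cmod (g t / (- p)) < 1).
      { rewrite Cmod_div, Cmod_opp by auto. apply Rlt_div_l; lra. }
      pose proof (Re_le_Cmod (g t / (- p))) as R1. assert (R2 : Rabs (Re (g t / (- p))%C) < 1) by lra. apply Rabs_def2 in R2.
      unfold Re in *. simpl in *. lra.
    + intros w [P [HP Hw]]. apply Hb. exists P. split; auto. right; auto.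
Qed.

Lemma wind_far L z p M : List.Forall piece_ok L -> joins z L z -> 0 < M ->
  (forall w, on_chain L w -> Cmod w <= M) -> M < Cmod p -> wind L p = 0.
Proof. intros. rewrite (wind_far_joins L z z p M); auto. ring. Qed.

Lemma wind_escape L z (p : R -> C) T : List.Forall piece_ok L -> joins z L z ->
  (forall s, 0 <= s < T -> pcont p s /\ ~ on_chain L (p s)) ->
  (forall M, exists s, 0 <= s < T /\ M < Cmod (p s)) -> wind L (p 0) = 0.
Proof.
  intros Hok HJ Hp Hinf. destruct (chain_bounded L Hok) as [M [HM Hb]].
  destruct (Hinf M) as [s [Hs HMs]]. rewrite <- (wind_far L z (p s) M); auto.
  symmetry. apply (wind_move L z p 0 s); auto; try lra; intros u Hu; apply Hp; lra.
Qed.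

Lemma Cmult_div_cancel (e X : C) : e <> 0 -> (e * X / e)%C = X.
Proof. intros. field. auto. Qed.

Lemma Del_side (e : C) c m t0 a b : e <> 0 -> 0 < c ->
  Del (fun t => e * (c, m * (t - t0))%R)%C a b = (clog (c, m * (b - t0))%R - clog (c, m * (a - t0))%R)%C.
Proof.
  intros He Hc.
  assert (Hp : forall t, pcont (fun t => (c, m * (t - t0)) : C) t).
  { intros t. apply cont_pair; [apply cont_const|].
    apply (cont_ext RtoC (fun t => RtoC m * (RtoC t - RtoC t0))%C) with (r := 1); [lra| |].
    - intros. rewrite RtoC_mult, RtoC_minus. auto.
    - apply cont_mult; [apply cont_const|]. apply cont_minus; [apply cont_self|apply cont_const]. }
  rewrite (Del_half _ a b e); auto.
  - rewrite !Cmult_div_cancel; auto.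
  - intros t Ht. split; [apply cont_mult; [apply cont_const|auto]|].
    rewrite Cmult_div_cancel; auto.
Qed.

Lemma Im_Del_side c m t0 a b :
  Im (clog (c, m * (b - t0))%R - clog (c, m * (a - t0))%R)%C = atan (m * (b - t0) / c) - atan (m * (a - t0) / c).
Proof. reflexivity. Qed.

(** The centre sees each side under a positive angle. A factor 1, -1, [i] or [-i] turns each side
    into the right half-plane, where the angle is a difference of arctangents. *)
Lemma dRect_center eta kap : 0 < eta -> 0 < kap ->
  dRect (fun u => u - (0, kap / 2)%R)%C (- eta) eta 0 kap <> 0.
Proof.
  intros He Hk E. apply (f_equal Im) in E. unfold dRect in E.
  assert (N : forall c : C, Cmod c = 1 -> c <> 0) by (intros c H; apply Cmod_gt_0; lra).
  rewrite (Del_ext (fun s => (s, 0)%R - (0, kap / 2)%R)%C (fun s => (- Ci) * (kap/2, 1 * (s - 0))%R)%C) in E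
    by (intros; unfold Ci, Cminus, Cplus, Cmult, Copp; simpl; f_equal; field).
  rewrite (Del_ext (fun t => (eta, t)%R - (0, kap / 2)%R)%C (fun t => 1 * (eta, 1 * (t - kap/2))%R)%C) in E
    by (intros; unfold RtoC, Cminus, Cplus, Cmult, Copp; simpl; f_equal; field).
  rewrite (Del_ext (fun s => (s, kap)%R - (0, kap / 2)%R)%C (fun s => Ci * (kap/2, (-1) * (s - 0))%R)%C) in E
    by (intros; unfold Ci, Cminus, Cplus, Cmult, Copp; simpl; f_equal; field).
  rewrite (Del_ext (fun t => (- eta, t)%R - (0, kap / 2)%R)%C (fun t => (-1) * (eta, (-1) * (t - kap/2))%R)%C) in E
    by (intros; unfold RtoC, Cminus, Cplus, Cmult, Copp; simpl; f_equal; field).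
  rewrite !Del_side in E; try lra; try (apply N; rewrite ?Cmod_opp, ?Cmod_Ci, ?Cmod_R, ?Rabs_Ropp, ?Rabs_R1; auto).
  2:{ rewrite Rabs_left; lra. }
  match type of E with Im (?a + ?b - ?c - ?d)%C = _ =>
    replace (Im (a + b - c - d)%C) with (Im a + Im b - Im c - Im d) in E by (unfold Im, Cminus, Cplus, Copp; simpl; ring) end.
  rewrite !Im_Del_side in E. change (Im 0) with 0 in E.
  assert (P1 : 0 < 1 * (eta - 0) / (kap/2)) by (apply Rdiv_lt_0_compat; lra).
  assert (P2 : 0 < 1 * (kap - kap/2) / eta) by (apply Rdiv_lt_0_compat; lra).
  replace (1 * (- eta - 0) / (kap/2)) with (- (1 * (eta - 0) / (kap/2))) in E by (field; lra).
  replace (-1 * (eta - 0) / (kap/2)) with (- (1 * (eta - 0) / (kap/2))) in E by (field; lra).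
  replace (-1 * (- eta - 0) / (kap/2)) with (1 * (eta - 0) / (kap/2)) in E by (field; lra).
  replace (1 * (0 - kap/2) / eta) with (- (1 * (kap - kap/2) / eta)) in E by (field; lra).
  replace (-1 * (0 - kap/2) / eta) with (1 * (kap - kap/2) / eta) in E by (field; lra).
  replace (-1 * (kap - kap/2) / eta) with (- (1 * (kap - kap/2) / eta)) in E by (field; lra).
  rewrite !atan_opp in E.
  pose proof (atan_increasing _ _ P1). pose proof (atan_increasing _ _ P2). rewrite atan_0 in *. lra.
Qed.

Lemma dRect_mult f g x1 x2 y1 y2 : x1 <= x2 -> y1 <= y2 ->
  (forall z, on_frame x1 x2 y1 y2 z -> ccont f z /\ f z <> 0) ->
  (forall z, on_frame x1 x2 y1 y2 z -> ccont g z /\ g z <> 0) ->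
  dRect (fun z => f z * g z)%C x1 x2 y1 y2 = (dRect f x1 x2 y1 y2 + dRect g x1 x2 y1 y2)%C.
Proof.
  intros Hx Hy Hf Hg. unfold dRect.
  assert (Nh : forall h, (forall z, on_frame x1 x2 y1 y2 z -> ccont h z /\ h z <> 0) ->
    forall y, y = y1 \/ y = y2 -> nonvanishing (fun s => h (s, y)) x1 x2).
  { intros h Hh y Hyy s Hs. minmax Hs.
    destruct (Hh (s, y)) as [C1 N1]; [split; [split; simpl|]; simpl; try tauto; destruct Hyy; lra|].
    split; auto. apply pcont_hor; auto. }
  assert (Nv : forall h, (forall z, on_frame x1 x2 y1 y2 z -> ccont h z /\ h z <> 0) ->
    forall x, x = x1 \/ x = x2 -> nonvanishing (fun t => h (x, t)) y1 y2).
  { intros h Hh x Hxx s Hs. minmax Hs.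
    destruct (Hh (x, s)) as [C1 N1]; [split; [split; simpl|]; simpl; try tauto; destruct Hxx; lra|].
    split; auto. apply pcont_ver; auto. }
  rewrite (Del_mult (fun s => f (s, y1)) (fun s => g (s, y1))) by auto.
  rewrite (Del_mult (fun s => f (s, y2)) (fun s => g (s, y2))) by auto.
  rewrite (Del_mult (fun t => f (x1, t)) (fun t => g (x1, t))) by auto.
  rewrite (Del_mult (fun t => f (x2, t)) (fun t => g (x2, t))) by auto. ring.
Qed.

Lemma dRect_ext f g x1 x2 y1 y2 : x1 <= x2 -> y1 <= y2 ->
  (forall z, on_frame x1 x2 y1 y2 z -> f z = g z) -> dRect f x1 x2 y1 y2 = dRect g x1 x2 y1 y2.
Proof.
  intros Hx Hy H. unfold dRect.
  rewrite (Del_ext (fun s => f (s, y1)) (fun s => g (s, y1))).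
  rewrite (Del_ext (fun s => f (s, y2)) (fun s => g (s, y2))).
  rewrite (Del_ext (fun t => f (x1, t)) (fun t => g (x1, t))).
  rewrite (Del_ext (fun t => f (x2, t)) (fun t => g (x2, t))). auto.
  all: rewrite Rmin_left, Rmax_right by lra; intros t Ht; apply H; split; [split; simpl; lra|simpl; tauto].
Qed.

(* Rerouting the loop around one side of a box leaves the winding number of one
   of the two points unchanged, and changes that of the other one. *)
Lemma wind_jump (G G' : C -> C) eta kap z rest : 0 < eta -> 0 < kap ->
  (forall u, in_box (- eta) eta (- kap) kap u -> cder G u (G' u) /\ G' u <> 0) ->
  (forall u v, in_box (- eta) eta (- kap) kap u -> in_box (- eta) eta (- kap) kap v -> G u = G v -> u = v) ->
  List.Forall piece_ok rest -> joins z (((fun t => G (t, 0)), - eta, eta) :: rest) z ->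
  (forall s, - (kap/2) <= s <= kap/2 -> ~ on_chain rest (G (0, s))) ->
  wind (((fun t => G (t, 0)), - eta, eta) :: rest) (G (0, kap/2)) <>
  wind (((fun t => G (t, 0)), - eta, eta) :: rest) (G (0, - (kap/2))).
Proof.
  intros He Hk HG Hinj Hok HJ Hav.
  assert (HGc : forall u, in_box (- eta) eta (- kap) kap u -> ccont G u).
  { intros u Hu. eapply der_cont. apply HG; auto. }
  set (left_ := ((fun s => G (- eta, s)), 0, kap) : piece).
  set (top_ := ((fun t => G (t, kap)), - eta, eta) : piece).
  set (right_ := ((fun s => G (eta, s)), kap, 0) : piece).
  (* The detour follows the other three sides of the upper half of the box, so the vertical segment
     between the two points no longer meets the loop. *)
  set (Lup := left_ :: top_ :: right_ :: rest).
  assert (HokU : List.Forall piece_ok Lup).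
  { repeat constructor; auto; intros t Ht; simpl in Ht.
    - minmax Ht. apply pcont_ver, HGc. split; simpl; lra.
    - minmax Ht. apply pcont_hor, HGc. split; simpl; lra.
    - minmax Ht. apply pcont_ver, HGc. split; simpl; lra. }
  assert (HJU : joins z Lup z).
  { simpl in HJ. destruct HJ as [J1 J2]. simpl. repeat split; auto. }
  assert (EU : wind Lup (G (0, kap/2)) = wind Lup (G (0, - (kap/2)))).
  { apply (wind_move Lup z (fun s => G (0, s)) (- (kap/2)) (kap/2)); auto; try lra.
    - intros s Hs. apply pcont_ver, HGc. split; simpl; lra.
    - intros s Hs [P [HP HPz]].
      assert (B0 : in_box (- eta) eta (- kap) kap (0, s)) by (split; simpl; lra).
      destruct HP as [<-|[<-|[<-|HP]]].
      + destruct HPz as [t [Ht E]]. minmax Ht.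
        apply Hinj in E; auto; [injection E; intros; lra|split; simpl; lra].
      + destruct HPz as [t [Ht E]]. minmax Ht.
        apply Hinj in E; auto; [injection E; intros; lra|split; simpl; lra].
      + destruct HPz as [t [Ht E]]. minmax Ht.
        apply Hinj in E; auto; [injection E; intros; lra|split; simpl; lra].
      + apply (Hav s Hs). exists P. auto. }
  (* The loop and its detour differ by the boundary of the upper half of the box, which contains the
     first of the two points and not the second. *)
  assert (Hdiff : forall s, s = kap/2 \/ s = - (kap/2) ->
    wind (((fun t => G (t, 0)), - eta, eta) :: rest) (G (0, s)) =
    (wind Lup (G (0, s)) + dRect (fun u => G u - G (0, s)) (- eta) eta 0 kap)%C).
  { intros s Hs. simpl. unfold dRect.
    rewrite (Del_swap (fun t => G (eta, t) - G (0, s))%C 0 kap).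
    - ring.
    - intros t Ht. minmax Ht. split.
      + apply cont_minus; [|apply cont_const]. apply pcont_ver, HGc. split; simpl; lra.
      + apply Cminus_eq_contra. intro E. apply Hinj in E; [injection E; intros; lra| |]; split; simpl; destruct Hs; lra. }
  rewrite !Hdiff, EU by auto. intro E.
  assert (E0 : dRect (fun u => G u - G (0, - (kap/2))%R)%C (- eta) eta 0 kap = 0).
  { apply dRect_zero; try lra. intros u [Hu1 Hu2]. split.
    - apply cont_minus; [|apply cont_const]. apply HGc. split; lra.
    - apply Cminus_eq_contra. intro E0. apply Hinj in E0; [subst u; simpl in Hu2; lra| |]; split; simpl; lra. }
  rewrite E0 in E.
  assert (E1 : dRect (fun u => G u - G (0, kap/2)%R)%C (- eta) eta 0 kap = 0).
  { set (w := wind Lup _) in E. set (x := dRect _ _ _ _ _) in E |- *.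
    transitivity (w + x - w)%C; [ring|]. rewrite E. ring. }
  clear E E0.
  set (u0 := (0, kap/2) : C) in *.
  assert (B0 : in_box (- eta) eta (- kap) kap u0) by (split; simpl; lra).
  (* The divided difference has no zero in the box, since [G] is injective with nonzero derivative.
     Thus [G u - G u0] has the same increment around the box as [u - u0]. *)
  set (k := fun u => if Ceq_dec u u0 then G' u0 else ((G u - G u0) / (u - u0))%C).
  assert (Hkc : forall u, in_box (- eta) eta 0 kap u -> ccont k u /\ k u <> 0).
  { intros u [Hu1 Hu2]. assert (Bu : in_box (- eta) eta (- kap) kap u) by (split; lra).
    destruct (Ceq_dec u u0) as [->|Hn].
    - destruct (HG u0 B0) as [Hd Hd0]. split.
      + intros eps Heps. destruct (Hd (eps/2)) as [d [Hdd K]]; [lra|]. exists d. split; auto.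
        intros y Hy. unfold k, cid in *. destruct (Ceq_dec u0 u0); [|congruence].
        destruct (Ceq_dec y u0) as [->|Hyu]; [rewrite Cmod_self; auto|].
        specialize (K y Hy). apply Cminus_eq_contra in Hyu.
        replace ((G y - G u0) / (y - u0) - G' u0)%C with ((G y - G u0 - (y - u0) * G' u0) / (y - u0))%C by (field; auto).
        rewrite Cmod_div by auto. apply Cmod_gt_0 in Hyu. apply Rlt_div_l; auto. nra.
      + unfold k. destruct (Ceq_dec u0 u0); [auto|congruence].
    - pose proof (proj1 (Cmod_gt_0 _) (Cminus_eq_contra _ _ Hn)) as Hpos. split.
      + apply (cont_ext cid (fun u => (G u - G u0) / (u - u0))%C) with (r := Cmod (u - u0)); auto.
        * intros y Hy. unfold k, cid in *. destruct (Ceq_dec y u0) as [->|]; auto. rewrite Cmod_sym in Hy. lra.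
        * apply cont_div; [apply cont_minus; [apply HGc; auto|apply cont_const]|apply ccont_minus_const|].
          apply Cminus_eq_contra; auto.
      + unfold k. destruct (Ceq_dec u u0) as [|]; [congruence|].
        intro E. apply Cmult_neq_0 in E; auto.
        * apply Cminus_eq_contra. intro E2. apply Hn, Hinj; auto.
        * intro E2. apply C1_nz. rewrite <- (Cinv_l (u - u0)) by (apply Cmod_gt_0; auto). rewrite E2. ring. }
  apply (dRect_center eta kap He Hk). fold u0.
  assert (EM : dRect (fun u => G u - G u0)%C (- eta) eta 0 kap =
     (dRect (fun u => u - u0)%C (- eta) eta 0 kap + dRect k (- eta) eta 0 kap)%C).
  { assert (Hfr : forall u, on_frame (- eta) eta 0 kap u -> u <> u0).
    { intros u [_ Hu] ->. simpl in Hu. lra. }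
    rewrite <- dRect_mult; try lra.
    - apply dRect_ext; try lra. intros u Hu. unfold k. destruct (Ceq_dec u u0) as [->|Hn]; [exfalso; apply (Hfr u0); auto|].
      field. apply Cminus_eq_contra; auto.
    - intros u Hu. split; [apply ccont_minus_const|apply Cminus_eq_contra; auto].
    - intros u [Hu _]. apply Hkc; auto. }
  rewrite E1, (dRect_zero k) in EM; auto; try lra.
  rewrite EM. ring.
Qed.

(** * Local structure of the boundary of the basin *)

(** What the geometric part needs to know about the basin, detached from the linearizing coordinate.
    The field [at_edge] is [edge_blowup]. *)
Record attracting (F : C -> C) (a : C) (N : C -> Prop) : Prop := {
  at_zero : F a = 0;
  at_near : exists ra, 0 < ra /\ forall z, Cmod (z - a) < ra -> N z;
  at_open : forall x, N x -> exists d, 0 < d /\ forall y, Cmod (y - x) < d -> N y;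
  at_flow : forall x t, Imax F x t -> (N (Phi F t x) <-> N x);
  at_tends : forall x, N x -> forall eps, 0 < eps -> exists T, 0 <= T /\
    forall t, T <= t -> Imax F x t /\ Cmod (Phi F t x - a) < eps;
  at_stable : forall eps, 0 < eps -> exists d, 0 < d /\ forall z, Cmod (z - a) < d -> forall t, 0 <= t ->
    Imax F z t /\ Cmod (Phi F t z - a) < eps;
  at_eq : forall x, N x -> F x = 0 -> x = a;
  at_edge : forall y s0, F y <> 0 -> ~ N y ->
    (forall th, 0 < th <= 1 -> Imax (rotf F) y (th * s0) /\ N (Phi (rotf F) (th * s0) y)) ->
    exists T, 0 < T /\ ~ Imax F y T }.

Arguments at_zero {F a N}.
Arguments at_near {F a N}.
Arguments at_open {F a N}.
Arguments at_flow {F a N}.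
Arguments at_tends {F a N}.
Arguments at_stable {F a N}.
Arguments at_eq {F a N}.
Arguments at_edge {F a N}.

Lemma NN_attracting {F a lam psi psi' r} : holo F -> F a = 0 -> linearization F a lam psi psi' r ->
  Re lam < 0 -> attracting F a (NN F a r).
Proof.
  intros HF Ha HL Hre. pose proof (lin_pos HL). constructor; auto.
  - exists (r/8). split; [lra|]. apply NN_near; auto.
  - intros y. apply NN_open; auto.
  - intros y t. eapply NN_flow_iff; eauto.
  - intros y. eapply NN_tends; eauto.
  - intros eps He. exists (Rmin eps r / 8). split; [apply Rdiv_lt_0_compat; [apply Rmin_glb_lt; auto|lra]|].
    intros z Hz t Ht. destruct (trapping HF HL Hre (Rmin eps r) z) with (t := t); auto.
    + split; [apply Rmin_glb_lt; auto|apply Rmin_r].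
    + split; auto. eapply Rlt_le_trans; [eassumption|apply Rmin_l].
  - intros y. eapply NN_equilibrium; eauto.
  - intros y s0. eapply edge_blowup; eauto.
Qed.

Lemma Rabs_sign sg u : sg = 1 \/ sg = -1 -> Rabs (sg * u) = Rabs u.
Proof. intros [-> | ->]; rewrite Rabs_mult, ?Rabs_R1, ?(Rabs_left (-1)) by lra; ring. Qed.

Lemma closed_min (X : R -> Prop) a b t0 : a <= t0 <= b -> X t0 ->
  (forall t, a <= t <= b -> ~ X t -> exists d, 0 < d /\ forall u, a <= u <= b -> Rabs (u - t) < d -> ~ X u) ->
  exists t, a <= t <= b /\ X t /\ forall u, a <= u < t -> ~ X u.
Proof.
  intros Ht0 HX Hc.
  destruct (classic (X a)) as [Ha|Ha].
  { exists a. split; [lra|]. split; auto. intros; lra. }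
  destruct (completeness (fun v => a <= v <= b /\ forall u, a <= u <= v -> ~ X u)) as [c [H1 H2]].
  - exists b. intros v [Hv _]. lra.
  - exists a. split; [lra|]. intros u Hu. replace u with a by lra. auto.
  - assert (Hac : a <= c) by (apply H1; split; [lra|]; intros u Hu; replace u with a by lra; auto).
    assert (Hct : c <= t0).
    { apply H2. intros v [Hv K]. apply Rnot_lt_le. intro. apply (K t0); auto. lra. }
    assert (Hlt : forall u, a <= u < c -> ~ X u).
    { intros u Hu HXu. assert (c <= u); [|lra]. apply H2. intros v [Hv K].
      apply Rnot_lt_le. intro. apply (K u); auto. lra. }
    exists c. split; [lra|]. split; auto. apply NNPP. intro HnX.
    destruct (Hc c ltac:(lra) HnX) as [d [Hd K]].
    assert (Hct' : c <> t0) by (intros ->; auto).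
    set (v := Rmin t0 (c + d/2)).
    assert (c < v) by (apply Rmin_glb_lt; lra).
    assert (v <= t0) by apply Rmin_l. assert (v <= c + d/2) by apply Rmin_r.
    assert (v <= c); [|lra]. apply H1. split; [lra|]. intros u Hu.
    destruct (Rlt_dec u c); [apply Hlt; lra|]. apply K; [lra|]. apply Rabs_def1; lra.
Qed.

Lemma closed_max (X : R -> Prop) a b t0 : a <= t0 <= b -> X t0 ->
  (forall t, a <= t <= b -> ~ X t -> exists d, 0 < d /\ forall u, a <= u <= b -> Rabs (u - t) < d -> ~ X u) ->
  exists t, a <= t <= b /\ X t /\ forall u, t < u <= b -> ~ X u.
Proof.
  intros Ht0 HX Hc.
  destruct (closed_min (fun t => X (- t)) (- b) (- a) (- t0)) as [t [Ht [HXt Hmin]]].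
  - lra.
  - rewrite Ropp_involutive. auto.
  - intros t Ht Hn. destruct (Hc (- t) ltac:(lra) Hn) as [d [Hd K]]. exists d. split; auto.
    intros u Hu Hut. apply K; [lra|]. replace (- u - - t) with (- (u - t)) by ring. rewrite Rabs_Ropp. auto.
  - exists (- t). split; [lra|]. split; auto. intros u Hu HXu. apply (Hmin (- u)); [lra|].
    rewrite Ropp_involutive. auto.
Qed.

Lemma curve_avoid (g : R -> C) a b y : (forall t, a <= t <= b -> pcont g t) ->
  (forall t, a <= t <= b -> g t <> y) -> exists d, 0 < d /\ forall t, a <= t <= b -> d <= Cmod (g t - y).
Proof.
  intros Hg Hn. apply (compact_interval (fun d t => d <= Cmod (g t - y))).
  - intros; lra.
  - intros t Ht. destruct (cont_nonzero RtoC (fun t => g t - y)%C t) as [d [Hd K]].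
    + apply cont_minus; auto. apply cont_const.
    + apply Cminus_eq_contra; auto.
    + pose proof (proj1 (Cmod_gt_0 _) (Cminus_eq_contra _ _ (Hn t Ht))).
      exists (Rmin d (Cmod (g t - y) / 2)). split; [apply Rmin_glb_lt; lra|]. intros u _ Hu.
      specialize (K u). rewrite Cmod_RtoC_minus in K. specialize (K (Rlt_Rmin_l Hu)).
      eapply Rle_trans; [apply Rmin_r|]. lra.
Qed.

Lemma periodic_times F x t : holo F -> Imax F x t -> Phi F t x = x ->
  forall n, Imax F x (INR n * t) /\ Phi F (INR n * t) x = x.
Proof.
  intros HF HI E. induction n as [|n [I1 I2]].
  - rewrite Rmult_0_l. split; [apply Imax_0; auto|apply Phi_0; auto].
  - rewrite S_INR. replace ((INR n + 1) * t) with (INR n * t + t) by ring.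
    assert (J : Imax F x (INR n * t + t)) by (apply flow_join; auto; rewrite I2; auto).
    split; auto. destruct (flow_split F HF x (INR n * t) t I1 J) as [_ S]. rewrite <- S, I2. auto.
Qed.

Lemma time_injective F x s t : holo F -> (forall u, 0 < u -> Imax F x u -> Phi F u x <> x) ->
  Imax F x s -> Imax F x t -> Phi F s x = Phi F t x -> s = t.
Proof.
  intros HF Hper.
  assert (H : forall s t, Imax F x s -> Imax F x t -> Phi F s x = Phi F t x -> ~ s < t).
  { clear s t. intros s t Hs Ht E Hlt. destruct (flow_back F HF x s Hs) as [A B]. rewrite E in A, B.
    assert (J : Imax F x (t + - s)) by (apply flow_join; auto).
    apply (Hper (t + - s)); auto; [lra|]. destruct (flow_split F HF x t (- s) Ht J) as [_ S]. congruence. }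
  intros Hs Ht E. destruct (Rtotal_order s t) as [Hlt|[?|Hgt]]; auto; exfalso;
  [apply (H s t)|apply (H t s)]; auto.
Qed.

Section Periodic.
Context {F : C -> C} (HF : holo F) {a : C} {N : C -> Prop} (HA : attracting F a N).

Lemma basin_not_periodic x t : N x -> F x <> 0 -> 0 < t -> Imax F x t -> Phi F t x <> x.
Proof.
  intros HN Hx Ht HI E.
  assert (Hn := periodic_times F x t HF HI E).
  apply Hx. replace x with a; [apply (at_zero HA)|].
  symmetry. apply separated. intros e He.
  destruct (at_tends HA x HN e He) as [T [HT K]].
  destruct (INR_unbounded (T / t)) as [n Hn'].
  destruct (Hn n) as [_ E2]. destruct (K (INR n * t)) as [_ K2].
  - apply Rlt_div_l in Hn'; lra.
  - rewrite E2 in K2. lra.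
Qed.

Lemma basin_time_injective x s t : N x -> F x <> 0 -> Imax F x s -> Imax F x t ->
  Phi F s x = Phi F t x -> s = t.
Proof.
  intros HN Hx. apply time_injective; auto. intros u Hu HI. apply basin_not_periodic; auto.
Qed.

Lemma wind_blowup L z y T : List.Forall piece_ok L -> joins z L z -> 0 < T -> ~ Imax F y T ->
  (forall t, 0 <= t -> Imax F y t -> ~ on_chain L (Phi F t y)) -> wind L y = 0.
Proof.
  intros Hok HJ HT Hn Hav.
  destruct (first_exit F HF y T HT Hn) as [T' [HT' [HI HIn]]].
  rewrite <- (Phi_0 F HF y) at 1.
  apply (wind_escape L z (fun s => Phi F s y) T'); auto.
  - intros s Hs. split; [apply Phi_pcont; auto|apply Hav; auto; lra].
  - intros M. destruct (blowup F HF y T' HI HIn (proj1 HT') M) as [t1 [Ht1 K]].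
    exists t1. split; auto. apply K. lra.
Qed.
End Periodic.

Section FlowBox.
Context {F : C -> C} (HF : holo F) {a : C} {N : C -> Prop} (HA : attracting F a N)
  {x : C} {g : C -> C} {rho : R} (Hg : chart F x g rho) (sg : R) (Hsg : sg = 1 \/ sg = -1).

(** A quarter, so that times up to [2 * b] together with heights up to [b] stay within
    [3 * b < rho]. *)
Let b : R := rho / 4.

(* Flow box coordinates: [t] is the time, [s] the height; [sg] chooses one of
   the two orientations of the heights. *)
Definition Pt (t s : R) : C := g (t, sg * s).

Lemma b_pos : 0 < b.
Proof. unfold b. pose proof (chart_pos Hg). lra. Qed.

Lemma Cmod_pt t s : Cmod (t, sg * s) <= Rabs t + Rabs s.
Proof.
  eapply Rle_trans; [apply Cmod_le_ReIm|]. simpl. rewrite Rabs_sign by auto. lra.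
Qed.

Lemma pt_bound t s : -2*b <= t <= 2*b -> -b <= s <= b -> Cmod (t, sg * s) <= 3 * b /\ 3 * b < rho.
Proof.
  intros Ht Hs. pose proof b_pos. split; [|unfold b in *; lra].
  eapply Rle_trans; [apply Cmod_pt|]. assert (Rabs t <= 2 * b) by (apply Rabs_le; lra).
  assert (Rabs s <= b) by (apply Rabs_le; lra). lra.
Qed.

Lemma Pt_flow t s u : -b <= t <= b -> -b <= s <= b -> -b <= u <= b ->
  Imax F (Pt t s) u /\ Phi F u (Pt t s) = Pt (t + u) s.
Proof.
  intros Ht Hs Hu. pose proof b_pos.
  destruct (chart_flow F HF x g rho (t, sg * s) u Hg) as [A B].
  - pose proof (Cmod_pt t s). assert (Rabs t <= b) by (apply Rabs_le; lra).
    assert (Rabs s <= b) by (apply Rabs_le; lra). assert (Rabs u <= b) by (apply Rabs_le; lra). unfold b in *. lra.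
  - split; auto. unfold Pt. rewrite B. f_equal. unfold Cplus, RtoC. simpl. f_equal. ring.
Qed.

Lemma Pt_rot t s u : -b <= t <= b -> -b <= s <= b -> -2*b < u < 2*b ->
  Imax (rotf F) (Pt t s) (sg * u) /\ Phi (rotf F) (sg * u) (Pt t s) = Pt t (s + u).
Proof.
  intros Ht Hs Hu. pose proof b_pos.
  destruct (chart_flow_rot F HF x g rho (t, sg * s) (sg * u) Hg) as [A B].
  - pose proof (Cmod_pt t s). assert (Rabs t <= b) by (apply Rabs_le; lra).
    assert (Rabs s <= b) by (apply Rabs_le; lra). assert (Rabs (sg * u) < 2 * b).
    { rewrite Rabs_sign by auto. apply Rabs_def1; lra. }
    unfold b in *. lra.
  - split; auto. unfold Pt. rewrite B. f_equal. unfold Cplus, RtoC, Cmult, Ci. simpl. f_equal; ring.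
Qed.

Lemma Pt_inj t s t' s' : -2*b <= t <= 2*b -> -b <= s <= b -> -2*b <= t' <= 2*b -> -b <= s' <= b ->
  Pt t s = Pt t' s' -> t = t' /\ s = s'.
Proof.
  intros Ht Hs Ht' Hs' E. pose proof (pt_bound t s Ht Hs). pose proof (pt_bound t' s' Ht' Hs').
  apply (chart_inj Hg) in E; try lra. injection E as E1 E2. split; auto.
  destruct Hsg as [-> | ->]; lra.
Qed.

Lemma Pt_ccont t s : -2*b <= t <= 2*b -> -b <= s <= b -> ccont g (t, sg * s).
Proof.
  intros Ht Hs. pose proof (pt_bound t s Ht Hs). eapply der_cont. apply (chart_der Hg). lra.
Qed.

Lemma Pt_pcont_s t s : -2*b <= t <= 2*b -> -b <= s <= b -> pcont (fun s => Pt t s) s.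
Proof.
  intros Ht Hs. apply (cont_comp RtoC cid (fun s => (t, sg * s)) g); [|apply Pt_ccont; auto].
  apply cont_pair; [apply cont_const|].
  apply (cont_ext RtoC (fun s => RtoC sg * RtoC s)%C) with (r := 1); [lra| |].
  - intros. rewrite RtoC_mult. auto.
  - apply cont_mult; [apply cont_const|apply cont_self].
Qed.

Lemma Pt_nonzero s : -b <= s <= b -> F (Pt 0 s) <> 0.
Proof.
  intros Hs E. pose proof b_pos. destruct (Pt_flow 0 s b) as [A B]; try lra.
  rewrite Phi_equilibrium in B by auto. apply Pt_inj in B; lra.
Qed.

(** The trace of the basin on the section at time 0; by [O_t] the other sections of the box have the
    same trace. *)
Definition O (s : R) : Prop := N (Pt 0 s).

Lemma O_t t s : -b <= t <= b -> -b <= s <= b -> (N (Pt t s) <-> O s).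
Proof.
  intros Ht Hs. pose proof b_pos. destruct (Pt_flow 0 s t) as [A B]; try lra. rewrite Rplus_0_l in B. rewrite <- B.
  apply (at_flow HA); auto.
Qed.

Lemma O_open s : -b <= s <= b -> O s -> exists d, 0 < d /\ forall u, Rabs (u - s) < d -> O u.
Proof.
  intros Hs HO. pose proof b_pos. destruct (at_open HA _ HO) as [d [Hd K]].
  destruct (Pt_pcont_s 0 s ltac:(lra) Hs d Hd) as [d' [Hd' K']]. exists d'. split; auto.
  intros u Hu. apply K, K'. rewrite Cmod_RtoC_minus. auto.
Qed.

(** The interval from [al] to [be] is the connected component of the trace that contains [o]. *)
Definition comp (o al be : R) : Prop := al < o < be /\ ~ O al /\ ~ O be /\ forall s, al < s < be -> O s.

Lemma comp_exists l u o : -b <= l -> u <= b -> l < o < u -> ~ O l -> ~ O u -> O o ->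
  exists al be, comp o al be /\ l <= al /\ be <= u.
Proof.
  intros Hl Hu Ho Nl Nu HO.
  assert (Hc : forall p q, -b <= p -> q <= b -> forall t, p <= t <= q -> ~ ~ O t ->
    exists d, 0 < d /\ forall u, p <= u <= q -> Rabs (u - t) < d -> ~ ~ O u).
  { intros p q Hp Hq t Ht Hn. destruct (O_open t) as [d [Hd K]]; [lra|tauto|]. exists d. split; auto. }
  destruct (closed_max (fun s => ~ O s) l o l) as [al [Hal [Nal Kal]]]; try lra; auto.
  { apply Hc; lra. }
  destruct (closed_min (fun s => ~ O s) o u u) as [be [Hbe [Nbe Kbe]]]; try lra; auto.
  { apply Hc; lra. }
  exists al, be. assert (al <> o) by (intros ->; auto). assert (be <> o) by (intros ->; auto).
  split; [|lra]. split; [lra|]. split; auto. split; auto. intros s Hs.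
  destruct (Rle_dec s o); apply NNPP; [apply Kal|apply Kbe]; lra.
Qed.

Lemma comp_unique o al be o' al' be' : comp o al be -> comp o' al' be' -> al < o' < be -> al = al' /\ be = be'.
Proof.
  intros (H1 & H2 & H3 & H4) (K1 & K2 & K3 & K4) Ho.
  split.
  - destruct (Rtotal_order al al') as [Hlt|[?|Hgt]]; auto; exfalso.
    + apply K2, H4. lra.
    + apply H2, K4. lra.
  - destruct (Rtotal_order be be') as [Hlt|[?|Hgt]]; auto; exfalso.
    + apply H3, K4. lra.
    + apply K3, H4. lra.
Qed.

Lemma comp_in o al be s : comp o al be -> al < s < be -> comp s al be.
Proof. intros (H1 & H2 & H3 & H4) Hs. repeat split; auto; lra. Qed.

Lemma edge_T o al be c : -b <= al -> be <= b -> comp o al be -> c = al \/ c = be -> exists T, 0 < T /\ ~ Imax F (Pt 0 c) T.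
Proof.
  intros Hal Hbe (H1 & H2 & H3 & H4) Hc. pose proof b_pos.
  (* Half the length of the component and the direction into it: the imaginary-time segment from the
     end point then runs inside the component. *)
  set (w := (be - al) / 2). set (e := if Req_dec_T c al then 1 else -1).
  apply (at_edge HA (Pt 0 c) (sg * (e * w))).
  - apply Pt_nonzero. destruct Hc; lra.
  - destruct Hc as [-> | ->]; auto.
  - intros th Hth. replace (th * (sg * (e * w))) with (sg * (th * (e * w))) by ring.
    assert (Hw : 0 < th * w <= w) by (unfold w; nra).
    assert (Hs : -2*b < th * (e * w) < 2*b /\ al < c + th * (e * w) < be).
    { unfold e. destruct (Req_dec_T c al) as [->|]; [|destruct Hc; [congruence|subst c]];
      unfold w in *; lra. }
    destruct (Pt_rot 0 c (th * (e * w))) as [A B]; try lra.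
    rewrite B. split; auto. apply H4. lra.
Qed.

(** As the flows commute, a passage from one height to another carries the neighbouring heights
    along by the same shift in exactly the same time. This rigidity makes return maps
    translations. *)
Lemma shift_return o o' t : -b <= o <= b -> -b <= o' <= b -> Imax F (Pt 0 o) t -> Phi F t (Pt 0 o) = Pt 0 o' ->
  exists d, 0 < d /\ forall e, Rabs e < d -> Imax F (Pt 0 (o + e)) t /\ Phi F t (Pt 0 (o + e)) = Pt 0 (o' + e).
Proof.
  intros Ho Ho' HI E. pose proof b_pos.
  destruct (commute F HF (Pt 0 o) t (Pt_nonzero o Ho) HI) as [d [Hd K]].
  exists (Rmin d b). split; [apply Rmin_glb_lt; auto|]. intros e He.
  assert (He1 := Rlt_Rmin_l He). assert (He2 := Rlt_Rmin_r He).
  apply Rabs_def2 in He2.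
  destruct (K (sg * e)) as (A1 & A2 & A3 & A4).
  { rewrite Rabs_sign; auto. }
  destruct (Pt_rot 0 o e) as [_ B1]; try lra. destruct (Pt_rot 0 o' e) as [_ B2]; try lra.
  rewrite E, B1, B2 in A4. rewrite B1 in A2. auto.
Qed.

(** * Returns to a transversal section *)

Definition ret (l u o t : R) : Prop :=
  0 < t /\ Imax F (Pt 0 o) t /\ exists s, l <= s <= u /\ Phi F t (Pt 0 o) = Pt 0 s.

Definition nonret (l u o : R) : Prop := forall t, ~ ret l u o t.

(** Up to time [b] the orbit is still in the box, at a time coordinate other than 0. Returns are
    therefore uniformly spaced from one another, which also lets them be counted. *)
Lemma ret_gap l u o t : -b <= l -> u <= b -> -b <= o <= b -> ret l u o t -> b < t.
Proof.
  intros Hl Hu Ho (Ht & HI & s & Hs & E). pose proof b_pos. apply Rnot_le_lt. intro Hle.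
  destruct (Pt_flow 0 o t) as [_ B]; try lra. rewrite E in B. apply Pt_inj in B; lra.
Qed.

Lemma ret_closed l u o t : -b <= l -> u <= b -> -b <= o <= b -> 0 < t -> Imax F (Pt 0 o) t -> ~ ret l u o t ->
  exists d, 0 < d /\ forall o' t', Rabs (o' - o) < d -> Rabs (t' - t) < d -> ~ ret l u o' t'.
Proof.
  intros Hl Hu Ho Ht HI Hn. pose proof b_pos.
  destruct (curve_avoid (fun s => Pt 0 s) l u (Phi F t (Pt 0 o))) as [d [Hd K]].
  - intros s Hs. apply Pt_pcont_s; lra.
  - intros s Hs E. apply Hn. split; auto. split; auto. exists s. split; auto.
  - destruct (Phi_cont F HF _ t HI d Hd) as [d1 [Hd1 K1]].
    destruct (Pt_pcont_s 0 o ltac:(lra) Ho d1 Hd1) as [d2 [Hd2 K2]].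
    exists (Rmin d1 d2). split; [apply Rmin_glb_lt; auto|].
    intros o' t' Ho' Ht' (_ & _ & s & Hs & E).
    destruct (K1 (Pt 0 o') t') as [_ C1].
    + apply K2. rewrite Cmod_RtoC_minus. apply (Rlt_Rmin_r Ho').
    + apply (Rlt_Rmin_l Ht').
    + specialize (K s Hs). rewrite E in C1. lra.
Qed.

Lemma O_forward o t : O o -> 0 <= t -> Imax F (Pt 0 o) t.
Proof.
  intros HO Ht. destruct (at_tends HA _ HO 1 Rlt_0_1) as [T [HT K]].
  destruct (K (Rmax T t) (Rmax_l _ _)) as [A _].
  apply (Imax_convex F _ 0 t (Rmax T t)); auto; [apply Imax_0; auto|]. split; auto. apply Rmax_r.
Qed.

Lemma ret_O o t s : O o -> Imax F (Pt 0 o) t -> Phi F t (Pt 0 o) = Pt 0 s -> O s.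
Proof. intros HO HI E. unfold O. rewrite <- E. apply (at_flow HA); auto. Qed.

Lemma ret_bounded l u o : -b <= l -> u <= b -> O o -> exists T, forall t, ret l u o t -> t <= T.
Proof.
  intros Hl Hu HO. pose proof b_pos.
  destruct (curve_avoid (fun s => Pt 0 s) l u a) as [d [Hd K]].
  - intros s Hs. apply Pt_pcont_s; lra.
  - intros s Hs E. apply (Pt_nonzero s); [lra|]. rewrite E. apply (at_zero HA).
  - destruct (at_tends HA _ HO d Hd) as [T [HT K1]]. exists T.
    intros t (_ & _ & s & Hs & E). apply Rnot_lt_le. intro Hlt.
    destruct (K1 t) as [_ C1]; [lra|]. rewrite E in C1. specialize (K s Hs). lra.
Qed.

Lemma first_return l u o t0 : -b <= l -> u <= b -> -b <= o <= b -> ret l u o t0 ->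
  exists t, ret l u o t /\ forall t', t' < t -> ~ ret l u o t'.
Proof.
  intros Hl Hu Ho Hr. pose proof b_pos. pose proof (ret_gap l u o t0 Hl Hu Ho Hr) as Hg0.
  assert (HI0 : Imax F (Pt 0 o) t0) by apply Hr.
  destruct (closed_min (fun t => ret l u o t) b t0 t0) as [t [Ht [HR Hmin]]]; try lra; auto.
  - intros t Ht Hn. destruct (ret_closed l u o t Hl Hu Ho ltac:(lra)) as [d [Hd K]]; auto.
    + apply (Imax_convex F _ 0 t t0); auto; [apply Imax_0; auto|lra].
    + exists d. split; auto. intros v _ Hv. apply K; auto. rewrite Rminus_diag, Rabs_R0. auto.
  - exists t. split; auto. intros t' Ht' Hr'. pose proof (ret_gap l u o t' Hl Hu Ho Hr'). apply (Hmin t'); auto. lra.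
Qed.

Lemma ret_compose l u o o' t t' : Imax F (Pt 0 o) t -> 0 < t -> Phi F t (Pt 0 o) = Pt 0 o' -> ret l u o' t' -> ret l u o (t + t').
Proof.
  intros HI Ht E (Ht' & HI' & s & Hs & E'). rewrite <- E in HI', E'.
  assert (J : Imax F (Pt 0 o) (t + t')) by (apply flow_join; auto).
  split; [lra|]. split; auto. exists s. split; auto.
  destruct (flow_split F HF _ t t' HI J) as [_ S]. rewrite <- S. auto.
Qed.

Lemma ret_decompose l u o o' t t' : Imax F (Pt 0 o) t -> t < t' -> Phi F t (Pt 0 o) = Pt 0 o' -> ret l u o t' -> ret l u o' (t' - t).
Proof.
  intros HI Ht E (Ht' & HI' & s & Hs & E').
  destruct (flow_split F HF _ t (t' - t) HI) as [A B]; [replace (t + (t' - t)) with t' by ring; auto|].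
  replace (t + (t' - t)) with t' in B by ring. rewrite E in A, B.
  split; [lra|]. split; auto. exists s. split; auto. rewrite B. auto.
Qed.

(** Return times form a closed bounded set, so there is a last one unless there is none; a height
    reached at the last return cannot return again. *)
Lemma last_return l u o : -b <= l -> u <= b -> l < o < u -> O o -> ~ O l -> ~ O u ->
  exists o', l < o' < u /\ O o' /\ nonret l u o'.
Proof.
  intros Hl Hu Ho HO Nl Nu. pose proof b_pos.
  destruct (classic (exists t0, ret l u o t0)) as [[t0 Hr]|Hn].
  2:{ exists o. split; auto. split; auto. intros t Ht. apply Hn. exists t. auto. }
  destruct (ret_bounded l u o Hl Hu HO) as [T HT].
  pose proof (ret_gap l u o t0 Hl Hu ltac:(lra) Hr). pose proof (HT t0 Hr).
  destruct (closed_max (fun t => ret l u o t) b T t0) as [t [Ht [HR Hmax]]]; try lra; auto.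
  - intros t Ht Hn. destruct (ret_closed l u o t Hl Hu ltac:(lra) ltac:(lra)) as [d [Hd K]]; auto.
    + apply O_forward; auto. lra.
    + exists d. split; auto. intros v _ Hv. apply K; auto. rewrite Rminus_diag, Rabs_R0. auto.
  - assert (HR' := HR). destruct HR' as (Htp & HI & s & Hs & E).
    assert (HOs : O s) by (apply (ret_O o t); auto).
    assert (s <> l) by (intros ->; auto). assert (s <> u) by (intros ->; auto).
    exists s. split; [lra|]. split; auto. intros t' Hr'.
    pose proof (ret_compose l u o s t t' HI Htp E Hr') as Hc.
    assert (0 < t') by apply Hr'. pose proof (HT _ Hc). apply (Hmax (t + t')); auto. lra.
Qed.

(* The heights with this property are open and closed in the component, since
   the flow commutes with the imaginary-time flow. *)
Lemma return_translation l u o al be tau de : -b <= l -> u <= b -> ~ O l -> ~ O u ->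
  comp o al be -> l <= al -> be <= u -> ret l u o tau -> Phi F tau (Pt 0 o) = Pt 0 (o + de) -> l <= o + de <= u ->
  (forall t, t < tau -> ~ ret l u o t) ->
  forall s, al < s < be -> Phi F tau (Pt 0 s) = Pt 0 (s + de) /\ l < s + de < u /\
    forall t, t < tau -> ~ ret l u s t.
Proof.
  intros Hl Hu Nl Nu Hcomp Hal Hbe Hr E Hde Hfirst. pose proof b_pos.
  destruct Hcomp as (H1 & H2 & H3 & H4).
  assert (Htau : b < tau) by (apply (ret_gap l u o); auto; lra).
  set (X := fun s => Phi F tau (Pt 0 s) = Pt 0 (s + de) /\ l <= s + de <= u /\ forall t, t < tau -> ~ ret l u s t).
  assert (Hin : forall s, al < s < be -> X s -> l < s + de < u).
  { intros s Hs (X1 & X2 & _). assert (O (s + de)).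
    { apply (ret_O s tau); auto. apply O_forward; auto. lra. }
    assert (s + de <> l) by (intro Z; rewrite Z in H0; auto). assert (s + de <> u) by (intro Z; rewrite Z in H0; auto). lra. }
  assert (Hloc : forall s, al < s < be -> exists d, 0 < d /\ forall v, al < v < be -> Rabs (v - s) < d -> (X v <-> X s)).
  { intros s Hs. assert (HI : Imax F (Pt 0 s) tau) by (apply O_forward; auto; lra).
    destruct (classic (X s)) as [HX|HX].
    - assert (Hss := Hin s Hs HX). destruct HX as (X1 & X2 & X3).
      destruct (shift_return s (s + de) tau) as [d1 [Hd1 K1]]; auto; try lra.
      (* Nearby heights have no earlier return either: before [b] by [ret_gap], up to [tau - b] by
         compactness, and after that because the orbit is in the box, on its way to the section. *)
      destruct (compact_interval (fun d t => forall v, Rabs (v - s) < d -> ~ ret l u v t) b (tau - b)) as [d2 [Hd2 K2]].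
      { intros d d' t Hd' Hle HQ v Hv. apply HQ. lra. }
      { intros t Ht. destruct (ret_closed l u s t Hl Hu ltac:(lra) ltac:(lra)) as [d [Hd K]].
        - apply O_forward; auto. lra.
        - apply X3. lra.
        - exists d. split; auto. }
      set (m := Rmin (s + de - l) (u - (s + de))).
      exists (Rmin (Rmin d1 d2) m). split.
      { unfold m. apply Rmin_glb_lt; apply Rmin_glb_lt; lra. }
      intros v Hv Hvs. split; [intros _; split; auto|]. intros _.
      assert (V12 := Rlt_Rmin_l Hvs). assert (Vm := Rlt_Rmin_r Hvs).
      assert (V1 := Rlt_Rmin_l V12). assert (V2 := Rlt_Rmin_r V12).
      assert (Vm1 := Rlt_Rmin_l Vm). assert (Vm2 := Rlt_Rmin_r Vm).
      apply Rabs_def2 in Vm1, Vm2.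
      destruct (K1 (v - s) V1) as [J1 J2]. replace (s + (v - s)) with v in * by ring.
      replace (s + de + (v - s)) with (v + de) in J2 by ring.
      split; auto. split; [lra|]. intros t Ht Hrt.
      pose proof (ret_gap l u v t Hl Hu ltac:(lra) Hrt).
      destruct (Rle_dec t (tau - b)); [apply (K2 t ltac:(lra) v V2 Hrt)|].
      destruct Hrt as (_ & HIt & s' & Hs' & E').
      destruct (flow_split F HF _ tau (t - tau) J1) as [_ S]; [replace (tau + (t - tau)) with t by ring; auto|].
      replace (tau + (t - tau)) with t in S by ring. rewrite J2 in S.
      destruct (Pt_flow 0 (v + de) (t - tau)) as [_ B]; try lra. rewrite S, E' in B. apply Pt_inj in B; lra.
    - destruct (classic (exists d, 0 < d /\ forall v, al < v < be -> Rabs (v - s) < d -> ~ X v)) as [[d [Hd K]]|Hno].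
      { exists d. split; auto. intros v Hv Hvs. specialize (K v Hv Hvs). tauto. }
      exfalso. apply HX.
      (* Closedness: [s] is now a limit of heights in [X]. The translation passes to the limit, and
         an earlier return of [s] would be shared by these heights through [shift_return]. *)
      assert (Hacc : forall d, 0 < d -> exists v, al < v < be /\ Rabs (v - s) < d /\ X v).
      { intros d Hd. apply NNPP. intro K. apply Hno. exists d. split; auto. intros v Hv Hvs HXv. apply K. exists v. auto. }
      assert (Hrange : l <= s + de <= u).
      { split; apply le_epsilon; intros e He; destruct (Hacc e He) as [v (_ & Hv2 & _ & HX2 & _)];
        apply Rabs_def2 in Hv2; lra. }
      split; [|split; auto].
      + apply separated. intros e He.
        destruct (Phi_ccont F HF _ tau HI (e/2)) as [d1 [Hd1 K1]]; [lra|].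
        destruct (Pt_pcont_s 0 s ltac:(lra) ltac:(lra) d1 Hd1) as [d2 [Hd2 K2]].
        destruct (Pt_pcont_s 0 (s + de) ltac:(lra) ltac:(lra) (e/2)) as [d3 [Hd3 K3]]; [lra|].
        destruct (Hacc (Rmin d2 d3)) as [v (_ & Hv2 & HX1 & _)]; [apply Rmin_glb_lt; auto|].
        assert (A1 : Cmod (Phi F tau (Pt 0 v) - Phi F tau (Pt 0 s)) < e/2).
        { apply K1, K2. rewrite Cmod_RtoC_minus. apply (Rlt_Rmin_l Hv2). }
        assert (A2 : Cmod (Pt 0 (v + de) - Pt 0 (s + de)) < e/2).
        { apply K3. rewrite Cmod_RtoC_minus. replace (v + de - (s + de)) with (v - s) by ring. apply (Rlt_Rmin_r Hv2). }
        rewrite HX1 in A1. rewrite Cmod_sym in A1.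
        pose proof (Cmod_tri (Phi F tau (Pt 0 s)) (Pt 0 (v + de)) (Pt 0 (s + de))). lra.
      + intros t Ht (Htp & HIt & s' & Hs' & E').
        assert (HOs' : O s') by (apply (ret_O s t); auto).
        assert (s' <> l) by (intros ->; auto). assert (s' <> u) by (intros ->; auto).
        destruct (shift_return s s' t) as [d1 [Hd1 K1]]; auto; try lra.
        destruct (Hacc (Rmin d1 (Rmin (s' - l) (u - s')))) as [v (_ & Hv2 & _ & _ & HX3)].
        { apply Rmin_glb_lt; auto. apply Rmin_glb_lt; lra. }
        assert (V1 := Rlt_Rmin_l Hv2). assert (Vm := Rlt_Rmin_r Hv2).
        assert (Vm1 := Rlt_Rmin_l Vm). assert (Vm2 := Rlt_Rmin_r Vm).
        apply Rabs_def2 in Vm1, Vm2. destruct (K1 (v - s) V1) as [J1 J2]. replace (s + (v - s)) with v in * by ring.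
        apply (HX3 t Ht). split; auto. split; auto. exists (s' + (v - s)). split; auto. lra. }
  assert (HXo : X o) by (repeat split; auto; lra).
  intros s Hs.
  assert (HXs : X s).
  { destruct (Rle_dec o s) as [Hle|Hle].
    - apply (interval_connected X o s Hle); auto. intros t Ht. destruct (Hloc t ltac:(lra)) as [d [Hd K]].
      exists d. split; auto. intros v Hv Hvt. apply K; auto. lra.
    - apply (interval_connected X s o ltac:(lra)); auto. intros t Ht. destruct (Hloc t ltac:(lra)) as [d [Hd K]].
      exists d. split; auto. intros v Hv Hvt. apply K; auto. lra. }
  pose proof (Hin s Hs HXs). destruct HXs as (? & ? & ?). auto.
Qed.

(** The first return of one height of a component is a translation of the whole component, so either
    all its heights return or none does. *)
Lemma nonret_comp l u o al be s : -b <= l -> u <= b -> ~ O l -> ~ O u -> comp o al be -> l <= al -> be <= u ->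
  nonret l u o -> al < s < be -> nonret l u s.
Proof.
  intros Hl Hu Nl Nu Hcomp Hal Hbe Hn Hs t Hr. pose proof (comp_in _ _ _ s Hcomp Hs) as Hcs.
  destruct (first_return l u s t Hl Hu ltac:(lra) Hr) as [t1 [Hr1 Hf]].
  assert (Hr1' := Hr1). destruct Hr1' as (Ht1 & HI1 & s' & Hs' & E).
  destruct (return_translation l u s al be t1 (s' - s)) with (s := o) as (A & B & _); auto.
  - rewrite E. f_equal. ring.
  - lra.
  - apply Hcomp.
  - apply (Hn t1). split; auto. destruct Hcomp as (H1 & _ & _ & H4). split; [apply O_forward; [apply H4; auto|lra]|].
    exists (o + (s' - s)). split; [lra|auto].
Qed.

(** [wind_jump] for a straight segment in the chart with unit direction [d]: an orbit arc if
    [d = 1], a piece of the section if [d] is imaginary. *)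
Lemma chart_jump w0 d eta kap z rest : Cmod d = 1 -> 0 < eta -> 0 < kap -> Cmod w0 + eta + kap < rho ->
  let L := ((fun t => g (w0 + d * RtoC t)%C), - eta, eta) :: rest in
  List.Forall piece_ok rest -> joins z L z ->
  (forall s, - (kap/2) <= s <= kap/2 -> ~ on_chain rest (g (w0 + d * (Ci * RtoC s))%C)) ->
  wind L (g (w0 + d * (Ci * RtoC (kap/2)))%C) <> wind L (g (w0 + d * (Ci * RtoC (- (kap/2))))%C).
Proof.
  intros Hd Heta Hkap Hsum L Hok HJ Hav.
  assert (Hd0 : d <> 0) by (apply Cmod_gt_0; lra).
  assert (Hi : forall s : R, (Ci * RtoC s)%C = (0, s)) by (intros; unfold Ci, Cmult, RtoC; simpl; f_equal; ring).
  set (G := fun u => g (w0 + d * u)%C).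
  assert (Hb : forall u, in_box (- eta) eta (- kap) kap u -> Cmod (w0 + d * u) < rho).
  { intros u [Hu1 Hu2]. eapply Rle_lt_trans; [apply Cmod_triangle|]. rewrite Cmod_mult, Hd, Rmult_1_l.
    pose proof (Cmod_le_ReIm u). assert (Rabs (Re u) <= eta) by (apply Rabs_le; lra).
    assert (Rabs (Im u) <= kap) by (apply Rabs_le; lra). lra. }
  rewrite !Hi.
  apply (wind_jump G (fun u => d * F (G u))%C eta kap z rest); auto.
  - intros u Hu. specialize (Hb u Hu). split.
    + unfold G. apply (der_comp cid cid (fun u => w0 + d * u)%C g); [|apply (chart_der Hg); auto].
      apply (der_val cid _ _ (0 + d * 1)%C); [ring|]. apply der_plus; [apply der_const|apply der_scal, der_self].
    + apply Cmult_neq_0; auto. intro E0.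
      pose proof (chart_flow F HF x g rho (w0 + d * u)%C ((rho - Cmod (w0 + d * u)) / 2) Hg) as [_ B].
      { rewrite Rabs_pos_eq; lra. }
      fold (G u) in B. rewrite Phi_equilibrium in B by auto. apply (chart_inj Hg) in B; auto.
      * apply (f_equal (fun v => v - (w0 + d * u))%C) in B.
        replace (w0 + d * u - (w0 + d * u))%C with (RtoC 0) in B by ring.
        match type of B with _ = (?p + ?q - ?p)%C => replace (p + q - p)%C with q in B by ring end.
        apply RtoC_inj in B. lra.
      * eapply Rle_lt_trans; [apply Cmod_triangle|]. rewrite Cmod_R, Rabs_pos_eq; lra.
  - intros u v Hu Hv E. apply (chart_inj Hg) in E; auto.
    replace u with ((w0 + d * u - w0) / d)%C by (field; auto). rewrite E. field. auto.
  - intros s Hs. rewrite <- Hi. apply Hav. auto.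
Qed.

Lemma orbit_hits l u o s t ta : -b <= l -> u <= b -> l <= o <= u -> O o -> nonret l u o -> l <= s <= u ->
  0 <= t -> 0 <= ta <= b -> Phi F t (Pt 0 o) = Pt ta s -> t = ta /\ s = o.
Proof.
  intros Hl Hu Ho HO Hn Hs Ht Hta E. pose proof b_pos.
  destruct (Rlt_dec t ta).
  { destruct (Pt_flow 0 o t) as [_ B]; try lra. rewrite E in B. apply Pt_inj in B; lra. }
  assert (HI : Imax F (Pt 0 o) t) by (apply O_forward; auto).
  destruct (flow_split F HF _ t (- ta) HI) as [_ S]; [apply O_forward; auto; lra|].
  rewrite E in S. destruct (Pt_flow ta s (- ta)) as [_ B]; try lra. rewrite S in B.
  replace (ta + - ta) with 0 in B by ring.
  destruct (Req_dec t ta) as [->|].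
  - replace (ta + - ta) with 0 in B by ring. rewrite Phi_0 in B by auto. apply Pt_inj in B; try lra.
  - exfalso. apply (Hn (t + - ta)). split; [lra|]. split; [apply O_forward; auto; lra|]. exists s. auto.
Qed.

Lemma segment_ball p q c r t : Cmod (p - c) < r -> Cmod (q - c) < r -> 0 <= t <= 1 ->
  Cmod (p + RtoC t * (q - p) - c) < r.
Proof.
  intros Hp Hq Ht. replace (p + t * (q - p) - c)%C with (RtoC (1 - t) * (p - c) + RtoC t * (q - c))%C by (rewrite RtoC_minus; ring).
  eapply Rle_lt_trans; [apply Cmod_triangle|]. rewrite !Cmod_mult, !Cmod_R, !Rabs_pos_eq by lra.
  destruct (Req_dec t 0) as [->|]; [lra|].
  assert (t * Cmod (q - c) < t * r) by (apply Rmult_lt_compat_l; lra).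
  assert ((1 - t) * Cmod (p - c) <= (1 - t) * r) by (apply Rmult_le_compat_l; lra). lra.
Qed.

Lemma nearby_inside al be c m : al < be -> c = al \/ c = be -> 0 < m -> exists e, Rabs e < m /\ al < c + e < be.
Proof.
  intros Hab Hc Hm. set (e := Rmin (m/2) ((be - al)/2)).
  assert (0 < e) by (apply Rmin_glb_lt; lra). assert (e <= m/2) by apply Rmin_l. assert (e <= (be-al)/2) by apply Rmin_r.
  destruct Hc as [-> | ->]; [exists e|exists (- e)]; rewrite ?Rabs_Ropp, Rabs_pos_eq by lra; lra.
Qed.

(** Escaping paths start at the time coordinate [b/2], since the loops below run along the section
    at time 0. *)
Lemma Pt_half_T c T : -b <= c <= b -> 0 < T -> ~ Imax F (Pt 0 c) T -> 0 < T - b/2 /\ ~ Imax F (Pt (b/2) c) (T - b/2).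
Proof.
  intros Hc HT Hn. pose proof b_pos.
  assert (b < T).
  { apply Rnot_le_lt. intro. apply Hn. apply Pt_flow; lra. }
  split; [lra|]. intro K. apply Hn. destruct (Pt_flow 0 c (b/2)) as [A B]; try lra.
  rewrite Rplus_0_l in B. rewrite <- B in K. replace T with (b/2 + (T - b/2)) by ring. apply flow_join; auto.
Qed.

Lemma Phi_half c t : -b <= c <= b -> Imax F (Pt (b/2) c) t ->
  Imax F (Pt 0 c) (b/2 + t) /\ Phi F t (Pt (b/2) c) = Phi F (b/2 + t) (Pt 0 c).
Proof.
  intros Hc HI. pose proof b_pos. destruct (Pt_flow 0 c (b/2)) as [A B]; try lra. rewrite Rplus_0_l in B.
  rewrite <- B in *. assert (J : Imax F (Pt 0 c) (b/2 + t)) by (apply flow_join; auto). split; auto.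
  destruct (flow_split F HF _ (b/2) t A J) as [_ S]. auto.
Qed.

Lemma pcont_Phi y t : Imax F y t -> pcont (fun t => Phi F t y) t.
Proof. apply Phi_pcont; auto. Qed.

(* The loop follows two orbits that never return to the section into [a] and
   is closed along the section.  Both ends of the component of [o1] escape to
   infinity, on the two sides of the loop. *)
Lemma nonret_unique l u o1 o2 c : -b <= l -> u <= b -> ~ O l -> ~ O u -> l < o1 -> o1 < c -> c < o2 -> o2 < u ->
  O o1 -> O o2 -> ~ O c -> nonret l u o1 -> nonret l u o2 -> False.
Proof.
  intros Hl Hu Nl Nu H1 H1c Hc2 H2 HO1 HO2 Nc HR1 HR2. pose proof b_pos.
  destruct (comp_exists l u o1) as (al & be & Hcomp & Hal & Hbe); auto; try lra.
  assert (Hcomp' := Hcomp). destruct Hcomp' as (C1 & C2 & C3 & C4).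
  assert (Hbc : be <= c) by (apply Rnot_lt_le; intro; apply Nc, C4; lra).
  destruct (at_near HA) as [ra [Hra Kra]].
  destruct (curve_avoid (fun s => Pt (b/2) s) l u a) as [de [Hde Kde]].
  { intros s Hs. apply Pt_pcont_s; lra. }
  { intros s Hs E. destruct (Pt_flow 0 s (b/2)) as [A B]; try lra. rewrite Rplus_0_l, E in B.
    apply (flow_nonzero F HF _ _ A (Pt_nonzero s ltac:(lra))). rewrite B. apply (at_zero HA). }
  (* A segment in the disc of this radius around [a] lies in the basin and misses the section at
     time [b/2]; it will connect the two orbits near [a]. *)
  set (r0 := Rmin de ra). assert (Hr0 : 0 < r0) by (apply Rmin_glb_lt; auto).
  assert (Hr1 : r0 <= de) by apply Rmin_l. assert (Hr2 : r0 <= ra) by apply Rmin_r.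
  destruct (at_tends HA _ HO1 r0 Hr0) as [T1 [HT1 K1]]. destruct (at_tends HA _ HO2 r0 Hr0) as [T2 [HT2 K2]].
  (* At least [b], so that the first orbit has passed the arc around time [b/2] where the loop will
     be crossed. *)
  set (t1 := Rmax T1 b). assert (T1 <= t1) by apply Rmax_l. assert (b <= t1) by apply Rmax_r.
  destruct (K1 t1) as [_ Z1]; auto. destruct (K2 T2) as [_ Z2]; [lra|].
  set (z1 := Phi F t1 (Pt 0 o1)) in *. set (z2 := Phi F T2 (Pt 0 o2)) in *.
  set (w0 := (b/2, sg * o1) : C).
  set (rest := ((fun t => Phi F t (Pt 0 o1)), b/2 + b/4, t1) :: ((fun t => z1 + RtoC t * (z2 - z1))%C, 0, 1) ::
    ((fun t => Phi F t (Pt 0 o2)), T2, 0) :: ((fun s => Pt 0 s), o2, o1) :: ((fun t => Phi F t (Pt 0 o1)), 0, b/2 - b/4) :: nil).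
  set (z := g (w0 + 1 * RtoC (- (b/4)))%C).
  set (L := ((fun t => g (w0 + 1 * RtoC t)%C), - (b/4), b/4) :: rest).
  assert (Em : forall t, g (w0 + 1 * RtoC t)%C = Pt (b/2 + t) o1).
  { intros t. unfold Pt, w0. f_equal. unfold Cplus, Cmult, RtoC. simpl. f_equal; ring. }
  assert (Ep : forall s, g (w0 + 1 * (Ci * RtoC s))%C = Pt (b/2) (o1 + sg * s)).
  { intros s. unfold Pt, w0. f_equal. unfold Cplus, Cmult, RtoC, Ci. simpl. f_equal; destruct Hsg as [-> | ->]; ring. }
  assert (Efl : forall t, 0 <= t <= b -> Phi F t (Pt 0 o1) = Pt t o1).
  { intros t Ht. destruct (Pt_flow 0 o1 t) as [_ B]; try lra. rewrite B. f_equal. ring. }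
  assert (Hok : List.Forall piece_ok rest).
  { repeat constructor; intros t Ht.
    - minmax Ht. apply pcont_Phi, O_forward; auto. lra.
    - eapply der_cont, rder_segment.
    - minmax Ht. apply pcont_Phi, O_forward; auto. lra.
    - minmax Ht. apply Pt_pcont_s; lra.
    - minmax Ht. apply pcont_Phi, O_forward; auto. lra. }
  assert (HJ : joins z L z).
  { simpl. rewrite !Em, Efl by lra. repeat split; auto.
    - unfold z. rewrite Em. auto.
    - fold z1. ring.
    - fold z2. ring.
    - rewrite Phi_0 by auto. auto.
    - rewrite Phi_0 by auto. auto.
    - unfold z. rewrite Em, Efl by lra. f_equal. }
  assert (HokL : List.Forall piece_ok L).
  { constructor; auto. intros t Ht. minmax Ht.
    apply (cont_ext RtoC (fun t => Phi F t (Pt (b/2) o1))) with (r := b/4); [lra| |].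
    - intros s Hs. rewrite Cmod_RtoC_minus in Hs. apply Rabs_def2 in Hs.
      destruct (Pt_flow (b/2) o1 s) as [_ B]; try lra. rewrite B, Em. auto.
    - apply pcont_Phi. apply Pt_flow; lra. }
  assert (Hrest : forall s, al <= s <= be -> ~ on_chain rest (Pt (b/2) s)).
  { intros s Hs [P [HP HPz]]. destruct HP as [<-|[<-|[<-|[<-|[<-|[]]]]]]; destruct HPz as [t [Ht E]].
    - minmax Ht.
      destruct (orbit_hits l u o1 s t (b/2)) as [A B]; auto; lra.
    - minmax Ht.
      pose proof (segment_ball z1 z2 a r0 t Z1 Z2 Ht) as S. rewrite E in S. specialize (Kde s ltac:(lra)). lra.
    - minmax Ht.
      destruct (orbit_hits l u o2 s t (b/2)) as [A B]; auto; lra.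
    - minmax Ht. apply Pt_inj in E; lra.
    - minmax Ht.
      destruct (orbit_hits l u o1 s t (b/2)) as [A B]; auto; lra. }
  assert (HL : forall s, al <= s <= be -> s <> o1 -> ~ on_chain L (Pt (b/2) s)).
  { intros s Hs Hn [P [[<-|HP] HPz]].
    - destruct HPz as [t [Ht E]]. minmax Ht. rewrite Em in E. apply Pt_inj in E; lra.
    - apply (Hrest s Hs). exists P. auto. }
  (* The loop lies in the basin except for its part in the section, so only that part could be hit
     by the orbit of an end point. Such a hit would make nearby heights of the component return. *)
  assert (HE : forall c, c = al \/ c = be -> wind L (Pt (b/2) c) = 0).
  { intros e He. destruct (edge_T o1 al be e) as [T [HT HnT]]; auto; try lra.
    assert (Hee : l <= e <= u) by (destruct He; lra).
    destruct (Pt_half_T e T) as [HT' HnT']; auto; try lra.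
    apply (wind_blowup HF L z (Pt (b/2) e) (T - b/2)); auto.
    intros t Ht HI. destruct (Phi_half e t) as [J S]; auto; [lra|]. rewrite S.
    assert (HnN : ~ N (Phi F (b/2 + t) (Pt 0 e))).
    { intro K. apply (at_flow HA) in K; auto. destruct He as [-> | ->]; auto. }
    intros [P [HP HPz]]. destruct HP as [<-|[<-|[<-|[<-|[<-|[<-|[]]]]]]]; destruct HPz as [v [Hv E]]; rewrite <- E in HnN.
    - minmax Hv. apply HnN. rewrite Em. apply O_t; auto; lra.
    - minmax Hv. apply HnN. apply (at_flow HA); auto. apply O_forward; auto; lra.
    - minmax Hv. apply HnN, Kra. pose proof (segment_ball z1 z2 a r0 v Z1 Z2 Hv). lra.
    - minmax Hv. apply HnN. apply (at_flow HA); auto. apply O_forward; auto; lra.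
    - minmax Hv.
      destruct (shift_return e v (b/2 + t)) as [d [Hd K]]; auto; try lra.
      destruct (nearby_inside al be e (Rmin d (Rmin (v - l) (u - v)))) as [k [Hk Hin]]; auto; try lra.
      { apply Rmin_glb_lt; auto. apply Rmin_glb_lt; lra. }
      assert (V1 := Rlt_Rmin_l Hk). assert (Vm := Rlt_Rmin_r Hk).
      assert (Vm1 := Rlt_Rmin_l Vm). assert (Vm2 := Rlt_Rmin_r Vm).
      apply Rabs_def2 in Vm1, Vm2. destruct (K k V1) as [A B].
      apply (nonret_comp l u o1 al be (e + k)) with (t := b/2 + t); auto.
      split; [lra|]. split; auto. exists (v + k). split; [lra|auto].
    - minmax Hv. apply HnN. apply (at_flow HA); auto. apply O_forward; auto; lra. }
  (* The jump is measured between the heights [o1 - kap/2] and [o1 + kap/2], both inside the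
     component and hence connected to its two ends off the loop. *)
  set (kap := Rmin (o1 - al) (be - o1)).
  assert (Hk0 : 0 < kap) by (apply Rmin_glb_lt; lra).
  assert (Hk1 : kap <= o1 - al) by apply Rmin_l. assert (Hk2 : kap <= be - o1) by apply Rmin_r.
  assert (Wp : wind L (Pt (b/2) (o1 + kap/2)) = 0).
  { rewrite <- (HE be) by auto. symmetry. apply (wind_move L z (fun s => Pt (b/2) s)); auto; try lra.
    - intros s Hs. apply Pt_pcont_s; lra.
    - intros s Hs. apply HL; lra. }
  assert (Wm : wind L (Pt (b/2) (o1 - kap/2)) = 0).
  { rewrite <- (HE al) by auto. apply (wind_move L z (fun s => Pt (b/2) s)); auto; try lra.
    - intros s Hs. apply Pt_pcont_s; lra.
    - intros s Hs. apply HL; lra. }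
  apply (chart_jump w0 1 (b/4) kap z rest); auto; try lra.
  - apply Cmod_1.
  - pose proof (Cmod_pt (b/2) o1) as Hw. fold w0 in Hw. assert (Rabs (b/2) = b/2) by (apply Rabs_pos_eq; lra).
    assert (Rabs o1 <= b) by (apply Rabs_le; lra). unfold b in *. lra.
  - intros s Hs. rewrite Ep. apply Hrest. destruct Hsg as [-> | ->]; lra.
  - fold L. rewrite !Ep. destruct Hsg as [Es | Es]; rewrite Es in *.
    + replace (o1 + 1 * (kap/2)) with (o1 + kap/2) by ring. replace (o1 + 1 * - (kap/2)) with (o1 - kap/2) by ring. congruence.
    + replace (o1 + -1 * (kap/2)) with (o1 - kap/2) by ring. replace (o1 + -1 * - (kap/2)) with (o1 + kap/2) by ring. congruence.
Qed.

(** A return of a component to itself would be a translation. A nonzero shift sends an inner height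
    to an end point, which would then lie in the basin; shift 0 gives a periodic orbit in the
    basin. *)
Lemma return_other l u o al be tau o' : -b <= l -> u <= b -> ~ O l -> ~ O u -> comp o al be -> l <= al -> be <= u ->
  ret l u o tau -> (forall t, t < tau -> ~ ret l u o t) -> l <= o' <= u -> Phi F tau (Pt 0 o) = Pt 0 o' -> ~ al < o' < be.
Proof.
  intros Hl Hu Nl Nu Hcomp Hal Hbe Hr Hf Ho' E Hin. pose proof b_pos.
  assert (Htr := return_translation l u o al be tau (o' - o) Hl Hu Nl Nu Hcomp Hal Hbe Hr).
  replace (o + (o' - o)) with o' in Htr by ring. specialize (Htr E Ho' Hf).
  destruct Hcomp as (C1 & C2 & C3 & C4). assert (Ht : 0 < tau) by apply Hr.
  assert (HO : forall s, al < s < be -> O (s + (o' - o))).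
  { intros s Hs. destruct (Htr s Hs) as (A & B & _). apply (ret_O s tau); auto. apply O_forward; auto. lra. }
  destruct (Rtotal_order o' o) as [Hlt|[Heq|Hgt]].
  - apply C2. replace al with ((al - (o' - o)) + (o' - o)) by ring. apply HO. lra.
  - apply (basin_not_periodic HF HA (Pt 0 o) tau); auto.
    + apply C4; auto.
    + apply Pt_nonzero; lra.
    + apply Hr.
    + rewrite E, Heq. auto.
  - apply C3. replace be with ((be - (o' - o)) + (o' - o)) by ring. apply HO. lra.
Qed.

(* The loop consists of an orbit arc between two consecutive crossings of the
   section and the section in between.  If an end of the previous component
   blew up before its return, the loop would have winding number 0 on its
   incoming side, hence not on its outgoing side, from where an end of the
   component of [o1] escapes. *)
Lemma return_width l u o2 o1 o0 al2 be2 al1 be1 tau2 tau1 :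
  -b <= l -> u <= b -> ~ O l -> ~ O u ->
  comp o2 al2 be2 -> l <= al2 -> be2 <= u -> comp o1 al1 be1 -> l <= al1 -> be1 <= u ->
  ret l u o2 tau2 -> (forall t, t < tau2 -> ~ ret l u o2 t) -> Phi F tau2 (Pt 0 o2) = Pt 0 o1 ->
  ret l u o1 tau1 -> (forall t, t < tau1 -> ~ ret l u o1 t) -> l <= o0 <= u -> Phi F tau1 (Pt 0 o1) = Pt 0 o0 ->
  be2 - al2 = be1 - al1.
Proof.
  intros Hl Hu Nl Nu Hc2 Hal2 Hbe2 Hc1 Hal1 Hbe1 Hr2 Hf2 E2 Hr1 Hf1 Ho0 E1. pose proof b_pos.
  assert (Hc2' := Hc2). destruct Hc2' as (A1 & A2 & A3 & A4).
  assert (Hc1' := Hc1). destruct Hc1' as (B1 & B2 & B3 & B4).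
  set (de := o1 - o2).
  assert (Htr := return_translation l u o2 al2 be2 tau2 de Hl Hu Nl Nu Hc2 Hal2 Hbe2 Hr2).
  replace (o2 + de) with o1 in Htr by (unfold de; ring). specialize (Htr E2 ltac:(lra) Hf2).
  assert (Ht2 : b < tau2) by (apply (ret_gap l u o2); auto; lra).
  assert (Ht1 : b < tau1) by (apply (ret_gap l u o1); auto; lra).
  assert (HO1 : O o1) by (apply B4; auto). assert (HO2 : O o2) by (apply A4; auto).
  assert (HO0 : O o0) by (apply (ret_O o1 tau1); auto; apply O_forward; auto; lra).
  (* It suffices to keep the translated end points out of the basin: the translate of the component
     of [o2] is then itself a component, and it contains [o1]. *)
  assert (Hkey : forall c, c = al2 \/ c = be2 -> ~ O (c + de)).
  2:{ destruct (comp_unique o1 (al2 + de) (be2 + de) o1 al1 be1) as [U1 U2]; auto; [|unfold de; lra|lra].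
      split; [unfold de; lra|]. split; [apply Hkey; auto|]. split; [apply Hkey; auto|].
      intros s Hs. destruct (Htr (s - de)) as (K1 & K2 & _); [lra|]. replace (s - de + de) with s in K1 by ring.
      apply (ret_O (s - de) tau2); auto; [apply A4; lra|]. apply O_forward; [apply A4|]; lra. }
  intros c Hc HOc.
  assert (NOc : ~ O c) by (destruct Hc as [-> | ->]; auto).
  assert (Hcr : l <= c <= u) by (destruct Hc as [-> | ->]; lra).
  assert (Hcde : l <= c + de <= u).
  { split; apply le_epsilon; intros e He; destruct (nearby_inside al2 be2 c e) as [k [Hk Hin]]; auto; try lra;
    apply Rabs_def2 in Hk; destruct (Htr (c + k) Hin) as (_ & K & _); lra. }
  (* If the end point [c] survives until [tau2], continuity places its image at [c + de], in the
     basin, and [c] would be in the basin too. So [c] blows up by then. *)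
  destruct (classic (Imax F (Pt 0 c) tau2)) as [HI|HnI].
  { apply NOc. unfold O. apply (at_flow HA _ tau2 HI).
    replace (Phi F tau2 (Pt 0 c)) with (Pt 0 (c + de)); auto.
    apply separated. intros e He.
    destruct (Phi_ccont F HF _ tau2 HI (e/2)) as [d1 [Hd1 K1]]; [lra|].
    destruct (Pt_pcont_s 0 c ltac:(lra) ltac:(lra) d1 Hd1) as [d2 [Hd2 K2]].
    destruct (Pt_pcont_s 0 (c + de) ltac:(lra) ltac:(lra) (e/2)) as [d3 [Hd3 K3]]; [lra|].
    destruct (nearby_inside al2 be2 c (Rmin d2 d3)) as [k [Hk Hin]]; auto; try lra; [apply Rmin_glb_lt; auto|].
    destruct (Htr (c + k) Hin) as (Ek & _ & _).
    assert (X1 : Cmod (Phi F tau2 (Pt 0 (c + k)) - Phi F tau2 (Pt 0 c)) < e/2).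
    { apply K1, K2. rewrite Cmod_RtoC_minus. replace (c + k - c) with k by ring. apply (Rlt_Rmin_l Hk). }
    assert (X2 : Cmod (Pt 0 (c + k + de) - Pt 0 (c + de)) < e/2).
    { apply K3. rewrite Cmod_RtoC_minus. replace (c + k + de - (c + de)) with k by ring. apply (Rlt_Rmin_r Hk). }
    rewrite Ek in X1. rewrite Cmod_sym in X2.
    pose proof (Cmod_tri (Pt 0 (c + de)) (Pt 0 (c + k + de)) (Phi F tau2 (Pt 0 c))). lra. }
  assert (Hn1 : ~ al2 < o1 < be2) by (apply (return_other l u o2 al2 be2 tau2); auto; lra).
  assert (Hn0 : ~ al1 < o0 < be1) by (apply (return_other l u o1 al1 be1 tau1); auto; lra).
  (* [ep] is the direction from [o1] to [o0], and [v'] the distance from [o1] to the end of its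
     component on that side. This end lies strictly before [o0], which belongs to another
     component. *)
  assert (Hv : exists ep v', (ep = 1 \/ ep = -1) /\ 0 < v' < ep * (o0 - o1) /\ (o1 + ep * v' = al1 \/ o1 + ep * v' = be1)).
  { assert (o0 <> al1) by (intros ->; auto). assert (o0 <> be1) by (intros ->; auto).
    destruct (Rlt_dec o1 o0).
    - exists 1, (be1 - o1). split; auto. split; [|right; ring]. destruct (Rlt_dec o0 be1); [exfalso; apply Hn0; lra|lra].
    - exists (-1), (o1 - al1). split; auto. split; [|left; ring]. destruct (Rlt_dec al1 o0); [exfalso; apply Hn0; lra|lra]. }
  destruct Hv as (ep & v' & Hep & Hv' & Hc'). set (D := ep * (o0 - o1)) in *. set (c' := o1 + ep * v') in *.
  assert (Hc'r : l <= c' <= u) by (destruct Hc' as [-> | ->]; lra).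
  assert (NOc' : ~ O c') by (destruct Hc' as [-> | ->]; auto).
  assert (Hseg : forall v, 0 <= v <= D -> l <= o1 + ep * v <= u).
  { intros v Hv. unfold D in *. destruct Hep as [-> | ->]; lra. }
  set (eta := Rmin (Rmin (v'/2) ((D - v')/2)) b).
  assert (Heta : 0 < eta) by (apply Rmin_glb_lt; auto; apply Rmin_glb_lt; lra).
  assert (Heta1 : eta <= v'/2) by (eapply Rle_trans; [apply Rmin_l|apply Rmin_l]).
  assert (Heta2 : eta <= (D - v')/2) by (eapply Rle_trans; [apply Rmin_l|apply Rmin_r]).
  assert (Heta3 : eta <= b) by apply Rmin_r.
  set (w0 := (0, sg * c') : C). set (d := (Ci * RtoC (- (sg * ep)))%C).
  assert (Hsgep : sg * ep = 1 \/ sg * ep = -1) by (destruct Hsg as [-> | ->], Hep as [-> | ->]; lra).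
  assert (Hd1 : Cmod d = 1).
  { unfold d. rewrite Cmod_mult, Cmod_Ci, Cmod_R, Rabs_Ropp. destruct Hsgep as [-> | ->]; rewrite ?Rabs_R1, ?(Rabs_left (-1)) by lra; lra. }
  assert (Em : forall t, g (w0 + d * RtoC t)%C = Pt 0 (o1 + ep * (v' - t))).
  { intros t. unfold Pt, w0, d, c'. f_equal. unfold Cplus, Cmult, RtoC, Ci. simpl. f_equal; ring. }
  assert (Ep : forall s, g (w0 + d * (Ci * RtoC s))%C = Pt (sg * ep * s) c').
  { intros s. unfold Pt, w0, d. f_equal. unfold Cplus, Cmult, RtoC, Ci. simpl. f_equal; ring. }
  (* The loop without the piece of section around [c']: along the section to [o1], along the orbit
     to [o0], and back along the section. *)
  set (rest := ((fun v => Pt 0 (o1 + ep * v)), v' - eta, 0) :: ((fun t => Phi F t (Pt 0 o1)), 0, tau1) ::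
    ((fun v => Pt 0 (o1 + ep * v)), D, v' + eta) :: nil).
  set (L := ((fun t => g (w0 + d * RtoC t)%C), - eta, eta) :: rest).
  set (z := g (w0 + d * RtoC (- eta))%C).
  assert (HcP : forall t v, -b <= t <= b -> 0 <= v <= D -> pcont (fun v => Pt t (o1 + ep * v)) v).
  { intros t v Ht Hv. specialize (Hseg v Hv). apply (pcont_affine o1 ep v (fun s => Pt t s)), Pt_pcont_s; lra. }
  assert (Hok : List.Forall piece_ok rest).
  { repeat constructor; intros t Ht.
    - minmax Ht. apply HcP; lra.
    - minmax Ht. apply pcont_Phi, O_forward; auto. lra.
    - minmax Ht. apply HcP; lra. }
  assert (HokL : List.Forall piece_ok L).
  { constructor; auto. intros t Ht. minmax Ht.
    apply (cont_ext RtoC (fun t => Pt 0 (o1 + ep * (v' - t)))) with (r := 1); [lra|intros; rewrite Em; auto|].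
    apply (cont_ext RtoC (fun t => Pt 0 (o1 + ep * (v' + -1 * t)))) with (r := 1); [lra|intros; do 3 f_equal; ring|].
    apply (pcont_affine v' (-1) t (fun v => Pt 0 (o1 + ep * v))), HcP; lra. }
  assert (HJ : joins z L z).
  { unfold z. simpl. rewrite !Em. repeat split; auto.
    - rewrite Phi_0 by auto. f_equal. ring.
    - rewrite E1. f_equal. unfold D. destruct Hep as [-> | ->]; ring.
    - do 2 f_equal. ring. }
  assert (HLpts : forall q, on_chain L q -> (exists t, 0 <= t <= tau1 /\ Phi F t (Pt 0 o1) = q) \/
     exists v, 0 <= v <= D /\ Pt 0 (o1 + ep * v) = q).
  { intros q [P [HP HPz]]. destruct HP as [<-|[<-|[<-|[<-|[]]]]]; destruct HPz as [t [Ht E]].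
    - minmax Ht. rewrite Em in E. right. exists (v' - t). split; [lra|auto].
    - minmax Ht. right. exists t. split; [lra|auto].
    - minmax Ht. left. exists t. auto.
    - minmax Ht. right. exists t. split; [lra|auto]. }
  assert (HAN : forall t, 0 <= t -> N (Phi F t (Pt 0 o1))).
  { intros t Ht. apply (at_flow HA); auto. apply O_forward; auto. }
  assert (Hoff_p : forall s, l <= s <= u -> s <> o1 -> ~ on_chain L (Pt (b/2) s)).
  { intros s Hs Hso HL. apply HLpts in HL. destruct HL as [[t [Ht E]]|[v [Hv E]]].
    - destruct (Rlt_dec t (b/2)).
      { destruct (Pt_flow 0 o1 t) as [_ Q]; try lra. rewrite E in Q. apply Pt_inj in Q; lra. }
      destruct (flow_split F HF (Pt 0 o1) t (- (b/2))) as [_ S]; [apply O_forward; auto; lra|apply O_forward; auto; lra|].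
      rewrite E in S. destruct (Pt_flow (b/2) s (- (b/2))) as [_ Q]; try lra. rewrite S in Q.
      replace (b/2 + - (b/2)) with 0 in Q by ring.
      destruct (Req_dec t (b/2)) as [->|].
      + replace (b/2 + - (b/2)) with 0 in Q by ring. rewrite Phi_0 in Q by auto. apply Pt_inj in Q; lra.
      + apply (Hf1 (t + - (b/2))); [lra|]. split; [lra|]. split; [apply O_forward; auto; lra|]. exists s. auto.
    - specialize (Hseg v Hv). apply Pt_inj in E; lra. }
  assert (Hoff_m : forall v, 0 <= v < D -> ~ on_chain L (Pt (- (b/2)) (o1 + ep * v))).
  { intros v Hv HL. assert (Hs := Hseg v ltac:(lra)). apply HLpts in HL. destruct HL as [[t [Ht E]]|[v2 [Hv2 E]]].
    - destruct (flow_split F HF (Pt 0 o1) t (b/2)) as [_ S]; [apply O_forward; auto; lra|apply O_forward; auto; lra|].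
      rewrite E in S. destruct (Pt_flow (- (b/2)) (o1 + ep * v) (b/2)) as [_ Q]; try lra. rewrite S in Q.
      replace (- (b/2) + b/2) with 0 in Q by ring.
      assert (Hrt : ret l u o1 (t + b/2)).
      { split; [lra|]. split; [apply O_forward; auto; lra|]. exists (o1 + ep * v). auto. }
      destruct (Rlt_dec (t + b/2) tau1); [apply (Hf1 (t + b/2)); auto|].
      destruct (Req_dec (t + b/2) tau1) as [Heq|].
      + rewrite Heq, E1 in Q. apply Pt_inj in Q; try lra. destruct Q as [_ Q]. unfold D in *.
        destruct Hep as [-> | ->]; lra.
      + assert (Hrt0 : ret l u o0 (t + b/2 - tau1)).
        { apply (ret_decompose l u o1 o0); auto; [apply Hr1|lra]. }
        pose proof (ret_gap l u o0 _ Hl Hu ltac:(lra) Hrt0). lra.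
    - pose proof (Hseg v2 Hv2). apply Pt_inj in E; lra. }
  (* The end point [c] escapes before [tau2]. A hit on the section part of the loop would give
     nearby heights of the component a return earlier than their first one. *)
  assert (W1 : wind L (Pt (b/2) c) = 0).
  { destruct (Pt_half_T c tau2) as [HT' HnT']; auto; try lra.
    apply (wind_blowup HF L z (Pt (b/2) c) (tau2 - b/2)); auto.
    intros t Ht HI HL. destruct (Phi_half c t) as [J S]; auto; [lra|]. rewrite S in HL.
    assert (HnN : ~ N (Phi F (b/2 + t) (Pt 0 c))).
    { intro K. apply (at_flow HA) in K; auto. }
    assert (Htt : b/2 + t < tau2).
    { apply Rnot_le_lt. intro. apply HnI. apply (Imax_convex F _ 0 tau2 (b/2 + t)); auto; [apply Imax_0; auto|lra]. }
    apply HLpts in HL. destruct HL as [[t' [Ht' E]]|[v [Hv E]]]; rewrite <- E in HnN.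
    - apply HnN, HAN. lra.
    - assert (Hvv := Hseg v Hv). set (s' := o1 + ep * v) in *.
      assert (v <> 0) by (intros ->; apply HnN; unfold s'; replace (o1 + ep * 0) with o1 by ring; auto).
      assert (v <> D).
      { intros ->. apply HnN. unfold s', D. replace (o1 + ep * (ep * (o0 - o1))) with o0 by (destruct Hep as [-> | ->]; ring). auto. }
      assert (s' <> l /\ s' <> u) as [? ?] by (unfold s', D in *; destruct Hep as [-> | ->]; lra).
      destruct (shift_return c s' (b/2 + t)) as [d0 [Hd0 K]]; auto; try lra.
      destruct (nearby_inside al2 be2 c (Rmin d0 (Rmin (s' - l) (u - s')))) as [k [Hk Hin]]; auto; try lra.
      { apply Rmin_glb_lt; auto. apply Rmin_glb_lt; lra. }
      assert (V1 := Rlt_Rmin_l Hk). assert (Vm := Rlt_Rmin_r Hk).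
      assert (Vm1 := Rlt_Rmin_l Vm). assert (Vm2 := Rlt_Rmin_r Vm).
      apply Rabs_def2 in Vm1, Vm2. destruct (K k V1) as [P1 P2].
      destruct (Htr (c + k) Hin) as (_ & _ & Kf). apply (Kf (b/2 + t) Htt).
      split; [lra|]. split; auto. exists (s' + k). split; [lra|auto]. }
  assert (W2 : wind L (Pt (b/2) o2) = 0).
  { rewrite <- W1. symmetry. apply (wind_move_between L z (fun s => Pt (b/2) s)); auto. intros s Hs.
    assert (l <= s <= u) by (unfold Rmin, Rmax in Hs; destruct (Rle_dec c o2); lra).
    split; [apply Pt_pcont_s; lra|]. apply Hoff_p; auto. intros ->.
    assert (o1 <> c) by (intros ->; auto). unfold Rmin, Rmax in Hs. destruct (Rle_dec c o2); destruct Hc as [-> | ->]; lra. }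
  (* The orbit of [o2] carries the value 0 from just after its start to just before its first return
     at [o1], that is to the incoming side of the section. *)
  assert (W3 : wind L (Pt (- (b/2)) o1) = 0).
  { rewrite <- W2. destruct (Pt_flow 0 o2 (b/2)) as [_ Q1]; try lra. rewrite Rplus_0_l in Q1. rewrite <- Q1.
    assert (Q2 : Phi F (tau2 - b/2) (Pt 0 o2) = Pt (- (b/2)) o1).
    { destruct (flow_split F HF (Pt 0 o2) tau2 (- (b/2))) as [_ S]; [apply O_forward; auto; lra|apply O_forward; auto; lra|].
      rewrite E2 in S. destruct (Pt_flow 0 o1 (- (b/2))) as [_ Q]; try lra. rewrite Q, Rplus_0_l in S. rewrite S. f_equal. }
    rewrite <- Q2. apply (wind_move L z (fun t => Phi F t (Pt 0 o2)) (b/2) (tau2 - b/2)); auto; try lra.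
    - intros t Ht. apply pcont_Phi, O_forward; auto. lra.
    - intros t Ht HL. apply HLpts in HL. destruct HL as [[t' [Ht' E]]|[v [Hv E]]].
      + destruct (flow_split F HF (Pt 0 o2) tau2 t') as [_ S]; [apply O_forward; auto; lra|apply O_forward; auto; lra|].
        rewrite E2, E in S. apply (basin_time_injective HF HA) in S; auto; try (apply O_forward; auto; lra); [lra|].
        apply Pt_nonzero; lra.
      + apply (Hf2 t); [lra|]. split; [lra|]. split; [apply O_forward; auto; lra|].
        exists (o1 + ep * v). split; [apply Hseg; auto|auto]. }
  assert (W4 : forall v, 0 <= v < D -> wind L (Pt (- (b/2)) (o1 + ep * v)) = 0).
  { intros v Hv. rewrite <- W3. replace (Pt (- (b/2)) o1) with (Pt (- (b/2)) (o1 + ep * 0)) by (f_equal; ring).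
    apply (wind_move L z (fun v => Pt (- (b/2)) (o1 + ep * v)) 0 v); auto; try lra.
    - intros w Hw. apply HcP; lra.
    - intros w Hw. apply Hoff_m. lra. }
  (* On the incoming side the value is 0 all along the section part; crossing the section at [c']
     changes it. *)
  assert (Hjump : wind L (Pt (b/2) c') <> 0).
  { assert (J : wind L (g (w0 + d * (Ci * RtoC (b/2)))%C) <> wind L (g (w0 + d * (Ci * RtoC (- (b/2))))%C)).
    { apply (chart_jump w0 d eta b z rest); auto.
      - pose proof (Cmod_pt 0 c') as Hw. fold w0 in Hw. rewrite Rabs_R0 in Hw.
        assert (Rabs c' <= b) by (apply Rabs_le; lra). unfold b in *. lra.
      - intros s Hs HL. rewrite Ep in HL. destruct HL as [P [HP HPz]].
        assert (Hs2 : -b <= sg * ep * s <= b) by (destruct Hsgep as [-> | ->]; lra).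
        destruct HP as [<-|[<-|[<-|[]]]]; destruct HPz as [t [Ht E]].
        + minmax Ht. pose proof (Hseg t ltac:(lra)). apply Pt_inj in E; try lra.
          destruct E as [_ E]. unfold c' in E. destruct Hep as [-> | ->]; lra.
        + minmax Ht. apply NOc'. apply (O_t (sg * ep * s)); try lra. rewrite <- E. apply HAN. lra.
        + minmax Ht. pose proof (Hseg t ltac:(lra)). apply Pt_inj in E; try lra.
          destruct E as [_ E]. unfold c' in E. destruct Hep as [-> | ->]; lra. }
    rewrite !Ep in J. assert (W5 := W4 v' ltac:(lra)). fold c' in W5.
    destruct Hsgep as [Es | Es]; rewrite Es in J.
    - replace (1 * (b/2)) with (b/2) in J by ring. replace (1 * - (b/2)) with (- (b/2)) in J by ring. congruence.
    - replace (-1 * (b/2)) with (- (b/2)) in J by ring. replace (-1 * - (b/2)) with (b/2) in J by ring. congruence. }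
  apply Hjump.
  set (lo := Rmin o1 o0). set (hi := Rmax o1 o0).
  assert (Hlohi : forall s, lo <= s <= hi <-> exists v, 0 <= v <= D /\ o1 + ep * v = s).
  { intros s. unfold lo, hi, D in *. unfold Rmin, Rmax. split.
    - intros Hs. exists (ep * (s - o1)). destruct (Rle_dec o1 o0); destruct Hep as [-> | ->]; lra.
    - intros [v [Hv <-]]. destruct (Rle_dec o1 o0); destruct Hep as [-> | ->]; lra. }
  assert (Hlo : l <= lo /\ hi <= u) by (unfold lo, hi, Rmin, Rmax; destruct (Rle_dec o1 o0); lra).
  destruct (edge_T o1 al1 be1 c') as [T [HT HnT]]; auto; try lra.
  destruct (Pt_half_T c' T) as [HT' HnT']; auto; try lra.
  assert (HcN : forall t, Imax F (Pt 0 c') t -> ~ N (Phi F t (Pt 0 c'))).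
  { intros t HI K. apply (at_flow HA) in K; auto. }
  (* The orbit of [c'] stays outside the basin, so it can meet the loop only in the section. If it
     does, just before that it is on the incoming side, where the value is 0; if not, it escapes.
     Both contradict the jump. *)
  destruct (classic (exists t0, ret lo hi c' t0)) as [[t0 Hr0]|Hnr].
  - destruct (first_return lo hi c' t0) as [t [Hrt Hft]]; auto; try lra.
    pose proof (ret_gap lo hi c' t ltac:(lra) ltac:(lra) ltac:(lra) Hrt) as Hgt.
    destruct Hrt as (Htp & HI & s' & Hs' & E). assert (Hs'' := Hs'). apply Hlohi in Hs''. destruct Hs'' as [v [Hv Ev]].
    assert (HvD : v < D).
    { destruct (Req_dec v D) as [->|]; [|lra]. exfalso. apply (HcN t HI). rewrite E, <- Ev. unfold D.
      replace (o1 + ep * (ep * (o0 - o1))) with o0 by (destruct Hep as [-> | ->]; ring). auto. }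
    rewrite <- (W4 v) by lra. rewrite Ev.
    destruct (Pt_flow 0 c' (b/2)) as [_ Q1]; try lra. rewrite Rplus_0_l in Q1. rewrite <- Q1.
    assert (HIt : forall t', 0 <= t' <= t -> Imax F (Pt 0 c') t').
    { intros t' Ht'. apply (Imax_convex F _ 0 t' t); auto. apply Imax_0; auto. }
    assert (Q2 : Phi F (t - b/2) (Pt 0 c') = Pt (- (b/2)) s').
    { destruct (flow_split F HF (Pt 0 c') t (- (b/2))) as [_ S]; auto; [apply HIt; lra|].
      rewrite E in S. destruct (Pt_flow 0 s' (- (b/2))) as [_ Q]; try lra. rewrite Q, Rplus_0_l in S. rewrite S. f_equal. }
    rewrite <- Q2. symmetry. apply (wind_move L z (fun t => Phi F t (Pt 0 c')) (b/2) (t - b/2)); auto; try lra.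
    + intros t' Ht'. apply pcont_Phi, HIt. lra.
    + intros t' Ht' HL. apply HLpts in HL. destruct HL as [[t2 [Ht2' E']]|[v2 [Hv2 E']]].
      * apply (HcN t'); [apply HIt; lra|]. rewrite <- E'. apply HAN. lra.
      * apply (Hft t'); [lra|]. split; [lra|]. split; [apply HIt; lra|]. exists (o1 + ep * v2). split; auto.
        apply Hlohi. exists v2. auto.
  - apply (wind_blowup HF L z (Pt (b/2) c') (T - b/2)); auto.
    intros t Ht HI HL. destruct (Phi_half c' t) as [J S]; auto; [lra|]. rewrite S in HL.
    apply HLpts in HL. destruct HL as [[t2 [Ht2' E']]|[v2 [Hv2 E']]].
    + apply (HcN (b/2 + t)); auto. rewrite <- E'. apply HAN. lra.
    + apply Hnr. exists (b/2 + t). split; [lra|]. split; auto. exists (o1 + ep * v2). split; auto.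
      apply Hlohi. exists v2. auto.
Qed.

(** If both the basin and its complement accumulated at height 0 from above, all components below a
    certain height would have the length of one fixed component, although components lie in
    arbitrarily short intervals [(0, c)]. *)
Lemma no_accumulation : ~ O 0 -> exists e, 0 < e <= b /\
  ((forall s, 0 < s < e -> O s) \/ (forall s, 0 < s < e -> ~ O s)).
Proof.
  intros N0. pose proof b_pos. apply NNPP. intro Hno.
  assert (Hout : forall e, 0 < e -> exists s, 0 < s < e /\ ~ O s).
  { intros e He. apply NNPP. intro K. apply Hno. exists (Rmin e b). split; [split; [apply Rmin_glb_lt; auto|apply Rmin_r]|].
    left. intros s Hs. apply NNPP. intro K'. apply K. exists s. split; auto. pose proof (Rmin_l e b). lra. }
  assert (Hins : forall e, 0 < e -> exists s, 0 < s < e /\ O s).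
  { intros e He. apply NNPP. intro K. apply Hno. exists (Rmin e b). split; [split; [apply Rmin_glb_lt; auto|apply Rmin_r]|].
    right. intros s Hs K'. apply K. exists s. split; auto. pose proof (Rmin_l e b). lra. }
  destruct (Hout b H) as [h [Hh Nh]]. destruct (Hins h ltac:(lra)) as [o [Ho HO]].
  (* The component of [oJ] never returns. By [nonret_unique] every basin height below it then
     returns to the section from 0 to [be0]. *)
  destruct (last_return 0 h o) as (oJ & HoJ & HOJ & HnJ); auto; try lra.
  destruct (comp_exists 0 h oJ) as (al0 & be0 & HcJ & Hal0 & Hbe0); auto; try lra.
  assert (HcJ' := HcJ). destruct HcJ' as (J1 & J2 & J3 & J4).
  assert (Hal0p : 0 < al0).
  { destruct (Req_dec al0 0) as [Z|]; [|lra]. exfalso. destruct (Hout be0) as [s [Hs Ns]]; [lra|]. apply Ns, J4. lra. }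
  assert (Hsub : forall l u l' u' o, l' <= l -> u <= u' -> nonret l' u' o -> nonret l u o).
  { intros l u l' u' p Hl Hu Hn t (A & B & s & Hs & E). apply (Hn t). split; auto. split; auto. exists s. split; auto. lra. }
  assert (HnJ0 : nonret 0 be0 oJ) by (apply (Hsub 0 be0 0 h); auto; lra).
  destruct (Hins al0 Hal0p) as [oo [Hoo HOo]].
  (* The component of [oK], the one below [al0] that never returns below [al0], provides the
     reference length. *)
  destruct (last_return 0 al0 oo) as (oK & HoK & HOK & HnK); auto; try lra.
  destruct (comp_exists 0 al0 oK) as (alK & beK & HcK & HalK & HbeK); auto; try lra.
  assert (HcK' := HcK). destruct HcK' as (K1 & K2 & K3 & K4).
  assert (Hret : forall p, 0 < p < al0 -> O p -> exists t, ret 0 be0 p t).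
  { intros p Hp HOp. apply NNPP. intro Hn. apply (nonret_unique 0 be0 p oJ al0); auto; try lra.
    intros t Ht. apply Hn. eauto. }
  (* Induction on a bound for the return times in units of [b]: each return uses up more than one
     unit. *)
  assert (Hwidth : forall n p al be, 0 < p < al0 -> comp p al be -> (forall t, ret 0 be0 p t -> t <= INR n * b) ->
     be - al = beK - alK).
  { induction n as [|n IH]; intros p al be Hp Hc Hn.
    - destruct (Hret p Hp) as [t Hr]; [apply Hc; apply Hc|]. specialize (Hn t Hr). simpl in Hn.
      destruct Hr. lra.
    - assert (Hc' := Hc). destruct Hc' as (P1 & P2 & P3 & P4). assert (HOp : O p) by (apply P4; auto).
      assert (Hbd : 0 <= al /\ be <= al0).
      { split; apply Rnot_lt_le; intro; [apply N0, P4; lra|apply J2, P4; lra]. }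
      destruct (Hret p Hp HOp) as [t0 Hr0].
      destruct (first_return 0 be0 p t0) as [t [Hr Hf]]; auto; try lra.
      assert (Hr' := Hr). destruct Hr' as (Htp & HI & s & Hs & E).
      assert (HOs : O s) by (apply (ret_O p t); auto).
      assert (s <> 0) by (intros ->; auto). assert (s <> al0) by (intros ->; auto). assert (s <> be0) by (intros ->; auto).
      pose proof (ret_gap 0 be0 p t ltac:(lra) ltac:(lra) ltac:(lra) Hr) as Hgap.
      (* A first return above [al0] ends in the component of [oJ], so [p] never returns below [al0]
         and shares the component of [oK]. Otherwise [return_width] compares [p] with its first
         return, which has fewer units left. *)
      destruct (Rlt_dec al0 s) as [Hlt|Hge].
      + assert (Hnp : nonret 0 al0 p).
        { intros t' Hr'. assert (Hr'' : ret 0 be0 p t').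
          { destruct Hr' as (Q1 & Q2 & s2 & Q3 & Q4). split; auto. split; auto. exists s2. split; auto. lra. }
          destruct (Rtotal_order t' t) as [Hlt'|[->|Hgt']].
          - apply (Hf t'); auto.
          - destruct Hr' as (Q1 & Q2 & s2 & Q3 & Q4). rewrite E in Q4. apply Pt_inj in Q4; lra.
          - apply (nonret_comp 0 be0 oJ al0 be0 s) with (t := t' - t); auto; try lra.
            apply (ret_decompose 0 be0 p s t t'); auto. }
        assert (Hsame : al < oK < be).
        { apply NNPP. intro Hns.
          destruct (Rlt_dec oK p).
          - assert (oK <= al) by (apply Rnot_lt_le; intro; apply Hns; lra).
            assert (oK <> al) by (intros ->; auto).
            apply (nonret_unique 0 al0 oK p al); auto; try lra.
          - assert (be <= oK) by (apply Rnot_lt_le; intro; apply Hns; lra).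
            assert (oK <> be) by (intros ->; auto).
            apply (nonret_unique 0 al0 p oK be); auto; try lra. }
        destruct (comp_unique p al be oK alK beK Hc HcK Hsame) as [-> ->]. auto.
      + assert (Hsr : 0 < s < al0) by lra.
        destruct (comp_exists 0 al0 s) as (als & bes & Hcs & Hals & Hbes); auto; try lra.
        assert (Hws : bes - als = beK - alK).
        { apply (IH s als bes); auto. intros t' Hr'.
          pose proof (ret_compose 0 be0 p s t t' HI Htp E Hr') as Hcm. specialize (Hn _ Hcm). rewrite S_INR in Hn. lra. }
        destruct (Hret s Hsr HOs) as [t2 Hr2].
        destruct (first_return 0 be0 s t2) as [t1 [Hr1 Hf1]]; auto; try lra.
        assert (Hr1' := Hr1). destruct Hr1' as (Ht1 & HI1 & s0 & Hs0 & E1).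
        rewrite <- Hws. apply (return_width 0 be0 p s s0 al be als bes t t1); auto; lra. }
  destruct (Hout (Rmin al0 (beK - alK))) as [c [Hc Nc]]; [apply Rmin_glb_lt; lra|].
  assert (c < al0) by (apply (Rlt_Rmin_l (proj2 Hc))).
  assert (c < beK - alK) by (apply (Rlt_Rmin_r (proj2 Hc))).
  destruct (Hins c ltac:(lra)) as [p [Hp HOp]].
  destruct (comp_exists 0 c p) as (al & be & Hcp & Hal & Hbe); auto; try lra.
  destruct (ret_bounded 0 be0 p ltac:(lra) ltac:(lra) HOp) as [T HT].
  destruct (INR_unbounded (T / b)) as [n Hn].
  assert (be - al = beK - alK).
  { apply (Hwidth n p); auto; try lra. intros t Hr. specialize (HT t Hr). apply Rlt_div_l in Hn; lra. }
  lra.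
Qed.
End FlowBox.

Arguments Pt : clear implicits.
Arguments O : clear implicits.

Lemma sign_abs s : exists sg, (sg = 1 \/ sg = -1) /\ s = sg * Rabs s.
Proof. destruct (Rle_dec 0 s); [exists 1|exists (-1)]; (split; [auto|]); [rewrite Rabs_pos_eq|rewrite Rabs_left]; lra. Qed.

Lemma Pt_origin {F x g rho} sg : chart F x g rho -> Pt g sg 0 0 = x.
Proof. intros Hg. unfold Pt. rewrite Rmult_0_r. apply (chart_0 Hg). Qed.

(** * Orbits on the boundary of the basin *)

Section Frontier.
Context {F : C -> C} (HF : holo F) {a : C} {N : C -> Prop} (HA : attracting F a N).

Definition frontier (x : C) : Prop := ~ N x /\ forall d, 0 < d -> exists y, Cmod (y - x) < d /\ N y.

Lemma frontier_closed x : ~ frontier x -> exists d, 0 < d /\ forall y, Cmod (y - x) < d -> ~ frontier y.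
Proof.
  intros H. destruct (classic (N x)) as [HN|HN].
  - destruct (at_open HA x HN) as [d [Hd K]]. exists d. split; auto. intros y Hy [Hn _]. auto.
  - assert (Hd : exists d, 0 < d /\ forall y, Cmod (y - x) < d -> ~ N y).
    { apply NNPP. intro K. apply H. split; auto. intros d Hd. apply NNPP. intro K'. apply K.
      exists d. split; auto. intros y Hy HNy. apply K'. eauto. }
    destruct Hd as [d [Hd K]]. exists (d/2). split; [lra|]. intros y Hy [_ Hf].
    destruct (Hf (d/2)) as [z [Hz HNz]]; [lra|]. apply (K z); auto. pose proof (Cmod_tri z y x). lra.
Qed.

Lemma frontier_limit x : (forall d, 0 < d -> exists y, Cmod (y - x) < d /\ frontier y) -> frontier x.
Proof.
  intros H. apply NNPP. intro Hn. destruct (frontier_closed x Hn) as [d [Hd K]].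
  destruct (H d Hd) as [y [Hy Hf]]. apply (K y); auto.
Qed.

Lemma frontier_flow x t : Imax F x t -> frontier x -> frontier (Phi F t x).
Proof.
  intros HI [Hn Hf]. split; [intro K; apply Hn, (at_flow HA x t HI), K|].
  intros d Hd. destruct (Phi_cont F HF x t HI d Hd) as [d1 [Hd1 K]].
  destruct (Hf d1 Hd1) as [y [Hy HN]]. destruct (K y t Hy) as [HIy Hc]; [rewrite Rminus_diag, Rabs_R0; auto|].
  exists (Phi F t y). split; auto. apply (at_flow HA); auto.
Qed.

Lemma frontier_crossing (p : R -> C) s0 s1 : s0 <= s1 -> (forall s, s0 <= s <= s1 -> pcont p s) ->
  ~ (N (p s0) <-> N (p s1)) -> exists s, s0 <= s <= s1 /\ frontier (p s).
Proof.
  intros H01 Hp Hne. apply NNPP. intro Hno. apply Hne.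
  apply (interval_connected (fun s => N (p s)) s0 s1 H01). intros t Ht.
  assert (Hd : exists d, 0 < d /\ forall z, Cmod (z - p t) < d -> (N z <-> N (p t))).
  { destruct (classic (N (p t))) as [HN|HN].
    - destruct (at_open HA _ HN) as [d [Hd K]]. exists d. split; auto. intros z Hz. specialize (K z Hz). tauto.
    - apply NNPP. intro K. apply Hno. exists t. split; auto. split; auto. intros d Hd. apply NNPP. intro K'.
      apply K. exists d. split; auto. intros z Hz. split; [intro HNz; exfalso; apply K'; eauto|tauto]. }
  destruct Hd as [d [Hd K]]. destruct (Hp t Ht d Hd) as [d1 [Hd1 K1]]. exists d1. split; auto.
  intros u _ Hu. apply K, K1. rewrite Cmod_RtoC_minus. auto.
Qed.

(** A basin point close to [x] in the flow box is moved along its own orbit to the section through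
    [x], which is an arc of the imaginary-time orbit. *)
Lemma frontier_rot x d : frontier x -> F x <> 0 -> 0 < d ->
  exists s, 0 < Rabs s < d /\ Imax (rotf F) x s /\ N (Phi (rotf F) s x).
Proof.
  intros [Hn Hf] Hx Hd. destruct (chart_exists F x HF Hx) as [g [rho Hg]]. pose proof (chart_pos Hg).
  set (e := Rmin d (rho / 4)). assert (He : 0 < e) by (apply Rmin_glb_lt; lra).
  assert (e <= d) by apply Rmin_l. assert (e <= rho / 4) by apply Rmin_r.
  destruct (chart_open Hg e He) as [d1 [Hd1 K]].
  destruct (Hf d1 Hd1) as [y [Hy HN]]. destruct (K y Hy) as ([t s] & Hw & _ & E).
  pose proof (Re_le_Cmod (t, s)) as Hr. pose proof (Im_le_Cmod (t, s)) as Hi. simpl in Hr, Hi.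
  assert (Ht := Rabs_def2 t e ltac:(lra)). assert (Hs := Rabs_def2 s e ltac:(lra)).
  assert (Ep : Pt g 1 t s = y) by (unfold Pt; rewrite Rmult_1_l; auto).
  assert (HO : N (Pt g 1 0 s)).
  { apply (O_t HF HA Hg 1) with (t := t); auto; try lra. rewrite Ep. auto. }
  assert (E0 := Pt_origin 1 Hg).
  destruct (Pt_rot HF Hg 1 (or_introl eq_refl) 0 0 s) as [A B]; try lra.
  rewrite E0, Rmult_1_l in A, B. rewrite Rplus_0_l in B. exists s. rewrite B. split; auto.
  split; [|lra]. apply Rabs_pos_lt. intros ->. apply Hn. rewrite <- E0. auto.
Qed.

Definition side (g : C -> C) (sg e : R) : Prop := forall s, 0 < s < e -> N (Pt g sg 0 s).

Lemma frontier_sides x g rho : frontier x -> F x <> 0 -> chart F x g rho ->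
  exists e, 0 < e <= rho / 4 /\
  (forall sg, sg = 1 \/ sg = -1 -> side g sg e \/ forall s, 0 < s < e -> ~ N (Pt g sg 0 s)).
Proof.
  intros Hf Hx Hg.
  assert (H0 : forall sg, ~ O N g sg 0).
  { intros sg HO. apply Hf. rewrite <- (Pt_origin sg Hg). auto. }
  destruct (no_accumulation HF HA Hg 1 ltac:(auto) (H0 1)) as [e1 [He1 K1]].
  destruct (no_accumulation HF HA Hg (-1) ltac:(auto) (H0 (-1))) as [e2 [He2 K2]].
  exists (Rmin e1 e2). split; [split; [apply Rmin_glb_lt; lra|]; eapply Rle_trans; [apply Rmin_l|lra]|].
  pose proof (Rmin_l e1 e2). pose proof (Rmin_r e1 e2).
  intros sg [-> | ->]; [destruct K1 as [K|K]|destruct K2 as [K|K]]; [left|right|left|right]; intros s Hs; apply K; lra.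
Qed.

(** [frontier_rot] finds a basin point in the section, which by the dichotomy of [frontier_sides]
    fills its whole side. *)
Lemma frontier_side x g rho : frontier x -> F x <> 0 -> chart F x g rho ->
  exists sg e, (sg = 1 \/ sg = -1) /\ 0 < e <= rho / 4 /\ side g sg e.
Proof.
  intros Hf Hx Hg. destruct (frontier_sides x g rho Hf Hx Hg) as [e [He K]].
  destruct (frontier_rot x e Hf Hx ltac:(lra)) as (s & Hs & HI & HN).
  assert (E : forall sg u, sg = 1 \/ sg = -1 -> 0 < u < e -> Phi (rotf F) (sg * u) x = Pt g sg 0 u).
  { intros sg u Hsg Hu. destruct (Pt_rot HF Hg sg Hsg 0 0 u) as [_ B]; try lra.
    rewrite (Pt_origin sg Hg) in B. rewrite B. f_equal; ring. }
  destruct (sign_abs s) as (sg & Hsg & Es). exists sg, e. split; auto. split; auto.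
  destruct (K sg Hsg) as [K'|K']; auto. exfalso. apply (K' (Rabs s) Hs). rewrite <- E, <- Es by auto. auto.
Qed.

Lemma frontier_blowup x : frontier x -> F x <> 0 -> exists T, 0 < T /\ ~ Imax F x T.
Proof.
  intros Hf Hx. destruct (chart_exists F x HF Hx) as [g [rho Hg]].
  destruct (frontier_side x g rho Hf Hx Hg) as (sg & e & Hsg & He & K).
  apply (at_edge HA x (sg * (e/2))); auto; [apply Hf|].
  intros th Hth. replace (th * (sg * (e/2))) with (sg * (th * (e/2))) by ring.
  destruct (Pt_rot HF Hg sg Hsg 0 0 (th * (e/2))) as [A B]; try lra; [nra|].
  rewrite (Pt_origin sg Hg) in A, B. split; auto. rewrite B, Rplus_0_l. apply K. nra.
Qed.

Lemma frontier_time_unique x s t : frontier x -> F x <> 0 -> Imax F x s -> Imax F x t ->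
  Phi F s x = Phi F t x -> s = t.
Proof.
  intros Hf Hx. apply time_injective; auto. intros u Hu HI E.
  destruct (frontier_blowup x Hf Hx) as [T [HT Hn]]. destruct (INR_unbounded (T / u)) as [n Hn']. apply Hn.
  destruct (periodic_times F x u HF HI E n) as [I _].
  apply (Imax_convex F x 0 T (INR n * u)); auto; [apply Imax_0; auto|]. apply Rlt_div_l in Hn'; lra.
Qed.

(** Every boundary point near [x] has height 0. Brought to the section at another height, it would
    lie in the basin on a full side, and on an empty side it would be a limit of basin points of
    that same side. *)
Lemma frontier_local x eps : frontier x -> F x <> 0 -> 0 < eps -> exists d, 0 < d /\
  forall y, frontier y -> Cmod (y - x) < d -> exists t, Rabs t < eps /\ Imax F x t /\ y = Phi F t x.
Proof.
  intros Hf Hx Heps. destruct (chart_exists F x HF Hx) as [g [rho Hg]].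
  destruct (frontier_sides x g rho Hf Hx Hg) as [e [He K]].
  set (e1 := Rmin eps (e/2)). assert (He1 : 0 < e1) by (apply Rmin_glb_lt; lra).
  assert (e1 <= eps) by apply Rmin_l. assert (e1 <= e/2) by apply Rmin_r.
  destruct (chart_open Hg e1 He1) as [d [Hd Ko]]. exists d. split; auto.
  intros y Hfy Hy. destruct (Ko y Hy) as ([t s] & Hw & _ & E).
  pose proof (Re_le_Cmod (t, s)) as Hr. pose proof (Im_le_Cmod (t, s)) as Hi. simpl in Hr, Hi.
  assert (Ht := Rabs_def2 t e1 ltac:(lra)).
  destruct (sign_abs s) as (sg & Hsg & Es). pose proof (Rabs_pos s).
  assert (Ep : Pt g sg t (Rabs s) = y) by (unfold Pt; rewrite <- Es; auto).
  assert (E0 := Pt_origin sg Hg).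
  destruct (Pt_flow HF Hg sg Hsg t (Rabs s) (- t)) as [A1 B1]; try lra. rewrite Ep in A1, B1.
  replace (t + - t) with 0 in B1 by ring.
  assert (Hf0 : frontier (Pt g sg 0 (Rabs s))) by (rewrite <- B1; apply frontier_flow; auto).
  destruct (Req_dec s 0) as [Hs0|Hs0].
  - exists t. split; [lra|]. subst s. rewrite Rabs_R0 in *.
    destruct (Pt_flow HF Hg sg Hsg 0 0 t) as [A B]; try lra. rewrite E0 in A, B. rewrite Rplus_0_l in B.
    split; auto. rewrite B. auto.
  - exfalso. assert (Hsp := Rabs_pos_lt s Hs0).
    destruct (K sg Hsg) as [K'|K']; [apply Hf0, K'; lra|].
    destruct (frontier_rot (Pt g sg 0 (Rabs s)) (Rmin (Rabs s) (e/2)) Hf0) as (u & Hu & HI & HN).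
    + apply (Pt_nonzero HF Hg sg Hsg). lra.
    + apply Rmin_glb_lt; lra.
    + assert (U1 := Rlt_Rmin_l (proj2 Hu)). assert (U2 := Rlt_Rmin_r (proj2 Hu)).
      assert (Hsu : -(e/2) < sg * u < e/2 /\ - Rabs s < sg * u) by (apply Rabs_def2 in U1, U2; destruct Hsg as [-> | ->]; lra).
      destruct (Pt_rot HF Hg sg Hsg 0 (Rabs s) (sg * u)) as [_ B]; try lra.
      replace (sg * (sg * u)) with u in B by (destruct Hsg as [-> | ->]; ring). rewrite B in HN.
      apply (K' (Rabs s + sg * u)); auto. lra.
Qed.

(** An equilibrium emanates from itself in this sense, so that equilibria and the orbits leaving
    them can be treated alike. *)
Definition emanates (x e : C) : Prop :=
  F e = 0 /\ (forall t, t <= 0 -> Imax F x t) /\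
  forall eps, 0 < eps -> exists T, 0 <= T /\ forall t, t <= - T -> Cmod (Phi F t x - e) < eps.

(** Up to the end the path stays on the orbit of its starting point, by [frontier_local]. Its time
    parameter is bounded above, because the orbit blows up forwards while the path is bounded, and
    it leaves every compact range of times, because the path approaches [e]. So it tends to the
    lower end of the orbit, which is infinite again by boundedness. *)
Lemma path_into_equilibrium (p : R -> C) s0 s1 e : s0 < s1 ->
  (forall s, s0 <= s <= s1 -> pcont p s /\ frontier (p s)) ->
  (forall s, s0 <= s < s1 -> F (p s) <> 0) -> p s1 = e -> F e = 0 -> emanates (p s0) e.
Proof.
  intros H01 Hp Hnz E1 He. set (y := p s0). assert (Hy : F y <> 0) by (apply Hnz; lra).
  assert (Hfy : frontier y) by (apply Hp; lra).
  (* [t] is the time at which the orbit of [y] is at [p s]; it is unique since the orbit is not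
     periodic. *)
  set (rel := fun s t => Imax F y t /\ p s = Phi F t y).
  assert (Huniq : forall s t t', rel s t -> rel s t' -> t = t').
  { intros s t t' [A B] [A' B']. apply (frontier_time_unique y); auto. congruence. }
  assert (Hshift : forall s s' t de, rel s t -> Imax F (p s) de -> p s' = Phi F de (p s) -> rel s' (t + de)).
  { intros s s' t de [A B] HI E. rewrite B in HI, E. assert (J : Imax F y (t + de)) by (apply flow_join; auto).
    split; auto. rewrite E. apply flow_split; auto. }
  assert (Hloc : forall s eps, s0 <= s < s1 -> 0 < eps -> exists d, 0 < d /\ forall s', s0 <= s' < s1 -> Rabs (s' - s) < d ->
     exists de, Rabs de < eps /\ Imax F (p s) de /\ p s' = Phi F de (p s)).
  { intros s eps Hs Heps. destruct (Hp s) as [Hc Hf]; [lra|].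
    destruct (frontier_local (p s) eps Hf (Hnz s Hs) Heps) as [d1 [Hd1 K1]].
    destruct (Hc d1 Hd1) as [d [Hd K]]. exists d. split; auto. intros s' Hs' Hss. apply K1; [apply Hp; lra|].
    apply K. rewrite Cmod_RtoC_minus. auto. }
  assert (Hrev : forall s s' t de, rel s' t -> Imax F (p s) de -> p s' = Phi F de (p s) -> rel s (t - de)).
  { intros s s' t de Hr HI E. destruct (flow_back F HF (p s) de HI) as [A B]. rewrite <- E in A, B.
    apply (Hshift s' s t (- de)); auto. }
  assert (R0 : rel s0 0) by (split; [apply Imax_0; auto|rewrite Phi_0; auto]).
  assert (Hex : forall s, s0 <= s < s1 -> exists t, rel s t).
  { intros s Hs. apply (interval_connected (fun v => exists t, rel v t) s0 s); [lra| |eauto].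
    intros v Hv. destruct (Hloc v 1 ltac:(lra) Rlt_0_1) as [d [Hd K]]. exists d. split; auto. intros u Hu Huv.
    destruct (K u ltac:(lra) Huv) as (de & _ & A & B). split; intros [t Ht]; eauto. }
  destruct (path_bounded p s0 s1) as [M [HM KM]]; [intros; apply Hp; auto|].
  destruct (frontier_blowup y Hfy Hy) as [T [HT HnT]]. destruct (first_exit F HF y T HT HnT) as [T1 [HT1 [HI1 Hn1]]].
  destruct (blowup F HF y T1 HI1 Hn1 (proj1 HT1) M) as [t1 [Ht1 Kt1]].
  assert (Hup : forall s t, s0 <= s < s1 -> rel s t -> t < t1).
  { intros s t Hs [A B]. apply Rnot_le_lt. intro Hle. destruct (Rlt_dec t T1).
    - specialize (Kt1 t ltac:(lra)). rewrite <- B in Kt1. specialize (KM s ltac:(lra)). lra.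
    - apply Hn1. apply (Imax_convex F y 0 T1 t); auto; [apply Imax_0; auto|lra]. }
  assert (Hnear : forall eps, 0 < eps -> exists s, s0 <= s < s1 /\ forall s', s <= s' <= s1 -> Cmod (p s' - e) < eps).
  { intros eps Heps. destruct (Hp s1 ltac:(lra)) as [Hc _]. destruct (Hc eps Heps) as [d [Hd K]].
    exists (Rmax s0 (s1 - d/2)). split; [split; [apply Rmax_l|apply Rmax_lub_lt; lra]|].
    intros s' Hs'. pose proof (Rmax_r s0 (s1 - d/2)). rewrite <- E1. apply K. rewrite Cmod_RtoC_minus.
    apply Rabs_def1; lra. }
  assert (Hdown : forall p0, Imax F y p0 -> p0 <= t1 -> exists s, s0 <= s < s1 /\ forall t, rel s t -> t < p0).
  { intros p0 HI0 Hp0. destruct (curve_avoid (fun t => Phi F t y) p0 t1 e) as [d [Hd K]].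
    - intros t Ht. apply Phi_pcont; auto. apply (Imax_convex F y p0 t t1); auto.
    - intros t Ht E. apply (flow_nonzero F HF y t); auto; [|rewrite E; auto].
      apply (Imax_convex F y p0 t t1); auto.
    - destruct (Hnear d Hd) as [s [Hs Ks]]. exists s. split; auto. intros t Hr. pose proof (Hup s t Hs Hr).
      apply Rnot_le_lt. intro Hle. specialize (K t ltac:(lra)). specialize (Ks s ltac:(lra)).
      destruct Hr as [_ B]. rewrite <- B in K. lra. }
  assert (HI : forall t, t <= 0 -> Imax F y t).
  { intros t Ht. apply NNPP. intro Hn.
    assert (Ht0 : t < 0) by (destruct (Req_dec t 0) as [->|]; [exfalso; apply Hn, Imax_0; auto|lra]).
    assert (Hn' : ~ Imax (negf F) y (- t)) by (rewrite Imax_negf, Ropp_involutive; auto).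
    pose proof (holo_negf F HF) as HN.
    destruct (first_exit _ HN y (- t) ltac:(lra) Hn') as [T2 [HT2 [HI2 Hn2]]].
    destruct (blowup _ HN y T2 HI2 Hn2 (proj1 HT2) M) as [t2 [Ht2 Kt2]].
    destruct (Hdown (- t2)) as [s [Hs Ks]]; [apply Imax_negf, HI2; lra|lra|].
    destruct (Hex s Hs) as [v Hv]. specialize (Ks v Hv). destruct Hv as [A B].
    assert (- v < T2).
    { apply Rnot_le_lt. intro. apply Hn2, Imax_negf. apply (Imax_convex F y v (- T2) 0); auto; [apply Imax_0; auto|lra]. }
    specialize (Kt2 (- v) ltac:(lra)). rewrite Phi_negf in Kt2 by (auto; rewrite Ropp_involutive; auto).
    rewrite Ropp_involutive, <- B in Kt2. specialize (KM s ltac:(lra)). lra. }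
  split; auto. split; auto. intros eps Heps. destruct (Hnear eps Heps) as [s2 [Hs2 K2]].
  (* A lower bound for the time parameter before [s2]: earlier times are attained only where the
     path is already close to [e]. *)
  destruct (compact_interval (fun d s => forall t, rel s t -> - (1/d) < t) s0 s2) as [d [Hd K]].
  { intros d d' s Hd' Hle HQ t Ht. specialize (HQ t Ht).
    assert (1/d <= 1/d') by (unfold Rdiv; rewrite !Rmult_1_l; apply Rinv_le_contravar; lra). lra. }
  { intros s Hs. destruct (Hex s ltac:(lra)) as [t Ht]. destruct (Hloc s 1 ltac:(lra) Rlt_0_1) as [d1 [Hd1 K1]].
    pose proof (Rabs_pos t). exists (Rmin d1 (1 / (Rabs t + 2))).
    assert (Hp2 : 0 < 1 / (Rabs t + 2)) by (apply Rdiv_lt_0_compat; lra).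
    split; [apply Rmin_glb_lt; auto|]. intros u Hu Hus v Hv.
    destruct (K1 u ltac:(lra) (Rlt_Rmin_l Hus)) as (de & Hde & A & B).
    rewrite (Huniq u v (t + de) Hv (Hshift s u t de Ht A B)). apply Rabs_def2 in Hde.
    assert (Rabs t + 2 <= 1 / Rmin d1 (1 / (Rabs t + 2))).
    { apply Rle_div_r; [apply Rmin_glb_lt; auto|].
      pose proof (Rmin_r d1 (1 / (Rabs t + 2))) as Hm. apply Rle_div_r in Hm; lra. }
    pose proof (Rle_abs (- t)). rewrite Rabs_Ropp in H1. lra. }
  assert (Hd' : 0 < 1/d) by (apply Rdiv_lt_0_compat; lra).
  exists (1/d). split; [lra|]. intros t Ht.
  destruct (Hdown t) as [s3 [Hs3 K3]]; [apply HI; lra|lra|].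
  (* An intermediate value argument: the time parameter moves continuously from 0 to below [t]. *)
  assert (Hatt : exists s, s0 <= s <= s3 /\ rel s t).
  { apply NNPP. intro Hno.
    assert (Hne : forall s v, s0 <= s <= s3 -> rel s v -> v <> t) by (intros s v Hs Hr ->; apply Hno; eauto).
    destruct (Hex s3 Hs3) as [v3 Hv3].
    assert (X : forall v, rel s3 v -> t < v).
    2:{ specialize (X v3 Hv3). specialize (K3 v3 Hv3). lra. }
    apply (interval_connected (fun s => forall v, rel s v -> t < v) s0 s3); [lra| |].
    2:{ intros v Hv. rewrite (Huniq s0 v 0); auto. lra. }
    intros s Hs. destruct (Hex s ltac:(lra)) as [v Hv]. specialize (Hne s v Hs Hv).
    destruct (Hloc s (Rabs (v - t)) ltac:(lra)) as [d1 [Hd1 K1]]; [apply Rabs_pos_lt; lra|].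
    exists d1. split; auto. intros u Hu Hus. destruct (K1 u ltac:(lra) Hus) as (de & Hde & A & B).
    pose proof (Hshift s u v de Hv A B) as Hvu. split; intros H w Hw.
    - rewrite (Huniq s w v Hw Hv). specialize (H _ Hvu). apply Rnot_le_lt. intro.
      rewrite (Rabs_left1 (v - t)) in Hde by lra. apply Rabs_def2 in Hde. lra.
    - rewrite (Huniq u w _ Hw Hvu). specialize (H v Hv). rewrite (Rabs_pos_eq (v - t)) in Hde by lra. apply Rabs_def2 in Hde. lra. }
  destruct Hatt as [s [Hs Hr]]. destruct (Rle_dec s s2).
  - specialize (K s ltac:(lra) t Hr). lra.
  - destruct Hr as [_ B]. fold y. rewrite <- B. apply K2. lra.
Qed.

(* The image of a small circle around [e] would shrink to a neighbourhood of
   [a] without crossing [e]. *)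
Lemma punctured_disc e d : F e = 0 -> ~ N e -> 0 < d -> (forall z, 0 < Cmod (z - e) < d -> N z) -> False.
Proof.
  intros He HnN Hd Hin.
  assert (Hae : a <> e).
  { intros E. apply HnN. destruct (at_near HA) as [ra [Hra Kra]]. apply Kra. rewrite <- E, Cmod_self. auto. }
  assert (Hae' : (a - e <> 0)%C) by (apply Cminus_eq_contra; auto).
  set (r1 := Cmod (a - e) / 2). pose proof (proj1 (Cmod_gt_0 _) Hae') as Hm.
  set (c := fun th : R => (e + RtoC (d/2) * cexp (Ci * RtoC th))%C).
  assert (Hdc : RtoC (d/2) <> 0) by (intro E; apply RtoC_inj in E; lra).
  assert (Hce : forall th, Cmod (c th - e) = d/2).
  { intros th. unfold c. match goal with |- Cmod ?x = _ => replace x with (RtoC (d/2) * cexp (Ci * RtoC th))%C by ring end.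
    rewrite Cmod_mult, Cmod_R, Rabs_pos_eq, Cmod_cexp_lin by lra. replace (Re Ci * th) with 0 by (simpl; ring). rewrite exp_0. ring. }
  assert (Hcc : forall th, pcont c th).
  { intros th. unfold c. apply cont_plus; [apply cont_const|]. apply cont_mult; [apply cont_const|].
    eapply der_cont, rder_cexp_lin. }
  assert (HcN : forall th, N (c th)) by (intros th; apply Hin; rewrite Hce; lra).
  destruct (at_stable HA r1) as [d1 [Hd1 Ks]]; [unfold r1; lra|].
  destruct (compact_interval (fun d th => forall t, 1/d <= t -> Imax F (c th) t /\ Cmod (Phi F t (c th) - a) < r1) 0 (2 * PI)) as [d2 [Hd2 K2]].
  { intros d0 d0' th Hd' Hle HQ t Ht. apply HQ. eapply Rle_trans; [|apply Ht]. unfold Rdiv. rewrite !Rmult_1_l. apply Rinv_le_contravar; lra. }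
  { intros th _. destruct (at_tends HA _ (HcN th) (d1/2)) as [T [HT K]]; [lra|].
    destruct (K T (Rle_refl _)) as [HI HTd]. destruct (Phi_cont F HF _ T HI (d1/2)) as [d3 [Hd3 K3]]; [lra|].
    destruct (Hcc th d3 Hd3) as [d4 [Hd4 K4]]. exists (Rmin d4 (1/(T+1))).
    assert (Hp2 : 0 < 1/(T+1)) by (apply Rdiv_lt_0_compat; lra).
    split; [apply Rmin_glb_lt; auto|]. intros u _ Hu t Ht.
    assert (HTt : T < t).
    { assert (T + 1 <= 1 / Rmin d4 (1/(T+1))); [|lra].
      apply Rle_div_r; [apply Rmin_glb_lt; auto|]. pose proof (Rmin_r d4 (1/(T+1))) as Hm2. apply Rle_div_r in Hm2; lra. }
    destruct (K3 (c u) T) as [A B].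
    { apply K4. rewrite Cmod_RtoC_minus. apply (Rlt_Rmin_l Hu). }
    { rewrite Rminus_diag, Rabs_R0. auto. }
    destruct (Ks (Phi F T (c u))) with (t := t - T) as [A2 B2]; [|lra|].
    { pose proof (Cmod_tri (Phi F T (c u)) (Phi F T (c th)) a). lra. }
    assert (J : Imax F (c u) (T + (t - T))) by (apply flow_join; auto).
    destruct (flow_split F HF _ T (t - T) A J) as [_ S]. rewrite S in B2. replace (T + (t - T)) with t in * by ring. auto. }
  set (T := 1/d2). assert (HT : 0 < T) by (apply Rdiv_lt_0_compat; lra). pose proof PI_RGT_0.
  assert (HI : forall t th, 0 <= t <= T -> 0 <= th <= 2 * PI -> Imax F (c th) t).
  { intros t th Ht Hth. destruct (K2 th Hth T (Rle_refl _)) as [A _].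
    apply (Imax_convex F _ 0 t T); auto. apply Imax_0; auto. }
  (* The homotopy that moves the circle by the flow up to time [T]. It never meets the equilibrium
     [e], so the increment of its logarithm around the rectangle vanishes. *)
  set (f := fun z => (Phi F (Re z) (c (Im z)) - e)%C).
  assert (E : dRect f 0 T 0 (2 * PI) = 0).
  { apply dRect_zero; try lra. intros z [Hz1 Hz2]. specialize (HI _ _ Hz1 Hz2). split.
    - intros eps Heps. destruct (Phi_cont F HF _ _ HI eps Heps) as [d3 [Hd3 K3]].
      destruct (Hcc (Im z) d3 Hd3) as [d4 [Hd4 K4]]. exists (Rmin d3 d4). split; [apply Rmin_glb_lt; auto|].
      intros w Hw. unfold f, cid in *. replace (Phi F (Re w) (c (Im w)) - e - (Phi F (Re z) (c (Im z)) - e))%C with (Phi F (Re w) (c (Im w)) - Phi F (Re z) (c (Im z)))%C by ring.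
      apply K3.
      + apply K4. rewrite Cmod_RtoC_minus, <- Im_minus. eapply Rle_lt_trans; [apply Im_le_Cmod|].
        apply (Rlt_Rmin_r Hw).
      + rewrite <- Re_minus. eapply Rle_lt_trans; [apply Re_le_Cmod|]. apply (Rlt_Rmin_l Hw).
    - unfold f. apply Cminus_eq_contra. intro E. destruct (flow_back F HF _ _ HI) as [_ B].
      rewrite E, Phi_equilibrium in B by auto. pose proof (Hce (Im z)) as Q. rewrite <- B, Cmod_self in Q. lra. }
  unfold dRect in E. simpl in E.
  assert (Ec : c (2 * PI) = c 0).
  { unfold c. do 2 f_equal. unfold cexp. simpl. replace (0 * (2 * PI) - 1 * 0) with 0 by ring. replace (0 * 0 - 1 * 0) with 0 by ring.
    replace (0 * 0 + 1 * (2 * PI)) with (2 * PI) by ring. replace (0 * 0 + 1 * 0) with 0 by ring.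
    rewrite sin_2PI, cos_2PI, sin_0, cos_0. auto. }
  assert (D1 : Del (fun s => f (s, 2 * PI)) 0 T = Del (fun s => f (s, 0)) 0 T).
  { apply Del_ext. intros t Ht. unfold f. simpl. rewrite Ec. auto. }
  (* At time [T] the image lies in the disc around [a] of half the distance to [e], hence in a
     half-plane seen from [e], and the closed curve has increment 0. *)
  assert (D2 : Del (fun t => f (T, t)) 0 (2 * PI) = 0).
  { destruct (cexp_surjective _ Hae') as [w0 Hw0].
    assert (Hpos : forall t, 0 <= t <= 2 * PI -> 0 < Re (f (T, t) / (a - e))%C).
    { intros t Ht. destruct (K2 t Ht T (Rle_refl _)) as [_ B].
      assert (Q : Cmod (f (T, t) / (a - e) - 1) < 1).
      { replace (f (T, t) / (a - e) - 1)%C with ((Phi F T (c t) - a) / (a - e))%C by (unfold f; simpl; field; auto).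
        rewrite Cmod_div by auto. apply Rlt_div_l; auto. unfold r1 in B. lra. }
      pose proof (Re_le_Cmod (f (T, t) / (a - e) - 1)) as Q2. rewrite Re_minus in Q2. simpl (Re 1) in Q2.
      assert (Q3 := Rabs_def2 _ _ (Rle_lt_trans _ _ _ Q2 Q)). lra. }
    rewrite (Del_eq _ _ _ (fun t => clog (f (T, t) / (a - e)) + w0)%C).
    - unfold f. simpl. rewrite Ec. ring.
    - intros t Ht. minmax Ht. split.
      + apply cont_plus; [|apply cont_const].
        apply (cont_comp RtoC cid (fun t => f (T, t) / (a - e))%C clog); [|apply ccont_clog; auto].
        apply cont_mult; [|apply cont_const]. unfold f. simpl. apply cont_minus; [|apply cont_const].
        apply (cont_comp RtoC cid c (Phi F T)); [apply Hcc|apply Phi_ccont; auto; apply HI; lra].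
      + rewrite cexp_plus, cexp_clog, Hw0 by auto. field. auto. }
  assert (D3 : Del (fun t => f (0, t)) 0 (2 * PI) = (Ci * RtoC (2 * PI))%C).
  { destruct (cexp_surjective _ Hdc) as [w0 Hw0].
    rewrite (Del_eq _ _ _ (fun t => w0 + Ci * RtoC t)%C); [ring|].
    intros t Ht. split.
    - apply cont_plus; [apply cont_const|apply cont_mult; [apply cont_const|apply cont_self]].
    - rewrite cexp_plus, Hw0. unfold f. simpl. rewrite Phi_0 by auto. unfold c. ring. }
  rewrite D1, D2, D3 in E. apply (f_equal Im) in E. unfold Re, Im, Cminus, Cplus, Copp, Cmult, Ci, RtoC in E. simpl in E. lra.
Qed.

(** A point of the basin and one outside it, supplied by [punctured_disc], are joined by a segment
    in the logarithm of [z - e]. Its image avoids [e] and stays in the disc, so it crosses the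
    boundary there. *)
Lemma frontier_near_equilibrium e d : F e = 0 -> frontier e -> 0 < d ->
  exists z, frontier z /\ 0 < Cmod (z - e) < d.
Proof.
  intros He [HnN Hf] Hd.
  destruct (Hf d Hd) as [z2 [Hz2 HN2]].
  assert (Hz1 : exists z1, 0 < Cmod (z1 - e) < d /\ ~ N z1).
  { apply NNPP. intro K. apply (punctured_disc e d He HnN Hd). intros z Hz. apply NNPP. intro. apply K. eauto. }
  destruct Hz1 as [z1 [Hz1 Hn1]].
  assert (H1 : (z1 - e <> 0)%C) by (apply Cmod_gt_0; lra).
  assert (H2 : (z2 - e <> 0)%C) by (apply Cminus_eq_contra; intros ->; auto).
  destruct (cexp_surjective _ H1) as [w1 E1]. destruct (cexp_surjective _ H2) as [w2 E2].
  set (p := fun t : R => (e + cexp (w1 + RtoC t * (w2 - w1)))%C).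
  destruct (frontier_crossing p 0 1) as [s [Hs Hfs]]; [lra| | |].
  - intros s _. apply cont_plus; [apply cont_const|].
    eapply der_cont. apply (rder_affine_comp cexp w1 (w2 - w1)), cder_cexp.
  - replace (p 0) with z1; [replace (p 1) with z2; [tauto|]|].
    + unfold p. replace (w1 + 1 * (w2 - w1))%C with w2 by ring. rewrite E2. ring.
    + unfold p. replace (w1 + 0 * (w2 - w1))%C with w1 by ring. rewrite E1. ring.
  - exists (p s). split; auto. unfold p.
    match goal with |- context [(e + ?x - e)%C] => replace (e + x - e)%C with x by ring end.
    split; [apply Cmod_gt_0, cexp_nonzero|]. rewrite Cmod_cexp.
    assert (A1 : exp (Re w1) < d) by (rewrite <- Cmod_cexp, E1; lra).
    assert (A2 : exp (Re w2) < d) by (rewrite <- Cmod_cexp, E2; lra).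
    replace (Re (w1 + RtoC s * (w2 - w1))) with (Re w1 + s * (Re w2 - Re w1)) by (destruct w1, w2; Ccomp).
    destruct (Rle_dec (Re w1) (Re w2)).
    + eapply Rle_lt_trans; [apply exp_le|apply A2]. nra.
    + eapply Rle_lt_trans; [apply exp_le|apply A1]. nra.
Qed.

Lemma frontier_exit z e r1 : frontier z -> F z <> 0 -> Cmod (z - e) < r1 ->
  exists t, 0 < t /\ Imax F z t /\ Cmod (Phi F t z - e) = r1 /\ forall s, 0 <= s <= t -> Cmod (Phi F s z - e) <= r1.
Proof.
  intros Hf Hz Hr.
  destruct (frontier_blowup z Hf Hz) as [T [HT HnT]]. destruct (first_exit F HF z T HT HnT) as [T1 [HT1 [HI1 Hn1]]].
  destruct (blowup F HF z T1 HI1 Hn1 (proj1 HT1) (Cmod e + r1)) as [t1 [Ht1 K1]]. specialize (K1 t1 ltac:(lra)).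
  assert (Hc : forall t, 0 <= t <= t1 -> forall eps, 0 < eps -> exists d, 0 < d /\ forall u, Rabs (u - t) < d -> Cmod (Phi F u z - Phi F t z) < eps).
  { intros t Ht eps He. destruct (Phi_pcont F HF z t (HI1 t ltac:(lra)) eps He) as [d [Hd K]]. exists d. split; auto.
    intros u Hu. apply K. rewrite Cmod_RtoC_minus. auto. }
  destruct (closed_min (fun t => r1 <= Cmod (Phi F t z - e)) 0 t1 t1) as [t [Ht [HX Hmin]]]; [lra| | |].
  - pose proof (Cmod_rev (Phi F t1 z) e). lra.
  - intros t Ht Hn. destruct (Hc t Ht (r1 - Cmod (Phi F t z - e))) as [d [Hd K]]; [lra|]. exists d. split; auto.
    intros u _ Hu Hge. specialize (K u Hu). pose proof (Cmod_tri (Phi F u z) (Phi F t z) e). lra.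
  - assert (Htp : 0 < t).
    { destruct (Req_dec t 0) as [->|]; [|lra]. rewrite Phi_0 in HX by auto. lra. }
    assert (Heq : Cmod (Phi F t z - e) = r1).
    { apply Rle_antisym; auto. apply le_epsilon. intros eps He. destruct (Hc t Ht eps He) as [d [Hd K]].
      set (u := Rmax 0 (t - d/2)). assert (0 <= u) by apply Rmax_l. assert (t - d/2 <= u) by apply Rmax_r.
      assert (u < t) by (apply Rmax_lub_lt; lra).
      specialize (K u). rewrite Cmod_sym in K. specialize (K ltac:(apply Rabs_def1; lra)). specialize (Hmin u ltac:(lra)). cbv beta in Hmin.
      pose proof (Cmod_tri (Phi F t z) (Phi F u z) e). lra. }
    exists t. split; auto. split; [apply HI1; lra|]. split; auto.
    intros s Hs. destruct (Req_dec s t) as [->|]; [lra|]. specialize (Hmin s ltac:(lra)). cbv beta in Hmin. lra.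
Qed.

(** Boundary points near [e] leave a small disc after a time that grows as they approach [e]. A
    limit [q] of their exit points therefore stays in the disc for all earlier times, up to a
    bounded shift. Going backwards, its orbit cannot accumulate elsewhere, so it tends to [e]. *)
Lemma frontier_emanates e : (exists z, F z <> 0) -> F e = 0 -> frontier e ->
  exists q, frontier q /\ F q <> 0 /\ emanates q e.
Proof.
  intros Hex He Hfe. destruct (isolated_zeros F e HF Hex) as [d0 [Hd0 K0]].
  set (r1 := d0/2). assert (Hr1 : 0 < r1) by (unfold r1; lra).
  assert (Hnz : forall z, 0 < Cmod (z - e) <= r1 -> F z <> 0) by (intros z Hz; apply K0; unfold r1 in Hz; lra).
  set (exits := fun z t => frontier z /\ 0 < t /\ Imax F z t /\ Cmod (Phi F t z - e) = r1 /\ forall s, 0 <= s <= t -> Cmod (Phi F s z - e) <= r1).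
  assert (Hsq : forall w, Cmod (w - e) <= r1 -> in_box (Re e - 2 * r1) (Re e + 2 * r1) (Im e - 2 * r1) (Im e + 2 * r1) w).
  { intros w Hw. pose proof (Re_le_Cmod (w - e)) as A. pose proof (Im_le_Cmod (w - e)) as B. rewrite Re_minus in A. rewrite Im_minus in B.
    assert (A' := Rabs_def2 _ (2 * r1) ltac:(eapply Rle_lt_trans; [apply A|lra])).
    assert (B' := Rabs_def2 _ (2 * r1) ltac:(eapply Rle_lt_trans; [apply B|lra])). split; lra. }
  assert (Hq : exists q, forall d, 0 < d -> exists z t, exits z t /\ 0 < Cmod (z - e) < d /\ Cmod (Phi F t z - q) < d).
  { apply NNPP. intro Hno.
    destruct (compact_box (fun d w => forall z t, exits z t -> 0 < Cmod (z - e) < d -> Phi F t z <> w)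
      (Re e - 2 * r1) (Re e + 2 * r1) (Im e - 2 * r1) (Im e + 2 * r1)) as [d [Hd K]].
    - intros d d' w Hd' Hle HQ z t Hx Hz. apply HQ; auto. lra.
    - intros q _. apply NNPP. intro K. apply Hno. exists q. intros d Hd. apply NNPP. intro K'. apply K.
      exists (d/2). split; [lra|]. intros w _ Hw1 Hw2 z t Hx Hz E. apply K'. exists z, t. split; auto.
      split; [lra|]. rewrite E. apply Cmod_near; auto.
    - destruct (frontier_near_equilibrium e (Rmin d r1) He Hfe) as [z [Hz Hzd]]; [apply Rmin_glb_lt; auto|].
      pose proof (Rmin_l d r1). pose proof (Rmin_r d r1).
      destruct (frontier_exit z e r1 Hz) as (t & Ht & HI & Heq & Hall); [apply Hnz; lra|lra|].
      apply (K (Phi F t z) (Hsq _ (Req_le _ _ Heq)) z t); auto; [|lra]. repeat split; auto; apply Hz. }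
  destruct Hq as [q Hq].
  assert (Hqr : Cmod (q - e) = r1).
  { apply Rle_antisym; apply le_epsilon; intros eps Heps; destruct (Hq eps Heps) as (z & t & (_ & _ & _ & Heq & _) & _ & Hd).
    - rewrite Cmod_sym in Hd. pose proof (Cmod_tri q (Phi F t z) e). lra.
    - pose proof (Cmod_tri (Phi F t z) q e). lra. }
  assert (Hfq : frontier q).
  { apply frontier_limit. intros d Hd. destruct (Hq d Hd) as (z & t & (Hfz & _ & HI & _) & _ & Hc).
    exists (Phi F t z). split; auto. apply frontier_flow; auto. }
  assert (Hqn : F q <> 0) by (apply Hnz; lra).
  assert (Hback : forall v, v <= -1 -> Imax F q v /\ Cmod (Phi F v q - e) <= r1).
  { intros v Hv. destruct (frontier_local q 1 Hfq Hqn Rlt_0_1) as [d1 [Hd1 K1]].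
    (* Starting within [r1 / K] of [e], a point needs more than time [1 - v] to reach the circle.
       The extra unit absorbs the time shift between [q] and the exit point. *)
    destruct (dep_pos F HF e (1 - v) (Imax_equilibrium F e _ He)) as (K & d2 & HK & Hd2 & Hdep); [lra|].
    destruct (Hq (Rmin d1 (Rmin d2 (r1 / K)))) as (z & t & (Hfz & Ht & HI & Heq & Hall) & Hz & Hc).
    { apply Rmin_glb_lt; auto. apply Rmin_glb_lt; auto. apply Rdiv_lt_0_compat; lra. }
    assert (C1 := Rlt_Rmin_l Hc).
    assert (C2 := Rlt_Rmin_r (proj2 Hz)).
    assert (C3 := Rlt_Rmin_r C2). assert (C4 := Rlt_Rmin_l C2).
    apply Rlt_div_r in C3; auto.
    assert (Htv : 1 - v < t).
    { apply Rnot_le_lt. intro. destruct (Hdep z t C4 ltac:(lra)) as [_ D]. rewrite (Phi_equilibrium F HF e), Heq in D by auto. lra. }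
    destruct (K1 (Phi F t z)) as (de & Hde & HId & E); [apply frontier_flow; auto|auto|].
    apply Rabs_def2 in Hde.
    destruct (flow_back F HF q de HId) as [A B]. rewrite <- E in A, B.
    assert (Hz' : Imax F z (t + (v - de))) by (apply (Imax_convex F z 0 _ t); auto; [apply Imax_0; auto|lra]).
    destruct (flow_split F HF z t (v - de) HI Hz') as [A1 B1]. rewrite E in A1, B1.
    assert (J : Imax F q (de + (v - de))) by (apply flow_join; auto).
    destruct (flow_split F HF q de (v - de) HId J) as [_ S]. rewrite B1 in S.
    replace (de + (v - de)) with v in * by ring. split; auto. rewrite <- S. apply Hall. lra. }
  exists q. split; auto. split; auto. split; auto.
  assert (HIq : forall t, t <= 0 -> Imax F q t).
  { intros t Ht. destruct (Rle_dec t (-1)); [apply Hback; auto|].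
    apply (Imax_convex F q (-1) t 0); [apply Hback; lra|apply Imax_0; auto|lra]. }
  split; auto. intros eps Heps.
  destruct (compact_box (fun d w => eps <= Cmod (w - e) <= r1 -> forall v, v <= - (1/d) -> v <= 0 -> Phi F v q <> w)
      (Re e - 2 * r1) (Re e + 2 * r1) (Im e - 2 * r1) (Im e + 2 * r1)) as [d [Hd K]].
  - intros d d' w Hd' Hle HQ Hw v Hv. apply HQ; auto.
    assert (1/d <= 1/d') by (unfold Rdiv; rewrite !Rmult_1_l; apply Rinv_le_contravar; lra). lra.
  - intros w _.
    assert (Hw : exists d T, 0 < d /\ 0 < T /\ forall v, v < - T -> v <= 0 -> Cmod (Phi F v q - w) < d -> eps <= Cmod (Phi F v q - e) <= r1 -> False).
    { destruct (classic (frontier w)) as [Hfw|Hfw].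
      2:{ destruct (frontier_closed w Hfw) as [d [Hd K]]. exists d, 1. split; auto. split; [lra|]. intros v Hv Hv0 Hc _.
          apply (K _ Hc). apply frontier_flow; auto. }
      destruct (Rlt_dec (Cmod (w - e)) eps) as [H1|H1].
      { exists (eps - Cmod (w - e)), 1. split; [lra|]. split; [lra|]. intros v _ _ Hc [Hl _].
        pose proof (Cmod_tri (Phi F v q) w e). lra. }
      destruct (Rlt_dec r1 (Cmod (w - e))) as [H2|H2].
      { exists (Cmod (w - e) - r1), 1. split; [lra|]. split; [lra|]. intros v _ _ Hc [_ Hl].
        rewrite Cmod_sym in Hc. pose proof (Cmod_tri w (Phi F v q) e). lra. }
      destruct (frontier_local w 1 Hfw (Hnz w ltac:(lra)) Rlt_0_1) as [d [Hd K]].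
      destruct (classic (exists v0, v0 <= 0 /\ Cmod (Phi F v0 q - w) < d)) as [[v0 [Hv0 Hc0]]|Hno].
      2:{ exists d, 1. split; auto. split; [lra|]. intros v _ Hv Hc _. apply Hno. eauto. }
      (* Two visits to the neighbourhood of [w] lie on one orbit arc through [w], at times within 1
         of it, so they are less than 2 apart. *)
      exists d, (2 - v0). split; auto. split; [lra|]. intros v Hv Hv' Hc _.
      destruct (K (Phi F v0 q)) as (d1 & Hd1 & I1 & E1); auto; [apply frontier_flow; auto|].
      destruct (K (Phi F v q)) as (d2 & Hd2 & I2 & E2); auto; [apply frontier_flow; auto|].
      apply Rabs_def2 in Hd1, Hd2.
      destruct (flow_back F HF w d1 I1) as [_ B1]. destruct (flow_back F HF q v0 (HIq v0 Hv0)) as [_ B0].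
      destruct (flow_split F HF w d1 (d2 - d1) I1) as [A3 B3]; [replace (d1 + (d2 - d1)) with d2 by ring; auto|].
      replace (d1 + (d2 - d1)) with d2 in B3 by ring. rewrite <- E1 in A3, B3. rewrite <- E2 in B3.
      assert (J : Imax F q (v0 + (d2 - d1))) by (apply flow_join; auto).
      destruct (flow_split F HF q v0 (d2 - d1) (HIq v0 Hv0) J) as [_ S]. rewrite B3 in S.
      assert (v = v0 + (d2 - d1)); [|lra]. apply (frontier_time_unique q); auto. }
    destruct Hw as (d & T & Hd & HT & K). set (m := Rmin (d/2) (1/(T+1))).
    assert (Hp2 : 0 < 1/(T+1)) by (apply Rdiv_lt_0_compat; lra).
    assert (Hm : 0 < m) by (apply Rmin_glb_lt; lra). assert (m <= d/2) by apply Rmin_l.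
    exists m. split; auto. intros w' _ Hw1 Hw2 Hw' v Hv Hv0 E. apply (K v); auto; [|rewrite E; apply Cmod_near; lra|rewrite E; auto].
    assert (T + 1 <= 1/m); [|lra]. apply Rle_div_r; auto.
    assert (Hm2 : m <= 1/(T+1)) by apply Rmin_r. apply Rle_div_r in Hm2; lra.
  - assert (Hd' : 0 < 1/d) by (apply Rdiv_lt_0_compat; lra).
    exists (Rmax 1 (1/d)). split; [eapply Rle_trans; [|apply Rmax_l]; lra|]. intros t Ht.
    pose proof (Rmax_l 1 (1/d)). pose proof (Rmax_r 1 (1/d)). destruct (Hback t ltac:(lra)) as [_ Hle].
    apply Rnot_le_lt. intro Hge. apply (K (Phi F t q) (Hsq _ Hle) (conj Hge Hle) t); auto; lra.
Qed.
End Frontier.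

Arguments frontier : clear implicits.
Arguments side : clear implicits.
Arguments emanates : clear implicits.

(** * Logarithmic coordinates on the basin *)

Lemma cexp_multiple z (n : nat) : cexp z = 1 -> cexp (RtoC (INR n) * z) = 1.
Proof.
  intros E. induction n as [|n IH].
  - simpl. replace (0 * z)%C with (RtoC 0) by ring. apply cexp_0.
  - rewrite S_INR, RtoC_plus. replace ((RtoC (INR n) + 1) * z)%C with (RtoC (INR n) * z + z)%C by ring.
    rewrite cexp_plus, IH, E. ring.
Qed.

Lemma cexp_opp z : cexp z = 1 -> cexp (- z) = 1.
Proof.
  intros E. replace (cexp (- z)) with (cexp (- z) * cexp z)%C by (rewrite E; ring).
  rewrite <- cexp_plus. replace (- z + z)%C with (RtoC 0) by ring. apply cexp_0.
Qed.

Lemma cexp_period (k : Z) : cexp (Ci * RtoC (2 * PI * IZR k)) = 1.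
Proof.
  assert (E : cexp (Ci * RtoC (2 * PI)) = 1).
  { unfold cexp. simpl. replace (0 * (2 * PI) - 1 * 0) with 0 by ring. replace (0 * 0 + 1 * (2 * PI)) with (2 * PI) by ring.
    rewrite exp_0, cos_2PI, sin_2PI. unfold RtoC. f_equal; ring. }
  destruct (Z.le_gt_cases 0 k).
  - replace (Ci * RtoC (2 * PI * IZR k))%C with (RtoC (INR (Z.to_nat k)) * (Ci * RtoC (2 * PI)))%C; [apply cexp_multiple; auto|].
    rewrite INR_IZR_INZ, Z2Nat.id by auto. rewrite (RtoC_mult (2 * PI)). ring.
  - replace (Ci * RtoC (2 * PI * IZR k))%C with (RtoC (INR (Z.to_nat (- k))) * - (Ci * RtoC (2 * PI)))%C; [apply cexp_multiple, cexp_opp; auto|].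
    rewrite INR_IZR_INZ, Z2Nat.id, opp_IZR by lia. rewrite (RtoC_mult (2 * PI)), RtoC_opp. ring.
Qed.

Lemma cexp_1 z : cexp z = 1 -> Rabs (Im z) < 2 * PI -> z = 0.
Proof.
  intros E H.
  assert (Hre : Re z = 0).
  { pose proof (Cmod_cexp z) as Q. rewrite E, Cmod_1 in Q. rewrite <- exp_0 in Q. symmetry. apply exp_inv; auto. }
  assert (Hc : cos (Im z) = 1).
  { apply (f_equal Re) in E. unfold cexp in E. simpl in E. rewrite Hre, exp_0 in E. lra. }
  assert (Him : sin (Im z / 2) = 0).
  { replace (Im z) with (2 * (Im z / 2)) in Hc by field. rewrite cos_2a_sin in Hc. nra. }
  assert (Im z = 0).
  { destruct (Rtotal_order (Im z) 0) as [Hlt|[?|Hgt]]; auto; exfalso; apply Rabs_def2 in H.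
    - assert (0 < sin (- (Im z / 2))) by (apply sin_gt_0; lra). rewrite sin_neg in *. lra.
    - assert (0 < sin (Im z / 2)) by (apply sin_gt_0; lra). lra. }
  destruct z as [u v]. simpl in *. subst. auto.
Qed.

Lemma Im_Ci_div x (l : C) : Re l < 0 ->
  Im (Ci * RtoC x / l) = x * Re l / (Re l * Re l + Im l * Im l).
Proof.
  destruct l as [l1 l2]. simpl. intros H. unfold Cdiv, Cmult, Cinv, Ci, RtoC, Im. simpl. field. nra.
Qed.

Section Coordinates.
Context {F : C -> C} (HF : holo F) {a lam : C} (Ha : F a = 0)
  {psi psi' : C -> C} {r : R} (HL : linearization F a lam psi psi' r) (Hre : Re lam < 0).

Let N : C -> Prop := NN F a r.
Let Ps : C -> C := Psi F a lam psi r.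
Let HA : attracting F a N := NN_attracting HF Ha HL Hre.

(** The coordinate [W] is a logarithm of [Psi] divided by [lam], and [Y] is the inverse map: a
    solution of [Y' = F (Y)] in complex time that fills the basin without [a] and has the period
    [2 i pi / lam]. *)
Definition dom (W : C) : Prop := exists y, N y /\ y <> a /\ Ps y = cexp (lam * W).

Definition Y (W : C) : C := epsilon (inhabits a) (fun y => N y /\ y <> a /\ Ps y = cexp (lam * W)).

Lemma Y_spec W : dom W -> N (Y W) /\ Y W <> a /\ Ps (Y W) = cexp (lam * W).
Proof. intros H. unfold Y. apply epsilon_spec, H. Qed.

Lemma Y_eq W y : N y -> y <> a -> Ps y = cexp (lam * W) -> dom W /\ Y W = y.
Proof.
  intros HN Hn E. assert (HD : dom W) by (exists y; auto). split; auto. destruct (Y_spec W HD) as (A & _ & B).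
  apply (Psi_injective HF HL Hre); auto. fold Ps. congruence.
Qed.

Lemma Y_nonzero W : dom W -> F (Y W) <> 0.
Proof. intros H. destruct (Y_spec W H) as (A & B & _). apply (NN_nonzero HF HL Hre); auto. Qed.

Lemma Y_flow W t : dom W -> 0 <= t -> dom (W + RtoC t) /\ Y (W + RtoC t) = Phi F t (Y W).
Proof.
  intros HD Ht. destruct (Y_spec W HD) as (A & B & E).
  destruct (NN_forward HF HL Hre _ A) as (_ & _ & HI & _). specialize (HI t Ht).
  apply Y_eq.
  - apply (NN_flow HF HL Hre); auto.
  - intro Q. apply (flow_nonzero F HF _ t HI (Y_nonzero W HD)). rewrite Q. auto.
  - unfold Ps. rewrite (Psi_flow HF HL Hre) by auto. fold Ps. rewrite E, <- cexp_plus. f_equal. ring.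
Qed.

(** Near [W] the map is a translated chart: the two flows translate the chart coordinate and
    multiply [Psi] by the matching exponentials. *)
Lemma Y_der W : dom W -> cder Y W (F (Y W)).
Proof.
  intros HD. destruct (Y_spec W HD) as (A & B & E).
  destruct (chart_exists F (Y W) HF (Y_nonzero W HD)) as [g [rho Hg]]. pose proof (chart_pos Hg) as Hrho.
  destruct (Psi_rot_local HF Ha HL Hre (Y W) A B) as [d [Hd K]].
  set (m := Rmin d (rho/3)). assert (Hm : 0 < m) by (apply Rmin_glb_lt; lra).
  assert (m <= d) by apply Rmin_l. assert (m <= rho/3) by apply Rmin_r.
  apply (der_ext cid (fun w => g (w - W)%C)) with (r := m); auto.
  - intros y Hy. unfold cid in Hy. set (w := (y - W)%C) in *. replace y with (W + w)%C by (unfold w; ring).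
    pose proof (Re_le_Cmod w) as Hr. pose proof (Im_le_Cmod w) as Hi.
    destruct (K (Im w)) as (I1 & N1 & E1); [lra|].
    destruct (chart_flow_rot F HF (Y W) g rho (RtoC 0) (Im w) Hg) as [I2 E2]; [rewrite Cmod_0; lra|].
    rewrite (chart_0 Hg) in E2. rewrite E2 in N1, E1.
    destruct (chart_flow F HF (Y W) g rho (0 + RtoC (Im w) * Ci)%C (Re w) Hg) as [I3 E3].
    { replace (0 + RtoC (Im w) * Ci)%C with (Ci * RtoC (Im w))%C by ring.
      rewrite Cmod_mult, Cmod_Ci, Cmod_R. lra. }
    replace (0 + RtoC (Im w) * Ci + RtoC (Re w))%C with w in E3 by (rewrite (C_split w) at 1; ring).
    symmetry. apply Y_eq.
    + rewrite <- E3. apply (NN_flow HF HL Hre); auto.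
    + intro Q. apply (flow_nonzero F HF _ _ I3); [|rewrite E3, Q; auto].
      apply (NN_nonzero HF HL Hre); auto. rewrite <- E2. intro Q2.
      assert (HR := holo_rotf F HF). apply (flow_nonzero _ HR (Y W) (Im w) I1).
      * unfold rotf. apply Cmult_neq_0; [apply Ci_nz|apply Y_nonzero; auto].
      * rewrite Q2. apply rotf_zero; auto.
    + rewrite <- E3. unfold Ps. rewrite (Psi_flow HF HL Hre) by auto. rewrite E1. fold Ps. rewrite E.
      rewrite <- !cexp_plus. f_equal. rewrite (C_split w) at 3. ring.
  - apply (der_val cid _ _ (1 * F (g (W - W)))%C).
    + replace (W - W)%C with (RtoC 0) by ring. rewrite (chart_0 Hg). ring.
    + apply (der_comp cid cid (fun w => w - W)%C g); [apply cder_minus_const|].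
      apply (chart_der Hg). rewrite Cmod_self. auto.
Qed.

Lemma Y_hor h X : dom (X, h) -> pcont (fun X => Y (X, h)) X.
Proof.
  intros H. apply (cont_comp RtoC cid (fun X => (X, h)) Y); [|eapply der_cont, Y_der; auto].
  apply cont_pair; [apply cont_self|apply cont_const].
Qed.

Lemma Y_ver sg X h : dom (X, sg * h) -> pcont (fun h => Y (X, sg * h)) h.
Proof.
  intros H. apply (cont_ext RtoC (fun h => Y (X, 0 + sg * h))) with (r := 1); [lra|intros; do 2 f_equal; ring|].
  apply (pcont_affine 0 sg h (fun v => Y (X, v))). rewrite Rplus_0_l.
  apply (cont_comp RtoC cid (fun v => (X, v)) Y); [|eapply der_cont, Y_der; auto].
  apply cont_pair; [apply cont_const|apply cont_self].
Qed.

(* The imaginary part of the period [2 i pi / lam], up to sign. *)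
Definition hgt : R := 2 * PI * - Re lam / (Re lam * Re lam + Im lam * Im lam).

Lemma hgt_pos : 0 < hgt.
Proof. unfold hgt. pose proof PI_RGT_0. apply Rdiv_lt_0_compat; nra. Qed.

(** Two coordinates of one point differ by a multiple of the period, and a nonzero multiple changes
    the imaginary part by at least [hgt]. *)
Lemma Y_inj W W' : dom W -> dom W' -> Y W = Y W' -> Rabs (Im W - Im W') < hgt -> W = W'.
Proof.
  intros H H' E Hi. destruct (Y_spec W H) as (_ & _ & E1). destruct (Y_spec W' H') as (_ & _ & E2).
  rewrite <- E in E2.
  assert (Q : cexp (lam * (W - W')) = 1).
  { apply (cexp_cancel (lam * W')). rewrite <- cexp_plus. replace (lam * W' + lam * (W - W'))%C with (lam * W)%C by ring.
    rewrite <- E1, E2. ring. }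
  assert (Hz : (lam * (W - W'))%C = 0).
  { apply cexp_1; auto. set (z := (lam * (W - W'))%C) in *.
    assert (Hz : Re z = 0).
    { pose proof (Cmod_cexp z) as Q2. rewrite Q, Cmod_1, <- exp_0 in Q2. symmetry. apply exp_inv; auto. }
    rewrite <- Im_minus in Hi. set (w := (W - W')%C) in *.
    assert (Er : Re lam * Re w - Im lam * Im w = 0) by (rewrite <- Hz; reflexivity).
    assert (Ei : Im z = Re lam * Im w + Im lam * Re w) by reflexivity.
    set (m := Re lam * Re lam + Im lam * Im lam). assert (0 < m) by (unfold m; nra).
    assert (Em : - Re lam * Im z = - m * Im w).
    { rewrite Ei. unfold m. replace (- Re lam * (Re lam * Im w + Im lam * Re w)) with (- (Re lam * Re lam) * Im w - Im lam * (Re lam * Re w)) by ring.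
      replace (Re lam * Re w) with (Im lam * Im w) by lra. ring. }
    assert (Eh : hgt * m = 2 * PI * - Re lam) by (unfold hgt; fold m; field; lra).
    apply (Rmult_lt_reg_l (- Re lam)); [lra|].
    replace (- Re lam * Rabs (Im z)) with (Rabs (- Re lam * Im z)) by (rewrite Rabs_mult, (Rabs_pos_eq (- Re lam)); lra).
    rewrite Em, Rabs_mult, Rabs_Ropp, (Rabs_pos_eq m) by lra.
    apply (Rmult_lt_compat_l m) in Hi; lra. }
  assert (lam <> 0) by (intro Z; assert (Z2 := Hre); rewrite Z in Z2; simpl in Z2; lra).
  apply Ceq_minus. destruct (Ceq_dec (W - W') 0) as [|Hn]; auto. exfalso. apply (Cmult_neq_0 lam (W - W')); auto.
Qed.

(** Adding periods moves the height into any prescribed half-open window of length [hgt]. *)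
Lemma log_choice (c : C) sg m : c <> 0 -> sg = 1 \/ sg = -1 ->
  exists X v, cexp (lam * (X, sg * v)) = c /\ m - hgt < v <= m.
Proof.
  intros Hc Hsg. pose proof hgt_pos as Hh. assert (Hlam : lam <> 0) by (intro Z; assert (Z2 := Hre); rewrite Z in Z2; simpl in Z2; lra).
  destruct (cexp_surjective c Hc) as [w Hw]. set (T := (w / lam)%C).
  set (q := (m - sg * Im T) / hgt). set (k := Int_part q).
  destruct (base_Int_part q) as [B1 B2]. fold k in B1, B2.
  (* Heights are measured in the orientation [sg], and this sign makes the added period raise the
     height by [k] times [hgt] for either orientation. *)
  set (n := if Req_dec_T sg 1 then (- k)%Z else k).
  assert (Hn : IZR n = - sg * IZR k).
  { unfold n. destruct (Req_dec_T sg 1) as [->|]; [rewrite opp_IZR; ring|]. destruct Hsg as [ |  -> ]; [tauto|ring]. }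
  set (P := (Ci * RtoC (2 * PI * IZR n) / lam)%C).
  assert (HP : Im P = sg * (IZR k * hgt)).
  { unfold P, hgt. rewrite Im_Ci_div, Hn by auto. assert (0 < Re lam * Re lam + Im lam * Im lam) by nra. field. lra. }
  exists (Re (T + P)), (sg * Im T + IZR k * hgt). split.
  - replace (Re (T + P), sg * (sg * Im T + IZR k * hgt)) with (T + P)%C.
    + replace (lam * (T + P))%C with (w + Ci * RtoC (2 * PI * IZR n))%C by (unfold T, P; field; auto).
      rewrite cexp_plus, cexp_period, Hw. ring.
    + rewrite (C_split (T + P)) at 1.
      replace (Im (T + P)) with (sg * (sg * Im T + IZR k * hgt)).
      * unfold Cplus, Cmult, Ci, RtoC. simpl. f_equal; ring.
      * replace (Im (T + P)) with (Im T + Im P) by reflexivity. rewrite HP. destruct Hsg as [-> | ->]; ring.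
  - assert (Eq : q * hgt = m - sg * Im T) by (unfold q; field; lra). nra.
Qed.

(** Moving to the right approaches [a], where the imaginary-time flow exists for any prescribed time
    and stays in the basin. *)
Lemma dom_far W0 H : dom W0 -> exists R0, forall X h, R0 <= X -> Rabs h <= H -> dom (X, h).
Proof.
  intros HD. destruct (Y_spec W0 HD) as (A & B & E).
  destruct (rot_near_a HF Ha (H + Rabs (Im W0)) (r/8)) as [d [Hd K]]; [pose proof (lin_pos HL); lra|].
  destruct (NN_tends HF HL Hre _ A d Hd) as [T [HT KT]].
  exists (Re W0 + T). intros X h HX Hh. set (t := X - Re W0). set (s := h - Im W0).
  destruct (KT t) as [HI Hc]; [unfold t; lra|].
  destruct (Y_flow W0 t HD) as [HD1 E1]; [unfold t; lra|]. destruct (Y_spec _ HD1) as (A1 & B1 & E2).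
  rewrite E1 in A1, B1, E2. set (z := Phi F t (Y W0)) in *.
  assert (Hs : Rabs s <= H + Rabs (Im W0)).
  { unfold s. eapply Rle_trans; [apply Rabs_triang|]. rewrite Rabs_Ropp. lra. }
  assert (HR := holo_rotf F HF).
  assert (Hrot : forall u, Rmin 0 s <= u <= Rmax 0 s -> Imax (rotf F) z u /\ N (Phi (rotf F) u z)).
  { intros u Hu. destruct (K z u Hc) as [I1 C1].
    - eapply Rle_trans; [|apply Hs]. unfold Rmin, Rmax in Hu. destruct (Rle_dec 0 s).
      + rewrite !Rabs_pos_eq; lra.
      + rewrite !Rabs_left1; lra.
    - split; auto. apply NN_near; auto. }
  exists (Phi (rotf F) s z).
  assert (Hin : Imax (rotf F) z s /\ N (Phi (rotf F) s z)) by (apply Hrot; split; [apply Rmin_r|apply Rmax_r]).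
  split; [apply Hin|]. split.
  - intro Q. apply (flow_nonzero _ HR z s); [apply Hin| |rewrite Q; apply rotf_zero; auto].
    unfold rotf. apply Cmult_neq_0; [apply Ci_nz|]. rewrite <- E1. apply Y_nonzero; auto.
  - assert (Q : Ps (Phi (rotf F) s z) = (cexp (Ci * lam * RtoC s) * Ps z)%C).
    { unfold Ps. destruct (Rle_dec 0 s).
      - pose proof (Psi_rot HF Ha HL Hre z 0 s) as Q. rewrite Rminus_0_r, (Phi_0 _ HR) in Q. apply Q; auto.
        minmax Hrot. auto.
      - pose proof (Psi_rot HF Ha HL Hre z s 0) as Q. rewrite (Phi_0 _ HR) in Q. rewrite Q; auto; try lra.
        + rewrite Cmult_assoc, <- cexp_plus. replace (Ci * lam * s + Ci * lam * (0 - s)%R)%C with (RtoC 0) by (rewrite RtoC_minus; ring).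
          rewrite cexp_0. ring.
        + minmax Hrot. auto. }
    rewrite Q, E2, <- cexp_plus. f_equal.
    replace ((X, h) : C) with (RtoC X + Ci * RtoC h)%C by (unfold Cplus, Cmult, Ci, RtoC; simpl; f_equal; ring).
    unfold s, t. rewrite (C_split W0) at 2. rewrite !RtoC_minus. ring.
Qed.

(** A full side of the flow box appears as a rectangle in the logarithmic coordinate. The number [c]
    is the value of [Psi] extrapolated along the section to height 0, that is to [x] itself, and any
    logarithm of [c] gives a corner of the rectangle. *)
Lemma side_coordinate x g rho sg e : frontier N x -> F x <> 0 -> chart F x g rho -> sg = 1 \/ sg = -1 ->
  0 < e <= rho / 4 -> side N g sg e -> exists c : C, c <> 0 /\
  forall X v, cexp (lam * (X, sg * v)) = c -> forall t s, 0 <= t <= rho / 4 -> 0 < s < e ->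
    dom (X + t, sg * (v + s)) /\ Y (X + t, sg * (v + s)) = Pt g sg t s.
Proof.
  intros Hf Hx Hg Hsg He Hs. assert (HR := holo_rotf F HF).
  assert (Hxa : x <> a) by (intros ->; auto).
  assert (E0 := Pt_origin sg Hg).
  assert (Hrot : forall s, 0 < s < e -> Imax (rotf F) x (sg * s) /\ Phi (rotf F) (sg * s) x = Pt g sg 0 s).
  { intros s Hss. destruct (Pt_rot HF Hg sg Hsg 0 0 s) as [A B]; try lra. rewrite E0 in A, B. rewrite Rplus_0_l in B. auto. }
  assert (Hnz : forall s, 0 < s < e -> Pt g sg 0 s <> a).
  { intros s Hss Q. apply (Pt_nonzero HF Hg sg Hsg s); [lra|]. rewrite Q. auto. }
  assert (Hstep : forall s s', 0 < s < e -> 0 < s' < e -> sg * s <= sg * s' ->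
    Ps (Pt g sg 0 s') = (cexp (Ci * lam * RtoC (sg * s' - sg * s)) * Ps (Pt g sg 0 s))%C).
  { intros s s' H1 H2 Hle. destruct (Hrot s H1) as [_ <-]. destruct (Hrot s' H2) as [_ <-].
    apply (Psi_rot HF Ha HL Hre); auto. intros u Hu.
    destruct (Hrot (sg * u)) as [A B]; [destruct Hsg as [-> | ->]; lra|].
    replace (sg * (sg * u)) with u in A, B by (destruct Hsg as [-> | ->]; ring). split; auto. rewrite B.
    apply Hs. destruct Hsg as [-> | ->]; lra. }
  assert (Hall : forall s s', 0 < s < e -> 0 < s' < e ->
    Ps (Pt g sg 0 s') = (cexp (Ci * lam * RtoC (sg * s' - sg * s)) * Ps (Pt g sg 0 s))%C).
  { intros s s' H1 H2. destruct (Rle_dec (sg * s) (sg * s')); [apply Hstep; auto|].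
    rewrite (Hstep s' s) by (auto; lra). rewrite Cmult_assoc, <- cexp_plus.
    replace (Ci * lam * (sg * s' - sg * s)%R + Ci * lam * (sg * s - sg * s')%R)%C with (RtoC 0) by (rewrite !RtoC_minus; ring).
    rewrite cexp_0. ring. }
  exists (cexp (- (Ci * lam * RtoC (sg * (e/2)))) * Ps (Pt g sg 0 (e/2)))%C. split.
  { apply Cmult_neq_0; [apply cexp_nonzero|]. apply (Psi_nonzero HF Ha HL Hre); [apply Hs|apply Hnz]; lra. }
  intros X v E t s Ht Hss.
  assert (H0 : dom (X, sg * (v + s)) /\ Y (X, sg * (v + s)) = Pt g sg 0 s).
  { apply Y_eq; [apply Hs; auto|apply Hnz; auto|]. rewrite (Hall (e/2) s) by lra.
    replace ((X, sg * (v + s)) : C) with ((X, (sg * v)%R) + Ci * RtoC (sg * s))%C by (unfold Cplus, Cmult, Ci, RtoC; simpl; f_equal; ring).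
    rewrite Cmult_plus_distr_l, cexp_plus, E.
    rewrite (Cmult_comm (cexp _ * Ps _)), Cmult_assoc, <- cexp_plus. f_equal. f_equal. rewrite RtoC_minus. ring. }
  destruct H0 as [HD EY]. destruct (Y_flow _ t HD) as [HD' E']; [lra|].
  replace ((X, (sg * (v + s))%R) + RtoC t)%C with ((X + t, sg * (v + s)) : C) in HD', E' by (unfold Cplus, RtoC; simpl; f_equal; ring).
  split; auto. rewrite E', EY. destruct (Pt_flow HF Hg sg Hsg 0 s t) as [_ B]; try lra.
  rewrite B, Rplus_0_l. auto.
Qed.

Lemma frontier_forward_avoid x e : frontier N x -> F x <> 0 -> F e = 0 ->
  exists d, 0 < d /\ forall t, 0 <= t -> Imax F x t -> d <= Cmod (Phi F t x - e).
Proof.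
  intros Hf Hx He. destruct (frontier_blowup HF HA x Hf Hx) as [T [HT HnT]].
  destruct (first_exit F HF x T HT HnT) as [T1 [HT1 [HI1 Hn1]]].
  destruct (blowup F HF x T1 HI1 Hn1 (proj1 HT1) (Cmod e + 1)) as [t1 [Ht1 K1]].
  destruct (curve_avoid (fun t => Phi F t x) 0 t1 e) as [d [Hd K]].
  - intros t Ht. apply Phi_pcont; auto. apply HI1. lra.
  - intros t Ht E. apply (flow_nonzero F HF x t); auto; [apply HI1; lra|rewrite E; auto].
  - exists (Rmin d 1). split; [apply Rmin_glb_lt; lra|]. intros t Ht HI.
    destruct (Rle_dec t t1); [eapply Rle_trans; [apply Rmin_l|apply K; lra]|].
    eapply Rle_trans; [apply Rmin_r|].
    assert (t < T1).
    { apply Rnot_le_lt. intro. apply Hn1. apply (Imax_convex F x 0 T1 t); auto; [apply Imax_0; auto|lra]. }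
    specialize (K1 t ltac:(lra)). pose proof (Cmod_rev (Phi F t x) e). lra.
Qed.

(** At equal heights the flow for time [X2 - X1] carries the section at [x1] into the one at [x2],
    height by height. Backwards the identity extends to height 0, as the backward orbit of [x2]
    exists. *)
Lemma same_height x1 x2 g1 g2 rho1 rho2 sg e X1 X2 v e1 e2 : sg = 1 \/ sg = -1 ->
  chart F x1 g1 rho1 -> chart F x2 g2 rho2 -> 0 < e1 <= rho1 / 4 -> 0 < e2 <= rho2 / 4 -> emanates F x2 e ->
  (forall s, 0 < s < e1 -> dom (X1, sg * (v + s)) /\ Y (X1, sg * (v + s)) = Pt g1 sg 0 s) ->
  (forall s, 0 < s < e2 -> dom (X2, sg * (v + s)) /\ Y (X2, sg * (v + s)) = Pt g2 sg 0 s) ->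
  X1 <= X2 -> exists t, Imax F x2 t /\ x1 = Phi F t x2.
Proof.
  intros Hsg Hg1 Hg2 He1 He2 (_ & HI2 & _) C1 C2 HX. set (t := X2 - X1).
  assert (E1 := Pt_origin sg Hg1).
  assert (E2 := Pt_origin sg Hg2).
  assert (HI : Imax F x2 (- t)) by (apply HI2; unfold t; lra).
  exists (- t). split; auto. apply separated. intros eps Heps.
  destruct (Pt_pcont_s Hg1 sg Hsg 0 0) with (eps := eps/2) as [d1 [Hd1 K1]]; try lra.
  destruct (Phi_ccont F HF x2 _ HI (eps/2)) as [d3 [Hd3 K3]]; [lra|].
  destruct (Pt_pcont_s Hg2 sg Hsg 0 0) with (eps := d3) as [d2 [Hd2 K2]]; try lra.
  rewrite E1 in K1. rewrite E2 in K2.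
  set (s := Rmin (Rmin d1 d2) (Rmin e1 e2) / 2).
  assert (Hm : 0 < Rmin (Rmin d1 d2) (Rmin e1 e2)) by (repeat apply Rmin_glb_lt; lra).
  pose proof (Rmin_l (Rmin d1 d2) (Rmin e1 e2)). pose proof (Rmin_r (Rmin d1 d2) (Rmin e1 e2)).
  pose proof (Rmin_l d1 d2). pose proof (Rmin_r d1 d2). pose proof (Rmin_l e1 e2). pose proof (Rmin_r e1 e2).
  assert (Hs : 0 < s /\ s < d1 /\ s < d2 /\ s < e1 /\ s < e2) by (unfold s; lra).
  destruct (C1 s) as [D1 Y1]; [lra|]. destruct (C2 s) as [D2 Y2]; [lra|].
  destruct (Y_flow _ t D1) as [_ E]; [unfold t; lra|].
  replace ((X1, (sg * (v + s))%R) + RtoC t)%C with ((X2, sg * (v + s)) : C) in E by (unfold t, Cplus, RtoC; simpl; f_equal; ring).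
  rewrite Y1, Y2 in E. destruct (Y_spec _ D1) as (NY & _). rewrite Y1 in NY.
  destruct (NN_forward HF HL Hre _ NY) as (_ & _ & HIf & _).
  destruct (flow_back F HF _ t (HIf t ltac:(unfold t; lra))) as [_ B]. rewrite <- E in B.
  specialize (K1 s). rewrite Cmod_RtoC_minus, Rminus_0_r, Rabs_pos_eq in K1 by lra. specialize (K1 ltac:(lra)). rewrite Cmod_sym in K1.
  specialize (K2 s). rewrite Cmod_RtoC_minus, Rminus_0_r, Rabs_pos_eq in K2 by lra. specialize (K2 ltac:(lra)).
  specialize (K3 (Pt g2 sg 0 s) K2). rewrite B in K3.
  pose proof (Cmod_tri x1 (Pt g1 sg 0 s) (Phi F (- t) x2)). lra.
Qed.

(** One half of the path across the loop: from the forward orbit of [x], which escapes, up to height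
    [s] in the flow box and then to the right inside the basin. *)
Lemma arm L z x g rho sg X v s Xend : List.Forall piece_ok L -> joins z L z ->
  frontier N x -> F x <> 0 -> chart F x g rho -> sg = 1 \/ sg = -1 -> 0 < s <= rho / 4 ->
  (forall t, 0 < t -> Imax F x t -> ~ on_chain L (Phi F t x)) ->
  (forall u, 0 < u <= s -> ~ on_chain L (Pt g sg (rho/4) u)) ->
  Y (X + rho/4, sg * (v + s)) = Pt g sg (rho/4) s -> X + rho/4 <= Xend ->
  (forall t, X + rho/4 <= t -> dom (t, sg * (v + s))) ->
  (forall t, X + rho/4 <= t <= Xend -> ~ on_chain L (Y (t, sg * (v + s)))) ->
  wind L (Y (Xend, sg * (v + s))) = 0.
Proof.
  intros Hok HJ Hf Hx Hg Hsg Hs Hforw Hup EY HX HD Hoff. assert (Hb := b_pos Hg).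
  assert (E0 := Pt_origin sg Hg).
  destruct (Pt_flow HF Hg sg Hsg 0 0 (rho/4)) as [HI E]; try lra. rewrite E0 in HI, E. rewrite Rplus_0_l in E.
  assert (W0 : wind L (Pt g sg (rho/4) 0) = 0).
  { rewrite <- E. assert (Hf1 := frontier_flow HF HA x _ HI Hf).
    destruct (frontier_blowup HF HA _ Hf1 (flow_nonzero F HF x _ HI Hx)) as [T [HT HnT]].
    apply (wind_blowup HF L z _ T); auto. intros t Ht HIt.
    assert (J : Imax F x (rho/4 + t)) by (apply flow_join; auto).
    destruct (flow_split F HF x (rho/4) t HI J) as [_ S]. rewrite S. apply Hforw; auto. lra. }
  rewrite (wind_move L z (fun t => Y (t, sg * (v + s))) (X + rho/4) Xend); auto.
  - rewrite EY, (wind_move L z (fun u => Pt g sg (rho/4) u) 0 s); auto; try lra.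
    + intros u Hu. apply (Pt_pcont_s Hg sg Hsg); lra.
    + intros u Hu. destruct (Req_dec u 0) as [->|]; [rewrite <- E; apply Hforw; auto; lra|apply Hup; lra].
  - intros t Ht. apply Y_hor, HD. lra.
Qed.

(* The loop runs from [e] along the first orbit, through the basin to the
   second one, and back to [e].  In logarithmic coordinates the part in the
   basin climbs from the first orbit, advances beyond both orbits, descends,
   and returns to the second orbit.  The remaining halves of the two orbits
   both escape to infinity, yet they are joined by a path which crosses the
   loop exactly once. *)
Lemma unique_side x1 x2 g1 g2 rho1 rho2 sg e1 e2 e : sg = 1 \/ sg = -1 ->
  frontier N x1 -> F x1 <> 0 -> chart F x1 g1 rho1 -> 0 < e1 <= rho1 / 4 -> side N g1 sg e1 -> emanates F x1 e ->
  frontier N x2 -> F x2 <> 0 -> chart F x2 g2 rho2 -> 0 < e2 <= rho2 / 4 -> side N g2 sg e2 -> emanates F x2 e ->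
  exists t, Imax F x1 t /\ x2 = Phi F t x1.
Proof.
  intros Hsg Hf1 Hx1 Hg1 He1 Hs1 Hem1 Hf2 Hx2 Hg2 He2 Hs2 Hem2. apply NNPP. intro Hno.
  assert (Hne : forall t1 t2, Imax F x1 t1 -> Imax F x2 t2 -> Phi F t1 x1 <> Phi F t2 x2).
  { intros t1 t2 I1 I2 E. apply Hno. destruct (flow_back F HF x2 t2 I2) as [A B]. rewrite <- E in A, B.
    exists (t1 + - t2). assert (J : Imax F x1 (t1 + - t2)) by (apply flow_join; auto). split; auto.
    destruct (flow_split F HF x1 t1 (- t2) I1 J) as [_ S]. rewrite <- S, B. auto. }
  destruct (side_coordinate x1 g1 rho1 sg e1 Hf1 Hx1 Hg1 Hsg He1 Hs1) as (c1 & Hc1 & C1).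
  destruct (side_coordinate x2 g2 rho2 sg e2 Hf2 Hx2 Hg2 Hsg He2 Hs2) as (c2 & Hc2 & C2).
  destruct (log_choice c1 sg 0 Hc1 Hsg) as (X1 & v1 & L1 & _).
  (* The branch is chosen with [v2] in the window of one period ending at [v1], so the second orbit
     lies at most one period below the first. *)
  destruct (log_choice c2 sg v1 Hc2 Hsg) as (X2 & v2 & L2 & Hv). specialize (C1 X1 v1 L1). specialize (C2 X2 v2 L2).
  pose proof hgt_pos as Hh. remember hgt as H eqn:EH.
  destruct (Req_dec v1 v2) as [Ev|Hv12].
  { subst v2. assert (C1' := fun s Hs => C1 0 s ltac:(lra) Hs). assert (C2' := fun s Hs => C2 0 s ltac:(lra) Hs).
    rewrite Rplus_0_r in C1', C2'. destruct (Rle_dec X1 X2).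
    - destruct (same_height x1 x2 g1 g2 rho1 rho2 sg e X1 X2 v1 e1 e2) as (t & I & E); auto.
      apply (Hne 0 t); auto; [apply Imax_0; auto|rewrite Phi_0; auto].
    - destruct (same_height x2 x1 g2 g1 rho2 rho1 sg e X2 X1 v1 e2 e1) as (t & I & E); auto; [lra|].
      apply Hno. eauto. }
  clear L1 L2 Hc1 Hc2 c1 c2.
  set (b1 := rho1 / 4) in *. set (b2 := rho2 / 4) in *.
  (* All heights of the loop and of the arms must lie strictly between [v2] and [v2 + H], where [Y]
     is injective, and the two sides must not overlap. *)
  assert (Hs1' : exists s1, 0 < s1 < e1 /\ v1 + s1 < v2 + H).
  { exists (Rmin e1 (v2 + H - v1) / 2). pose proof (Rmin_l e1 (v2 + H - v1)). pose proof (Rmin_r e1 (v2 + H - v1)).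
    assert (0 < Rmin e1 (v2 + H - v1)) by (apply Rmin_glb_lt; lra). lra. }
  assert (Hs2' : exists s2, 0 < s2 < e2 /\ v2 + s2 < v1).
  { exists (Rmin e2 (v1 - v2) / 2). pose proof (Rmin_l e2 (v1 - v2)). pose proof (Rmin_r e2 (v1 - v2)).
    assert (0 < Rmin e2 (v1 - v2)) by (apply Rmin_glb_lt; lra). lra. }
  destruct Hs1' as (s1 & Hs1' & Ht1). destruct Hs2' as (s2 & Hs2' & Ht2).
  assert (Hmono : forall X X' h, dom (X, sg * h) -> X <= X' -> dom (X', sg * h)).
  { intros X X' h HD HX. destruct (Y_flow _ (X' - X) HD) as [A _]; [lra|].
    replace ((X', sg * h) : C) with ((X, (sg * h)%R) + RtoC (X' - X))%C; auto.
    unfold Cplus, RtoC. simpl. f_equal; ring. }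
  assert (D1 : forall X s, X1 <= X -> 0 < s < e1 -> dom (X, sg * (v1 + s))).
  { intros X s HX Hs. apply (Hmono X1); auto. destruct (C1 0 s) as [A _]; try lra. rewrite Rplus_0_r in A. auto. }
  assert (D2 : forall X s, X2 <= X -> 0 < s < e2 -> dom (X, sg * (v2 + s))).
  { intros X s HX Hs. apply (Hmono X2); auto. destruct (C2 0 s) as [A _]; try lra. rewrite Rplus_0_r in A. auto. }
  (* Far to the right the whole strip of heights from [v2] to [v2 + H] belongs to the domain, so the
     loop and the second arm can change height there. *)
  destruct (dom_far (X1, sg * (v1 + s1)) (Rabs v2 + H)) as [R0 HR0]; [apply D1; lra|].
  assert (HR : exists R, R0 + 1 <= R /\ X1 + b1 + 1 <= R /\ X2 + b2 + 1 <= R).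
  { exists (Rmax R0 (Rmax (X1 + b1) (X2 + b2)) + 1). pose proof (Rmax_l R0 (Rmax (X1 + b1) (X2 + b2))).
    pose proof (Rmax_r R0 (Rmax (X1 + b1) (X2 + b2))). pose proof (Rmax_l (X1 + b1) (X2 + b2)). pose proof (Rmax_r (X1 + b1) (X2 + b2)). lra. }
  destruct HR as (R & HRa & HRb & HRc).
  assert (DR : forall X h, R - 1 <= X -> v2 <= h <= v2 + H -> dom (X, sg * h)).
  { intros X h HX Hhh. apply HR0; [lra|].
    assert (Rabs (sg * h) = Rabs h) as ->.
    { apply Rabs_sign. auto. }
    pose proof (Rle_abs v2). pose proof (Rle_abs (- v2)) as Q. rewrite Rabs_Ropp in Q. apply Rabs_le. lra. }
  destruct Hem1 as (HFe & Hback1 & Hlim1). destruct Hem2 as (_ & Hback2 & Hlim2).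
  assert (HeN : ~ N e).
  { intro HNe. destruct (at_open HA e HNe) as [d [Hd K]]. destruct (Hlim1 d Hd) as [T [HT KT]].
    apply Hf1. apply (at_flow HA x1 (- T)); [apply Hback1; lra|]. apply K, KT. lra. }
  assert (HYe : forall W, dom W -> Y W <> e) by (intros W HD E; apply HeN; rewrite <- E; apply Y_spec; auto).
  assert (HPe : forall x g rho s, chart F x g rho -> 0 <= s <= rho / 4 -> Pt g sg (rho/4) s <> e).
  { intros x g rho s Hg Hs E. pose proof (chart_pos Hg).
    destruct (Pt_flow HF Hg sg Hsg 0 s (rho/4)) as [A B]; try lra.
    apply (flow_nonzero F HF _ _ A); [apply (Pt_nonzero HF Hg sg Hsg); lra|]. rewrite B, Rplus_0_l, E. auto. }
  destruct (curve_avoid (fun u => Pt g1 sg b1 u) 0 (s1/2) e) as (da & Hda & Ka).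
  { intros u Hu. apply (Pt_pcont_s Hg1 sg Hsg); unfold b1 in *; lra. }
  { intros u Hu. apply (HPe x1 g1 rho1); auto. unfold b1 in *. lra. }
  destruct (curve_avoid (fun u => Pt g2 sg b2 u) 0 (s2/2) e) as (de & Hde & Ke).
  { intros u Hu. apply (Pt_pcont_s Hg2 sg Hsg); unfold b2 in *; lra. }
  { intros u Hu. apply (HPe x2 g2 rho2); auto. unfold b2 in *. lra. }
  destruct (curve_avoid (fun t => Y (t, sg * (v1 + s1/2))) (X1 + b1) (R + 1) e) as (db & Hdb & Kb).
  { intros t Ht. apply Y_hor, D1; lra. }
  { intros t Ht. apply HYe, D1; lra. }
  destruct (curve_avoid (fun h => Y (R + 1, sg * h)) (v2 + s2/2) (v1 + s1/2) e) as (dc & Hdc & Kc).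
  { intros t Ht. apply Y_ver, DR; lra. }
  { intros t Ht. apply HYe, DR; lra. }
  destruct (curve_avoid (fun t => Y (t, sg * (v2 + s2/2))) (X2 + b2) (R + 1) e) as (dd & Hdd & Kd).
  { intros t Ht. apply Y_hor, D2; lra. }
  { intros t Ht. apply HYe, D2; lra. }
  destruct (frontier_forward_avoid x1 e Hf1 Hx1 HFe) as (df & Hdf & Kf).
  destruct (frontier_forward_avoid x2 e Hf2 Hx2 HFe) as (dg & Hdg & Kg).
  (* At most the distance from [e] to each part of the two arms, so that the short segment
     connecting the two orbits near [e] misses them. *)
  assert (Hdl : exists dl, 0 < dl /\ dl <= da /\ dl <= db /\ dl <= dc /\ dl <= dd /\ dl <= de /\ dl <= df /\ dl <= dg).
  { assert (Hm2 : forall u v, 0 < u -> 0 < v -> exists w, 0 < w /\ w <= u /\ w <= v).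
    { intros u v Hu Hv'. exists (Rmin u v). split; [apply Rmin_glb_lt; auto|]. split; [apply Rmin_l|apply Rmin_r]. }
    destruct (Hm2 da db) as (w1 & ? & ? & ?); auto. destruct (Hm2 dc dd) as (w2 & ? & ? & ?); auto.
    destruct (Hm2 de df) as (w3 & ? & ? & ?); auto. destruct (Hm2 w1 w2) as (w4 & ? & ? & ?); auto.
    destruct (Hm2 w3 dg) as (w5 & ? & ? & ?); auto. destruct (Hm2 w4 w5) as (w6 & ? & ? & ?); auto.
    exists w6. lra. }
  destruct Hdl as (dl & Hdl & Hla & Hlb & Hlc & Hld & Hle & Hlf & Hlg).
  destruct (Hlim1 dl Hdl) as (T1 & HT1 & KT1). destruct (Hlim2 dl Hdl) as (T2 & HT2 & KT2).
  set (T := Rmax T1 T2). assert (T1 <= T) by apply Rmax_l. assert (T2 <= T) by apply Rmax_r.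
  set (z1 := Phi F (- T) x1). set (z2 := Phi F (- T) x2).
  assert (Hz1 : Cmod (z1 - e) < dl) by (apply KT1; lra). assert (Hz2 : Cmod (z2 - e) < dl) by (apply KT2; lra).
  assert (Heta : exists eta, 0 < eta /\ 2 * eta < H /\ eta < s1/2 /\ eta < v1 + s1/2 - (v2 + s2)).
  { exists (Rmin H (Rmin s1 (v1 + s1/2 - (v2 + s2))) / 3).
    assert (0 < Rmin H (Rmin s1 (v1 + s1/2 - (v2 + s2)))) by (repeat apply Rmin_glb_lt; lra).
    pose proof (Rmin_l H (Rmin s1 (v1 + s1/2 - (v2 + s2)))). pose proof (Rmin_r H (Rmin s1 (v1 + s1/2 - (v2 + s2)))).
    pose proof (Rmin_l s1 (v1 + s1/2 - (v2 + s2))). pose proof (Rmin_r s1 (v1 + s1/2 - (v2 + s2))). lra. }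
  destruct Heta as (eta & Heta & Heta1 & Heta2 & Heta3).
  (* The arms run at half the heights [s1] and [s2] of the loop, below its two horizontal sides. The
     first arm is to cross the descending side of the loop at this height. *)
  set (h1 := v1 + s1/2) in *.
  set (W0 := (R, sg * h1) : C). set (d := (- (Ci * RtoC sg))%C).
  set (G := fun u => Y (W0 + d * u)%C).
  assert (Hd0 : d <> 0).
  { unfold d. intro Q. apply (f_equal Im) in Q. unfold Im, Copp, Cmult, Ci, RtoC in Q. simpl in Q. destruct Hsg; subst sg; lra. }
  assert (EW : forall u, (W0 + d * u)%C = (R + sg * Im u, sg * (h1 - Re u))).
  { intros [u v]. unfold W0, d, Cplus, Cmult, Copp, Ci, RtoC, Re, Im. simpl. f_equal; ring. }
  set (rest := ((fun t => Y (R, sg * t)), h1 - eta, v2 + s2) :: ((fun t => Y (t, sg * (v2 + s2))), R, X2) ::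
    ((fun s => Pt g2 sg 0 s), s2, 0) :: ((fun t => Phi F t x2), 0, - T) :: ((fun t => z2 + RtoC t * (z1 - z2))%C, 0, 1) ::
    ((fun t => Phi F t x1), - T, 0) :: ((fun s => Pt g1 sg 0 s), 0, s1) :: ((fun t => Y (t, sg * (v1 + s1))), X1, R) ::
    ((fun t => Y (R, sg * t)), v1 + s1, h1 + eta) :: nil).
  set (L := ((fun t => G (t, 0)), - eta, eta) :: rest). set (z := G (- eta, 0)).
  assert (Hbb : 0 < b1 /\ 0 < b2).
  { unfold b1, b2. pose proof (chart_pos Hg1). pose proof (chart_pos Hg2). lra. }
  assert (E01 := Pt_origin sg Hg1).
  assert (E02 := Pt_origin sg Hg2).
  assert (EY1 : forall s, 0 < s < e1 -> Pt g1 sg 0 s = Y (X1, sg * (v1 + s))).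
  { intros s Hs. destruct (C1 0 s) as [_ A]; try lra. rewrite Rplus_0_r in A. auto. }
  assert (EY2 : forall s, 0 < s < e2 -> Pt g2 sg 0 s = Y (X2, sg * (v2 + s))).
  { intros s Hs. destruct (C2 0 s) as [_ A]; try lra. rewrite Rplus_0_r in A. auto. }
  assert (Hok : List.Forall piece_ok rest).
  { repeat constructor; intros t Ht.
    - minmax Ht. apply Y_ver, DR; unfold h1 in *; lra.
    - minmax Ht. apply Y_hor, D2; lra.
    - minmax Ht. apply (Pt_pcont_s Hg2 sg Hsg); unfold b2 in *; lra.
    - minmax Ht. apply pcont_Phi, Hback2; auto. lra.
    - eapply der_cont, rder_segment.
    - minmax Ht. apply pcont_Phi, Hback1; auto. lra.
    - minmax Ht. apply (Pt_pcont_s Hg1 sg Hsg); unfold b1 in *; lra.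
    - minmax Ht. apply Y_hor, D1; lra.
    - unfold h1 in *. minmax Ht. apply Y_ver, DR; lra. }
  assert (HG : forall u, in_box (- eta) eta (-1) 1 u -> dom (W0 + d * u)).
  { intros u [Hu1 Hu2]. rewrite EW. unfold h1 in *. apply DR; [destruct Hsg as [-> | ->]; lra|lra]. }
  assert (HokL : List.Forall piece_ok L).
  { constructor; auto. intros t Ht. minmax Ht. unfold G.
    apply (cont_comp RtoC cid (fun t => W0 + d * (t, 0%R))%C Y).
    - apply cont_plus; [apply cont_const|]. apply cont_mult; [apply cont_const|]. apply cont_pair; [apply cont_self|apply cont_const].
    - eapply der_cont, Y_der. apply HG. split; simpl; lra. }
  assert (EG : forall t s, G (t, s) = Y (R + sg * s, sg * (h1 - t))) by (intros; unfold G; rewrite EW; auto).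
  assert (HJ : joins z L z).
  { unfold z. simpl. rewrite !EG, Rmult_0_r, Rplus_0_r. repeat split; auto.
    - rewrite Phi_0, E02; auto.
    - fold z2. ring.
    - fold z1. ring.
    - rewrite E01, Phi_0; auto.
    - rewrite EY1 by lra. auto.
    - do 3 f_equal. ring. }
  (* Logarithmic coordinates of the part of [rest] inside the basin, which reduces disjointness from
     the loop to comparing coordinates. *)
  set (SL := fun X h => (X = R /\ v2 + s2 <= h <= v1 + s1 /\ (h <= h1 - eta \/ h1 + eta <= h)) \/
    (h = v2 + s2 /\ X2 <= X <= R) \/ (h = v1 + s1 /\ X1 <= X <= R) \/ (X = X1 /\ v1 < h <= v1 + s1) \/ (X = X2 /\ v2 < h <= v2 + s2)).
  assert (HLrest : forall q, on_chain rest q -> (exists X h, SL X h /\ dom (X, sg * h) /\ q = Y (X, sg * h)) \/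
    (exists t, t <= 0 /\ (q = Phi F t x1 \/ q = Phi F t x2)) \/ Cmod (q - e) < dl).
  { unfold SL. intros q [P [HP HPz]]. destruct HP as [<-|[<-|[<-|[<-|[<-|[<-|[<-|[<-|[<-|[]]]]]]]]]]; destruct HPz as [t [Ht E]].
    - minmax Ht. left. exists R, t. split; [unfold h1 in *; lra|]. split; auto. apply DR; unfold h1 in *; lra.
    - minmax Ht. left. exists t, (v2 + s2). split; [lra|]. split; auto. apply D2; lra.
    - minmax Ht. destruct (Req_dec t 0) as [->|].
      + right. left. exists 0. split; [lra|]. right. rewrite Phi_0 by auto. congruence.
      + left. exists X2, (v2 + t). split; [lra|]. split; [apply D2; lra|]. rewrite <- EY2 by lra. auto.
    - minmax Ht. right. left. exists t. split; [lra|]. auto.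
    - minmax Ht. right. right. rewrite <- E. apply segment_ball; auto.
    - minmax Ht. right. left. exists t. split; [lra|]. auto.
    - minmax Ht. destruct (Req_dec t 0) as [->|].
      + right. left. exists 0. split; [lra|]. left. rewrite Phi_0 by auto. congruence.
      + left. exists X1, (v1 + t). split; [lra|]. split; [apply D1; lra|]. rewrite <- EY1 by lra. auto.
    - minmax Ht. left. exists t, (v1 + s1). split; [lra|]. split; auto. apply D1; lra.
    - unfold h1 in *. minmax Ht. left. exists R, t. split; [lra|]. split; auto. apply DR; lra. }
  assert (HN1 : forall t, Imax F x1 t -> ~ N (Phi F t x1)) by (intros t HI K; apply (at_flow HA) in K; auto; apply Hf1; auto).
  assert (HN2 : forall t, Imax F x2 t -> ~ N (Phi F t x2)) by (intros t HI K; apply (at_flow HA) in K; auto; apply Hf2; auto).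
  assert (Hsgd : forall u v, Rabs (sg * u - sg * v) = Rabs (u - v)).
  { intros u v. rewrite <- Rmult_minus_distr_l. apply Rabs_sign. auto. }
  assert (Hsame : forall X h X' h', dom (X, sg * h) -> dom (X', sg * h') -> v2 < h < v2 + H -> v2 < h' < v2 + H ->
    Y (X, sg * h) = Y (X', sg * h') -> X = X' /\ h = h').
  { intros X h X' h' A B Hh1 Hh2 E. apply Y_inj in E; auto.
    - injection E as E1 E2. split; auto. destruct Hsg as [-> | ->]; lra.
    - simpl. rewrite Hsgd, <- EH. apply Rabs_def1; lra. }
  assert (Hoffr : forall X h, dom (X, sg * h) -> v2 < h < v2 + H -> dl <= Cmod (Y (X, sg * h) - e) ->
    on_chain rest (Y (X, sg * h)) -> SL X h).
  { intros X h HD Hhh Hc HC. destruct (HLrest _ HC) as [(X' & h' & HS & HD' & E)|[(t & Ht & [E|E])|K]]; [| | |lra].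
    - apply Hsame in E; auto; [destruct E; subst; auto|]. unfold SL, h1 in HS. lra.
    - exfalso. apply (HN1 t); auto. rewrite <- E. apply Y_spec; auto.
    - exfalso. apply (HN2 t); auto. rewrite <- E. apply Y_spec; auto. }
  assert (Hmid : forall q, on_piece ((fun t => G (t, 0)), - eta, eta) q -> exists h, h1 - eta <= h <= h1 + eta /\ q = Y (R, sg * h)).
  { intros q [t [Ht E]]. minmax Ht. exists (h1 - t). split; [lra|].
    rewrite <- E, EG, Rmult_0_r, Rplus_0_r. auto. }
  assert (Hoff : forall X h, dom (X, sg * h) -> v2 < h < v2 + H -> dl <= Cmod (Y (X, sg * h) - e) ->
    on_chain L (Y (X, sg * h)) -> SL X h \/ (X = R /\ h1 - eta <= h <= h1 + eta)).
  { intros X h HD Hhh Hc (P & [<-|HP] & HPz).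
    - right. destruct (Hmid _ HPz) as (h' & Hh' & E). apply Hsame in E; auto; [destruct E; subst; auto| |unfold h1 in *; lra].
      apply DR; unfold h1 in *; lra.
    - left. apply Hoffr; auto. exists P. auto. }
  assert (HoffG : forall q, ~ N q -> dl <= Cmod (q - e) -> on_chain L q -> exists t, t <= 0 /\ (q = Phi F t x1 \/ q = Phi F t x2)).
  { intros q Hq Hc (P & [<-|HP] & HPz).
    - exfalso. destruct (Hmid _ HPz) as (h' & Hh' & E). apply Hq. rewrite E. apply Y_spec, DR; unfold h1 in *; lra.
    - destruct (HLrest q) as [(X' & h' & HS & HD' & E)|[K|K]]; [exists P; auto| |auto|lra].
      exfalso. apply Hq. rewrite E. apply Y_spec. auto. }
  assert (A1 : wind L (Y (R - 1/2, sg * h1)) = 0).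
  { unfold h1. apply (arm L z x1 g1 rho1 sg X1 v1 (s1/2)); auto; fold b1; try lra.
    - intros t Ht HI HC. destruct (HoffG _ (HN1 t HI)) with (2 := HC) as (t' & Ht' & [E|E]).
      + specialize (Kf t ltac:(lra) HI). lra.
      + apply (frontier_time_unique HF HA) in E; auto. lra.
      + apply (Hne t t'); auto.
    - intros u Hu HC. destruct (C1 b1 u) as [A B]; try lra. specialize (Ka u ltac:(lra)). rewrite <- B in Ka, HC.
      destruct (Hoff _ _ A) with (3 := HC) as [K|K]; [lra|lra| |unfold h1 in *; lra]. unfold SL, h1 in K. lra.
    - apply C1; lra.
    - intros t Ht. apply D1; lra.
    - intros t Ht HC. specialize (Kb t ltac:(lra)).
      destruct (Hoff t (v1 + s1/2)) with (4 := HC) as [K|K]; [apply D1; lra|lra|unfold h1 in *; lra| |unfold h1 in *; lra]. unfold SL, h1 in K. lra. }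
  (* The second arm passes below the loop, climbs to the right of it to the height [h1], and comes
     back until it faces the end of the first arm across the descending side. *)
  assert (A2 : wind L (Y (R + 1/2, sg * h1)) = 0).
  { assert (B1 : wind L (Y (R + 1, sg * (v2 + s2/2))) = 0).
    { apply (arm L z x2 g2 rho2 sg X2 v2 (s2/2)); auto; fold b2; try lra.
      - intros t Ht HI HC. destruct (HoffG _ (HN2 t HI)) with (2 := HC) as (t' & Ht' & [E|E]).
        + specialize (Kg t ltac:(lra) HI). lra.
        + apply (Hne t' t); auto.
        + apply (frontier_time_unique HF HA) in E; auto. lra.
      - intros u Hu HC. destruct (C2 b2 u) as [A B]; try lra. specialize (Ke u ltac:(lra)). rewrite <- B in Ke, HC.
        destruct (Hoff _ _ A) with (3 := HC) as [K|K]; [lra|lra| |unfold h1 in *; lra]. unfold SL, h1 in K. lra.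
      - apply C2; lra.
      - intros t Ht. apply D2; lra.
      - intros t Ht HC. specialize (Kd t ltac:(lra)).
        destruct (Hoff t (v2 + s2/2)) with (4 := HC) as [K|K]; [apply D2; lra|lra|lra| |unfold h1 in *; lra]. unfold SL, h1 in K. lra. }
    rewrite <- B1. transitivity (wind L (Y (R + 1, sg * h1))).
    - symmetry. apply (wind_move L z (fun t => Y (t, sg * h1)) (R + 1/2) (R + 1)); auto; try lra.
      + intros t Ht. apply Y_hor, DR; unfold h1; lra.
      + intros t Ht HC. specialize (Kb t ltac:(lra)). fold h1 in Kb.
        destruct (Hoff t h1) with (4 := HC) as [K|K]; [apply DR; unfold h1; lra|unfold h1; lra|lra| |lra]. unfold SL, h1 in K. lra.
    - apply (wind_move L z (fun h => Y (R + 1, sg * h)) (v2 + s2/2) h1); auto; unfold h1 in *; try lra.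
      + intros h Hhh. apply Y_ver, DR; lra.
      + intros h Hhh HC. specialize (Kc h ltac:(lra)).
        destruct (Hoff (R + 1) h) with (4 := HC) as [K|K]; [apply DR; lra|lra|lra| |lra]. unfold SL in K. lra. }
  apply (wind_jump G (fun u => d * F (G u))%C eta 1 z rest); auto; try lra.
  - intros u Hu. specialize (HG u Hu). split; [|apply Cmult_neq_0; auto; apply Y_nonzero; auto].
    unfold G. apply (der_comp cid cid (fun u => W0 + d * u)%C Y); [|apply Y_der; auto].
    apply (der_val cid _ _ (0 + d * 1)%C); [ring|]. apply der_plus; [apply der_const|apply der_scal, der_self].
  - intros u w Hu Hw E. assert (HGu := HG u Hu). assert (HGw := HG w Hw). destruct Hu as [Hu1 Hu2], Hw as [Hw1 Hw2].
    unfold G in E. rewrite !EW in *. apply Hsame in E; auto; try (unfold h1 in *; lra). destruct E as [Ea Eb].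
    destruct u as [u1 u2], w as [w1 w2]. simpl in *. f_equal; [lra|]. destruct Hsg as [-> | ->]; lra.
  - intros s Hs HC. rewrite EG, Rminus_0_r in HC. assert (Hss : -1/2 <= sg * s <= 1/2) by (destruct Hsg as [-> | ->]; lra).
    specialize (Kb (R + sg * s) ltac:(lra)). fold h1 in Kb.
    assert (K : SL (R + sg * s) h1) by (apply Hoffr; auto; [apply DR; unfold h1; lra|unfold h1; lra|lra]).
    unfold SL in K. unfold h1 in *. lra.
  - fold L. rewrite !EG, Rminus_0_r. destruct Hsg as [Es | Es]; rewrite Es in *.
    + replace (R + 1 * (1/2)) with (R + 1/2) by ring. replace (R + 1 * - (1/2)) with (R - 1/2) by ring. congruence.
    + replace (R + -1 * (1/2)) with (R - 1/2) by ring. replace (R + -1 * - (1/2)) with (R + 1/2) by ring. congruence.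
Qed.
End Coordinates.

(** * Paths *)

(** Clamping the parameter trades continuity relative to the unit interval for two-sided continuity
    on the line. *)
Lemma joined_path (B : C -> Prop) x y : joined B x y <->
  exists p : R -> C, (forall s, pcont p s) /\ (forall s, 0 <= s <= 1 -> B (p s)) /\ p 0 = x /\ p 1 = y.
Proof.
  split.
  - intros (ga & Hc & HB & H0 & H1). exists (fun s => ga (clamp 0 1 s)). split; [|split].
    + intros s eps He. assert (Hin := clamp_in 0 1 s ltac:(lra)).
      assert (Hl : locally (ga (clamp 0 1 s)) (fun z => Cmod (z - ga (clamp 0 1 s)) < eps)).
      { apply locally_Cmod. exists eps. auto. }
      specialize (Hc _ Hin _ Hl). unfold filtermap, within in Hc. apply locally_Rabs in Hc. destruct Hc as [d [Hd K]].
      exists d. split; auto. intros u Hu. rewrite Cmod_RtoC_minus in Hu. apply K; [|apply clamp_in; lra].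
      eapply Rle_lt_trans; [apply clamp_lip|auto].
    + intros s Hs. apply HB, clamp_in. lra.
    + rewrite !clamp_id by lra. auto.
  - intros (p & Hc & HB & H0 & H1). exists p. split; auto.
    intros s Hs P HP. apply locally_Cmod in HP. destruct HP as [eps [He HP]].
    destruct (Hc s eps He) as [d [Hd K]]. unfold filtermap, within. apply locally_Rabs. exists d. split; auto.
    intros u Hu _. apply HP, K. rewrite Cmod_RtoC_minus. auto.
Qed.

Lemma joined_intro (B : C -> Prop) (p : R -> C) :
  (forall s, 0 <= s <= 1 -> pcont p s /\ B (p s)) -> joined B (p 0) (p 1).
Proof.
  intros H. apply joined_path. exists (fun s => p (clamp 0 1 s)). split; [|split].
  - intros s. apply (cont_comp RtoC RtoC (clamp 0 1) p); [apply pcont_clamp|apply H, clamp_in; lra].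
  - intros s Hs. apply H, clamp_in. lra.
  - rewrite !clamp_id by lra. auto.
Qed.

Lemma joined_sym B x y : joined B x y -> joined B y x.
Proof.
  intros H. apply joined_path in H. destruct H as (p & Hc & HB & <- & <-).
  replace (p 1) with (p (1 + -1 * 0)) by (f_equal; ring). replace (p 0) with (p (1 + -1 * 1)) by (f_equal; ring).
  apply (joined_intro B (fun s => p (1 + -1 * s))). intros s Hs. split; [apply pcont_affine; auto|apply HB; lra].
Qed.

Lemma joined_trans B x y z : joined B x y -> joined B y z -> joined B x z.
Proof.
  intros H1 H2. apply joined_path in H1, H2. destruct H1 as (p & Hp & HB & <- & E1). destruct H2 as (q & Hq & HB' & E2 & <-).
  set (f := fun s => if Rle_dec s (1/2) then p (0 + 2 * s) else q (-1 + 2 * s)).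
  replace (p 0) with (f 0) by (unfold f; destruct (Rle_dec 0 (1/2)); [f_equal; ring|lra]).
  replace (q 1) with (f 1) by (unfold f; destruct (Rle_dec 1 (1/2)); [lra|f_equal; ring]).
  apply joined_intro. intros s Hs. split.
  - apply (pcont_glue (fun s => p (0 + 2 * s)) (fun s => q (-1 + 2 * s))); [apply pcont_affine; auto|apply pcont_affine; auto|].
    replace (0 + 2 * (1/2)) with 1 by field. replace (-1 + 2 * (1/2)) with 0 by field. congruence.
  - unfold f. destruct (Rle_dec s (1/2)); [apply HB; lra|apply HB'; lra].
Qed.

(** * Discs with rational data *)

(** Cantor pairing decodes five naturals; differences of naturals supply integer numerators, over
    the common denominator [m + 1]. The radius is twice the grid width, so some disc of each mesh
    contains any given point. *)
Definition disc (n : nat) : C * R :=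
  let (p, m) := of_nat n in
  let (u, v) := of_nat p in
  let (i, j) := of_nat u in
  let (k, l) := of_nat v in
  (((INR i - INR j) / (INR m + 1), (INR k - INR l) / (INR m + 1)), 2 / (INR m + 1)).

Definition in_disc (n : nat) (z : C) : Prop := Cmod (z - fst (disc n)) < snd (disc n).

Lemma rational_approx x m : 0 < m -> exists i j, Rabs (x - (INR i - INR j) / m) < 1 / m.
Proof.
  intros Hm. destruct (base_Int_part (x * m)) as [B1 B2]. set (k := Int_part (x * m)) in *.
  exists (Z.to_nat k), (Z.to_nat (- k)).
  assert (E : INR (Z.to_nat k) - INR (Z.to_nat (- k)) = IZR k).
  { rewrite !INR_IZR_INZ, <- minus_IZR. f_equal. lia. }
  assert (Hm' : 0 < 1 / m) by (apply Rdiv_lt_0_compat; lra).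
  rewrite E. replace (x - IZR k / m) with ((x * m - IZR k) * (1 / m)) by (field; lra).
  rewrite Rabs_pos_eq by (apply Rmult_le_pos; lra). rewrite <- (Rmult_1_l (1 / m)) at 2. apply Rmult_lt_compat_r; lra.
Qed.

Lemma small_disc z d : 0 < d -> exists n, in_disc n z /\ forall y, in_disc n y -> Cmod (y - z) < d.
Proof.
  intros Hd. destruct (INR_unbounded (4 / d)) as [m Hm]. set (M := INR m + 1).
  assert (HM : 0 < M) by (unfold M; pose proof (pos_INR m); lra).
  assert (H4 : 4 / M < d).
  { apply Rlt_div_l in Hm; [|lra]. apply Rlt_div_l; auto. unfold M. lra. }
  destruct (rational_approx (Re z) M HM) as (i & j & H1). destruct (rational_approx (Im z) M HM) as (k & l & H2).
  exists (to_nat (to_nat (to_nat (i, j), to_nat (k, l)), m)). unfold in_disc, disc. rewrite !cancel_of_to. simpl fst. simpl snd. fold M.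
  set (c := ((INR i - INR j) / M, (INR k - INR l) / M) : C).
  assert (Hz : Cmod (z - c) < 2 / M).
  { eapply Rle_lt_trans; [apply Cmod_le_ReIm|]. rewrite Re_minus, Im_minus. simpl. replace (2 / M) with (1 / M + 1 / M) by (field; lra). lra. }
  split; auto. intros y Hy. rewrite Cmod_sym in Hz. pose proof (Cmod_tri y c z).
  replace (4 / M) with (2 / M + 2 / M) in H4 by (field; lra). lra.
Qed.

Lemma least_nat (P : nat -> Prop) : (exists n, P n) -> exists n, P n /\ forall m, (m < n)%nat -> ~ P m.
Proof.
  intros [n Hn]. revert Hn. induction n as [n IH] using (well_founded_induction lt_wf). intros Hn.
  destruct (classic (exists m, (m < n)%nat /\ P m)) as [[m [Hm HP]]|Hno]; [eauto|].
  exists n. split; auto. intros m Hm HP. apply Hno. eauto.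
Qed.

(** * Path components of the frontier *)

Lemma sequential_limit (phi : R -> C) (tk : nat -> R) l v :
  (forall eps, 0 < eps -> exists T, forall t, T <= t -> Cmod (phi t - l) < eps) -> is_lim_seq tk p_infty ->
  filterlim (fun k => phi (tk k)) eventually (locally v) -> v = l.
Proof.
  intros Ht Hlim Hc. apply separated. intros eps Heps. destruct (Ht (eps/2)) as [T KT]; [lra|].
  assert (Hl : locally v (fun y => Cmod (y - v) < eps/2)) by (apply locally_Cmod; exists (eps/2); split; [lra|auto]).
  specialize (Hc _ Hl). destruct Hc as [n1 Hn1]. apply is_lim_seq_spec in Hlim. destruct (Hlim T) as [n2 Hn2].
  specialize (Hn1 (Nat.max n1 n2) (Nat.le_max_l _ _)). specialize (Hn2 (Nat.max n1 n2) (Nat.le_max_r _ _)).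
  specialize (KT (tk (Nat.max n1 n2)) ltac:(lra)). rewrite Cmod_sym in Hn1.
  pose proof (Cmod_tri v (phi (tk (Nat.max n1 n2))) l). lra.
Qed.

Section Components.
Context {F : C -> C} (HF : holo F) (Hex : exists z, F z <> 0) {a lam : C} (Ha : F a = 0)
  {psi psi' : C -> C} {r : R} (HL : linearization F a lam psi psi' r) (Hre : Re lam < 0).

Let N : C -> Prop := NN F a r.
Let HA : attracting F a N := NN_attracting HF Ha HL Hre.
Let K : C -> Prop := frontier N.

Lemma orbit_refl x : orbit F x x.
Proof. exists 0. split; [apply Imax_0; auto|rewrite Phi_0; auto]. Qed.

Lemma orbit_sym x y : orbit F x y -> orbit F y x.
Proof. intros (t & HI & ->). destruct (flow_back F HF x t HI) as [A B]. exists (- t). auto. Qed.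

Lemma orbit_trans x y z : orbit F x y -> orbit F y z -> orbit F x z.
Proof.
  intros (t & HI & ->) (s & HI' & ->). assert (J : Imax F x (t + s)) by (apply flow_join; auto).
  exists (t + s). split; auto. apply flow_split; auto.
Qed.

Lemma emanates_equilibrium e : F e = 0 -> emanates F e e.
Proof.
  intros He. split; auto. split; [intros; apply Imax_equilibrium; auto|]. intros eps Heps. exists 0. split; [lra|].
  intros t _. rewrite Phi_equilibrium, Cmod_self by auto. auto.
Qed.

Lemma emanates_unique x e e' : emanates F x e -> emanates F x e' -> e = e'.
Proof.
  intros (_ & _ & H) (_ & _ & H'). apply separated. intros eps He.
  destruct (H (eps/2)) as [T [HT K1]]; [lra|]. destruct (H' (eps/2)) as [T' [HT' K2]]; [lra|].
  specialize (K1 (- Rmax T T')). specialize (K2 (- Rmax T T')). pose proof (Rmax_l T T'). pose proof (Rmax_r T T').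
  specialize (K1 ltac:(lra)). specialize (K2 ltac:(lra)). rewrite Cmod_sym in K1.
  pose proof (Cmod_tri e (Phi F (- Rmax T T') x) e'). lra.
Qed.

Lemma emanates_fixed x e : emanates F x e -> F x = 0 -> x = e.
Proof. intros H Hx. apply (emanates_unique x); auto. apply emanates_equilibrium; auto. Qed.

Lemma emanates_orbit x y e : orbit F x y -> emanates F x e -> emanates F y e.
Proof.
  intros (t & HI & ->) (He & Hb & H).
  assert (HI' : forall s, s <= Rmin 0 (- t) -> Imax F x (t + s)).
  { intros s Hs. apply Hb. pose proof (Rmin_r 0 (- t)). lra. }
  assert (Hs : forall s, Imax F x (t + s) -> Imax F (Phi F t x) s /\ Phi F s (Phi F t x) = Phi F (t + s) x).
  { intros s Hs. apply flow_split; auto. }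
  split; auto. split.
  - intros s Hs0. destruct (Rle_dec s (Rmin 0 (- t))).
    + apply Hs, HI'. auto.
    + apply (Imax_convex F _ (Rmin 0 (- t)) s 0); [apply Hs, HI'; lra|apply Imax_0; auto|lra].
  - intros eps Heps. destruct (H eps Heps) as [T [HT KT]]. exists (T + Rabs t). pose proof (Rabs_pos t). pose proof (Rle_abs t).
    split; [lra|]. intros s Hss. destruct (Hs s) as [_ ->]; [apply HI'; apply Rmin_glb; lra|]. apply KT. lra.
Qed.

(** The description of path components by orbits, to be compared with [joined]. The second case also
    links an equilibrium to the orbits emanating from it. *)
Definition linked (x y : C) : Prop := orbit F x y \/ exists e, emanates F x e /\ emanates F y e.

Lemma linked_sym x y : linked x y -> linked y x.
Proof. intros [H|(e & H1 & H2)]; [left; apply orbit_sym; auto|right; eauto]. Qed.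

Lemma linked_trans x y z : linked x y -> linked y z -> linked x z.
Proof.
  intros [H|(e & H1 & H2)] [H'|(e' & H1' & H2')].
  - left. apply (orbit_trans x y z); auto.
  - right. exists e'. split; auto. apply (emanates_orbit y); auto. apply orbit_sym; auto.
  - right. exists e. split; auto. apply (emanates_orbit y); auto.
  - right. exists e. rewrite (emanates_unique y e e') at 2 by auto. auto.
Qed.

Lemma emanates_frontier x e : K x -> emanates F x e -> K e.
Proof.
  intros Hx (He & Hb & H). apply (frontier_limit HA). intros d Hd.
  destruct (H d Hd) as [T [HT KT]]. exists (Phi F (- T) x). split; [apply KT; lra|].
  apply (frontier_flow HF HA); auto. apply Hb. lra.
Qed.

Lemma emanates_joined x e : K x -> emanates F x e -> joined K x e.
Proof.
  intros Hx Hem. assert (HKe := emanates_frontier x e Hx Hem). destruct Hem as (He & Hb & H).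
  (* The time [ln (1 - s)] runs through all negative times as [s] tends to 1, where the equilibrium
     completes the path. *)
  set (p := fun s => if Rlt_dec s 1 then Phi F (ln (1 - s)) x else e).
  assert (Hln : forall s, 0 <= s < 1 -> ln (1 - s) <= 0).
  { intros s Hs. rewrite <- ln_1. destruct (Req_dec s 0) as [->|]; [rewrite Rminus_0_r; lra|]. left. apply ln_increasing; lra. }
  replace x with (p 0) at 1.
  2:{ unfold p. destruct (Rlt_dec 0 1); [|lra]. rewrite Rminus_0_r, ln_1, Phi_0; auto. }
  replace e with (p 1) at 1 by (unfold p; destruct (Rlt_dec 1 1); [lra|auto]).
  apply joined_intro. intros s Hs. unfold p at 2. destruct (Rlt_dec s 1) as [Hs1|Hs1].
  - split; [|apply (frontier_flow HF HA); auto; apply Hb, Hln; lra].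
    apply (cont_ext RtoC (fun s => Phi F (ln (1 - s)) x)) with (r := 1 - s); [lra| |].
    + intros u Hu. rewrite Cmod_RtoC_minus in Hu. apply Rabs_def2 in Hu. unfold p. destruct (Rlt_dec u 1); [auto|lra].
    + apply (cont_comp RtoC RtoC (fun s => ln (1 - s)) (fun t => Phi F t x)); [|apply Phi_pcont; auto; apply Hb, Hln; lra].
      intros eps Heps. destruct (ln_continue (1 - s) ltac:(lra) eps Heps) as [d [Hd Kd]].
      exists (Rmin d (1 - s)). split; [apply Rmin_glb_lt; lra|]. intros u Hu. rewrite Cmod_RtoC_minus in *.
      assert (U1 := Rlt_Rmin_l Hu). assert (U2 := Rlt_Rmin_r Hu). apply Rabs_def2 in U2.
      destruct (Req_dec u s) as [->|Hus]; [rewrite Rminus_diag, Rabs_R0; auto|].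
      apply (Kd (1 - u)). split.
      * split; [unfold D_x, no_cond; lra|lra].
      * simpl. unfold Rdist. replace (1 - u - (1 - s)) with (- (u - s)) by ring. rewrite Rabs_Ropp. auto.
  - split; auto. replace s with 1 by lra. intros eps Heps. destruct (H eps Heps) as [T [HT KT]].
    exists (exp (- T)). split; [apply exp_pos|]. intros u Hu. rewrite Cmod_RtoC_minus in Hu. apply Rabs_def2 in Hu.
    unfold p. destruct (Rlt_dec 1 1); [lra|]. destruct (Rlt_dec u 1); [|rewrite Cmod_self; auto].
    apply KT. rewrite <- (ln_exp (- T)). left. apply ln_increasing; lra.
Qed.

Lemma linked_joined x y : K x -> K y -> linked x y -> joined K x y.
Proof.
  intros Hx Hy [(t & HI & ->)|(e & H1 & H2)].
  - rewrite <- (Phi_0 F HF x) at 1. replace 0 with (0 + t * 0) by ring. replace (Phi F t x) with (Phi F (0 + t * 1) x) by (f_equal; ring).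
    apply (joined_intro K (fun s => Phi F (0 + t * s) x)). intros s Hs.
    assert (J : Imax F x (0 + t * s)).
    { destruct (Rle_dec 0 t).
      - apply (Imax_convex F x 0 _ t); auto; [apply Imax_0; auto|nra].
      - apply (Imax_convex F x t _ 0); auto; [apply Imax_0; auto|nra]. }
    split; [|apply (frontier_flow HF HA); auto].
    apply (pcont_affine 0 t s (fun t => Phi F t x)). apply Phi_pcont; auto.
  - apply joined_trans with e; [apply emanates_joined; auto|apply joined_sym, emanates_joined; auto].
Qed.

(** The path is cut at its first visit to [e]; before that it meets no equilibrium, and
    [path_into_equilibrium] applies. *)
Lemma near_equilibrium (p : R -> C) e d u t : u <= t -> (forall s, pcont p s) -> (forall s, u <= s <= t -> K (p s)) ->
  (forall s, u <= s <= t -> Cmod (p s - e) < d) -> (forall z, 0 < Cmod (z - e) < d -> F z <> 0) ->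
  F e = 0 -> p t = e -> emanates F (p u) e.
Proof.
  intros Hut Hp HK Hd Hz He Et.
  destruct (closed_min (fun s => p s = e) u t t) as [s1 [Hs1 [E1 Hmin]]]; [lra|auto| |].
  - intros s Hs Hn. destruct (cont_nonzero RtoC (fun s => p s - e)%C s) as [d1 [Hd1 K1]].
    + apply cont_minus; auto. apply cont_const.
    + apply Cminus_eq_contra; auto.
    + exists d1. split; auto. intros v _ Hv E. specialize (K1 v). rewrite Cmod_RtoC_minus, E, Cmod_self in K1.
      pose proof (proj1 (Cmod_gt_0 _) (Cminus_eq_contra _ _ Hn)). specialize (K1 Hv). lra.
  - destruct (Req_dec u s1) as [->|]; [rewrite E1; apply emanates_equilibrium; auto|].
    apply (path_into_equilibrium HF HA p u s1); auto; [lra| |].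
    + intros s Hs. split; auto. apply HK. lra.
    + intros s Hs. apply Hz. split; [|apply Hd; lra]. apply Cmod_gt_0, Cminus_eq_contra, Hmin. auto.
Qed.

(** Being linked to the starting point is locally constant along the path: by [frontier_local] at
    ordinary points, and by [near_equilibrium], applied to the path and to its reversal, at
    equilibria. *)
Lemma joined_linked x y : joined K x y -> linked x y.
Proof.
  intros H. apply joined_path in H. destruct H as (p & Hp & HK & <- & <-).
  apply (interval_connected (fun s => linked (p 0) (p s)) 0 1); [lra| |left; apply orbit_refl].
  intros t Ht.
  assert (Hloc : exists d, 0 < d /\ forall u, 0 <= u <= 1 -> Rabs (u - t) < d -> linked (p t) (p u)).
  { destruct (Ceq_dec (F (p t)) 0) as [He|Hn].
    - destruct (isolated_zeros F (p t) HF Hex) as [d1 [Hd1 K1]]. destruct (Hp t d1 Hd1) as [d [Hd Kd]].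
      assert (Kd' : forall s, Rabs (s - t) < d -> Cmod (p s - p t) < d1) by (intros; apply Kd; rewrite Cmod_RtoC_minus; auto).
      exists d. split; auto. intros u Hu Hut. apply Rabs_def2 in Hut. right. exists (p t). split; [apply emanates_equilibrium; auto|].
      destruct (Rle_dec u t).
      + apply (near_equilibrium p (p t) d1 u t); auto.
        * intros s Hs. apply HK. lra.
        * intros s Hs. apply Kd', Rabs_def1; lra.
      + replace u with (0 + -1 * - u) by ring.
        apply (near_equilibrium (fun s => p (0 + -1 * s)) (p t) d1 (- u) (- t)); auto; try lra.
        * intros s. apply pcont_affine. auto.
        * intros s Hs. apply HK. lra.
        * intros s Hs. apply Kd', Rabs_def1; lra.
        * f_equal. ring.
    - destruct (frontier_local HF HA (p t) 1 (HK t Ht) Hn Rlt_0_1) as [d1 [Hd1 K1]].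
      destruct (Hp t d1 Hd1) as [d [Hd Kd]]. exists d. split; auto. intros u Hu Hut. left.
      destruct (K1 (p u)) as (s & _ & HI & E); [apply HK; auto|apply Kd; rewrite Cmod_RtoC_minus; auto|]. exists s. auto. }
  destruct Hloc as [d [Hd Kd]]. exists d. split; auto. intros u Hu Hut. specialize (Kd u Hu Hut).
  split; intros H; [apply linked_trans with (p u); auto; apply linked_sym; auto|apply linked_trans with (p t); auto].
Qed.

Lemma joined_frontier x y : K x -> joined K x y <-> K y /\ linked x y.
Proof.
  intros Hx. split.
  - intros H. split; [|apply joined_linked; auto]. apply joined_path in H. destruct H as (p & _ & HK & _ & <-). apply HK. lra.
  - intros [Hy H]. apply linked_joined; auto.
Qed.

(** The basin lies on one of two sides of each orbit, so two of the three orbits share a side and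
    [unique_side] identifies them. *)
Lemma two_orbits e x1 x2 x3 : K x1 -> F x1 <> 0 -> emanates F x1 e -> K x2 -> F x2 <> 0 -> emanates F x2 e ->
  K x3 -> F x3 <> 0 -> emanates F x3 e -> orbit F x1 x2 \/ orbit F x1 x3 \/ orbit F x2 x3.
Proof.
  assert (Hside : forall x, K x -> F x <> 0 -> exists g rho sg e, (sg = 1 \/ sg = -1) /\ chart F x g rho /\ 0 < e <= rho / 4 /\ side N g sg e).
  { intros x Hx Hn. destruct (chart_exists F x HF Hn) as [g [rho Hg]].
    destruct (frontier_side HF HA x g rho Hx Hn Hg) as (sg & e0 & Hsg & He & Hs). exists g, rho, sg, e0. auto. }
  intros H1 N1 E1 H2 N2 E2 H3 N3 E3.
  destruct (Hside x1 H1 N1) as (g1 & r1 & sg1 & e1 & S1 & G1 & L1 & D1).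
  destruct (Hside x2 H2 N2) as (g2 & r2 & sg2 & e2 & S2 & G2 & L2 & D2).
  destruct (Hside x3 H3 N3) as (g3 & r3 & sg3 & e3 & S3 & G3 & L3 & D3).
  assert (Hp : sg1 = sg2 \/ sg1 = sg3 \/ sg2 = sg3) by (destruct S1, S2, S3; subst; auto).
  destruct Hp as [E|[E|E]]; [left|right; left|right; right]; rewrite E in *.
  - apply (unique_side HF Ha HL Hre x1 x2 g1 g2 r1 r2 sg2 e1 e2 e); auto.
  - apply (unique_side HF Ha HL Hre x1 x3 g1 g3 r1 r3 sg3 e1 e3 e); auto.
  - apply (unique_side HF Ha HL Hre x2 x3 g2 g3 r2 r3 sg3 e2 e3 e); auto.
Qed.

Lemma component_representative x : K x -> exists y, K y /\ F y <> 0 /\ linked x y.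
Proof.
  intros Hx. destruct (Ceq_dec (F x) 0) as [He|Hn].
  - destruct (frontier_emanates HF HA x Hex He Hx) as (q & Hq & Hnq & Hem). exists q. split; auto. split; auto.
    right. exists x. split; auto. apply emanates_equilibrium; auto.
  - exists x. split; auto. split; auto. left. apply orbit_refl.
Qed.

(** The disc meets the boundary only within the component of [x], so distinct components have
    disjoint sets of such numbers. *)
Definition isolates (n : nat) (x : C) : Prop := K x /\ in_disc n x /\ forall y, K y -> in_disc n y -> linked x y.

Lemma isolates_exists x : K x -> exists n y, linked x y /\ isolates n y.
Proof.
  intros Hx. destruct (component_representative x Hx) as (y & Hy & Hn & Hl).
  destruct (frontier_local HF HA y 1 Hy Hn Rlt_0_1) as [d [Hd Kd]].
  destruct (small_disc y d Hd) as (n & Hin & Hsm). exists n, y. split; auto. split; auto. split; auto.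
  intros z Hz Hzn. left. destruct (Kd z Hz (Hsm z Hzn)) as (t & _ & HI & E). exists t. auto.
Qed.

Definition component (n : nat) (y : C) : Prop := exists x, isolates n x /\ K y /\ linked x y.

(** Only the least number isolating a component counts, which makes the indexing injective. *)
Definition index (n : nat) : Prop := exists x, isolates n x /\
  forall m x', (m < n)%nat -> isolates m x' -> ~ linked x x'.

Lemma component_joined n x : isolates n x -> same_set (component n) (joined K x).
Proof.
  intros Hx y. rewrite joined_frontier by apply Hx. split.
  - intros (x' & (Hx' & Hin & _) & Hy & Hl). split; auto. apply linked_trans with x'; auto. apply Hx; auto.
  - intros [Hy Hl]. exists x. auto.
Qed.

Lemma index_exists x : K x -> exists n x0, index n /\ isolates n x0 /\ linked x x0.
Proof.
  intros Hx. destruct (least_nat (fun n => exists y, linked x y /\ isolates n y)) as (n & (y & Hl & Hi) & Hmin).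
  - apply isolates_exists; auto.
  - exists n, y. split; auto. exists y. split; auto. intros m x' Hm Hi' Hl'. apply (Hmin m Hm). exists x'. split; auto.
    apply linked_trans with y; auto.
Qed.

Lemma index_unique m n : index m -> index n -> same_set (component m) (component n) -> m = n.
Proof.
  assert (H : forall m n, index m -> index n -> same_set (component m) (component n) -> ~ (m < n)%nat).
  { intros m' n' (x & Hx & _) (y & Hy & Hmin) E Hlt.
    assert (Hc : component n' x). { apply E. exists x. split; auto. split; [apply Hx|left; apply orbit_refl]. }
    apply (component_joined n' y Hy), joined_frontier in Hc; [|apply Hy]. apply (Hmin m' x); auto. apply Hc. }
  intros H1 H2 E. destruct (Nat.lt_trichotomy m n) as [?|[?|?]]; auto; exfalso.
  - apply (H m n); auto.
  - apply (H n m); auto. intros x. symmetry. apply E.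
Qed.

Lemma frontier_positive x : K x -> F x <> 0 -> positive_separatrix F x.
Proof.
  intros Hx Hn. destruct (frontier_blowup HF HA x Hx Hn) as [T [HT HnT]].
  exists T. intros t [HI Ht]. rewrite Rabs_pos_eq by auto. apply Rnot_lt_le. intro. apply HnT.
  apply (Imax_convex F x 0 T t); auto; [apply Imax_0; auto|lra].
Qed.

Lemma emanates_not_negative x e : emanates F x e -> ~ negative_separatrix F x.
Proof.
  intros (_ & Hb & _) [M HM]. specialize (HM (- (Rabs M + 1))). pose proof (Rabs_pos M). pose proof (Rle_abs M).
  assert (Rabs (- (Rabs M + 1)) <= M) by (apply HM; split; [apply Hb|]; lra). rewrite Rabs_Ropp, Rabs_pos_eq in H1; lra.
Qed.

Lemma emanates_attached x e : emanates F x e -> attached F x e.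
Proof.
  intros (He & Hb & H). right. intros v. unfold singleton. split.
  - intros (tk & HI & Hlim & Hc). apply (sequential_limit (fun t => Phi F (- t) x) (fun k => - tk k)).
    + intros eps Heps. destruct (H eps Heps) as [T [HT KT]]. exists T. intros t Ht. apply KT. lra.
    + apply (is_lim_seq_opp tk m_infty). auto.
    + apply filterlim_ext with (2 := Hc). intros k. rewrite Ropp_involutive. auto.
  - intros ->. exists (fun k => - INR k). split; [intros k; apply Hb; pose proof (pos_INR k); lra|]. split.
    + apply is_lim_seq_spec. intros M. destruct (INR_unbounded (- M)) as [n Hn]. exists n. intros k Hk.
      apply le_INR in Hk. lra.
    + intros P HP. apply locally_Cmod in HP. destruct HP as [eps [Heps HP]]. destruct (H eps Heps) as [T [HT KT]].
      destruct (INR_unbounded T) as [n Hn]. exists n. intros k Hk. apply HP, KT. apply le_INR in Hk. lra.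
Qed.

(** If [x] emanates from no equilibrium, linked points share its orbit. Otherwise the component
    consists of the equilibrium and the orbits emanating from it, of which there is at least one by
    [frontier_emanates] and at most two by [two_orbits]. *)
Lemma component_types x S : K x -> stable F a -> ~ unstable F a -> same_set S (fun y => K y /\ linked x y) ->
  type_A F a S \/ type_B F a S \/ type_C F a S.
Proof.
  intros Hx Hst Hun HS.
  assert (Horb : forall q y, K q -> orbit F q y -> K y).
  { intros q y Hq (t & HI & ->). apply (frontier_flow HF HA); auto. }
  assert (Hsm : forall q e, K q -> F q <> 0 -> emanates F q e -> sign_matches F a q).
  { intros q e Hq Hn Hem. pose proof (frontier_positive q Hq Hn). pose proof (emanates_not_negative q e Hem).
    split; tauto. }
  destruct (classic (exists e, emanates F x e)) as [[e He]|Hno].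
  - right. assert (HKe := emanates_frontier x e Hx He). assert (Hee : F e = 0) by apply He.
    destruct (frontier_emanates HF HA e Hex Hee HKe) as (q & Hq & Hnq & Hem).
    assert (HS' : forall y, S y <-> K y /\ emanates F y e).
    { intros y. rewrite (HS y). split; intros [Hy Hl]; split; auto.
      - destruct Hl as [Hl|(e' & H1 & H2)]; [apply (emanates_orbit x); auto|]. rewrite (emanates_unique x e e'); auto.
      - right. exists e. auto. }
    assert (Hey : K e /\ emanates F e e) by (split; auto; apply emanates_equilibrium; auto).
    assert (Hqy : forall q y, K q -> emanates F q e -> orbit F q y -> K y /\ emanates F y e).
    { intros q' y H1 H2 H3. split; [apply (Horb q'); auto|apply (emanates_orbit q'); auto]. }
    destruct (classic (exists q', K q' /\ F q' <> 0 /\ emanates F q' e /\ ~ orbit F q q')) as [(q' & Hq' & Hnq' & Hem' & Hno)|Hno].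
    + right. exists q, q', e.
      split; [left; apply frontier_positive; auto|]. split; [apply (Hsm q e); auto|].
      split; [left; apply frontier_positive; auto|]. split; [apply (Hsm q' e); auto|].
      split; [intro E; apply Hno, E, orbit_refl|]. split; auto.
      split; [apply emanates_attached; auto|]. split; [apply emanates_attached; auto|].
      intros y. rewrite HS'. split.
      * intros [Hy Hey']. destruct (Ceq_dec (F y) 0) as [Hy0|Hyn]; [right; right; apply (emanates_fixed y); auto|].
        destruct (two_orbits e q q' y) as [?|[?|?]]; auto. tauto.
      * intros [?|[?| ->]]; eauto.
    + left. exists q, e. split; [left; apply frontier_positive; auto|]. split; [apply (Hsm q e); auto|].
      split; auto. split; [apply emanates_attached; auto|].
      intros y. rewrite HS'. split.
      * intros [Hy Hey']. destruct (Ceq_dec (F y) 0) as [Hy0|Hyn]; [right; apply (emanates_fixed y); auto|].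
        left. apply NNPP. intro. apply Hno. exists y. auto.
      * intros [?| ->]; eauto.
  - left. assert (Hn : F x <> 0) by (intro E; apply Hno; exists x; apply emanates_equilibrium; auto).
    pose proof (frontier_positive x Hx Hn) as Hpos. exists x. split; [left; auto|]. split.
    (* The orbit blows up forwards. If it is not double-sided it cannot also be a negative
       separatrix, and both equivalences hold. *)
    + split; [auto|]. split; [tauto|]. intros Hd. split; [tauto|]. split; [|tauto]. intros Hneg. exfalso. apply Hd.
      destruct Hpos as [M1 H1]. destruct Hneg as [M2 H2]. exists (Rmax M1 M2). intros t Ht.
      destruct (Rle_dec 0 t).
      * eapply Rle_trans; [apply H1; auto|apply Rmax_l].
      * eapply Rle_trans; [apply H2; split; auto; lra|apply Rmax_r].
    + intros y. rewrite (HS y). split.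
      * intros [_ [H|(e & H & _)]]; auto. exfalso. eauto.
      * intros H. split; [apply (Horb x); auto|left; auto].
Qed.

Lemma omega_plus_basin x : NN F a r x <-> same_set (omega_plus F x) (singleton a).
Proof.
  split.
  - intros Hx v. unfold singleton. assert (Ht := NN_tends HF HL Hre x Hx). split.
    + intros (tk & HI & Hlim & Hc). apply (sequential_limit (fun t => Phi F t x) tk); auto.
      intros eps Heps. destruct (Ht eps Heps) as [T [HT KT]]. exists T. intros t Htt. apply KT; auto.
    + intros ->. destruct (NN_forward HF HL Hre x Hx) as (_ & _ & HI & _).
      exists INR. split; [intros k; apply HI, pos_INR|]. split; [apply is_lim_seq_INR|].
      intros P HP. apply locally_Cmod in HP. destruct HP as [eps [Heps HP]]. destruct (Ht eps Heps) as [T [HT KT]].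
      destruct (INR_unbounded T) as [n Hn]. exists n. intros k Hk. apply HP, KT. apply le_INR in Hk. lra.
  - intros H. destruct (proj2 (H a) eq_refl) as (tk & HI & Hlim & Hc).
    pose proof (lin_pos HL).
    assert (Hl : locally a (fun y => Cmod (y - a) < r/8)) by (apply locally_Cmod; exists (r/8); split; [lra|auto]).
    specialize (Hc _ Hl). destruct Hc as [n1 Hn1]. apply is_lim_seq_spec in Hlim. destruct (Hlim 0) as [n2 Hn2].
    specialize (Hn1 (Nat.max n1 n2) (Nat.le_max_l _ _)). specialize (Hn2 (Nat.max n1 n2) (Nat.le_max_r _ _)).
    exists (tk (Nat.max n1 n2)). split; [lra|]. auto.
Qed.

Lemma boundary_frontier z : boundary N z <-> K z.
Proof.
  split.
  - intros [H1 H2]. split.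
    + intro HN. destruct (at_open HA z HN) as [d [Hd Kd]].
      destruct (H2 N) as (y & Hy & Hny); auto. apply locally_Cmod. eauto.
    + intros d Hd. destruct (H1 (fun y => Cmod (y - z) < d)) as (y & Hy & HNy); eauto. apply locally_Cmod. eauto.
  - intros [Hn Hf]. split.
    + intros U HU. apply locally_Cmod in HU. destruct HU as [d [Hd Kd]]. destruct (Hf d Hd) as (y & Hy & HNy). eauto.
    + intros U HU. apply locally_singleton in HU. eauto.
Qed.
End Components.

Arguments linked : clear implicits.
Arguments isolates : clear implicits.
Arguments component : clear implicits.
Arguments index : clear implicits.

(** * Time reversal *)

Section Reversal.
Context (F : C -> C) (HF : holo F).

Lemma orbit_negf x v : orbit (negf F) x v -> orbit F x v.
Proof.
  intros (t & HI & ->). apply Imax_negf in HI. exists (- t). split; auto. apply Phi_negf; auto.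
Qed.

Lemma omega_plus_negf x v : omega_plus (negf F) x v -> omega_minus F x v.
Proof.
  intros (tk & HI & Hl & Hc). exists (fun k => - tk k).
  assert (HI' : forall k, Imax F x (- tk k)) by (intros k; apply Imax_negf; auto).
  split; auto. split; [apply (is_lim_seq_opp tk p_infty); auto|].
  apply filterlim_ext with (2 := Hc). intros k. apply Phi_negf; auto.
Qed.

Lemma omega_minus_negf x v : omega_minus (negf F) x v -> omega_plus F x v.
Proof.
  intros (tk & HI & Hl & Hc). exists (fun k => - tk k).
  assert (HI' : forall k, Imax F x (- tk k)) by (intros k; apply Imax_negf; auto).
  split; auto. split; [apply (is_lim_seq_opp tk m_infty); auto|].
  apply filterlim_ext with (2 := Hc). intros k. apply Phi_negf; auto.
Qed.

Lemma tends_to_plus_negf x a : tends_to_plus (negf F) x a -> tends_to_minus F x a.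
Proof.
  intros [HI Hc].
  assert (HI' : forall t, t <= 0 -> Imax F x t).
  { intros t Ht. rewrite <- (Ropp_involutive t). apply Imax_negf, HI. lra. }
  split; auto. intros P HP. destruct (Hc P HP) as [M HM]. exists (Rmin 0 (- M)). intros t Ht.
  pose proof (Rmin_l 0 (- M)). pose proof (Rmin_r 0 (- M)).
  specialize (HM (- t) ltac:(lra)). rewrite Phi_negf, Ropp_involutive in HM; auto. rewrite Ropp_involutive. apply HI'. lra.
Qed.

Lemma tends_to_minus_negf x a : tends_to_minus (negf F) x a -> tends_to_plus F x a.
Proof.
  intros [HI Hc].
  assert (HI' : forall t, 0 <= t -> Imax F x t).
  { intros t Ht. rewrite <- (Ropp_involutive t). apply Imax_negf, HI. lra. }
  split; auto. intros P HP. destruct (Hc P HP) as [M HM]. exists (Rmax 0 (- M)). intros t Ht.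
  pose proof (Rmax_l 0 (- M)). pose proof (Rmax_r 0 (- M)).
  specialize (HM (- t) ltac:(lra)). rewrite Phi_negf, Ropp_involutive in HM; auto. rewrite Ropp_involutive. apply HI'. lra.
Qed.

Lemma stable_negf a : stable (negf F) a -> unstable F a.
Proof. unfold stable, unstable. apply filter_imp. intros x. apply tends_to_plus_negf; auto. Qed.

Lemma unstable_negf a : unstable (negf F) a -> stable F a.
Proof. unfold stable, unstable. apply filter_imp. intros x. apply tends_to_minus_negf; auto. Qed.

Lemma positive_negf x : positive_separatrix (negf F) x -> negative_separatrix F x.
Proof.
  intros [M HM]. exists M. intros t [HI Ht]. rewrite <- Rabs_Ropp. apply HM. split; [|lra].
  apply Imax_negf. rewrite Ropp_involutive. auto.
Qed.

Lemma negative_negf x : negative_separatrix (negf F) x -> positive_separatrix F x.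
Proof.
  intros [M HM]. exists M. intros t [HI Ht]. rewrite <- Rabs_Ropp. apply HM. split; [|lra].
  apply Imax_negf. rewrite Ropp_involutive. auto.
Qed.

Lemma double_negf x : double_sided_separatrix (negf F) x -> double_sided_separatrix F x.
Proof.
  intros [M HM]. exists M. intros t HI. rewrite <- Rabs_Ropp. apply HM.
  apply Imax_negf. rewrite Ropp_involutive. auto.
Qed.
End Reversal.

Section ReversalIff.
Context (F : C -> C) (HF : holo F).

Let HN : holo (negf F) := holo_negf F HF.

(** The one-sided lemmas hold for every field, so applying them to [negf F] and using that [negf] is
    an involution gives the converses. *)
Ltac reverse := let H := fresh in split; intros H;
  match type of H with _ (negf _) _ => idtac | _ (negf _) _ _ => idtac
  | _ => rewrite <- (negf_invol F) in H end;
  first [apply orbit_negf in H | apply omega_plus_negf in H | apply omega_minus_negf in H |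
    apply stable_negf in H | apply unstable_negf in H | apply positive_negf in H |
    apply negative_negf in H | apply double_negf in H]; auto.

Lemma orbit_negf_iff x v : orbit (negf F) x v <-> orbit F x v.
Proof. reverse. Qed.
Lemma omega_plus_negf_iff x v : omega_plus (negf F) x v <-> omega_minus F x v.
Proof. reverse. Qed.
Lemma omega_minus_negf_iff x v : omega_minus (negf F) x v <-> omega_plus F x v.
Proof. reverse. Qed.
Lemma stable_negf_iff a : stable (negf F) a <-> unstable F a.
Proof. reverse. Qed.
Lemma unstable_negf_iff a : unstable (negf F) a <-> stable F a.
Proof. reverse. Qed.
Lemma positive_negf_iff x : positive_separatrix (negf F) x <-> negative_separatrix F x.
Proof. reverse. Qed.
Lemma negative_negf_iff x : negative_separatrix (negf F) x <-> positive_separatrix F x.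
Proof. reverse. Qed.
Lemma double_negf_iff x : double_sided_separatrix (negf F) x <-> double_sided_separatrix F x.
Proof. reverse. Qed.

Lemma same_set_l {T} (A B S : T -> Prop) : (forall v, A v <-> B v) -> (same_set A S <-> same_set B S).
Proof. intros H. split; intros E v; rewrite <- (E v), (H v); tauto. Qed.

Lemma attached_negf x e : attached (negf F) x e -> attached F x e.
Proof.
  unfold attached. rewrite (same_set_l _ _ _ (omega_plus_negf_iff x)), (same_set_l _ _ _ (omega_minus_negf_iff x)). tauto.
Qed.

Lemma basin_negf a x : basin (negf F) a x <-> basin F a x.
Proof.
  unfold basin. rewrite (same_set_l _ _ _ (omega_plus_negf_iff x)), (same_set_l _ _ _ (omega_minus_negf_iff x)).
  rewrite stable_negf_iff, unstable_negf_iff. tauto.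
Qed.

Lemma separatrix_negf x : separatrix (negf F) x -> separatrix F x.
Proof. unfold separatrix. rewrite positive_negf_iff, negative_negf_iff. tauto. Qed.

Lemma sign_matches_negf a x : sign_matches (negf F) a x -> sign_matches F a x.
Proof. unfold sign_matches. rewrite positive_negf_iff, negative_negf_iff, stable_negf_iff, unstable_negf_iff. tauto. Qed.

Lemma sign_compatible_negf a x : sign_compatible (negf F) a x -> sign_compatible F a x.
Proof.
  intros (H1 & H2 & H3). rewrite stable_negf_iff, positive_negf_iff in H1. rewrite unstable_negf_iff, negative_negf_iff in H2.
  rewrite double_negf_iff in H3. split; auto. split; auto. intros H. apply sign_matches_negf; auto.
Qed.

Lemma equilibrium_negf e : equilibrium (negf F) e -> equilibrium F e.
Proof. unfold equilibrium, negf. intros E. replace (F e) with (- - F e)%C by ring. rewrite E. ring. Qed.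

Lemma types_negf a S : type_A (negf F) a S \/ type_B (negf F) a S \/ type_C (negf F) a S ->
  type_A F a S \/ type_B F a S \/ type_C F a S.
Proof.
  intros [(x & H1 & H2 & H3)|[(x & e & H1 & H2 & H3 & H4 & H5)|(x & y & e & H1 & H2 & H3 & H4 & H5 & H6 & H7 & H8 & H9)]].
  - left. exists x. split; [apply separatrix_negf; auto|]. split; [apply sign_compatible_negf; auto|].
    intros v. rewrite (H3 v). apply orbit_negf_iff.
  - right. left. exists x, e. split; [apply separatrix_negf; auto|]. split; [apply sign_matches_negf; auto|].
    split; [apply equilibrium_negf; auto|]. split; [apply attached_negf; auto|].
    intros v. rewrite (H5 v), orbit_negf_iff. tauto.
  - right. right. exists x, y, e. split; [apply separatrix_negf; auto|]. split; [apply sign_matches_negf; auto|].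
    split; [apply separatrix_negf; auto|]. split; [apply sign_matches_negf; auto|].
    split; [intro E; apply H5; intros v; rewrite !orbit_negf_iff; apply E|].
    split; [apply equilibrium_negf; auto|]. split; [apply attached_negf; auto|]. split; [apply attached_negf; auto|].
    intros v. rewrite (H9 v), !orbit_negf_iff. tauto.
Qed.
End ReversalIff.

(** * The classification for a stable point and its transport by time reversal *)

Definition classification (F : C -> C) (a : C) : Prop :=
  exists (Q : nat -> Prop) (Cn : nat -> C -> Prop),
    (forall n, Q n -> path_component (boundary (basin F a)) (Cn n)) /\
    (forall S, path_component (boundary (basin F a)) S ->
       exists n, Q n /\ same_set S (Cn n)) /\
    (forall m n, Q m -> Q n -> same_set (Cn m) (Cn n) -> m = n) /\
    same_set (boundary (basin F a)) (fun z => exists n, Q n /\ Cn n z) /\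
    (forall n, Q n ->
       type_A F a (Cn n) \/ type_B F a (Cn n) \/ type_C F a (Cn n)).

Lemma linearization_negf F a lam psi psi' r :
  linearization F a lam psi psi' r -> linearization (negf F) a (- lam) psi psi' r.
Proof.
  intros [H1 H2 H3 H4 H5 H6]. constructor; auto. intros z Hz. unfold negf.
  replace (- F z * psi' z)%C with (- (F z * psi' z))%C by ring. rewrite H4 by auto. ring.
Qed.

Lemma classification_stable F a lam : holo F -> (exists z, F z <> 0) -> F a = 0 -> cder F a lam ->
  lam <> 0 -> stable F a -> classification F a.
Proof.
  intros HF Hex Ha Hlam Hl0 Hst.
  destruct (linearization_exists F a lam HF Ha Hlam Hl0) as (psi & psi' & r & HL).
  assert (Hre := lin_stable_Re F a lam psi psi' r HF Ha HL Hst).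
  (* The same coordinate linearizes the reversed field with multiplier [- lam], whose real part
     would also have to be negative. *)
  assert (Hun : ~ unstable F a).
  { intro Hun. apply stable_negf_iff in Hun; auto.
    assert (Re (- lam) < 0).
    { apply (lin_stable_Re (negf F) a (- lam) psi psi' r); auto; [apply holo_negf; auto| |apply linearization_negf; auto].
      unfold negf. rewrite Ha. ring. }
    simpl in H. unfold Re in Hre. lra. }
  assert (EB : basin F a = NN F a r).
  { apply functional_extensionality. intros x. apply propositional_extensionality. unfold basin.
    rewrite (omega_plus_basin HF HL Hre). tauto. }
  assert (EK : boundary (basin F a) = frontier (NN F a r)).
  { rewrite EB. apply functional_extensionality. intros x. apply propositional_extensionality.
    apply (boundary_frontier HF Ha HL Hre). }
  unfold classification. rewrite EK.
  pose proof (component_joined HF Hex Ha HL Hre) as Hcj.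
  pose proof (index_exists HF Hex Ha HL Hre) as Hie.
  pose proof (joined_frontier HF Hex Ha HL Hre) as Hjf.
  exists (index F a r), (component F a r). split; [|split; [|split; [|split]]].
  - intros n (x & Hx & _). exists x. split; [apply Hx|apply Hcj; auto].
  - intros S (x & Hx & HS). destruct (Hie x Hx) as (n & y & Hn & Hy & Hl). exists n. split; auto.
    intros v. rewrite (HS v), (Hcj n y Hy v). rewrite (Hjf x v Hx), (Hjf y v) by apply Hy.
    split; intros [Hv Hl']; split; auto.
    + apply linked_trans with x; auto. apply linked_sym; auto.
    + apply linked_trans with y; auto.
  - apply (index_unique HF Hex Ha HL Hre).
  - intros x. split.
    + intros Hx. destruct (Hie x Hx) as (n & y & Hn & Hy & Hl). exists n. split; auto.
      exists y. split; auto. split; auto. apply linked_sym; auto.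
    + intros (n & _ & y & _ & Hx & _). auto.
  - intros n (x & Hx & _). apply (component_types HF Hex Ha HL Hre x); auto; [apply Hx|].
    intros v. rewrite (Hcj n x Hx v). apply Hjf. apply Hx.
Qed.

Lemma classification_negf F a : holo F -> classification (negf F) a -> classification F a.
Proof.
  intros HF (Q & Cn & H1 & H2 & H3 & H4 & H5).
  assert (EB : basin (negf F) a = basin F a).
  { apply functional_extensionality. intros x. apply propositional_extensionality. apply basin_negf; auto. }
  rewrite EB in *. exists Q, Cn. repeat (split; auto). intros n Hn. apply types_negf; auto.
Qed.

Theorem theorem4p12 (F : C -> C) (a : C)
    (hF : entire F) (hF0 : exists z, F z <> RtoC 0)
    (ha : node_or_focus F a) :
  exists (Q : nat -> Prop) (Cn : nat -> C -> Prop),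
    (forall n, Q n -> path_component (boundary (basin F a)) (Cn n)) /\
    (forall S, path_component (boundary (basin F a)) S ->
       exists n, Q n /\ same_set S (Cn n)) /\
    (forall m n, Q m -> Q n -> same_set (Cn m) (Cn n) -> m = n) /\
    same_set (boundary (basin F a)) (fun z => exists n, Q n /\ Cn n z) /\
    (forall n, Q n ->
       type_A F a (Cn n) \/ type_B F a (Cn n) \/ type_C F a (Cn n)).
Proof.
  destruct ha as [[Ha Hd] Hs]. assert (HF : holo F) by (apply entire_holo; auto).
  assert (Hl : cder F a (C_derive F a)) by (apply is_derive_cder, C_derive_correct; auto).
  destruct Hs as [Hs|Hs].
  - apply (classification_stable F a (C_derive F a)); auto.
  - apply classification_negf; auto.
    apply (classification_stable (negf F) a (- C_derive F a)).
    + apply holo_negf; auto.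
    + destruct hF0 as [z Hz]. exists z. unfold negf. intro E. apply Hz. replace (F z) with (- - F z)%C by ring. rewrite E. ring.
    + unfold negf. rewrite Ha. ring.
    + apply der_opp; auto.
    + intro E. apply Hd. replace (C_derive F a) with (- - C_derive F a)%C by ring. rewrite E. ring.
    + apply stable_negf_iff; auto.
Qed.
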